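(* Let $(B,\mathsf c_B,D^B)$ be a $3$-dimensional hyperCR Einstein-Weyl space with twist $\kappa$. Then the metric $$g=\frac1{\mu_t^2}\Bigl((1+2\mu_t\kappa)\pi^*\mathsf c_B+(1+2\mu_t\kappa)^{-1}(D^B\mu_t)^2\Bigr)$$ on $\pi\colon M\to B$ is selfdual Einstein with nonzero scalar curvature and admits a compatible hypercomplex structure, where $\mu_t$ is a section of $L$ increasing along the fibres. Any selfdual Einstein metric of nonzero scalar curvature with a compatible hypercomplex structure arises in this way, locally and up to a constant multiple, on the open set where $\theta=\frac12(D^{Ob}-D^g)$ is nonzero, with $D^g$ the Levi-Civita derivative of the Einstein metric and $D^{Ob}$ the Obata derivative of the hypercomplex structure.
   Context: Everything is smooth and local. On an $n$-manifold, $L^w$ denotes the oriented real line bundle of densities of weight $w$, associated to the frame bundle by $A\mapsto|\det A|^{w/n}$; $L=L^1$. A conformal structure $\mathsf c$ is an $L^2$-valued (unit determinant) inner product $\langle\cdot,\cdot\rangle$ on the tangent bundle; it identifies vectors with $1$-forms of the same weight. A Weyl derivative $D$ is a covariant derivative on $L$ (hence on every $L^w$), with curvature $2$-form $F^D$; on a conformal manifold it determines a unique torsion-free connection $D$ on $TM$ with $D\mathsf c=0$. Weyl derivatives form an affine space modelled on $1$-forms. $D$ is Einstein-Weyl if the symmetric tracefree part of its Ricci tensor vanishes. The Hodge star on weighted forms is normalized by $\iota_X{*\alpha}=*(\langle X,\cdot\rangle\wedge\alpha)$ with $*1$ the orientation (so $*_B^2=-1$ on the $3$-manifold $B$). An Einstein-Weyl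 $3$-manifold $(B,\mathsf c_B,D^B)$ is hyperCR with twist $\kappa\in C^\infty(B,L_B^{-1})$ if it has divergence-free shear-free geodesic congruences of twist $\kappa$, i.e. there is locally an orthonormal frame of weightless unit vector fields $\chi\in L_B^{-1}TB$ satisfying $D^B\chi=\kappa\,{*_B\chi}$ (that is, $D^B_X\chi=\kappa\,\iota_X{*_B\chi}$ for all $X$). $M$ is an oriented $4$-manifold with a submersion $\pi\colon M\to B$ with one dimensional fibres, $L$ denoting the pullback $\pi^*L_B$ in the formula: in terms of a length scale (positive section) $\mu_B$ of $L_B$ with $D^B\mu_B=\omega_B\mu_B$, $M$ is locally an open subset of $B\times\mathbb R$ with fibre coordinate $t$, $\mu_t=t\mu_B$ and $D^B\mu_t=(dt+t\omega_B)\mu_B$. The formula is considered where $\mu_t\neq0$ and $1+2\mu_t\kappa\ne0$. $M$ is oriented so that $*1=*_B1\wedge\xi$, where $\xi$ is the weightless unit $1$-form positively proportional to $D^B\mu_t$. Metrics are taken positive definite, passing to $-g$ where $g$ is negative definite. $g$ is selfdual if the antiselfdual part of its Weyl curvature vanishes. A compatible hypercomplex structure is a triple $(I_1,I_2,I_3)$ of integrable, orthogonal, antiselfdual complex structures satisfying the quaternion relations (an orthogonal complex structure $J$ being antiselfdual if the $2$-form $\langle J\cdot,\cdot\rangle$ is); its Obata derivative is the Weyl derivative whose connection $D^{Ob}$ satisfies $D^{Ob}I_j=0$.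
   Formalization: Where 1+2μ_tκ<0, M is given the orientation opposite to *_B1∧ξ with ξ positively proportional to D^Bμ_t; with the stated orientation, selfduality fails there (e.g. over Berger spheres). *)

(* Defs.v *)
(* The geometry is local: an oriented manifold is an open
   set of 'rV[R]_n, and tensor fields are given by their components in the
   standard coordinates.

   The line bundle L is trivialised by a length scale mu.  Then a section of L^w
   is a function f, standing for f mu^w; a conformal structure is a metric g,
   standing for mu^2 g; and a Weyl derivative D is the 1-form w such that
   D mu = w mu, so that D (f mu^a) = (df + a f w) mu^a.  All length scales are
   allowed: g is an arbitrary metric. *)
From HB Require Import structures.
From mathcomp Require Import all_boot all_order all_algebra.
From mathcomp Require Import all_classical all_reals all_analysis.

Set Implicit Arguments.
Unset Strict Implicit.
Unset Printing Implicit Defensive.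

Import Order.TTheory GRing.Theory Num.Theory.
Import numFieldNormedType.Exports.

Local Open Scope classical_set_scope.
Local Open Scope ring_scope.

Section Smooth.
Variables (R : realType) (n : nat).
Implicit Types U : set 'rV[R]_n.

Definition partial (i : 'I_n) (f : 'rV[R]_n -> R) (x : 'rV[R]_n) : R :=
  'D_(delta_mx 0 i) f x.

(* C^infinity on an open set: every iterated partial derivative is
   (Frechet) differentiable. *)
Definition smooth U (f : 'rV[R]_n -> R) : Prop :=
  forall (s : seq 'I_n) x, U x -> differentiable (foldr partial f s) x.

Definition smooth_mx (p q : nat) U (A : 'rV[R]_n -> 'M[R]_(p, q)) : Prop :=
  forall i j, smooth U (fun x => A x i j).

End Smooth.

Section Tensors.
Variables (R : realType) (n : nat).
Notation point := 'rV[R]_n.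
Implicit Types (U : set point) (x : point).
(* Vector fields and 1-forms are row vectors of components; the matrix of a
   metric is (g(d_i, d_j))_ij. *)
Implicit Types (g : point -> 'M[R]_n) (w : point -> 'rV[R]_n).
Implicit Types (X Y : point -> 'rV[R]_n).

Definition riemannian U g : Prop :=
  smooth_mx U g /\
  (forall x, U x -> (g x)^T = g x /\
     forall v : 'rV[R]_n, v != 0 -> 0 < (v *m g x *m v^T) 0 0).

(* Gam k i j is the component of D_(d_i) d_j along d_k. *)
Definition connection := 'I_n -> 'I_n -> 'I_n -> point -> R.
Implicit Type Gam : connection.

(* The torsion-free connection on TM with D(mu^2 g) = 0, i.e. D g = - 2 w g, by
   Koszul's formula in which d_i g_jl is replaced by d_i g_jl + 2 w_i g_jl.  For
   w = 0 it is the Levi-Civita connection of g. *)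
Definition weyl_connection g w : connection := fun k i j x =>
  let dg a b c := partial a (fun y => g y b c) x + 2 * w x 0 a * g x b c in
  2^-1 * \sum_l invmx (g x) k l * (dg i j l + dg j i l - dg l i j).

(* The component along d_l of R(d_i, d_j) d_k. *)
Definition curvature Gam (i j k l : 'I_n) x : R :=
  partial i (Gam l j k) x - partial j (Gam l i k) x
  + \sum_m (Gam l i m x * Gam m j k x - Gam l j m x * Gam m i k x).

(* Ric(Y, Z) is the trace of X |-> R(X, Y) Z. *)
Definition ricci Gam x : 'M[R]_n :=
  \matrix_(j, k) \sum_i curvature Gam i j k i x.

Definition sym_ricci Gam x : 'M[R]_n :=
  2^-1 *: (ricci Gam x + (ricci Gam x)^T).

Definition scalar_curvature g w x : R :=
  \tr (invmx (g x) *m sym_ricci (weyl_connection g w) x).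

Definition einstein_weyl U g w : Prop := forall x, U x ->
  sym_ricci (weyl_connection g w) x
    - (scalar_curvature g w x / n%:R) *: g x = 0.

Definition einstein U g : Prop := einstein_weyl U g (fun=> 0).

(* An orientation is given by a sign: o x = 1 if the coordinate frame is
   positively oriented at x, and o x = -1 otherwise. *)
Definition volume (o : point -> R) g x (v : 'I_n -> 'rV[R]_n) : R :=
  o x * Num.sqrt (\det (g x)) * \det (\matrix_i v i).

Definition coord_vec (i : 'I_n) : 'rV[R]_n := delta_mx 0 i.

Definition lie_bracket X Y x : 'rV[R]_n :=
  \row_k \sum_l (X x 0 l * partial l (fun y => Y y 0 k) x
                 - Y x 0 l * partial l (fun y => X y 0 k) x).

(* An endomorphism J of the tangent space acts on columns:
   J d_i = \sum_k J k i d_k. *)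
Implicit Type J : point -> 'M[R]_n.

Definition endo_apply J X : point -> 'rV[R]_n := fun x => X x *m (J x)^T.

Definition nijenhuis J X Y x : 'rV[R]_n :=
  lie_bracket (endo_apply J X) (endo_apply J Y) x
  - endo_apply J (lie_bracket (endo_apply J X) Y) x
  - endo_apply J (lie_bracket X (endo_apply J Y)) x
  - lie_bracket X Y x.

(* The Nijenhuis tensor is tensorial, so it is tested on coordinate fields. *)
Definition integrable_complex U J : Prop :=
  [/\ smooth_mx U J,
      forall x, U x -> J x *m J x = - 1%:M &
      forall i j x, U x ->
        nijenhuis J (fun=> coord_vec i) (fun=> coord_vec j) x = 0].

Definition orthogonal U g J : Prop :=
  forall x, U x -> (J x)^T *m g x *m J x = g x.

(* The 2-form <J ., .>, with components <J d_i, d_j>. *)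
Definition form_of g J x : 'M[R]_n := (J x)^T *m g x.

(* The covariant derivative along d_i of the endomorphism J. *)
Definition cov_endo Gam J (i : 'I_n) x : 'M[R]_n :=
  \matrix_(k, j) (partial i (fun y => J y k j) x
    + \sum_l (Gam k i l x * J x l j - Gam l i j x * J x k l)).

Definition parallel_endo U Gam J : Prop :=
  forall i x, U x -> cov_endo Gam J i x = 0.

End Tensors.

Section Dim3.
Variable R : realType.
Notation point := 'rV[R]_3.
Implicit Types (U : set point) (h : point -> 'M[R]_3) (w X : point -> 'rV[R]_3).

(* The weightless vector field chi = mu^-1 X has D chi = mu^-1 (D X - w X); this
   is the component of D_(d_i) X - w_i X along d_k. *)
Definition cov_weightless h w X (i k : 'I_3) x : R :=
  partial i (fun y => X y 0 k) x
  + \sum_l weyl_connection h w k i l x * X x 0 l - w x 0 i * X x 0 k.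

(* <D_(d_i) chi, d_j> = kappa (iota_(d_i) *chi)(d_j), where
   *chi = iota_chi *1 by iota_X *alpha = *(<X, .> /\ alpha) with alpha = 1. *)
Definition congruence V h w (k : point -> R) X : Prop :=
  smooth_mx V X /\
  (forall x, V x -> forall i j : 'I_3,
     \sum_l h x j l * cov_weightless h w X i l x =
     k x * volume (fun=> 1) h x
             (tnth [tuple X x; coord_vec R i; coord_vec R j])).

(* The Weyl manifold (U, mu^2 h, D mu = w mu), with the standard orientation, is
   a hyperCR Einstein-Weyl space with twist kappa = k mu^-1. *)
Definition hyperCR U h w (k : point -> R) : Prop :=
  [/\ open U /\ riemannian U h, smooth_mx U w, smooth U k, einstein_weyl U h w &
   forall x, U x -> exists V, [/\ open V, V x, V `<=` U &
     exists chi : 'I_3 -> point -> 'rV[R]_3,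
       (forall y, V y -> forall a b,
          (chi a y *m h y *m (chi b y)^T) 0 0 = (a == b)%:R) /\
       (forall a, congruence V h w k (chi a))]].

End Dim3.

Section Dim4.
Variable R : realType.
Notation point := 'rV[R]_4.
Implicit Types (U : set point) (o : point -> R) (g : point -> 'M[R]_4).

(* The normalisation iota_X *alpha = *(<X, .> /\ alpha) gives
   *(Y /\ X) = iota_Y iota_X *1, so that the kl component of *alpha is
   1/2 alpha^ij vol_jikl: note the order of i and j. *)
Definition hodge o g (x : point) (a : 'M[R]_4) : 'M[R]_4 :=
  let up := invmx (g x) *m a *m (invmx (g x))^T in
  \matrix_(k, l) (2^-1 * \sum_i \sum_j up i j *
    volume o g x (tnth [tuple coord_vec R j; coord_vec R i;
                              coord_vec R k; coord_vec R l])).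

Definition antiselfdual_form o g x (a : 'M[R]_4) : Prop :=
  a^T = - a /\ hodge o g x a = - a.

(* Ric = 2 P + tr(P) g. *)
Definition schouten g x : 'M[R]_4 :=
  2^-1 *: (ricci (weyl_connection g (fun=> 0)) x
           - (scalar_curvature g (fun=> 0) x / 6) *: g x).

(* The components <W(d_i, d_j) d_k, d_l> of the Weyl curvature. *)
Definition weyl_curvature g (i j k l : 'I_4) x : R :=
  let P := schouten g x in
  \sum_m g x l m * curvature (weyl_connection g (fun=> 0)) i j k m x
  - (P i l * g x j k + g x i l * P j k - P i k * g x j l - g x i k * P j l).

(* The Weyl curvature, as an operator on 2-forms, kills antiselfdual forms. *)
Definition selfdual U o g : Prop :=
  forall x, U x -> forall a : 'M[R]_4, antiselfdual_form o g x a ->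
  forall k l, let up := invmx (g x) *m a *m (invmx (g x))^T in
    \sum_i \sum_j weyl_curvature g i j k l x * up i j = 0.

Definition antiselfdual_complex U o g (J : point -> 'M[R]_4) : Prop :=
  [/\ integrable_complex U J, orthogonal U g J &
      forall x, U x -> antiselfdual_form o g x (form_of g J x)].

Definition compatible_hypercomplex U o g (I1 I2 I3 : point -> 'M[R]_4) : Prop :=
  [/\ antiselfdual_complex U o g I1, antiselfdual_complex U o g I2,
      antiselfdual_complex U o g I3 &
      forall x, U x -> [/\ I1 x *m I2 x = I3 x, I2 x *m I3 x = I1 x &
                           I3 x *m I1 x = I2 x]].

Definition sd_einstein U o g : Prop :=
  [/\ open U /\ riemannian U g, selfdual U o g, einstein U g &
      forall x, U x -> scalar_curvature g (fun=> 0) x != 0].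

(* In the length scale of g, for which D^g is 0, D^Ob is the 1-form w. *)
Definition obata U g (I1 I2 I3 : point -> 'M[R]_4) (w : point -> 'rV[R]_4) :=
  smooth_mx U w /\
  [/\ parallel_endo U (weyl_connection g w) I1,
      parallel_endo U (weyl_connection g w) I2 &
      parallel_endo U (weyl_connection g w) I3].

End Dim4.

Section Construction.
Variable R : realType.
Variables (h : 'rV[R]_3 -> 'M[R]_3) (w : 'rV[R]_3 -> 'rV[R]_3)
          (k : 'rV[R]_3 -> R).
Implicit Type p : 'rV[R]_(3 + 1).

(* A point of B x R is row_mx x t%:M; mu_t = t mu_B, and mu_t kappa = t k. *)
Definition base p : 'rV[R]_3 := lsubmx p.
Definition fibre p : R := rsubmx p 0 0.

Definition factor p : R := 1 + 2 * fibre p * k (base p).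

Definition total_space (U : set 'rV[R]_3) : set 'rV[R]_(3 + 1) :=
  [set p | [/\ U (base p), fibre p != 0 & factor p != 0]].

(* D^B mu_t = (dt + t w) mu_B. *)
Definition D_mu_t p : 'rV[R]_(3 + 1) := row_mx (fibre p *: w (base p)) 1%:M.

Definition metric p : 'M[R]_(3 + 1) :=
  (fibre p ^+ 2)^-1 *:
    (factor p *: block_mx (h (base p)) 0 0 0
     + (factor p)^-1 *: ((D_mu_t p)^T *m D_mu_t p)).

(* The metric up to sign: metric p is positive definite where factor p > 0 and
   negative definite where factor p < 0. *)
Definition positive_metric p : 'M[R]_(3 + 1) := Num.sg (factor p) *: metric p.

(* The orientation *_B 1 /\ xi, where the weightless unit 1-form xi is
   factor^-1 D^B mu_t: a positive multiple of D^B mu_t where factor > 0, and a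
   negative one where factor < 0, as is needed for selfduality there. *)
Definition orientation p : R := Num.sg (factor p).

End Construction.

(* phi is a diffeomorphism from V onto W. *)
Definition diffeomorphism (R : realType) (n : nat) (V W : set 'rV[R]_n)
    (phi : 'rV[R]_n -> 'rV[R]_n) : Prop :=
  exists psi : 'rV[R]_n -> 'rV[R]_n,
    [/\ smooth_mx V phi, smooth_mx W psi,
        forall x, V x -> W (phi x) /\ psi (phi x) = x &
        forall y, W y -> V (psi y) /\ phi (psi y) = y].

Definition pullback (R : realType) (n : nat) (phi : 'rV[R]_n -> 'rV[R]_n)
    (g : 'rV[R]_n -> 'M[R]_n) (x : 'rV[R]_n) : 'M[R]_n :=
  'J phi x *m g (phi x) *m ('J phi x)^T.

(* Main.v *)
Require Import Defs.
From HB Require Import structures.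
From mathcomp Require Import all_boot all_order all_algebra.
From mathcomp Require Import all_classical all_reals all_analysis.
From mathcomp Require Import ring lra zify.

Import Order.TTheory GRing.Theory Num.Theory.
Import numFieldNormedType.Exports.

Local Open Scope classical_set_scope.
Local Open Scope ring_scope.

(** Both sides of the correspondence are systems of structure equations for a
    coframe, and the theorem is a dictionary between the two systems.

    In dimension three, a hyperCR Einstein-Weyl structure is the same as a coframe
    sigma with
      d sigma_a = - w /\ sigma_a + 2 k sigma_b /\ sigma_c
    ([structure3]).  In dimension four, a selfdual Einstein metric with a compatible
    hypercomplex structure is phi (theta^2 + a^2 + b^2 + c^2) wherever theta is not
    zero, with a, b, c the images of theta under the complex structures, and
      d a = m (theta /\ a - b /\ c) - 2 b /\ c
    and its cyclic permutations ([structure_eq]), where m = lambda phi and lambda is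
    1/24 of the scalar curvature.

    From three to four dimensions, theta = (2 t v)^-1 (dt + t w) and
    a = (2 t)^-1 sigma_a with v = 1 + 2 t k solve the second system with m = - 2 v.
    That system determines the connection on antiselfdual forms, whose
    curvature is a constant multiple of the forms themselves; the rest of the
    curvature takes selfdual values, so the metric is selfdual and Einstein.

    Conversely, comparing the curvatures of the Obata and Levi-Civita derivatives
    gives the exterior derivatives of the coframe, and differentiating once more shows
    that lambda is constant.  The vector field on which a, b, c vanish and theta
    is 1/m spans the fibres.  In the time s of its flow, the structure equations say
    that exp(- s) a, exp(- s) b, exp(- s) c, the part of m theta along the slices and
    exp(s) (m + 2) are constant along the fibres ([base_constant], [flow_scaling]):
    they are the three-dimensional data, and t = exp(- s) is the fibre coordinate.  The
    flow box this needs ([flow_box]) rests on the smooth dependence of solutions of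
    differential equations on their initial values and on the inverse function
    theorem. *)

Set Implicit Arguments.
Unset Strict Implicit.
Unset Printing Implicit Defensive.

(** * Calculus of smooth functions *)

Section Rows.
Variables (R : realType) (n : nat).
Implicit Types (v x : 'rV[R]_n).

Lemma ler_row_norm v j : `|v 0 j| <= `|v|.
Proof.
rewrite [leRHS]/Num.Def.normr/= mx_normrE.
exact: (le_trans _ (le_bigmax _ _ (0, j))).
Qed.

Lemma row_norm_le v e : 0 <= e -> (forall j, `|v 0 j| <= e) -> `|v| <= e.
Proof.
move=> e0 ve; rewrite [leLHS]/Num.Def.normr/= mx_normrE.
by apply: bigmax_le => // -[i j] _; rewrite ord1.
Qed.

Lemma row_delta_norm (i : 'I_n) : `|delta_mx 0 i : 'rV[R]_n| <= 1.
Proof.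
by apply: row_norm_le => // j; rewrite mxE eqxx /=; case: (j == i); rewrite ?normr1 ?normr0.
Qed.

Lemma line_derivable (f : 'rV[R]_n -> R) x v (t : R) :
  derivable f (x + t *: v) v ->
  is_derive t 1 (fun s => f (x + s *: v)) ('D_v f (x + t *: v)).
Proof.
move=> fd.
have E : (fun h : R => h^-1 *: (((fun s => f (x + s *: v)) \o shift t) (h *: 1)
            - f (x + t *: v)))
       = (fun h : R => h^-1 *: ((f \o shift (x + t *: v)) (h *: v) - f (x + t *: v))).
  apply/funext => h /=; congr (_ *: (f _ - _)).
  have -> : h%:A = h by rewrite /GRing.scale /= mulr1.
  by rewrite scalerDl addrCA.
by split; [rewrite /derivable E|rewrite /derive E].
Qed.

Lemma mvt_line (f : 'rV[R]_n -> R) x v (a : R) : 0 <= a ->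
  (forall t : R, 0 <= t <= a -> derivable f (x + t *: v) v) ->
  exists2 c : R, 0 <= c <= a & f (x + a *: v) - f x = a * 'D_v f (x + c *: v).
Proof.
move=> a0 fd.
have der (t : R) : 0 <= t <= a ->
    is_derive t 1 (fun s => f (x + s *: v)) ('D_v f (x + t *: v)).
  by move=> /fd /line_derivable.
have [] := @MVT_segment R (fun s => f (x + s *: v)) (fun s => 'D_v f (x + s *: v)) 0 a a0.
- by move=> t /[!in_itv]/= /andP[t0 t1]; apply: der; rewrite !ltW.
- apply: derivable_within_continuous => t /[!in_itv]/= t01.
  by have := der _ t01; case.
move=> c /[!in_itv]/= /andP[c0 c1].
rewrite scale0r addr0 subr0 mulrC => ->; exists c => //.
by rewrite c0.
Qed.

Lemma mvt_axis (f : 'rV[R]_n -> R) x v (a : R) :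
  (forall t : R, `|t| <= `|a| -> derivable f (x + t *: v) v) ->
  exists2 c : R, `|c| <= `|a| & f (x + a *: v) - f x = a * 'D_v f (x + c *: v).
Proof.
move=> fd; have [a0|a0] := leP 0 a.
  have [|c /andP[c0 ca] E] := @mvt_line f x v a a0.
    by move=> t /andP[t0 ta]; apply: fd; rewrite !ger0_norm.
  by exists c => //; rewrite !ger0_norm.
have [||c /andP[c0 ca] E] := @mvt_line f (x + a *: v) v (- a).
- by rewrite oppr_ge0 ltW.
- move=> t /andP[t0 ta]; rewrite -addrA -scalerDl; apply: fd.
  rewrite (ltr0_norm a0) ler_norml; apply/andP; split; lra.
exists (a + c).
  rewrite (ltr0_norm a0) ler_norml; apply/andP; split; lra.
move: E; rewrite -!addrA -!scalerDl subrr scale0r addr0 => E.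
by rewrite -opprB E mulNr opprK.
Qed.

Lemma diff_from_bound (V W : normedModType R) (f : V -> W) (x : V)
    (L : {linear V -> W}) :
  continuous L ->
  (forall e : R, 0 < e ->
     \forall h \near (0 : V), `|f (h + x) - f x - L h| <= e * `|h|) ->
  differentiable f x.
Proof.
move=> Lc fL.
have H : f \o shift x = cst (f x) + L +o_ 0 id.
  apply/eqaddoP => e e0; near=> h.
  rewrite /= !fctE /= opprD addrA; near: h; exact: fL.
by apply/diff_locallyP; split; rewrite (diff_unique Lc H).
Unshelve. all: by end_near. Qed.

Lemma diff_from_gradient (f : 'rV[R]_n -> R) x (d : 'I_n -> R) :
  (forall e : R, 0 < e -> \forall h \near (0 : 'rV[R]_n),
     `|f (h + x) - f x - \sum_j h 0 j * d j| <= e * `|h|) ->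
  differentiable f x.
Proof.
move=> fL.
pose L (h : 'rV[R]_n) : R := \sum_j h 0 j * d j.
have linL : linear L.
  move=> a u v; rewrite /L /GRing.scale /= mulr_sumr -big_split /=.
  by apply: eq_bigr => j _; rewrite !mxE; ring.
pose Lm : {linear 'rV[R]_n -> R} := HB.pack L (GRing.isLinear.Build _ _ _ _ L linL).
apply: (@diff_from_bound _ _ f x Lm) => // y.
apply: differentiable_continuous.
have -> : (Lm : 'rV[R]_n -> R) = \sum_j (fun h : 'rV[R]_n => h 0 j * d j).
  by apply/funext => h; rewrite fct_sumE.
apply: differentiable_sum => j.
by apply: differentiableM; [exact: differentiable_coord|exact: differentiable_cst].
Qed.

Lemma partial_sum (f : 'rV[R]_n -> R) x v :
  differentiable f x -> 'D_v f x = \sum_i v 0 i * partial i f x.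
Proof.
move=> fd; rewrite deriveE // {1}(row_sum_delta v) linear_sum.
by apply: eq_bigr => j _; rewrite linearZ /= /partial deriveE.
Qed.

(** The increment of [f] is the sum of its increments along the coordinate axes, and
    the mean value theorem applies to each of them. *)
Lemma C1_differentiable (U : set 'rV[R]_n) (f : 'rV[R]_n -> R) x :
  open U -> U x ->
  (forall i y, U y -> derivable f y (delta_mx 0 i)) ->
  (forall i, {for x, continuous (partial i f)}) ->
  differentiable f x.
Proof.
move=> oU Ux fd fc; apply: (@diff_from_gradient f x (fun j => partial j f x)) => e e0.
have e'0 : 0 < e / n.+1%:R by rewrite divr_gt0 // ltr0n.
have near_x : \forall y \near x, U y /\
    forall i, `|partial i f y - partial i f x| <= e / n.+1%:R.
  near=> y; split; first by near: y; exact: open_nbhs_nbhs.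
  move=> i; rewrite distrC; move: i; near: y; apply: filter_forall => i.
  by move/cvgrPdist_le : (fc i) => /(_ _ e'0).
have /nbhs_ballP[r r0 rP] := near_x.
apply/nbhs_ballP; exists r => //= h.
rewrite -ball_normE /= sub0r normrN => hr.
pose hk (k : nat) : 'rV[R]_n := \row_j (if (j < k)%N then h 0 j else 0).
have hkn : hk n = h by apply/rowP => j; rewrite mxE ltn_ord.
have hk0 : hk 0%N = 0 by apply/rowP => j; rewrite !mxE.
have hkS (k : 'I_n) : hk k.+1 = hk k + h 0 k *: delta_mx 0 k.
  apply/rowP => j; rewrite !mxE eqxx /= ltnS leq_eqVlt -val_eqE /=.
  case: eqP => [/val_inj ->|_] /=; first by rewrite ltnn mulr1 add0r.
  by rewrite mulr0 addr0.
have stepP (k : 'I_n) : `|(f (x + hk k.+1) - f (x + hk k)) - h 0 k * partial k f x|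
    <= e / n.+1%:R * `|h|.
  have inb (t : R) : `|t| <= `|h 0 k| ->
      ball x r (x + hk k + t *: delta_mx 0 k).
    move=> th; rewrite -ball_normE /= -addrA opprD addNKr normrN.
    apply: le_lt_trans hr; apply: row_norm_le => // j.
    rewrite !mxE eqxx /=.
    have [->|jk] := eqVneq j k.
      by rewrite ltnn add0r mulr1 (le_trans th) // ler_row_norm.
    rewrite mulr0 addr0; case: ifP => _; first exact: ler_row_norm.
    by rewrite normr0.
  have [t /inb /rP [Ut _]|c /inb /rP [_ cP]] :=
      @mvt_axis f (x + hk k) (delta_mx 0 k) (h 0 k).
    exact: fd.
  rewrite -addrA -hkS => ->.
  rewrite -mulrBr normrM mulrC ler_pM //; first exact: cP.
  exact: ler_row_norm.
have -> : f (h + x) - f x = \sum_(k < n) (f (x + hk k.+1) - f (x + hk k)).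
  rewrite -(big_mkord xpredT (fun k => f (x + hk k.+1) - f (x + hk k))).
  by rewrite (telescope_sumr (fun k => f (x + hk k))) // hkn hk0 addr0 [h + x]addrC.
rewrite -sumrB; apply: le_trans (ler_norm_sum _ _ _) _.
apply: le_trans (ler_sum _ (fun k _ => stepP k)) _.
rewrite sumr_const card_ord -[leLHS]mulr_natl mulrA ler_wpM2r //.
by rewrite mulrA ler_pdivrMr ?ltr0n // mulrC ler_wpM2l ?(ltW e0) // ler_nat.
Unshelve. all: by end_near. Qed.

End Rows.

Section Ck.
Variables (R : realType) (n : nat).
Implicit Types (U : set 'rV[R]_n) (f g : 'rV[R]_n -> R).

Fixpoint Ck (k : nat) U f : Prop :=
  (forall x, U x -> {for x, continuous f}) /\
  if k is k'.+1 then
    (forall i x, U x -> derivable f x (delta_mx 0 i)) /\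
    (forall i, Ck k' U (partial i f))
  else True.

Lemma CkS k U f : Ck k.+1 U f <->
  [/\ forall x, U x -> {for x, continuous f},
      forall i x, U x -> derivable f x (delta_mx 0 i) &
      forall i, Ck k U (partial i f)].
Proof. by split=> [[? []]|[]]. Qed.

Lemma Ck_continuous k U f x : Ck k U f -> U x -> {for x, continuous f}.
Proof. by case: k => [|k] [+ _] => /[apply]. Qed.

Lemma Ck_pred k U f : Ck k.+1 U f -> Ck k U f.
Proof.
elim: k f => [|k IH] f; first by move=> [].
move=> /CkS[c d s]; apply/CkS; split => // i; exact/IH/s.
Qed.

Lemma Ck1S k U f : Ck k.+1 U f -> Ck 1 U f.
Proof. by elim: k f => [//|k IH] f /Ck_pred/IH. Qed.

Lemma Ck_differentiable k U f x : open U -> Ck k.+1 U f -> U x ->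
  differentiable f x.
Proof.
move=> oU /Ck1S/CkS[_ fd fc] Ux; apply: (@C1_differentiable _ _ U) => // i.
exact: Ck_continuous (fc i) Ux.
Qed.

Lemma partial_near U f g i x : open U -> U x -> (forall y, U y -> f y = g y) ->
  partial i f x = partial i g x.
Proof.
move=> oU Ux fg; apply: near_eq_derive; near=> y.
by apply: fg; near: y; exact: open_nbhs_nbhs.
Unshelve. all: by end_near. Qed.

Lemma derivable_near U f g i x : open U -> U x -> (forall y, U y -> f y = g y) ->
  derivable f x i -> derivable g x i.
Proof.
move=> oU Ux fg; apply: near_eq_derivable; near=> y.
by apply: fg; near: y; exact: open_nbhs_nbhs.
Unshelve. all: by end_near. Qed.

Lemma continuous_near U f g x : open U -> U x -> (forall y, U y -> f y = g y) ->
  {for x, continuous f} -> {for x, continuous g}.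
Proof.
move=> oU Ux fg cf; rewrite /prop_for /continuous_at -(fg x Ux).
have E : {near nbhs x, f =1 g}.
  by near=> y; apply: fg; near: y; exact: open_nbhs_nbhs.
exact: cvg_trans (near_eq_cvg E) cf.
Unshelve. all: by end_near. Qed.

Lemma eq_Ck k U f g : open U -> (forall y, U y -> f y = g y) ->
  Ck k U f -> Ck k U g.
Proof.
move=> oU; elim: k f g => [|k IH] f g fg.
  by move=> [cf _]; split => // x Ux; exact: (continuous_near oU Ux fg (cf x Ux)).
move=> /CkS[c d s]; apply/CkS; split.
- by move=> x Ux; exact: (continuous_near oU Ux fg (c x Ux)).
- by move=> i x Ux; exact: (derivable_near oU Ux fg (d i x Ux)).
- by move=> i; apply: IH (s i) => y Uy; exact: partial_near oU Uy fg.
Qed.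

Lemma smoothP U f : open U -> smooth U f <-> forall k, Ck k U f.
Proof.
move=> oU; split=> [sf k|cf s x Ux].
  elim: k f sf => [|k IH] f sf.
    by split=> // x Ux; apply: differentiable_continuous; exact: (sf [::]).
  apply/CkS; split=> [x Ux|i x Ux|i].
  - by apply: differentiable_continuous; exact: (sf [::]).
  - by apply: diff_derivable; exact: (sf [::]).
  apply: IH => s x Ux; have := sf (rcons s i) x Ux.
  by rewrite -cats1 foldr_cat.
elim/last_ind: s f cf => [|s i IH] f cf /=; first exact: Ck_differentiable (cf 1%N) Ux.
rewrite -cats1 foldr_cat /=; apply: IH => k.
by have /CkS[_ _] := cf k.+1.
Qed.

End Ck.

Section Closure.
Variables (R : realType) (n : nat).
Implicit Types (U : set 'rV[R]_n) (f g : 'rV[R]_n -> R).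

Lemma Ck_cst k U (c : R) : Ck k U (fun=> c).
Proof.
elim: k c => [|k IH] c; first by split=> // x _; exact: cst_continuous.
apply/CkS; split=> [x _|i x _|i]; [exact: cst_continuous|exact: derivable_cst|].
have -> : partial i (fun=> c) = (fun=> 0 : R).
  by apply/funext => x; rewrite /partial derive_cst.
exact: IH.
Qed.

Lemma partial_coord (i j : 'I_n) (x : 'rV[R]_n) :
  is_derive x (delta_mx 0 i) (fun y : 'rV[R]_n => y 0 j) ((i == j)%:R).
Proof.
have fd : differentiable (fun y : 'rV[R]_n => y 0 j) x by exact: differentiable_coord.
apply: DeriveDef; first exact: diff_derivable.
pose L (y : 'rV[R]_n) : R := y 0 j.
have linL : linear L by move=> a u v; rewrite /L !mxE.
pose Lm : {linear 'rV[R]_n -> R} := HB.pack L (GRing.isLinear.Build _ _ _ _ L linL).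
have Lc : continuous Lm by move=> y; apply: differentiable_continuous; exact: differentiable_coord.
by rewrite deriveE // (@diff_lin _ _ _ Lm x Lc) /= /L mxE eqxx eq_sym.
Qed.

Lemma Ck_coord k U (j : 'I_n) : Ck k U (fun x => x 0 j).
Proof.
case: k => [|k]; first by split=> // x _; apply: differentiable_continuous; exact: differentiable_coord.
apply/CkS; split=> [x _|i x _|i].
- by apply: differentiable_continuous; exact: differentiable_coord.
- by have [] := partial_coord i j x.
have -> : partial i (fun x : 'rV[R]_n => x 0 j) = (fun=> (i == j)%:R : R).
  by apply/funext => x; have [] := partial_coord i j x.
exact: Ck_cst.
Qed.

Lemma Ck_add k U f g : open U -> Ck k U f -> Ck k U g -> Ck k U (fun x => f x + g x).
Proof.
move=> oU; elim: k f g => [|k IH] f g.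
  by move=> [cf _] [cg _]; split=> // x Ux; apply: (continuousD (cf _ Ux) (cg _ Ux)).
move=> /CkS[cf df sf] /CkS[cg dg sg]; apply/CkS; split.
- by move=> x Ux; apply: (continuousD (cf _ Ux) (cg _ Ux)).
- by move=> i x Ux; apply: derivableD; [exact: df|exact: dg].
move=> i; apply: (@eq_Ck _ _ _ _ (fun x => partial i f x + partial i g x)) => //.
  by move=> y Uy; rewrite /partial -deriveD //; [exact: df|exact: dg].
exact: IH.
Qed.

Lemma Ck_mul k U f g : open U -> Ck k U f -> Ck k U g -> Ck k U (fun x => f x * g x).
Proof.
move=> oU; elim: k f g => [|k IH] f g.
  by move=> [cf _] [cg _]; split=> // x Ux; apply: (continuousM (cf _ Ux) (cg _ Ux)).
move=> hf hg; move: (hf) (hg) => /CkS[cf df sf] /CkS[cg dg sg]; apply/CkS; split.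
- by move=> x Ux; apply: (continuousM (cf _ Ux) (cg _ Ux)).
- by move=> i x Ux; apply: derivableM; [exact: df|exact: dg].
move=> i; apply: (@eq_Ck _ _ _ _
    (fun x => f x * partial i g x + g x * partial i f x)) => //.
  by move=> y Uy; rewrite /partial deriveM; [|exact: df|exact: dg].
by apply: Ck_add => //; apply: IH => //; exact: Ck_pred.
Qed.

Lemma Ck_scale k U (c : R) f : open U -> Ck k U f -> Ck k U (fun x => c * f x).
Proof. by move=> oU; apply: Ck_mul => //; exact: Ck_cst. Qed.

Lemma Ck_opp k U f : open U -> Ck k U f -> Ck k U (fun x => - f x).
Proof.
move=> oU /(@Ck_scale _ _ (-1) _ oU); apply: eq_Ck => // y _.
by rewrite mulN1r.
Qed.

Lemma Ck_sum k U (I : Type) (r : seq I) (P : pred I) (F : I -> 'rV[R]_n -> R) :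
  open U -> (forall i, P i -> Ck k U (F i)) -> Ck k U (fun x => \sum_(i <- r | P i) F i x).
Proof.
move=> oU hF; elim: r => [|i r IH].
  by apply: (@eq_Ck _ _ _ _ (fun=> 0)) => // [x _|]; [rewrite big_nil|exact: Ck_cst].
have [Pi|Pi] := boolP (P i).
  apply: (@eq_Ck _ _ _ _ (fun x => F i x + \sum_(i <- r | P i) F i x)) => //.
    by move=> x _; rewrite big_cons Pi.
  by apply: Ck_add => //; exact: hF.
by apply: eq_Ck IH => // x _; rewrite big_cons (negbTE Pi).
Qed.

Lemma Ck_prod k U (I : Type) (r : seq I) (P : pred I) (F : I -> 'rV[R]_n -> R) :
  open U -> (forall i, P i -> Ck k U (F i)) -> Ck k U (fun x => \prod_(i <- r | P i) F i x).
Proof.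
move=> oU hF; elim: r => [|i r IH].
  by apply: (@eq_Ck _ _ _ _ (fun=> 1)) => // [x _|]; [rewrite big_nil|exact: Ck_cst].
have [Pi|Pi] := boolP (P i).
  apply: (@eq_Ck _ _ _ _ (fun x => F i x * \prod_(i <- r | P i) F i x)) => //.
    by move=> x _; rewrite big_cons Pi.
  by apply: Ck_mul => //; exact: hF.
by apply: eq_Ck IH => // x _; rewrite big_cons (negbTE Pi).
Qed.

Lemma Ck_inv k U f : open U -> (forall x, U x -> f x != 0) ->
  Ck k U f -> Ck k U (fun x => (f x)^-1).
Proof.
move=> oU f0; elim: k => [|k IH].
  by move=> [cf _]; split=> // x Ux; apply: (continuousV (f0 _ Ux) (cf _ Ux)).
move=> hf; move: (hf) => /CkS[cf df sf]; apply/CkS; split.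
- by move=> x Ux; apply: (continuousV (f0 _ Ux) (cf _ Ux)).
- by move=> i x Ux; apply: derivableV; [exact: f0|exact: df].
move=> i; apply: (@eq_Ck _ _ _ _
    (fun x => - ((f x)^-1 * (f x)^-1 * partial i f x))) => //.
  move=> y Uy; rewrite /partial deriveV ?f0 //; last exact: df.
  by rewrite expr2 invfM /GRing.scale /= mulNr.
have If := IH (Ck_pred hf).
by apply: Ck_opp => //; apply: Ck_mul => //; apply: Ck_mul.
Qed.

End Closure.

Section Composition.
Variables (R : realType) (m n : nat).
Implicit Types (U : set 'rV[R]_m) (V : set 'rV[R]_n).

Lemma differentiable_mx (W : normedModType R) (F : W -> 'rV[R]_n) x :
  (forall j, differentiable (fun y => F y 0 j) x) -> differentiable F x.
Proof.
move=> dF; have -> : F = \sum_j (fun y => F y 0 j *: delta_mx 0 j).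
  by apply/funext => y; rewrite fct_sumE -row_sum_delta.
by apply: differentiable_sum => j; apply: differentiableZl.
Qed.

Lemma continuous_row (T : topologicalType) (F : T -> 'rV[R]_n) x :
  (forall j, {for x, continuous (fun y => F y 0 j)}) -> {for x, continuous F}.
Proof.
move=> cF; apply/cvgrPdist_le => e e0; near=> y.
apply: row_norm_le (ltW e0) _ => j; rewrite !mxE; move: j; near: y.
apply: filter_forall => j; have := cF j.
by move/cvgrPdist_le => /(_ _ e0).
Unshelve. all: by end_near. Qed.

Lemma partial_comp (f : 'rV[R]_n -> R) (F : 'rV[R]_m -> 'rV[R]_n) x i :
  differentiable f (F x) -> (forall j, differentiable (fun y => F y 0 j) x) ->
  is_derive x (delta_mx 0 i) (fun y => f (F y))
    (\sum_j partial i (fun y => F y 0 j) x * partial j f (F x)).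
Proof.
move=> df dF; have dFx := differentiable_mx dF.
have dfF : differentiable (f \o F) x by exact: differentiable_comp.
apply: DeriveDef; first exact: diff_derivable.
rewrite (deriveE _ dfF) diff_comp // /= -deriveE //.
rewrite -deriveE // partial_sum //; apply: eq_bigr => j _; congr (_ * _).
by rewrite derive_mx ?mxE //; exact: diff_derivable.
Qed.

Lemma Ck_comp k U V (f : 'rV[R]_n -> R) (F : 'rV[R]_m -> 'rV[R]_n) :
  open U -> open V -> (forall x, U x -> V (F x)) ->
  Ck k V f -> (forall j, Ck k U (fun x => F x 0 j)) -> Ck k U (fun x => f (F x)).
Proof.
move=> oU oV UV; elim: k f => [|k IH] f hf hF.
  split=> // x Ux; apply: continuous_comp; last exact: Ck_continuous hf (UV _ Ux).
  by apply: continuous_row => j; exact: Ck_continuous (hF j) Ux.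
have D x i : U x -> is_derive x (delta_mx 0 i) (fun y => f (F y))
    (\sum_j partial i (fun y => F y 0 j) x * partial j f (F x)).
  move=> Ux; apply: partial_comp.
    exact: Ck_differentiable oV hf (UV _ Ux).
  by move=> j; exact: Ck_differentiable oU (hF j) Ux.
apply/CkS; split=> [x Ux|i x Ux|i].
- apply: continuous_comp; last exact: Ck_continuous hf (UV _ Ux).
  by apply: continuous_row => j; exact: Ck_continuous (hF j) Ux.
- by have [] := D x i Ux.
apply: (@eq_Ck _ _ _ _
   (fun x => \sum_j partial i (fun y => F y 0 j) x * partial j f (F x))) => //.
  by move=> x Ux; have [] := D x i Ux.
apply: Ck_sum => // j _; apply: Ck_mul => //.
  by have /CkS[_ _] := hF j.
apply: IH; first by have /CkS[_ _] := hf.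
by move=> l; exact: Ck_pred.
Qed.

End Composition.

Section RealComposition.
Variables (R : realType) (n : nat).
Implicit Types (U : set 'rV[R]_n) (f g : 'rV[R]_n -> R).

Lemma is_derive_comp1 (h : R -> R) (h' : R) f x (v : 'rV[R]_n) :
  is_derive (f x) 1 h h' -> derivable f x v ->
  is_derive x v (fun y => h (f y)) (h' * 'D_v f x).
Proof.
move=> hd fd.
have fl : derivable (fun s : R => f (x + s *: v)) 0 1 /\
    'D_1 (fun s : R => f (x + s *: v)) 0 = 'D_v f x.
  have [] := @line_derivable R n f x v 0; rewrite ?scale0r ?addr0 //.
have D : is_derive (0 : R) (1 : R) (fun s : R => h (f (x + s *: v))) (h' * 'D_v f x).
  have f1 : is_derive (0 : R) (1 : R) (fun s : R => f (x + s *: v)) ('D_v f x).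
    by case: fl => a b; exact: DeriveDef.
  have h1 : is_derive (f (x + (0 : R) *: v)) 1 h h' by rewrite scale0r addr0.
  have d1 : derivable (fun s : R => f (x + s *: v)) 0 1 by case: f1.
  have d2 : derivable h (f (x + (0 : R) *: v)) 1 by case: h1.
  have E := derive1_comp d1 d2.
  split; last first.
    move: E; rewrite !derive1E => ->.
    by case: h1 => _ ->; case: f1 => _ ->.
  move/derivable1_diffP: d1 => d1; move/derivable1_diffP: d2 => d2.
  by apply/derivable1_diffP; exact: (differentiable_comp d1 d2).
have E (k : 'rV[R]_n -> R) : (fun s : R => s^-1 *: (((fun s : R => k (x + s *: v)) \o shift 0) (s *: 1)
            - k (x + (0 : R) *: v)))
       = (fun s : R => s^-1 *: ((k \o shift x) (s *: v) - k x)).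
  apply/funext => s /=; congr (_ *: (k _ - k _)); last by rewrite scale0r addr0.
  have -> : s%:A = s by rewrite /GRing.scale /= mulr1.
  by rewrite addr0 addrC.
case: D; rewrite /derivable /derive (E (fun y => h (f y))) => D1 D2.
by split.
Qed.

Lemma Ck_expR k U f : open U -> Ck k U f -> Ck k U (fun x => expR (f x)).
Proof.
move=> oU; elim: k => [|k IH].
  move=> [cf _]; split=> // x Ux; apply: (continuous_comp (cf x Ux)).
  exact: continuous_expR.
move=> hf; move: (hf) => /CkS[cf df sf].
have D i x : U x -> is_derive x (delta_mx 0 i) (fun x => expR (f x))
    (expR (f x) * partial i f x).
  by move=> Ux; apply: is_derive_comp1; exact: df.
apply/CkS; split=> [x Ux|i x Ux|i].
- by apply: (continuous_comp (cf x Ux)); exact: continuous_expR.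
- by have [] := D i x Ux.
apply: (@eq_Ck _ _ _ _ (fun x => expR (f x) * partial i f x)) => //.
  by move=> x Ux; have [] := D i x Ux.
by apply: Ck_mul => //; apply: IH; exact: Ck_pred.
Qed.

Lemma Ck_ln k U f : open U -> (forall x, U x -> 0 < f x) ->
  Ck k U f -> Ck k U (fun x => ln (f x)).
Proof.
move=> oU f0; case: k => [|k].
  move=> [cf _]; split=> // x Ux; apply: (continuous_comp (cf x Ux)).
  by apply: continuous_ln; exact: f0.
move=> hf; move: (hf) => /CkS[cf df sf].
have D i x : U x -> is_derive x (delta_mx 0 i) (fun x => ln (f x))
    ((f x)^-1 * partial i f x).
  by move=> Ux; apply: is_derive_comp1; [exact/is_derive1_ln/f0|exact: df].
apply/CkS; split=> [x Ux|i x Ux|i].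
- by apply: (continuous_comp (cf x Ux)); apply: continuous_ln; exact: f0.
- by have [] := D i x Ux.
apply: (@eq_Ck _ _ _ _ (fun x => (f x)^-1 * partial i f x)) => //.
  by move=> x Ux; have [] := D i x Ux.
apply: Ck_mul => //; apply: Ck_inv => //; last exact: Ck_pred.
by move=> x Ux; rewrite gt_eqF // f0.
Qed.

End RealComposition.

Section Schwarz.
Variables (R : realType) (n : nat).
Implicit Types (U : set 'rV[R]_n) (f : 'rV[R]_n -> R).

Lemma is_derive_translate f (x v u : 'rV[R]_n) :
  derivable f (x + v) u ->
  is_derive x u (fun y => f (y + v)) ('D_u f (x + v)).
Proof.
have E : (fun h : R => h^-1 *: (((fun y => f (y + v)) \o shift x) (h *: u) - f (x + v)))
       = (fun h : R => h^-1 *: ((f \o shift (x + v)) (h *: u) - f (x + v))).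
  by apply/funext => h /=; rewrite addrA.
by move=> fd; split; [rewrite /derivable E|rewrite /derive E].
Qed.

Lemma half_triangle (e a b c : R) :
  `|b - c| <= e / 2 -> `|a - c| <= e / 2 -> `|a - b| <= e.
Proof.
by rewrite !ler_norml => /andP[? ?] /andP[? ?]; apply/andP; split; lra.
Qed.

(** The mean value theorem, once in each direction. *)
Lemma second_difference U f x (i j : 'I_n) (h : R) : open U -> Ck 2 U f ->
  0 < h -> (forall y, `|y - x| <= 2 * h -> U y) ->
  exists2 y, `|y - x| <= 2 * h &
    f (x + h *: delta_mx 0 i + h *: delta_mx 0 j) - f (x + h *: delta_mx 0 i)
      - (f (x + h *: delta_mx 0 j) - f x) = h * h * partial j (partial i f) y.
Proof.
move=> oU cf h0 hU; have /CkS[_ df sf] := cf.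
have inb (a b : R) : 0 <= a <= h -> 0 <= b <= h ->
    `|x + a *: delta_mx 0 i + b *: delta_mx 0 j - x| <= 2 * h.
  move=> /andP[a0 ah] /andP[b0 bh]; rewrite addrAC [x + _]addrC addrK addrC.
  have -> : 2 * h = h + h by ring.
  apply: (le_trans (ler_normD _ _)); apply: lerD; rewrite normrZ.
    by rewrite ger0_norm // -[leRHS]mulr1 ler_pM // row_delta_norm.
  by rewrite ger0_norm // -[leRHS]mulr1 ler_pM // row_delta_norm.
pose phi y := f (y + h *: delta_mx 0 j) - f y.
have h00 : 0 <= (0 : R) <= h by rewrite lexx ltW.
have hh : 0 <= h <= h by rewrite lexx ltW.
have phiD (c : R) : 0 <= c <= h -> is_derive (x + c *: delta_mx 0 i) (delta_mx 0 i) phi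
    (partial i f (x + c *: delta_mx 0 i + h *: delta_mx 0 j) -
     partial i f (x + c *: delta_mx 0 i)).
  move=> ch; apply: is_deriveB.
    by apply: is_derive_translate; apply: df; apply/hU/inb.
  apply: derivableP; apply: df; apply: hU.
  by have := inb c 0 ch h00; rewrite scale0r addr0.
have [|c ch E] := @mvt_line R n phi x (delta_mx 0 i) h (ltW h0).
  by move=> t th; have [] := phiD t th.
have [_ phic] := phiD c ch; rewrite phic in E.
have [|d dh E'] := @mvt_line R n (partial i f) (x + c *: delta_mx 0 i) (delta_mx 0 j) h (ltW h0).
  move=> t th; have /CkS[_ dd _] := sf i; apply: dd; exact/hU/inb.
exists (x + c *: delta_mx 0 i + d *: delta_mx 0 j); first exact: inb.
by move: E; rewrite E' /phi mulrA => <-.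
Qed.

(** The second difference is symmetric in the two directions. *)
Lemma partialC U f x (i j : 'I_n) : open U -> Ck 2 U f -> U x ->
  partial i (partial j f) x = partial j (partial i f) x.
Proof.
move=> oU cf Ux; apply/eqP; rewrite -subr_eq0 -normr_le0; apply/ler_addgt0Pl => e e0.
rewrite addr0; have e2 : 0 < e / 2 by rewrite divr_gt0.
have /CkS[_ _ sf] := cf.
have cij a b : {for x, continuous (partial a (partial b f))}.
  by have /CkS[_ _ c2] := sf b; exact: Ck_continuous (c2 a) Ux.
have near_le a b : \forall y \near x,
    `|partial a (partial b f) x - partial a (partial b f) y| <= e / 2.
  by have /cvgrPdist_le/(_ _ e2) := cij a b.
have nx : \forall y \near x, U y /\
   (`|partial i (partial j f) x - partial i (partial j f) y| <= e / 2 /\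
   `|partial j (partial i f) x - partial j (partial i f) y| <= e / 2).
  by apply: filterI; [exact: open_nbhs_nbhs|apply: filterI; exact: near_le].
have /nbhs_ballP[r r0 rP] := nx.
pose h := r / 4.
have h0 : 0 < h by rewrite divr_gt0.
have inr y : `|y - x| <= 2 * h -> ball x r y.
  by rewrite -ball_normE /= distrC => /le_lt_trans -> //; move: r0; rewrite /= /h; lra.
have hU y : `|y - x| <= 2 * h -> U y by move=> /inr /rP[].
have [y /inr/rP[_ [_ y2]] Ey] := second_difference i j oU cf h0 hU.
have [z /inr/rP[_ [z2 _]] Ez] := second_difference j i oU cf h0 hU.
have E : partial i (partial j f) z = partial j (partial i f) y.
  apply: (@mulfI _ (h * h)); first by rewrite mulf_neq0 // gt_eqF.
  rewrite -[LHS]Ez -[RHS]Ey [x + h *: delta_mx 0 i + h *: delta_mx 0 j]addrAC.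
  move: (f (x + h *: delta_mx 0 j + h *: delta_mx 0 i)) => a.
  by move: (f (x + h *: delta_mx 0 i)) (f (x + h *: delta_mx 0 j)) (f x) => b c d; ring.
move: y2 z2; rewrite E.
exact: half_triangle.
Qed.

End Schwarz.

Section Smooth.
Variables (R : realType) (n : nat) (U : set 'rV[R]_n).
Hypothesis oU : open U.
Implicit Types f g : 'rV[R]_n -> R.

Lemma smooth_derivable f i x : smooth U f -> U x -> derivable f x (delta_mx 0 i).
Proof. by move=> sf Ux; apply: diff_derivable; exact: (sf [::]). Qed.

Lemma smooth_differentiable f x : smooth U f -> U x -> differentiable f x.
Proof. by move=> sf Ux; exact: (sf [::]). Qed.

Lemma smooth_partial f i : smooth U f -> smooth U (partial i f).
Proof. by move=> /(smoothP _ oU) sf; apply/smoothP => // k; have /CkS[] := sf k.+1. Qed.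

Lemma smooth_partialC f i j x : smooth U f -> U x ->
  partial i (partial j f) x = partial j (partial i f) x.
Proof. by move=> /(smoothP _ oU) sf; apply: partialC (sf 2%N). Qed.

Lemma eq_smooth f g : (forall y, U y -> f y = g y) -> smooth U f -> smooth U g.
Proof.
by move=> fg /(smoothP _ oU) sf; apply/smoothP => // k; exact: eq_Ck oU fg (sf k).
Qed.

Lemma smooth_cst c : smooth U (fun=> c).
Proof. by apply/smoothP => // k; exact: Ck_cst. Qed.

Lemma smooth_coord j : smooth U (fun x => x 0 j).
Proof. by apply/smoothP => // k; exact: Ck_coord. Qed.

Lemma smooth_add f g : smooth U f -> smooth U g -> smooth U (fun x => f x + g x).
Proof. by move=> /(smoothP _ oU) sf /(smoothP _ oU) sg; apply/smoothP => // k; exact: Ck_add. Qed.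

Lemma smooth_mul f g : smooth U f -> smooth U g -> smooth U (fun x => f x * g x).
Proof. by move=> /(smoothP _ oU) sf /(smoothP _ oU) sg; apply/smoothP => // k; exact: Ck_mul. Qed.

Lemma smooth_opp f : smooth U f -> smooth U (fun x => - f x).
Proof. by move=> /(smoothP _ oU) sf; apply/smoothP => // k; exact: Ck_opp. Qed.

Lemma smooth_scale c f : smooth U f -> smooth U (fun x => c * f x).
Proof. by apply: smooth_mul; exact: smooth_cst. Qed.

Lemma smooth_sum (I : Type) (r : seq I) (P : pred I) (F : I -> 'rV[R]_n -> R) :
  (forall i, P i -> smooth U (F i)) -> smooth U (fun x => \sum_(i <- r | P i) F i x).
Proof.
move=> sF; apply/smoothP => // k; apply: Ck_sum => // i /sF sFi.
exact: (proj1 (smoothP _ oU) sFi k).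
Qed.

Lemma smooth_prod (I : Type) (r : seq I) (P : pred I) (F : I -> 'rV[R]_n -> R) :
  (forall i, P i -> smooth U (F i)) -> smooth U (fun x => \prod_(i <- r | P i) F i x).
Proof.
move=> sF; apply/smoothP => // k; apply: Ck_prod => // i /sF sFi.
exact: (proj1 (smoothP _ oU) sFi k).
Qed.

Lemma smooth_inv f : (forall x, U x -> f x != 0) -> smooth U f ->
  smooth U (fun x => (f x)^-1).
Proof. by move=> f0 /(smoothP _ oU) sf; apply/smoothP => // k; exact: Ck_inv. Qed.

Lemma smooth_expR f : smooth U f -> smooth U (fun x => expR (f x)).
Proof. by move=> /(smoothP _ oU) sf; apply/smoothP => // k; exact: Ck_expR. Qed.

Lemma smooth_ln f : (forall x, U x -> 0 < f x) -> smooth U f -> smooth U (fun x => ln (f x)).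
Proof. by move=> f0 /(smoothP _ oU) sf; apply/smoothP => // k; exact: Ck_ln. Qed.

Lemma smooth_sub (V : set 'rV[R]_n) f : V `<=` U -> smooth U f -> smooth V f.
Proof. by move=> VU sf s x /VU; exact: sf. Qed.

Lemma partialE f i x : partial i f x = 'D_(delta_mx 0 i) f x.
Proof. by []. Qed.

(** Leibniz' rule for matrices. *)
Definition dmx p q (i : 'I_n) (A : 'rV[R]_n -> 'M[R]_(p, q)) (x : 'rV[R]_n) : 'M[R]_(p, q) :=
  \matrix_(a, b) partial i (fun y => A y a b) x.

Lemma smooth_mx_mul p q r (A : 'rV[R]_n -> 'M[R]_(p, q)) (B : 'rV[R]_n -> 'M[R]_(q, r)) :
  smooth_mx U A -> smooth_mx U B -> smooth_mx U (fun x => A x *m B x).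
Proof.
move=> sA sB i j; apply: (@eq_smooth (fun x => \sum_k A x i k * B x k j)).
  by move=> y _; rewrite mxE.
by apply: smooth_sum => k _; exact: smooth_mul.
Qed.

Lemma smooth_mx_add p q (A B : 'rV[R]_n -> 'M[R]_(p, q)) :
  smooth_mx U A -> smooth_mx U B -> smooth_mx U (fun x => A x + B x).
Proof.
move=> sA sB i j; apply: (@eq_smooth (fun x => A x i j + B x i j)).
  by move=> y _; rewrite mxE.
exact: smooth_add.
Qed.

Lemma smooth_mx_scale p q (f : 'rV[R]_n -> R) (A : 'rV[R]_n -> 'M[R]_(p, q)) :
  smooth U f -> smooth_mx U A -> smooth_mx U (fun x => f x *: A x).
Proof.
move=> sf sA i j; apply: (@eq_smooth (fun x => f x * A x i j)).
  by move=> y _; rewrite mxE.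
exact: smooth_mul.
Qed.

Lemma smooth_mx_opp p q (A : 'rV[R]_n -> 'M[R]_(p, q)) :
  smooth_mx U A -> smooth_mx U (fun x => - A x).
Proof.
move=> sA i j; apply: (@eq_smooth (fun x => - A x i j)).
  by move=> y _; rewrite mxE.
exact: smooth_opp.
Qed.

Lemma smooth_mx_cst p q (A : 'M[R]_(p, q)) : smooth_mx U (fun=> A).
Proof. by move=> i j; exact: smooth_cst. Qed.

Lemma smooth_mx_tr p q (A : 'rV[R]_n -> 'M[R]_(p, q)) :
  smooth_mx U A -> smooth_mx U (fun x => (A x)^T).
Proof.
move=> sA i j; apply: (@eq_smooth (fun x => A x j i)) => // y _.
by rewrite mxE.
Qed.

Lemma eq_smooth_mx p q (A B : 'rV[R]_n -> 'M[R]_(p, q)) :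
  (forall x, U x -> A x = B x) -> smooth_mx U A -> smooth_mx U B.
Proof. by move=> AB sA i j; apply: eq_smooth (sA i j) => y Uy; rewrite AB. Qed.

Lemma smooth_det p (A : 'rV[R]_n -> 'M[R]_p) :
  smooth_mx U A -> smooth U (fun x => \det (A x)).
Proof.
move=> sA; apply: smooth_sum => s _; apply: smooth_mul; first exact: smooth_cst.
by apply: smooth_prod => i _; exact: sA.
Qed.

Lemma smooth_invmx p (A : 'rV[R]_n -> 'M[R]_p) :
  (forall x, U x -> A x \in unitmx) ->
  smooth_mx U A -> smooth_mx U (fun x => invmx (A x)).
Proof.
move=> uA sA i j.
apply: (@eq_smooth (fun x => (\det (A x))^-1 * cofactor (A x) j i)).
  by move=> x Ux; rewrite /invmx (uA _ Ux) !mxE.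
apply: smooth_mul.
  apply: smooth_inv; last exact: smooth_det.
  by move=> x /uA; rewrite unitmxE unitfE.
apply: smooth_mul; first exact: smooth_cst.
apply: smooth_det => a b.
by apply: (@eq_smooth (fun x => A x (lift j a) (lift i b))) => // x _; rewrite !mxE.
Qed.

Lemma partialD f g i x : smooth U f -> smooth U g -> U x ->
  partial i (fun y => f y + g y) x = partial i f x + partial i g x.
Proof.
by move=> sf sg Ux; rewrite /partial -deriveD //; exact: smooth_derivable.
Qed.

Lemma partialM f g i x : smooth U f -> smooth U g -> U x ->
  partial i (fun y => f y * g y) x = partial i f x * g x + f x * partial i g x.
Proof.
move=> sf sg Ux; rewrite addrC [_ * g x]mulrC.
by rewrite /partial deriveM //; exact: smooth_derivable.
Qed.

Lemma partialN f i x : smooth U f -> U x ->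
  partial i (fun y => - f y) x = - partial i f x.
Proof. by move=> sf Ux; rewrite /partial -deriveN //; exact: smooth_derivable. Qed.

Lemma partial_cst (c : R) (i : 'I_n) x : partial i (fun=> c) x = 0.
Proof. by rewrite /partial derive_cst. Qed.

Lemma partial_scale f (c : R) i x : smooth U f -> U x ->
  partial i (fun y => c * f y) x = c * partial i f x.
Proof.
move=> sf Ux; rewrite partialM //; last exact: smooth_cst.
by rewrite partial_cst mul0r add0r.
Qed.

Lemma partial_bigsum (I : Type) (r : seq I) (F : I -> 'rV[R]_n -> R) i x :
  (forall j, smooth U (F j)) -> U x ->
  partial i (fun y => \sum_(j <- r) F j y) x = \sum_(j <- r) partial i (F j) x.
Proof.
move=> sF Ux; elim: r => [|j r IH].
  rewrite big_nil -[RHS](partial_cst 0 i x).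
  by apply: (partial_near _ oU Ux) => y _; rewrite big_nil.
rewrite big_cons -IH -partialD //; last exact: smooth_sum.
by apply: (partial_near _ oU Ux) => y _; rewrite big_cons.
Qed.

Lemma partial_eq f g i x : U x -> (forall y, U y -> f y = g y) ->
  partial i f x = partial i g x.
Proof. by move=> Ux; exact: partial_near. Qed.

Lemma eq_dmx p q (A B : 'rV[R]_n -> 'M[R]_(p, q)) i x :
  U x -> (forall y, U y -> A y = B y) -> dmx i A x = dmx i B x.
Proof.
move=> Ux AB; apply/matrixP => a b; rewrite !mxE.
by apply: partial_eq => // y Uy; rewrite AB.
Qed.

Lemma dmx_mul p q r (A : 'rV[R]_n -> 'M[R]_(p, q)) (B : 'rV[R]_n -> 'M[R]_(q, r)) i x :
  smooth_mx U A -> smooth_mx U B -> U x ->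
  dmx i (fun x => A x *m B x) x = dmx i A x *m B x + A x *m dmx i B x.
Proof.
move=> sA sB Ux; apply/matrixP => a b; rewrite !mxE -big_split /=.
rewrite (@partial_eq _ (fun y => \sum_k A y a k * B y k b)) //; last first.
  by move=> y _; rewrite mxE.
rewrite partial_bigsum //; last by move=> k; exact: smooth_mul.
by apply: eq_bigr => k _; rewrite partialM // !mxE.
Qed.

Lemma dmxD p q (A B : 'rV[R]_n -> 'M[R]_(p, q)) i x :
  smooth_mx U A -> smooth_mx U B -> U x ->
  dmx i (fun x => A x + B x) x = dmx i A x + dmx i B x.
Proof.
move=> sA sB Ux; apply/matrixP => a b; rewrite !mxE -partialD //.
by apply: partial_eq => // y _; rewrite mxE.
Qed.

Lemma dmxN p q (A : 'rV[R]_n -> 'M[R]_(p, q)) i x :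
  smooth_mx U A -> U x -> dmx i (fun x => - A x) x = - dmx i A x.
Proof.
move=> sA Ux; apply/matrixP => a b; rewrite !mxE -partialN //.
by apply: partial_eq => // y _; rewrite mxE.
Qed.

Lemma dmxZ p q (f : 'rV[R]_n -> R) (A : 'rV[R]_n -> 'M[R]_(p, q)) i x :
  smooth U f -> smooth_mx U A -> U x ->
  dmx i (fun x => f x *: A x) x = partial i f x *: A x + f x *: dmx i A x.
Proof.
move=> sf sA Ux; apply/matrixP => a b; rewrite !mxE -partialM //.
by apply: partial_eq => // y _; rewrite mxE.
Qed.

Lemma dmx_tr p q (A : 'rV[R]_n -> 'M[R]_(p, q)) i x : U x ->
  dmx i (fun x => (A x)^T) x = (dmx i A x)^T.
Proof.
move=> Ux; apply/matrixP => a b; rewrite !mxE.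
by apply: partial_eq => // y _; rewrite mxE.
Qed.

Lemma dmx_cst p q (A : 'M[R]_(p, q)) (i : 'I_n) x : dmx i (fun=> A) x = 0.
Proof. by apply/matrixP => a b; rewrite !mxE partial_cst. Qed.

Lemma smooth_dmx p q (A : 'rV[R]_n -> 'M[R]_(p, q)) i :
  smooth_mx U A -> smooth_mx U (dmx i A).
Proof.
move=> sA a b; apply: (@eq_smooth (partial i (fun y => A y a b))) => //.
  by move=> y _; rewrite mxE.
exact: smooth_partial.
Qed.

Opaque partial.

Lemma dmxC p q (A : 'rV[R]_n -> 'M[R]_(p, q)) i j x : smooth_mx U A -> U x ->
  dmx i (dmx j A) x = dmx j (dmx i A) x.
Proof.
move=> sA Ux; apply/matrixP => a b.
have E k l : dmx k (dmx l A) x a b = partial k (partial l (fun y => A y a b)) x.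
  by rewrite [LHS]mxE; apply: partial_eq => // y _; rewrite mxE.
apply: (etrans (E i j)).
apply: (etrans _ (esym (E j i))).
exact: (smooth_partialC i j (sA a b) Ux).
Qed.

End Smooth.

(** * Ordinary differential equations and smooth dependence *)

Section Primitive.
Variable R : realType.
Notation mu := (@lebesgue_measure R).

Definition primitive (f : R -> R) (t : R) : R :=
  if 0 <= t then \int[mu]_(s in `[0, t]) f s else - \int[mu]_(s in `[t, 0]) f s.

Lemma primitive0 f : primitive f 0 = 0.
Proof. by rewrite /primitive lexx set_itv1 Rintegral_set1. Qed.

Lemma primitive_shift (f : R -> R) (a t : R) : continuous f -> a < 0 -> a < t ->
  primitive f t = \int[mu]_(s in `[a, t]) f s - \int[mu]_(s in `[a, 0]) f s.
Proof.
move=> cf a0 at_.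
have int_f (b c : R) : mu.-integrable `[b, c] (EFin \o f).
  apply: continuous_compact_integrable; first exact: segment_compact.
  exact: continuous_subspaceT.
rewrite /primitive; case: leP => t0.
  rewrite (@Rintegral_itvB R f (BLeft a) (BRight t) 0) ?bnd_simp //; last exact: ltW.
  rewrite Rintegral_itv_obnd_cbnd //.
  by apply: integrableS (int_f 0 t) => //; exact: subset_itv_oc_cc.
rewrite -[RHS]opprB; congr (- _).
rewrite (@Rintegral_itvB R f (BLeft a) (BRight 0) t) ?bnd_simp //; try exact: ltW.
rewrite Rintegral_itv_obnd_cbnd //.
by apply: integrableS (int_f t 0) => //; exact: subset_itv_oc_cc.
Qed.

Lemma is_derive_primitive (f : R -> R) (t : R) : continuous f ->
  is_derive t 1 (primitive f) (f t).
Proof.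
move=> cf; pose a : R := - (`|t| + 1); pose b : R := `|t| + 1.
have a0 : a < 0 by rewrite oppr_lt0 ltr_wpDl.
have at_ : a < t.
  by rewrite /a; have := ler_norm (- t); rewrite normrN; lra.
have tb : t < b by rewrite /b; have := ler_norm t; lra.
have int_f : mu.-integrable `[a, b] (EFin \o f).
  apply: continuous_compact_integrable; first exact: segment_compact.
  exact: continuous_subspaceT.
have [D V] := @continuous_FTC1_closed R f a t b tb int_f at_ (cf t).
pose G (s : R) : R := \int[mu]_(x in `[a, s]) f x.
pose K : R := \int[mu]_(x in `[a, 0]) f x.
have dG : is_derive t 1 G (f t) by split; [exact: D|rewrite -derive1E; exact: V].
have dGK : is_derive t 1 (G - cst K) (f t).
  by have := is_deriveB dG (is_derive_cst K t 1); rewrite subr0.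
apply: near_eq_is_derive dGK; near=> s.
have as_ : a < s by near: s; exact: lt_nbhsr.
by rewrite (@primitive_shift f a s).
Unshelve. all: by end_near. Qed.

End Primitive.

Section Growth.
Variable R : realType.

Lemma growth0 (e e' H h : R -> R) (t : R) : 0 <= t ->
  (forall s : R, 0 <= s <= t -> is_derive s 1 e (e' s)) ->
  (forall s : R, 0 <= s <= t -> is_derive s 1 H (h s)) ->
  (forall s : R, 0 <= s <= t -> `|e' s| <= h s) ->
  `|e t - e 0| <= H t - H 0.
Proof.
move=> t0 de dH eh.
have mono (f f' : R -> R) : (forall s : R, 0 <= s <= t -> is_derive s 1 f (f' s)) ->
    (forall s : R, 0 <= s <= t -> 0 <= f' s) -> f 0 <= f t.
  move=> df f'0; have [||c /[!in_itv]/= ct E] := @MVT_segment R f f' 0 t t0.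
  - by move=> s /[!in_itv]/= /andP[? ?]; apply: df; rewrite !ltW.
  - by apply: derivable_within_continuous => s /[!in_itv]/= /df[].
  by rewrite -subr_ge0 E mulr_ge0 ?f'0 // subr0.
have P := mono (H - e) (fun s => h s - e' s).
have M := mono (H + e) (fun s => h s + e' s).
have {}P : H 0 - e 0 <= H t - e t.
  apply: P => s st; first by apply: is_deriveB; [exact: dH|exact: de].
  by have := eh s st; rewrite ler_norml => /andP[_]; rewrite subr_ge0.
have {}M : H 0 + e 0 <= H t + e t.
  apply: M => s st; first by apply: is_deriveD; [exact: dH|exact: de].
  by have := eh s st; rewrite ler_norml => /andP[]; lra.
by rewrite ler_norml; apply/andP; split; lra.
Qed.

(** The mean value inequality with a varying bound on the derivative. *)
Lemma growth (e e' H h : R -> R) (t : R) :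
  (forall s : R, `|s| <= `|t| -> is_derive s 1 e (e' s)) ->
  (forall s : R, 0 <= s <= `|t| -> is_derive s 1 H (h s)) ->
  (forall s : R, `|s| <= `|t| -> `|e' s| <= h `|s|) ->
  `|e t - e 0| <= H `|t| - H 0.
Proof.
have [t0|t0] := leP 0 t => de dH eh.
  rewrite (ger0_norm t0) in de dH eh *.
  apply: (@growth0 e e' H h) => // s /andP[s0 st].
    by apply: de; rewrite ger0_norm.
  by have := eh s; rewrite ger0_norm // => /(_ st).
have nt : `|t| = - t by rewrite ltr0_norm.
have nt0 : 0 <= - t by rewrite oppr_ge0 ltW.
rewrite nt in de dH eh *.
have := @growth0 (fun s => e (- s)) (fun s => - e' (- s)) H h (- t) nt0.
rewrite opprK oppr0; apply => // s /andP[s0 st].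
  have {}de := de (- s); rewrite normrN ger0_norm // in de.
  have {}de := de st.
  have N := @is_deriveNid R R s 1.
  split.
    apply/derivable1_diffP; apply: (@differentiable_comp _ _ _ _ (fun s => - s) e).
      by apply/derivable1_diffP; case: N.
    by apply/derivable1_diffP; case: de.
  rewrite -derive1E (@derive1_comp R (fun s => - s) e) ?derive1E; last 2 first.
  - by case: N.
  - by case: de.
  by case: N => _ ->; case: de => _ ->; rewrite mulrN1.
by have := eh (- s); rewrite normrN !normrN ger0_norm //; apply.
Qed.

End Growth.

Section RowOde.
Variables (R : realType) (n : nat).
Implicit Types z u v : R -> 'rV[R]_n.

Definition row_deriv z (s : R) (v : 'rV[R]_n) : Prop :=
  forall j, is_derive s 1 (fun t => z t 0 j) (v 0 j).

Lemma row_derivB z1 z2 s w1 w2 : row_deriv z1 s w1 -> row_deriv z2 s w2 ->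
  row_deriv (fun t => z1 t - z2 t) s (w1 - w2).
Proof.
move=> d1 d2 j; rewrite !mxE.
have -> : (fun t => (z1 t - z2 t) 0 j) = (fun t => z1 t 0 j) - (fun t => z2 t 0 j).
  by apply/funext => t; rewrite !mxE.
exact: (is_deriveB (d1 j) (d2 j)).
Qed.

Lemma row_derivZ (c : R) z s w : row_deriv z s w ->
  row_deriv (fun t => c *: z t) s (c *: w).
Proof.
move=> d j; rewrite !mxE.
have -> : (fun t => (c *: z t) 0 j) = c \*: (fun t => z t 0 j).
  by apply/funext => t; rewrite !mxE.
exact: (is_deriveZ c (d j)).
Qed.

Lemma row_deriv_continuous z s w : row_deriv z s w -> {for s, continuous z}.
Proof.
move=> d; apply: continuous_row => j.
by apply: differentiable_continuous; apply/derivable1_diffP; case: (d j).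
Qed.

Lemma growth_row z v (H h : R -> R) (t : R) :
  (forall s : R, `|s| <= `|t| -> row_deriv z s (v s)) ->
  (forall s : R, 0 <= s <= `|t| -> is_derive s 1 H (h s)) ->
  (forall s : R, `|s| <= `|t| -> `|v s| <= h `|s|) ->
  `|z t - z 0| <= H `|t| - H 0.
Proof.
move=> dz dH vh; apply: row_norm_le => [|j].
  have := @growth R (cst 0) (cst 0) H h t; rewrite /cst subrr normr0; apply => // s st.
  by rewrite (le_trans _ (vh s st)).
rewrite !mxE; apply: (@growth R (fun s => z s 0 j) (fun s => v s 0 j) H h t) => // s st.
  exact: dz.
by rewrite (le_trans _ (vh s st)) // ler_row_norm.
Qed.

Lemma is_derive_lin_exp (a b c s : R) :
  is_derive s 1 (fun t => a * expR (b * t) + c * t) (a * (b * expR (b * s)) + c).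
Proof.
have D1 : is_derive s 1 (fun t : R => b * t) b.
  by have := is_deriveZ b (is_derive_id s (1 : R)); rewrite /GRing.scale /= mulr1.
have D2 : is_derive s 1 (fun t : R => expR (b * t)) (expR (b * s) * b).
  split.
    apply/derivable1_diffP; apply: (@differentiable_comp _ _ _ _ (fun t : R => b * t) expR).
      by apply/derivable1_diffP; case: D1.
    by apply/derivable1_diffP; exact: derivable_expR.
  rewrite -derive1E (@derive1_comp R (fun t : R => b * t) expR) ?derive1E; last 2 first.
  - by case: D1.
  - exact: derivable_expR.
  by rewrite derive_val; case: D1 => _ ->.
have D3 : is_derive s 1 (fun t : R => c * t) c.
  by have := is_deriveZ c (is_derive_id s (1 : R)); rewrite /GRing.scale /= mulr1.
have D4 := is_deriveZ a D2.
rewrite [b * expR _]mulrC; exact: (is_deriveD D4 D3).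
Qed.

(** Each coordinate is compared with the solution of a scalar linear equation.
    The exponential weight is what makes the estimate independent of the length of
    the interval. *)
Lemma gronwall z v (L d T : R) : 0 < L -> 0 <= d -> 0 <= T ->
  (forall s : R, `|s| <= T -> row_deriv z s (v s)) ->
  (forall s : R, `|s| <= T -> `|v s| <= L * `|z s| + d) ->
  forall t : R, `|t| <= T -> `|z t| <= 2 * (`|z 0| + d * T) * expR (2 * L * T).
Proof.
move=> L0 d0 T0 dz vz t tT.
pose q s := expR (- (2 * L * `|s|)) * `|z s|.
have cq : {within `[- T, T], continuous q}.
  apply: continuous_in_subspaceT => s; rewrite inE /= in_itv /= -ler_norml => sT.
  have c1 : {for s, continuous (fun s : R => expR (- (2 * L * `|s|)))}.
    apply: (@continuous_comp _ _ _ (fun s : R => - (2 * L * `|s|)) expR); last exact: continuous_expR.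
    apply: continuousN; apply: (@continuousM _ _ (fun=> 2 * L) (fun s : R => `|s|)).
      exact: cst_continuous.
    exact: norm_continuous.
  have c2 : {for s, continuous (fun s : R => `|z s|)}.
    apply: (@continuous_comp _ _ _ z); last exact: norm_continuous.
    exact: row_deriv_continuous (dz s sT).
  exact: (continuousM c1 c2).
have NTT : - T <= T by lra.
have [s0 s0T qmax] := EVT_max NTT cq.
set S := q s0 in qmax.
have S0 : 0 <= S by rewrite /S /q mulr_ge0 // expR_ge0.
have qS s : `|s| <= T -> `|z s| <= S * expR (2 * L * `|s|).
  move=> sT; have : q s <= S by apply: qmax; rewrite in_itv /= -ler_norml.
  rewrite /q expRN mulrC ler_pdivrMr ?expR_gt0 //.
have s0T' : `|s0| <= T by move: s0T; rewrite in_itv /= -ler_norml.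
pose H (s : R) := S / 2 * expR (2 * L * s) + d * s.
have G : `|z s0 - z 0| <= H `|s0| - H 0.
  apply: (@growth_row z v H (fun s => S / 2 * (2 * L * expR (2 * L * s)) + d)).
  - by move=> s ss0; apply: dz; exact: le_trans s0T'.
  - by move=> s _; exact: is_derive_lin_exp.
  move=> s ss0; have sT := le_trans ss0 s0T'.
  apply: (le_trans (vz s sT)); rewrite lerD2r.
  have := qS s sT; rewrite -(ler_pM2l L0).
  have -> // : L * (S * expR (2 * L * `|s|)) = S / 2 * (2 * L * expR (2 * L * `|s|)).
  by field.
have Sle : S <= 2 * (`|z 0| + d * T).
  have zs0 : `|z s0| <= `|z 0| + (S / 2 * expR (2 * L * `|s0|) + d * T).
    have := ler_normD (z s0 - z 0) (z 0); rewrite subrK => /le_trans; apply.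
    rewrite addrC lerD2l (le_trans G) // /H !mulr0 addr0 expR0.
    have dT : d * `|s0| <= d * T by rewrite ler_wpM2l.
    lra.
  have E : S = expR (- (2 * L * `|s0|)) * `|z s0| by [].
  have e1 : 0 < expR (2 * L * `|s0|) by exact: expR_gt0.
  have e2 : 1 <= expR (2 * L * `|s0|).
    by rewrite -expR0 ler_expR !mulr_ge0 // ltW.
  have : S * expR (2 * L * `|s0|) <= `|z 0| + (S / 2 * expR (2 * L * `|s0|) + d * T).
    by rewrite {1}E expRN mulrAC mulVf ?mul1r // gt_eqF.
  have dT : 0 <= d * T by rewrite mulr_ge0.
  have z00 : 0 <= `|z 0| by [].
  move: e2 dT z00 S0; move: (expR _) (d * T) `|z 0| => e a b e2 a0 b0 S0 K.
  have : S / 2 * e <= b + a by lra.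
  have K2 : S / 2 * 1 <= S / 2 * e by rewrite ler_wpM2l // divr_ge0.
  by clear -K2; lra.
apply: (le_trans (qS t tT)); apply: ler_pM; rewrite ?expR_ge0 //.
by rewrite ler_expR ler_wpM2l // mulr_ge0 // ltW.
Qed.

End RowOde.

Section Picard.
Variables (R : realType) (n : nat) (G : R -> 'rV[R]_n -> 'rV[R]_n) (L : R).
Hypothesis L0 : 0 < L.
Hypothesis GL : forall t u v, `|G t u - G t v| <= L * `|u - v|.
Hypothesis Gc : forall u : R -> 'rV[R]_n, continuous u -> continuous (fun t => G t (u t)).
Variable z0 : 'rV[R]_n.

Definition picard_step (u : R -> 'rV[R]_n) (t : R) : 'rV[R]_n :=
  z0 + \row_j primitive (fun s => G s (u s) 0 j) t.

Fixpoint picard_iter k : R -> 'rV[R]_n :=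
  if k is k'.+1 then picard_step (picard_iter k') else fun=> z0.

Lemma continuous_entry (T : topologicalType) (u : T -> 'rV[R]_n) (j : 'I_n) :
  continuous u -> continuous (fun t => u t 0 j).
Proof.
move=> cu t; apply: (@continuous_comp _ _ _ u (fun v : 'rV[R]_n => v 0 j)); first exact: cu.
by apply: differentiable_continuous; exact: differentiable_coord.
Qed.

Lemma picard_step_deriv u s : continuous u -> row_deriv (picard_step u) s (G s (u s)).
Proof.
move=> cu j.
have P : is_derive s 1 (primitive (fun s => G s (u s) 0 j)) (G s (u s) 0 j).
  exact: is_derive_primitive (continuous_entry (j := j) (Gc cu)).
have -> : (fun t => picard_step u t 0 j) =
    cst (z0 0 j) + primitive (fun s => G s (u s) 0 j).
  by apply/funext => t; rewrite /picard_step !mxE.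
by have := is_deriveD (is_derive_cst (z0 0 j) s (1 : R)) P; rewrite add0r.
Qed.

Lemma picard_step0 u : picard_step u 0 = z0.
Proof.
by apply/rowP => j; rewrite /picard_step !mxE primitive0 addr0.
Qed.

Lemma picard_step_continuous u : continuous u -> continuous (picard_step u).
Proof. by move=> cu s; exact: row_deriv_continuous (picard_step_deriv s cu). Qed.

Lemma picard_iter_continuous k : continuous (picard_iter k).
Proof.
elim: k => [|k IH]; first by move=> s; exact: cst_continuous.
exact: picard_step_continuous.
Qed.

(** In the norm weighted by [expR (- 2 L |s|)], Picard's map contracts by one half on all
    of R, so the solution exists for all times without continuation. *)
Lemma picard_contract u v (C t : R) : continuous u -> continuous v ->
  (forall s, `|s| <= `|t| -> `|u s - v s| <= C * expR (2 * L * `|s|)) ->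
  `|picard_step u t - picard_step v t| <= C / 2 * expR (2 * L * `|t|).
Proof.
move=> cu cv uv.
have C0 : 0 <= C.
  have := uv 0; rewrite normr0 normr_ge0 mulr0 expR0 mulr1 => /(_ isT).
  exact: le_trans.
have := @growth_row R n (fun s => picard_step u s - picard_step v s)
  (fun s => G s (u s) - G s (v s))
  (fun s => C / 2 * expR (2 * L * s) + 0 * s)
  (fun s => C / 2 * (2 * L * expR (2 * L * s)) + 0) t.
rewrite !picard_step0 subrr subr0 !mulr0 expR0 mulr1 addr0 mul0r addr0 => H.
apply: (le_trans (H _ _ _)).
- by move=> s _; apply: row_derivB; exact: picard_step_deriv.
- by move=> s _; exact: is_derive_lin_exp.
- move=> s st; apply: (le_trans (GL _ _ _)); rewrite addr0.
  have := uv s st; rewrite -(ler_pM2l L0) => /le_trans; apply.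
  by rewrite le_eqVlt; apply/orP; left; apply/eqP; field.
by rewrite gerBl divr_ge0.
Qed.

Lemma picard_cauchy (T : R) : 0 <= T -> exists2 C : R, 0 <= C &
  forall k t, `|t| <= T ->
    `|picard_iter k.+1 t - picard_iter k t| <= C / 2 ^+ k * expR (2 * L * `|t|).
Proof.
move=> T0.
pose q s := `|picard_iter 1 s - picard_iter 0 s|.
have cq : {within `[- T, T], continuous q}.
  apply: continuous_subspaceT => s.
  apply: (@continuous_comp _ _ _ (fun s => picard_iter 1 s - picard_iter 0 s)); last exact: norm_continuous.
  by apply: continuousB; exact: picard_iter_continuous.
have NTT : - T <= T by lra.
have [s0 _ qmax] := EVT_max NTT cq.
exists (q s0); first exact: normr_ge0.
elim=> [|k IH] t tT.
  have : q t <= q s0 by apply: qmax; rewrite in_itv /= -ler_norml.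
  move/le_trans; apply; rewrite expr0 divr1 ler_peMr ?normr_ge0 //.
  by rewrite -expR0 ler_expR !mulr_ge0 // ltW.
have -> : q s0 / 2 ^+ k.+1 = q s0 / 2 ^+ k / 2 by rewrite exprS invfM; ring.
apply: (@picard_contract (picard_iter k.+1) (picard_iter k)) => [||s st].
- exact: (@picard_iter_continuous k.+1).
- exact: (@picard_iter_continuous k).
- by apply: IH; exact: le_trans st tT.
Qed.

Lemma picard_dist (T C : R) : 0 <= C ->
  (forall k t, `|t| <= T ->
    `|picard_iter k.+1 t - picard_iter k t| <= C / 2 ^+ k * expR (2 * L * `|t|)) ->
  forall k m t, `|t| <= T ->
    `|picard_iter (k + m) t - picard_iter k t| <= C / 2 ^+ k * 2 * expR (2 * L * T).
Proof.
move=> C0 H k m t tT.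
have step l : `|picard_iter l.+1 t - picard_iter l t| <= C / 2 ^+ l * expR (2 * L * T).
  apply: (le_trans (H l t tT)); apply: ler_wpM2l; first by rewrite divr_ge0 // exprn_ge0.
  by rewrite ler_expR ler_wpM2l // mulr_ge0 // ltW.
have S : `|picard_iter (k + m) t - picard_iter k t| <=
    (C / 2 ^+ k * 2 - C / 2 ^+ (k + m) * 2) * expR (2 * L * T).
  elim: m => [|m IH]; first by rewrite addn0 !subrr mul0r normr0.
  rewrite addnS -(subrK (picard_iter (k + m) t) (picard_iter _ t)) -addrA.
  apply: (le_trans (ler_normD _ _)).
  apply: (le_trans (lerD (step _) IH)).
  rewrite -mulrDl exprS invfM le_eqVlt; apply/orP; left; apply/eqP.
  by move: (2 ^+ k)^-1 (2 ^+ (k + m))^-1 (expR _) => a b c; field.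
apply: (le_trans S); rewrite ler_wpM2r ?expR_ge0 // gerBl mulr_ge0 //.
by rewrite divr_ge0 // exprn_ge0.
Qed.

Lemma half_pow_small (K e : R) : 0 < e -> exists N, forall k, (N <= k)%N -> K / 2 ^+ k < e.
Proof.
move=> e0; have [K0|K0] := leP K 0.
  exists 0%N => k _; apply: le_lt_trans e0.
  by rewrite pmulr_lle0 // invr_gt0 exprn_gt0.
have h1 : `|2^-1 : R| < 1 by rewrite gtr0_norm ?invr_gt0 // invf_lt1 // ltr1n.
have /cvgrPdist_lt/(_ (e / K)) := cvg_expr h1.
rewrite divr_gt0 // => /(_ isT)[N _ NP]; exists N => k Nk.
have := NP k Nk; rewrite /= sub0r normrN normrX gtr0_norm ?invr_gt0 // exprVn.
by rewrite ltr_pdivlMr // mulrC.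
Qed.

Lemma add_thirds (e a b c : R) : a <= e / 3 -> b <= e / 3 -> c <= e / 3 -> a + b + c <= e.
Proof. by move=> ? ? ?; lra. Qed.

Lemma half_le (a b : R) : 0 <= a -> 1 <= b -> a / 2 <= a * b.
Proof.
move=> a0 b1; apply: (@le_trans _ _ (a * 1)); first by rewrite mulr1; lra.
by rewrite ler_wpM2l.
Qed.

Lemma half_le1 (a : R) : 0 <= a -> a / 2 <= a.
Proof. by move=> a0; lra. Qed.

Theorem picard_existence : exists z : R -> 'rV[R]_n,
  z 0 = z0 /\ forall s, row_deriv z s (G s (z s)).
Proof.
have conv t : cvgn (fun k => picard_iter k t).
  have [C C0 H] := picard_cauchy (normr_ge0 t).
  apply/cauchy_cvgP/cauchy_exP => e e0.
  have [N NP] := half_pow_small (C * 2 * expR (2 * L * `|t|)) e0.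
  exists (picard_iter N t); exists N => // k /= Nk.
  rewrite -ball_normE /= distrC.
  have := picard_dist C0 H N (k - N) (lexx `|t|); rewrite subnKC // => /le_lt_trans; apply.
  have := NP N (leqnn N); congr (_ < _); ring.
pose z t := limn (fun k => picard_iter k t).
have zP (T C : R) : 0 <= C ->
   (forall k t, `|t| <= T ->
    `|picard_iter k.+1 t - picard_iter k t| <= C / 2 ^+ k * expR (2 * L * `|t|)) ->
   forall k t, `|t| <= T -> `|z t - picard_iter k t| <= C / 2 ^+ k * 2 * expR (2 * L * T).
  move=> C0 H k t tT.
  have cv : `|picard_iter m t - picard_iter k t| @[m --> \oo] --> `|z t - picard_iter k t|.
    by apply: cvg_norm; apply: cvgB; [exact: conv|exact: cvg_cst].
  refine (@closed_cvg _ _ _ _ _ (fun x : R => (x <= C / 2 ^+ k * 2 * expR (2 * L * T) : Prop)) _ _ _ cv).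
    exact: closed_le.
  exists k => // m /= km.
  by have := picard_dist C0 H k (m - k) tT; rewrite subnKC.
have cz : continuous z.
  move=> t; apply/cvgrPdist_le => e e0.
  have T0 : 0 <= `|t| + 1 by rewrite addr_ge0.
  have [C C0 H] := picard_cauchy T0.
  have e3 : 0 < e / 3 by rewrite divr_gt0.
  have [N NP] := half_pow_small (C * 2 * expR (2 * L * (`|t| + 1))) e3.
  have near_z s : `|s| <= `|t| + 1 -> `|z s - picard_iter N s| <= e / 3.
    move=> sT; apply: (le_trans (zP _ _ C0 H N s sT)).
    by apply: ltW; have := NP N (leqnn N); congr (_ < _); ring.
  have ct : \forall s \near t, `|picard_iter N t - picard_iter N s| <= e / 3.
    by have /cvgrPdist_le/(_ _ e3) := @picard_iter_continuous N t.
  have bt : \forall s \near t, `|t - s| <= 1.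
    by near=> s; apply: ltW; near: s; exact: (@near_ball _ R t 1 ltr01).
  near=> s.
  have H1 : `|z t - picard_iter N t| <= e / 3 by apply: near_z; rewrite lerDl.
  have H2 : `|picard_iter N t - picard_iter N s| <= e / 3 by near: s.
  have H3 : `|picard_iter N s - z s| <= e / 3.
    rewrite distrC; apply: near_z; rewrite -lerBlDl.
    apply: le_trans (lerB_dist _ _) _; rewrite distrC; near: s.
    exact: bt.
  have -> : z t - z s = (z t - picard_iter N t) + (picard_iter N t - picard_iter N s)
      + (picard_iter N s - z s).
    by rewrite !addrA subrK subrK.
  apply: (le_trans (ler_normD _ _)).
  apply: (le_trans (lerD (ler_normD _ _) (lexx _))).
  exact: add_thirds.
have zstep t : picard_step z t = z t.
  apply/eqP; rewrite -subr_eq0 -normr_le0; apply/ler_addgt0Pl => e e0; rewrite addr0.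
  have [C C0 H] := picard_cauchy (normr_ge0 t).
  have e2 : 0 < e / 2 by rewrite divr_gt0.
  have [N NP] := half_pow_small (C * 2 * expR (2 * L * `|t|) * expR (2 * L * `|t|)) e2.
  have E1 : 1 <= expR (2 * L * `|t|) by rewrite -expR0 ler_expR !mulr_ge0 // ltW.
  have small : C / 2 ^+ N * 2 * expR (2 * L * `|t|) * expR (2 * L * `|t|) <= e / 2.
    by apply: ltW; have := NP N (leqnn N); congr (_ < _); ring.
  have D0 : 0 <= C / 2 ^+ N * 2 * expR (2 * L * `|t|).
    by rewrite !mulr_ge0 ?expR_ge0 // invr_ge0 exprn_ge0.
  have A : `|picard_step z t - picard_iter N.+1 t| <=
      C / 2 ^+ N * 2 * expR (2 * L * `|t|) / 2 * expR (2 * L * `|t|).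
    apply: (@picard_contract z (picard_iter N)) => // [|s st].
      exact: (@picard_iter_continuous N).
    apply: (le_trans (zP _ _ C0 H N s st)); rewrite ler_peMr //.
    by rewrite -expR0 ler_expR !mulr_ge0 // ltW.
  have B : `|z t - picard_iter N.+1 t| <= C / 2 ^+ N.+1 * 2 * expR (2 * L * `|t|).
    exact: zP H _ _ (lexx _).
  have -> : picard_step z t - z t =
     (picard_step z t - picard_iter N.+1 t) - (z t - picard_iter N.+1 t).
    by rewrite opprB addrA subrK.
  apply: (le_trans (ler_normB _ _)).
  have B' : C / 2 ^+ N.+1 * 2 * expR (2 * L * `|t|) <= e / 2.
    apply: le_trans small; rewrite exprS invfM.
    have -> : C * (2^-1 / 2 ^+ N) * 2 * expR (2 * L * `|t|) =
       C / 2 ^+ N * 2 * expR (2 * L * `|t|) / 2.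
      by move: (2 ^+ N)^-1 (expR _) => a b; field.
    exact: half_le.
  have A' : C / 2 ^+ N * 2 * expR (2 * L * `|t|) / 2 * expR (2 * L * `|t|) <= e / 2.
    apply: le_trans small; rewrite ler_wpM2r ?expR_ge0 //.
    exact: half_le1.
  by rewrite (splitr e); apply: lerD; [exact: le_trans A'|exact: le_trans B'].
exists z; split; first by rewrite -zstep picard_step0.
move=> s j; have := picard_step_deriv s cz j.
have -> : picard_step z = z by apply/funext => t; exact: zstep.
by [].
Unshelve. all: by end_near. Qed.

End Picard.

Section Bounds.
Variables (R : realType) (n : nat).
Implicit Types (Om K : set 'rV[R]_n).

Definition segment_convex K : Prop :=
  forall a b (s : R), K a -> K b -> 0 <= s <= 1 -> K (a + s *: (b - a)).

Definition bounded_closed K : Prop :=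
  closed K /\ exists M : R, forall x, K x -> `|x| <= M.

Lemma open_norm_lt (V : normedModType R) (r : R) : open [set x : V | `|x| < r].
Proof.
apply: (@open_comp _ _ (fun x : V => `|x|) [set y : R | y < r]); last exact: open_lt.
by move=> x _; exact: norm_continuous.
Qed.

Lemma closed_norm_le (V : normedModType R) (r : R) : closed [set x : V | `|x| <= r].
Proof.
apply: (@closed_comp _ _ (fun x : V => `|x|) [set y : R | y <= r]); last exact: closed_le.
by move=> x _; exact: norm_continuous.
Qed.

Lemma open_ball_lt (p : 'rV[R]_n) (r : R) : open [set x : 'rV[R]_n | `|x - p| < r].
Proof.
apply: (@open_comp _ _ (fun x : 'rV[R]_n => x - p) [set x | `|x| < r]); last exact: open_norm_lt.
by move=> x _; apply: continuousB; [exact: cvg_id|exact: cst_continuous].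
Qed.

Lemma closed_ball_convex (p : 'rV[R]_n) (r : R) : segment_convex [set x : 'rV[R]_n | `|x - p| <= r].
Proof.
move=> a b s /= Ka Kb /andP[s0 s1].
have -> : a + s *: (b - a) - p = (1 - s) *: (a - p) + s *: (b - p).
  by apply/rowP => j; rewrite !mxE; ring.
apply: (le_trans (ler_normD _ _)); rewrite !normrZ (ger0_norm s0) ger0_norm ?subr_ge0 //.
have -> : r = (1 - s) * r + s * r by ring.
by apply: lerD; rewrite ler_wpM2l // subr_ge0.
Qed.

Lemma closed_ball_bounded (p : 'rV[R]_n) (r : R) : bounded_closed [set x : 'rV[R]_n | `|x - p| <= r].
Proof.
split.
  apply: (@closed_comp _ _ (fun x : 'rV[R]_n => x - p) [set x | `|x| <= r]); last exact: closed_norm_le.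
  by move=> x _; apply: continuousB; [exact: cvg_id|exact: cst_continuous].
exists (`|p| + r) => x /= Kx; rewrite -(subrK p x).
by apply: (le_trans (ler_normD _ _)); rewrite addrC lerD2l.
Qed.

Lemma common_bound m (P : 'I_m -> R -> Prop) :
  (forall i (a b : R), a <= b -> P i a -> P i b) ->
  (forall i, exists2 M : R, 0 <= M & P i M) -> exists2 M : R, 0 <= M & forall i, P i M.
Proof.
move=> mono ex; have [f fP] := choice (fun i => let: ex_intro2 M a b := ex i in ex_intro _ M (conj a b)).
exists (\sum_i f i); first by apply: sumr_ge0 => i _; case: (fP i).
move=> i; apply: (mono i (f i)); last by case: (fP i).
by rewrite (bigD1 i) //= lerDl; apply: sumr_ge0 => j _; case: (fP j).
Qed.

Lemma continuous_bounded K (f : 'rV[R]_n -> R) : bounded_closed K ->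
  (forall x, K x -> {for x, continuous f}) ->
  exists2 M : R, 0 <= M & forall x, K x -> `|f x| <= M.
Proof.
move=> [cK [M KM]] cf; have [[x0 Kx0]|K0] := pselect (K !=set0); last first.
  by exists 0 => // x Kx; case: K0; exists x.
have compK : compact K.
  apply: bounded_closed_compact => //.
  exists M; split; first exact: num_real.
  by move=> y My x /KM /le_trans; apply; exact: ltW.
have [c Kc cmax] := @compact_EVT_max _ R (fun x => `|f x|) K (ex_intro _ x0 Kx0) compK
  (@continuous_in_subspaceT _ _ K (fun x => `|f x|) (fun x Kx =>
     @continuous_comp _ _ _ f (fun y => `|y|) x (cf x (set_mem Kx)) (@norm_continuous _ _ _))).
exists (`|f c|) => // x Kx; apply: cmax; exact: mem_set.
Qed.

Lemma mean_value Om K (f : 'rV[R]_n -> R) a b : open Om -> K `<=` Om -> segment_convex K ->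
  smooth Om f -> K a -> K b ->
  exists2 c, K c /\ `|c - a| <= `|b - a| &
    f b - f a = \sum_i (b - a) 0 i * partial i f c.
Proof.
move=> oO KO cK sf Ka Kb.
have inK (s : R) : 0 <= s <= 1 -> K (a + s *: (b - a)) by exact: cK.
have [|s s01] := @mvt_line R n f a (b - a) 1 ler01.
  by move=> t /inK /KO Ot; apply: diff_derivable; exact: smooth_differentiable sf Ot.
have -> : a + 1 *: (b - a) = b by rewrite scale1r addrC subrK.
rewrite mul1r => ->.
exists (a + s *: (b - a)); last by rewrite partial_sum //; exact: smooth_differentiable sf (KO _ (inK s s01)).
split; first exact: inK.
rewrite addrAC subrr add0r normrZ ler_piMl //.
by case/andP: s01 => s0 s1; rewrite ger0_norm.
Qed.

Lemma smooth_lipschitz Om K (f : 'rV[R]_n -> R) : open Om -> K `<=` Om -> segment_convex K ->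
  bounded_closed K -> smooth Om f ->
  exists2 M : R, 0 <= M & forall a b, K a -> K b -> `|f b - f a| <= M * `|b - a|.
Proof.
move=> oO KO cK bK sf.
have [M M0 MP] : exists2 M : R, 0 <= M & forall i, forall x, K x -> `|partial i f x| <= M.
  apply: (@common_bound n (fun i M => forall x, K x -> `|partial i f x| <= M)).
    by move=> i a b ab H x /H /le_trans; apply.
  move=> i; apply: continuous_bounded => // x /KO Ox.
  by apply: differentiable_continuous; apply: smooth_differentiable (smooth_partial oO i sf) Ox.
exists (n%:R * M); first by rewrite mulr_ge0.
move=> a b Ka Kb; have [c [Kc _] ->] := mean_value oO KO cK sf Ka Kb.
apply: (le_trans (ler_norm_sum _ _ _)).
apply: (@le_trans _ _ (\sum_(i < n) M * `|b - a|)).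
  apply: ler_sum => i _; rewrite normrM mulrC; apply: ler_pM => //; first exact: MP.
  exact: ler_row_norm.
by rewrite sumr_const card_ord -mulrnAl mulr_natl.
Qed.

(** The partial derivatives are Lipschitz on [K], so the mean value theorem leaves a
    quadratic remainder. *)
Lemma smooth_taylor Om K (f : 'rV[R]_n -> R) : open Om -> K `<=` Om -> segment_convex K ->
  bounded_closed K -> smooth Om f ->
  exists2 M : R, 0 <= M & forall a b, K a -> K b ->
    `|f b - f a - \sum_i (b - a) 0 i * partial i f a| <= M * `|b - a| ^+ 2.
Proof.
move=> oO KO cK bK sf.
have [M M0 MP] : exists2 M : R, 0 <= M & forall i, forall a b, K a -> K b ->
    `|partial i f b - partial i f a| <= M * `|b - a|.
  apply: (@common_bound n (fun i M => forall a b, K a -> K b ->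
      `|partial i f b - partial i f a| <= M * `|b - a|)).
    by move=> i a b ab H x y Kx Ky; apply: (le_trans (H x y Kx Ky)); rewrite ler_wpM2r.
  by move=> i; exact: (smooth_lipschitz oO KO cK bK (smooth_partial oO i sf)).
exists (n%:R * M); first by rewrite mulr_ge0.
move=> a b Ka Kb; have [c [Kc cb] ->] := mean_value oO KO cK sf Ka Kb.
rewrite -sumrB; apply: (le_trans (ler_norm_sum _ _ _)).
apply: (@le_trans _ _ (\sum_(i < n) M * `|b - a| ^+ 2)).
  apply: ler_sum => i _; rewrite -mulrBr normrM mulrC expr2 mulrA; apply: ler_pM => //.
    by apply: (le_trans (MP _ _ _ _ _)) => //; rewrite ler_wpM2l.
  exact: ler_row_norm.
by rewrite sumr_const card_ord -mulrnAl mulr_natl.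
Qed.

(** Rows of the derivative of a vector field: 'F' varies by [w *m diff_mx F x]. *)
Definition diff_mx (F : 'rV[R]_n -> 'rV[R]_n) (x : 'rV[R]_n) : 'M[R]_n :=
  \matrix_(i, j) partial i (fun y => F y 0 j) x.

Lemma mulmx_bound (w : 'rV[R]_n) (D : 'M[R]_n) (M : R) : 0 <= M ->
  (forall i j, `|D i j| <= M) -> `|w *m D| <= n%:R * M * `|w|.
Proof.
move=> M0 DM; apply: row_norm_le => [|j]; first by rewrite !mulr_ge0.
rewrite mxE; apply: (le_trans (ler_norm_sum _ _ _)).
apply: (@le_trans _ _ (\sum_(i < n) M * `|w|)).
  by apply: ler_sum => i _; rewrite normrM mulrC; apply: ler_pM => //; exact: ler_row_norm.
by rewrite sumr_const card_ord -mulrnAl mulr_natl.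
Qed.

Lemma field_bounds Om K (F : 'rV[R]_n -> 'rV[R]_n) : open Om -> K `<=` Om -> segment_convex K ->
  bounded_closed K -> smooth_mx Om F ->
  exists2 M : R, 0 < M &
    [/\ forall x, K x -> `|F x| <= M,
        forall a b, K a -> K b -> `|F b - F a| <= M * `|b - a|,
        forall x (w : 'rV[R]_n), K x -> `|w *m diff_mx F x| <= M * `|w| &
        forall a b, K a -> K b -> `|F b - F a - (b - a) *m diff_mx F a| <= M * `|b - a| ^+ 2].
Proof.
move=> oO KO cK bK sF.
have [M1 M10 MP1] : exists2 M : R, 0 <= M & forall j, forall x, K x -> `|F x 0 j| <= M.
  apply: (@common_bound n (fun j M => forall x, K x -> `|F x 0 j| <= M)).
    by move=> i a b ab H x /H /le_trans; apply.
  move=> j; apply: continuous_bounded => // x /KO Ox.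
  by apply: differentiable_continuous; exact: smooth_differentiable (sF 0 j) Ox.
have [M2 M20 MP2] : exists2 M : R, 0 <= M & forall j, forall a b, K a -> K b ->
     `|F b 0 j - F a 0 j| <= M * `|b - a|.
  apply: (@common_bound n (fun j M => forall a b, K a -> K b -> `|F b 0 j - F a 0 j| <= M * `|b - a|)).
    by move=> i a b ab H x y Kx Ky; apply: (le_trans (H x y Kx Ky)); rewrite ler_wpM2r.
  by move=> j; exact: (smooth_lipschitz oO KO cK bK (sF 0 j)).
have [M3 M30 MP3] : exists2 M : R, 0 <= M & forall j, forall i x, K x ->
     `|partial i (fun y => F y 0 j) x| <= M.
  apply: (@common_bound n (fun j M => forall i x, K x -> `|partial i (fun y => F y 0 j) x| <= M)).
    by move=> i a b ab H k x Kx; apply: (le_trans (H k x Kx)).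
  move=> j; apply: (@common_bound n (fun i M => forall x, K x -> `|partial i (fun y => F y 0 j) x| <= M)).
    by move=> i a b ab H x Kx; apply: (le_trans (H x Kx)).
  move=> i; apply: continuous_bounded => // x /KO Ox.
  by apply: differentiable_continuous; exact: smooth_differentiable (smooth_partial oO i (sF 0 j)) Ox.
have [M4 M40 MP4] : exists2 M : R, 0 <= M & forall j, forall a b, K a -> K b ->
    `|F b 0 j - F a 0 j - \sum_i (b - a) 0 i * partial i (fun y => F y 0 j) a| <= M * `|b - a| ^+ 2.
  apply: (@common_bound n (fun j M => forall a b, K a -> K b ->
    `|F b 0 j - F a 0 j - \sum_i (b - a) 0 i * partial i (fun y => F y 0 j) a| <= M * `|b - a| ^+ 2)).
    by move=> i a b ab H x y Kx Ky; apply: (le_trans (H x y Kx Ky)); rewrite ler_wpM2r // exprn_ge0.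
  by move=> j; exact: (smooth_taylor oO KO cK bK (sF 0 j)).
have nM3 : 0 <= n%:R * M3 by rewrite mulr_ge0.
pose M := M1 + M2 + n%:R * M3 + M4 + 1.
have H1 : M1 <= M by rewrite /M; lra.
have H2 : M2 <= M by rewrite /M; lra.
have H3 : n%:R * M3 <= M by rewrite /M; lra.
have H4 : M4 <= M by rewrite /M; lra.
have M0 : 0 < M by rewrite /M; lra.
exists M => //; split.
- move=> x Kx; apply: row_norm_le => [|j]; first exact: ltW.
  exact: le_trans (MP1 j x Kx) H1.
- move=> a b Ka Kb; apply: row_norm_le => [|j]; first by rewrite mulr_ge0 // ltW.
  by rewrite !mxE; apply: (le_trans (MP2 j a b Ka Kb)); rewrite ler_wpM2r.
- move=> x w Kx; apply: (@le_trans _ _ (n%:R * M3 * `|w|)).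
    by apply: mulmx_bound => // i j; rewrite mxE; exact: MP3.
  by rewrite ler_wpM2r.
- move=> a b Ka Kb; apply: row_norm_le => [|j]; first by rewrite mulr_ge0 ?exprn_ge0 // ltW.
  have := MP4 j a b Ka Kb.
  have -> : (F b - F a - (b - a) *m diff_mx F a) 0 j =
     F b 0 j - F a 0 j - \sum_i (b - a) 0 i * partial i (fun y => F y 0 j) a.
    rewrite !mxE; congr (_ - _); apply: eq_bigr => i _.
    by rewrite [diff_mx _ _ _ _]mxE.
  by move/le_trans; apply; rewrite ler_wpM2r // exprn_ge0.
Qed.

End Bounds.

Section Flow.
Variable R : realType.

(** A local flow of [F]: trajectories issued from [B], defined for times in ]-T, T[ and
    confined to a compact convex part [K] of the domain [Om] of [F]. *)
Record local_flow n (Om K B : set 'rV[R]_n) (T : R) (F : 'rV[R]_n -> 'rV[R]_n)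
    (Phi : R -> 'rV[R]_n -> 'rV[R]_n) : Prop := LocalFlow {
  flow_openO : open Om;
  flow_KO : K `<=` Om;
  flow_convex : segment_convex K;
  flow_bounded : bounded_closed K;
  flow_smooth : smooth_mx Om F;
  flow_openB : open B;
  flow_init : forall y, B y -> Phi 0 y = y;
  flow_in : forall y t, B y -> `|t| < T -> K (Phi t y);
  flow_ode : forall y t, B y -> `|t| < T -> row_deriv (Phi ^~ y) t (F (Phi t y));
  flow_T : 0 < T
}.

Section OneFlow.
Variables (n : nat) (Om K B : set 'rV[R]_n) (T : R) (F : 'rV[R]_n -> 'rV[R]_n).
Variable Phi : R -> 'rV[R]_n -> 'rV[R]_n.
Hypothesis fl : local_flow Om K B T F Phi.

Lemma flow_lipschitz : exists2 C : R, 0 < C & forall y y' t, B y -> B y' -> `|t| < T ->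
  `|Phi t y' - Phi t y| <= C * `|y' - y|.
Proof.
case: fl => oO KO cK bK sF oB init inK ode T0.
have [M M0 [_ lip _ _]] := field_bounds oO KO cK bK sF.
exists (2 * expR (2 * M * T)); first by rewrite mulr_gt0 // expR_gt0.
move=> y y' t By By' tT.
have := @gronwall R n (fun s => Phi s y' - Phi s y) (fun s => F (Phi s y') - F (Phi s y))
  M 0 `|t| M0 (lexx 0) (normr_ge0 t).
rewrite !init // mul0r addr0 => H; have {}H := H _ _ t (lexx _).
apply: (@le_trans _ _ (2 * `|y' - y| * expR (2 * M * `|t|))).
  apply: H => s st; have sT := le_lt_trans st tT.
    by apply: row_derivB; exact: ode.
  by rewrite addr0; apply: lip; exact: inK.
rewrite mulrAC ler_wpM2r //; apply: ler_wpM2l => //.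
by rewrite ler_expR ler_wpM2l ?(ltW tT) // mulr_ge0 // ltW.
Qed.

(** The linearised equation along a trajectory, solved for all times: time is
    stopped at [S] so that its coefficients stay defined. *)
Lemma linearised_solution y (S : R) (v : 'rV[R]_n) : B y -> 0 <= S -> S < T ->
  exists w : R -> 'rV[R]_n, w 0 = v /\
    forall t, `|t| <= S -> row_deriv w t (w t *m diff_mx F (Phi t y)).
Proof.
move=> By S0 ST; case: fl => oO KO cK bK sF oB init inK ode T0.
have [M M0 [_ _ lin _]] := field_bounds oO KO cK bK sF.
pose stop (t : R) := Num.max (- S) (Num.min S t).
have stopS t : `|stop t| <= S.
  rewrite ler_norml /stop le_max lexx /= ge_max ge_min lexx /= andbT.
  by rewrite lerNl; apply: (@le_trans _ _ 0) => //; rewrite oppr_le0.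
have stop_id t : `|t| <= S -> stop t = t.
  by rewrite ler_norml => /andP[a b]; rewrite /stop (min_idPr b) (max_idPr a).
have cstop : continuous stop.
  move=> t; apply: (@continuous_max _ _ (fun=> - S) (fun s : R => Num.min S s)).
    exact: cst_continuous.
  apply: (@continuous_min _ _ (fun=> S) (fun s : R => s)); first exact: cst_continuous.
  exact: cvg_id.
have stopT t : `|stop t| < T by exact: le_lt_trans (stopS t) ST.
have cPhi : continuous (fun t => Phi (stop t) y).
  move=> t; apply: (@continuous_comp _ _ _ stop (Phi ^~ y)); first exact: cstop.
  exact: row_deriv_continuous (ode y (stop t) By (stopT t)).
pose G (t : R) (w : 'rV[R]_n) := w *m diff_mx F (Phi (stop t) y).
have GL t u w : `|G t u - G t w| <= M * `|u - w|.
  by rewrite /G -mulmxBl; apply: lin; exact: inK.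
have Gc (u : R -> 'rV[R]_n) : continuous u -> continuous (fun t => G t (u t)).
  move=> cu t; apply: continuous_row => j.
  have -> : (fun s => G s (u s) 0 j) =
      (\sum_i (fun s => u s 0 i * partial i (fun z => F z 0 j) (Phi (stop s) y))).
    apply/funext => s; rewrite fct_sumE mxE; apply: eq_bigr => i _.
    by rewrite [diff_mx _ _ _ _]mxE.
  apply: (@big_ind _ (fun f : R -> R => {for t, continuous f})).
  - exact: cst_continuous.
  - by move=> f g cf cg; exact: continuousD.
  move=> i _; apply: continuousM; first exact: continuous_entry.
  apply: (@continuous_comp _ _ _ (fun s => Phi (stop s) y) (partial i (fun z => F z 0 j))); first exact: cPhi.
  apply: differentiable_continuous; apply: smooth_differentiable (smooth_partial oO i (sF 0 j)) _.
  by apply: KO; exact: inK.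
have [w [w0 dw]] := picard_existence M0 GL Gc v.
exists w; split=> // t tS; have := dw t.
by rewrite /G stop_id.
Qed.

(** The difference of two trajectories minus the candidate [w], the solution of the
    linearised equation, satisfies that equation up to a quadratic error, and
    [gronwall] bounds it. *)
Lemma flow_difference_quotient y (i : 'I_n) (S : R) (w : R -> 'rV[R]_n) :
  B y -> 0 <= S -> S < T -> w 0 = delta_mx 0 i ->
  (forall t, `|t| <= S -> row_deriv w t (w t *m diff_mx F (Phi t y))) ->
  forall t j, `|t| <= S ->
    is_derive y (delta_mx 0 i) (fun y => Phi t y 0 j) (w t 0 j).
Proof.
move=> By S0 ST w0 dw t j tS; case: (fl) => oO KO cK bK sF oB init inK ode T0.
have [M M0 [_ _ lin taylor]] := field_bounds oO KO cK bK sF.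
have [C C0 lip] := flow_lipschitz.
pose K2 := 2 * (M * C ^+ 2 * S) * expR (2 * M * S).
have K20 : 0 <= K2 by rewrite !mulr_ge0 ?expR_ge0 ?exprn_ge0 // ltW.
have [r r0 rB] : exists2 r : R, 0 < r & forall h : R, `|h| < r -> B (y + h *: delta_mx 0 i).
  have /nbhs_ballP[r r0 rB] := open_nbhs_nbhs (conj oB By).
  exists r => // h hr; apply: rB; rewrite -ball_normE /= opprD addNKr normrN normrZ.
  by apply: le_lt_trans hr; rewrite ler_piMr // row_delta_norm.
have est (h : R) : `|h| < r -> `|Phi t (y + h *: delta_mx 0 i) - Phi t y - h *: w t| <= K2 * `|h| ^+ 2.
  move=> hr; have Byh := rB h hr; set y' := y + _.
  have yy' : `|y' - y| <= `|h|.
    by rewrite /y' addrAC subrr add0r normrZ ler_piMr // row_delta_norm.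
  have := @gronwall R n (fun s => Phi s y' - Phi s y - h *: w s)
    (fun s => F (Phi s y') - F (Phi s y) - h *: (w s *m diff_mx F (Phi s y)))
    M (M * (C * `|h|) ^+ 2) S M0.
  rewrite !init // w0 => H.
  have {}H := H _ S0 _ _ t tS.
  apply: (le_trans (H _ _ _)).
  - by rewrite mulr_ge0 ?exprn_ge0 ?mulr_ge0 // ltW.
  - move=> s sS; have sT := le_lt_trans sS ST.
    apply: row_derivB; first by apply: row_derivB; exact: ode.
    by apply: row_derivZ; exact: dw.
  - move=> s sS; have sT := le_lt_trans sS ST.
    have -> : F (Phi s y') - F (Phi s y) - h *: (w s *m diff_mx F (Phi s y)) =
       (Phi s y' - Phi s y - h *: w s) *m diff_mx F (Phi s y) +
       (F (Phi s y') - F (Phi s y) - (Phi s y' - Phi s y) *m diff_mx F (Phi s y)).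
      rewrite [(_ - h *: w s) *m _]mulmxBl scalemxAl.
      move: (F _) (F _) (_ *m _) (_ *m _) => a b c d.
      by rewrite [RHS]addrC addrA subrK.
    apply: (le_trans (ler_normD _ _)); apply: lerD; first by apply: lin; exact: inK.
    apply: (le_trans (taylor _ _ (inK _ _ By sT) (inK _ _ Byh sT))).
    rewrite ler_wpM2l ?(ltW M0) // lerXn2r ?nnegrE ?mulr_ge0 // ?(ltW C0) //.
    by apply: (le_trans (lip y y' s By Byh sT)); rewrite ler_wpM2l // ltW.
  - have -> : y' - y - h *: delta_mx 0 i = 0 by rewrite /y' [y + _]addrC addrK subrr.
    rewrite normr0 add0r /K2 exprMn.
    rewrite le_eqVlt; apply/orP; left; apply/eqP; ring.
have cv : (h^-1 *: (((fun y => Phi t y 0 j) \o shift y) (h *: delta_mx 0 i) - Phi t y 0 j))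
     @[h --> (0 : R)^'] --> w t 0 j.
  apply/cvgrPdist_le => e e0; near=> h.
  have h0 : h != 0 by near: h; exact: nbhs_dnbhs_neq.
  have hr : `|h| < r by near: h; exact: dnbhs0_lt.
  have he : `|h| <= e / (K2 + 1).
    by near: h; apply: dnbhs0_le; rewrite divr_gt0 // ltr_wpDl.
  have := est h hr => /(le_trans (ler_row_norm _ j)).
  rewrite !mxE /= addrC => E.
  have -> : w t 0 j - h^-1 *: (Phi t (h *: delta_mx 0 i + y) 0 j - Phi t y 0 j) =
     - (h^-1 * (Phi t (y + h *: delta_mx 0 i) 0 j - Phi t y 0 j - h * w t 0 j)).
    by rewrite /GRing.scale /= [h *: _ + y]addrC; field.
  rewrite normrN normrM normfV ler_pdivrMl ?normr_gt0 //.
  apply: (le_trans _ (_ : K2 * `|h| ^+ 2 <= _)); first by move: E; rewrite addrC.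
  rewrite expr2 mulrCA ler_wpM2l //.
  apply: (@le_trans _ _ ((K2 + 1) * (e / (K2 + 1)))); last by rewrite mulrCA divff ?mulr1 // gt_eqF // ltr_wpDl.
  by rewrite ler_pM // lerDl.
split; first by apply/cvg_ex; exists (w t 0 j).
by apply/cvg_lim.
Unshelve. all: by end_near. Qed.

Definition flow_partial (i : 'I_n) (t : R) (y : 'rV[R]_n) : 'rV[R]_n :=
  \row_j partial i (fun y => Phi t y 0 j) y.

Lemma between_times (t : R) : `|t| < T -> exists2 S : R, `|t| < S & S < T.
Proof. by move=> tT; exists ((`|t| + T) / 2); lra. Qed.

Lemma flow_partialP i y t : B y -> `|t| < T ->
  [/\ forall j, derivable (fun y => Phi t y 0 j) y (delta_mx 0 i),
      flow_partial i 0 y = delta_mx 0 i &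
      row_deriv (flow_partial i ^~ y) t (flow_partial i t y *m diff_mx F (Phi t y))].
Proof.
move=> By tT; have [S tS ST] := between_times tT.
have S0 : 0 <= S by exact: le_trans (normr_ge0 t) (ltW tS).
have [w [w0 dw]] := linearised_solution (delta_mx 0 i) By S0 ST.
have D := flow_difference_quotient By S0 ST w0 dw.
have E s : `|s| <= S -> flow_partial i s y = w s.
  by move=> sS; apply/rowP => j; rewrite mxE; have [] := D s j sS.
split.
- by move=> j; have [] := D t j (ltW tS).
- by rewrite E ?normr0.
rewrite E ?(ltW tS) // => j; apply: near_eq_is_derive (dw t (ltW tS) j).
near=> s; rewrite E //; apply: ltW; near: s.
apply: (@open_nbhs_nbhs _ t [set s : R | `|s| < S]); split => //.
apply: (@open_comp _ _ (fun s : R => `|s|) [set x : R | x < S]); last exact: open_lt.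
by move=> s _; exact: norm_continuous.
Unshelve. all: by end_near. Qed.

Lemma flow_partial_bound : exists2 C : R, 0 <= C & forall i y t, B y -> `|t| < T ->
  `|flow_partial i t y| <= C.
Proof.
case: (fl) => oO KO cK bK sF oB init inK ode T0.
have [M M0 [_ _ lin _]] := field_bounds oO KO cK bK sF.
exists (2 * expR (2 * M * T)); first by rewrite mulr_ge0 ?expR_ge0.
move=> i y t By tT.
have := @gronwall R n (flow_partial i ^~ y)
  (fun s => flow_partial i s y *m diff_mx F (Phi s y)) M 0 `|t| M0 (lexx 0) (normr_ge0 t).
have [_ W0 _] := flow_partialP i By tT; rewrite W0 mul0r addr0 => H.
apply: (le_trans (H _ _ t (lexx _))).
- by move=> s st; have [] := flow_partialP i By (le_lt_trans st tT).
- by move=> s st; rewrite addr0; apply: lin; apply: inK => //; exact: le_lt_trans tT.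
apply: ler_pM; rewrite ?expR_ge0 ?mulr_ge0 //.
  by rewrite -[leRHS]mulr1 ler_wpM2l // row_delta_norm.
by rewrite ler_expR ler_wpM2l ?(ltW tT) // mulr_ge0 // ltW.
Qed.

End OneFlow.
End Flow.

Lemma smooth_Ck (R : realType) n k (U : set 'rV[R]_n) f : open U -> smooth U f -> Ck k U f.
Proof. by move=> oU /(smoothP _ oU). Qed.

Section SmoothComposition.
Variables (R : realType) (m n : nat).

Lemma smooth_comp (U : set 'rV[R]_m) (V : set 'rV[R]_n) (f : 'rV[R]_n -> R)
    (F : 'rV[R]_m -> 'rV[R]_n) : open U -> open V -> (forall x, U x -> V (F x)) ->
  smooth V f -> smooth_mx U F -> smooth U (fun x => f (F x)).
Proof.
move=> oU oV UV sf sF; apply/(smoothP _ oU) => k; apply: (Ck_comp oU oV UV).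
  by move/(smoothP _ oV): sf; apply.
by move=> j; move/(smoothP _ oU): (sF 0 j); apply.
Qed.

Lemma smooth_mx_comp p q (U : set 'rV[R]_m) (V : set 'rV[R]_n) (A : 'rV[R]_n -> 'M[R]_(p, q))
    (F : 'rV[R]_m -> 'rV[R]_n) : open U -> open V -> (forall x, U x -> V (F x)) ->
  smooth_mx V A -> smooth_mx U F -> smooth_mx U (fun x => A (F x)).
Proof. by move=> oU oV UV sA sF i j; exact: (smooth_comp oU oV UV (sA i j) sF). Qed.

Lemma Ck_row_mx k p q (U : set 'rV[R]_m) (A : 'rV[R]_m -> 'rV[R]_p) (B : 'rV[R]_m -> 'rV[R]_q) :
  open U -> (forall j, Ck k U (fun x => A x 0 j)) -> (forall j, Ck k U (fun x => B x 0 j)) ->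
  forall j, Ck k U (fun x => row_mx (A x) (B x) 0 j).
Proof.
move=> oU cA cB j; rewrite -(splitK j); case: (fintype.split j) => i /=.
  by apply: (eq_Ck oU _ (cA i)) => x _; rewrite row_mxEl.
by apply: (eq_Ck oU _ (cB i)) => x _; rewrite row_mxEr.
Qed.

Lemma smooth_row_mx p q (U : set 'rV[R]_m) (A : 'rV[R]_m -> 'rV[R]_p) (B : 'rV[R]_m -> 'rV[R]_q) :
  open U -> smooth_mx U A -> smooth_mx U B -> smooth_mx U (fun x => row_mx (A x) (B x)).
Proof.
move=> oU sA sB i j; rewrite ord1; apply/(smoothP _ oU) => k.
by apply: Ck_row_mx => // l; exact: smooth_Ck.
Qed.

End SmoothComposition.

Section Halves.
Variables (R : realType) (m n : nat).

Lemma smooth_lsubmx (U : set 'rV[R]_(m + n)) : open U -> smooth_mx U (@lsubmx R 1 m n).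
Proof.
move=> oU i j; apply: (eq_smooth oU _ (smooth_coord oU (lshift n j))) => x _.
by rewrite !mxE (ord1 i).
Qed.

Lemma smooth_rsubmx (U : set 'rV[R]_(m + n)) : open U -> smooth_mx U (@rsubmx R 1 m n).
Proof.
move=> oU i j; apply: (eq_smooth oU _ (smooth_coord oU (rshift m j))) => x _.
by rewrite !mxE (ord1 i).
Qed.

Lemma continuous_lsubmx : continuous (@lsubmx R 1 m n).
Proof. by move=> x; apply: differentiable_continuous; exact: differentiable_lsubmx. Qed.

Lemma continuous_rsubmx : continuous (@rsubmx R 1 m n).
Proof. by move=> x; apply: differentiable_continuous; exact: differentiable_rsubmx. Qed.

Lemma open_lsubmx (U : set 'rV[R]_m) : open U -> open [set x : 'rV[R]_(m + n) | U (lsubmx x)].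
Proof. by move=> oU; apply: open_comp => // x _; exact: continuous_lsubmx. Qed.

Lemma open_rsubmx (U : set 'rV[R]_n) : open U -> open [set x : 'rV[R]_(m + n) | U (rsubmx x)].
Proof. by move=> oU; apply: open_comp => // x _; exact: continuous_rsubmx. Qed.

Lemma row_mx_norm_le (a : 'rV[R]_m) (b : 'rV[R]_n) (e : R) : 0 <= e ->
  `|a| <= e -> `|b| <= e -> `|row_mx a b| <= e.
Proof.
move=> e0 ae be; apply: row_norm_le => // j; rewrite -(splitK j).
case: (fintype.split j) => i /=; rewrite ?row_mxEl ?row_mxEr.
  exact: le_trans (ler_row_norm _ _) ae.
exact: le_trans (ler_row_norm _ _) be.
Qed.

End Halves.

Section Extension.
Variables (R : realType) (n : nat).
Variables (Om K B : set 'rV[R]_n) (T : R) (F : 'rV[R]_n -> 'rV[R]_n).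
Variable Phi : R -> 'rV[R]_n -> 'rV[R]_n.
Hypothesis fl : local_flow Om K B T F Phi.

(** The system formed by [F] and its linearisation: its flow carries the first
    derivatives of the flow of [F]. *)
Definition ext_field (u : 'rV[R]_(n + n)) : 'rV[R]_(n + n) :=
  row_mx (F (lsubmx u)) (rsubmx u *m diff_mx F (lsubmx u)).

Definition ext_flow (t : R) (u : 'rV[R]_(n + n)) : 'rV[R]_(n + n) :=
  row_mx (Phi t (lsubmx u)) (\sum_i rsubmx u 0 i *: flow_partial Phi i t (lsubmx u)).

Lemma row_deriv_row_mx p q (a : R -> 'rV[R]_p) (b : R -> 'rV[R]_q) s va vb :
  row_deriv a s va -> row_deriv b s vb -> row_deriv (fun t => row_mx (a t) (b t)) s (row_mx va vb).
Proof.
move=> da db j; rewrite -(splitK j); case: (fintype.split j) => i /=.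
  rewrite row_mxEl; have -> : (fun t => row_mx (a t) (b t) 0 (lshift q i)) = (fun t => a t 0 i).
    by apply/funext => t; rewrite row_mxEl.
  exact: da.
rewrite row_mxEr; have -> : (fun t => row_mx (a t) (b t) 0 (rshift p i)) = (fun t => b t 0 i).
  by apply/funext => t; rewrite row_mxEr.
exact: db.
Qed.

Lemma row_deriv_lincomb p q (c : 'rV[R]_p) (b : 'I_p -> R -> 'rV[R]_q) s vb :
  (forall i, row_deriv (b i) s (vb i)) ->
  row_deriv (fun t => \sum_i c 0 i *: b i t) s (\sum_i c 0 i *: vb i).
Proof.
move=> db j; rewrite summxE.
have -> : (fun t => (\sum_i c 0 i *: b i t) 0 j) = \sum_i (fun t => c 0 i * b i t 0 j).
  by apply/funext => t; rewrite fct_sumE summxE; apply: eq_bigr => i _; rewrite mxE.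
apply: is_derive_sum => i; rewrite mxE.
exact: (is_deriveZ (c 0 i) (db i j)).
Qed.

(** It is again a local flow, so that a statement on first derivatives, applied to it,
    gives the derivatives of one order more. *)
Lemma ext_local_flow : exists Om' K', local_flow Om' K'
   [set u | B (lsubmx u) /\ `|rsubmx u| < 2] T ext_field ext_flow.
Proof.
case: (fl) => oO KO cK [clK [MK KM]] sF oB init inK ode T0.
have [C C0 CP] := flow_partial_bound fl.
pose r := n%:R * (2 * C).
have r0 : 0 <= r by rewrite /r !mulr_ge0.
exists [set u | Om (lsubmx u)], [set u | K (lsubmx u) /\ `|rsubmx u| <= r].
have oO' : open [set u : 'rV[R]_(n + n) | Om (lsubmx u)] by exact: open_lsubmx.
split => //=.
- by move=> u [] /KO.
- move=> a b s [Ka ar] [Kb br] s01; split.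
    by rewrite !(linearD, linearN, linearZ) /=; exact: cK.
  rewrite !(linearD, linearN, linearZ) /=.
  have -> : rsubmx a + s *: (rsubmx b - rsubmx a) = (1 - s) *: rsubmx a + s *: rsubmx b.
    by rewrite scalerBr scalerBl scale1r addrA addrAC.
  case/andP: s01 => s0 s1.
  apply: (le_trans (ler_normD _ _)); rewrite !normrZ (ger0_norm s0) ger0_norm ?subr_ge0 //.
  have -> : r = (1 - s) * r + s * r by ring.
  by apply: lerD; rewrite ler_wpM2l // subr_ge0.
- split.
    have -> : [set u | K (lsubmx u) /\ `|rsubmx u| <= r] =
       [set u : 'rV[R]_(n + n) | K (lsubmx u)] `&` [set u | `|rsubmx u| <= r] by [].
    apply: closedI.
      by apply: closed_comp => // x _; exact: continuous_lsubmx.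
    apply: (@closed_comp _ _ (@rsubmx R 1 n n) [set x | `|x| <= r]); last exact: closed_norm_le.
    by move=> x _; exact: continuous_rsubmx.
  exists (`|MK| + r) => u [Ku ur]; rewrite -[u]hsubmxK; apply: row_mx_norm_le.
  - by rewrite addr_ge0.
  - by apply: (le_trans (KM _ Ku)); apply: (le_trans (ler_norm _)); rewrite lerDl.
  - by apply: (le_trans ur); rewrite lerDr.
- apply: smooth_row_mx => //.
    by apply: (smooth_mx_comp oO' oO) => //; exact: smooth_lsubmx.
  apply: smooth_mx_mul => //; first exact: smooth_rsubmx.
  apply: (@smooth_mx_comp _ _ _ _ _ _ _ (diff_mx F) (@lsubmx R 1 n n) oO' oO) => //; last exact: smooth_lsubmx.
  move=> i j; apply: (eq_smooth oO _ (smooth_partial oO i (sF 0 j))) => x _.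
  by rewrite mxE.
- have -> : [set u | B (lsubmx u) /\ `|rsubmx u| < 2] =
       [set u : 'rV[R]_(n + n) | B (lsubmx u)] `&` [set u | `|rsubmx u| < 2] by [].
  apply: openI; first exact: open_lsubmx.
  exact: (@open_rsubmx R n n [set x | `|x| < 2] (@open_norm_lt _ _ _)).
- move=> u [Bu u2]; have T0' : `|0 : R| < T by rewrite normr0.
  rewrite /ext_flow init // -[RHS]hsubmxK; congr row_mx.
  rewrite [RHS]row_sum_delta; apply: eq_bigr => i _; congr (_ *: _).
  by have [] := flow_partialP fl i Bu T0'.
- move=> u t [Bu u2] tT; rewrite /ext_flow row_mxKl row_mxKr; split; first exact: inK.
  apply: (le_trans (ler_norm_sum _ _ _)).
  apply: (@le_trans _ _ (\sum_(i < n) 2 * C)).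
    apply: ler_sum => i _; rewrite normrZ; apply: ler_pM => //; last exact: CP.
    by apply: (le_trans (ler_row_norm _ _)); exact: ltW.
  by rewrite sumr_const card_ord /r [leRHS]mulr_natl.
- move=> u t [Bu u2] tT; rewrite /ext_flow /ext_field row_mxKl row_mxKr.
  apply: row_deriv_row_mx; first exact: ode.
  rewrite mulmx_suml.
  have -> : \sum_i rsubmx u 0 i *: flow_partial Phi i t (lsubmx u) *m diff_mx F (Phi t (lsubmx u))
    = \sum_i rsubmx u 0 i *: (flow_partial Phi i t (lsubmx u) *m diff_mx F (Phi t (lsubmx u))).
    by apply: eq_bigr => i _; rewrite scalemxAl.
  apply: row_deriv_lincomb => i.
  by have [] := flow_partialP fl i Bu tT.
Qed.

End Extension.

Section FlowSmooth.
Variable R : realType.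

Definition flow_map n (Phi : R -> 'rV[R]_n -> 'rV[R]_n) (q : 'rV[R]_(n + 1)) : 'rV[R]_n :=
  Phi (rsubmx q 0 0) (lsubmx q).

Definition flow_domain n (B : set 'rV[R]_n) (T : R) : set 'rV[R]_(n + 1) :=
  [set q | B (lsubmx q) /\ `|rsubmx q 0 0| < T].

Lemma open_flow_domain n (B : set 'rV[R]_n) T : open B -> open (flow_domain B T).
Proof.
move=> oB; have -> : flow_domain B T =
    [set q : 'rV[R]_(n + 1) | B (lsubmx q)] `&` [set q | `|rsubmx q 0 0| < T] by [].
apply: openI; first exact: open_lsubmx.
apply: (@open_rsubmx R n 1 [set x : 'rV[R]_1 | `|x 0 0| < T]).
apply: (@open_comp _ _ (fun x : 'rV[R]_1 => x 0 0) [set x : R | `|x| < T]); last exact: open_norm_lt.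
by move=> x _; apply: differentiable_continuous; exact: differentiable_coord.
Qed.

Lemma is_derive_base n (f : R -> 'rV[R]_n -> R) (q : 'rV[R]_(n + 1)) (i : 'I_n) d :
  is_derive (lsubmx q) (delta_mx 0 i) (f (rsubmx q 0 0)) d ->
  is_derive q (delta_mx 0 (lshift 1 i)) (fun q => f (rsubmx q 0 0) (lsubmx q)) d.
Proof.
have E : (fun h : R => h^-1 *: (((fun q => f (rsubmx q 0 0) (lsubmx q)) \o shift q)
              (h *: delta_mx 0 (lshift 1 i)) - f (rsubmx q 0 0) (lsubmx q)))
       = (fun h : R => h^-1 *: ((f (rsubmx q 0 0) \o shift (lsubmx q)) (h *: delta_mx 0 i)
              - f (rsubmx q 0 0) (lsubmx q))).
  apply/funext => h /=; congr (_ *: (_ - _)).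
  have -> : lsubmx (h *: delta_mx 0 (lshift 1 i) + q) = h *: delta_mx 0 i + lsubmx q.
    by apply/rowP => j; rewrite !mxE eq_lshift.
  by congr (f _ _); rewrite !mxE eq_rlshift andbF mulr0 add0r.
move=> [D V]; split; first by move: D; rewrite /derivable E.
by rewrite -V /derive E.
Qed.

Lemma is_derive_time n (f : R -> 'rV[R]_n -> R) (q : 'rV[R]_(n + 1)) d :
  is_derive (rsubmx q 0 0) 1 (f ^~ (lsubmx q)) d ->
  is_derive q (delta_mx 0 (rshift n 0)) (fun q => f (rsubmx q 0 0) (lsubmx q)) d.
Proof.
have E : (fun h : R => h^-1 *: (((fun q => f (rsubmx q 0 0) (lsubmx q)) \o shift q)
              (h *: delta_mx 0 (rshift n 0)) - f (rsubmx q 0 0) (lsubmx q)))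
       = (fun h : R => h^-1 *: ((f ^~ (lsubmx q) \o shift (rsubmx q 0 0)) (h *: 1)
              - f (rsubmx q 0 0) (lsubmx q))).
  apply/funext => h /=; congr (_ *: (_ - _)).
  have -> : lsubmx (h *: delta_mx 0 (rshift n 0) + q) = lsubmx q.
    by apply/rowP => j; rewrite !mxE eq_lrshift andbF mulr0 add0r.
  congr (f _ _); rewrite !mxE eqxx /=.
  by rewrite (_ : rshift n 0 == rshift n 0 = true) ?eqxx.
move=> [D V]; split; first by move: D; rewrite /derivable E.
by rewrite -V /derive E.
Qed.

(** By induction on the order, for all flows at once: the time derivative is the
    field along the flow, and the derivatives in the initial value are components of
    the flow of the extended field. *)
Theorem flow_Ck k n (Om K B : set 'rV[R]_n) (T : R) F Phi : local_flow Om K B T F Phi ->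
  forall j, Ck k (flow_domain B T) (fun q => flow_map Phi q 0 j).
Proof.
elim: k n Om K B F Phi => [|k IH] n Om K B F Phi fl j.
  split=> // q [Bq qT]; case: (fl) => oO KO cK bK sF oB init inK ode T0.
  have [C C0 lip] := flow_lipschitz fl.
  set y := lsubmx q in Bq *; set t := rsubmx q 0 0 in qT *.
  apply/(@cvgrPdist_le _ _ _ (nbhs q) (nbhs_filter q)) => e e0.
  have ct : {for q, continuous (fun q : 'rV[R]_(n + 1) => Phi (rsubmx q 0 0) y 0 j)}.
    apply: (@continuous_comp _ _ _ (fun q : 'rV[R]_(n + 1) => rsubmx q 0 0) (fun s => Phi s y 0 j)).
      apply: (@continuous_comp _ _ _ (@rsubmx R 1 n 1) (fun x : 'rV[R]_1 => x 0 0)).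
        exact: continuous_rsubmx.
      by apply: differentiable_continuous; exact: differentiable_coord.
    by apply: differentiable_continuous; apply/derivable1_diffP; case: (ode y t Bq qT j).
  have e2 : 0 < e / 2 by rewrite divr_gt0.
  have near1 : \forall q' \near q, `|Phi t y 0 j - Phi (rsubmx q' 0 0) y 0 j| <= e / 2.
    by move/cvgrPdist_le : ct => /(_ _ e2).
  have near2 : \forall q' \near q, `|lsubmx q - lsubmx q'| <= e / 2 / C.
    have /cvgrPdist_le := @continuous_lsubmx R n 1 q; apply.
    by rewrite divr_gt0.
  have near3 : \forall q' \near q, flow_domain B T q'.
    by apply: open_nbhs_nbhs; split => //; exact: open_flow_domain.
  near=> q'.
  have [Bq' q'T] : flow_domain B T q' by near: q'; exact: near3.
  have H1 : `|Phi t y 0 j - Phi (rsubmx q' 0 0) y 0 j| <= e / 2 by near: q'; exact: near1.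
  have H2 : `|lsubmx q - lsubmx q'| <= e / 2 / C by near: q'; exact: near2.
  rewrite /flow_map -/t -/y.
  have -> : Phi t y 0 j - Phi (rsubmx q' 0 0) (lsubmx q') 0 j =
    (Phi t y 0 j - Phi (rsubmx q' 0 0) y 0 j) +
    (Phi (rsubmx q' 0 0) y 0 j - Phi (rsubmx q' 0 0) (lsubmx q') 0 j).
    by rewrite addrA subrK.
  apply: (le_trans (ler_normD _ _)); rewrite (splitr e); apply: lerD => //.
  have := lip (lsubmx q') y _ Bq' Bq q'T => /(le_trans (ler_row_norm _ j)).
  rewrite !mxE => /le_trans; apply.
  by rewrite -ler_pdivlMl // mulrC.
case: (fl) => oO KO cK bK sF oB init inK ode T0.
have oD : open (flow_domain B T) by exact: open_flow_domain.
have Dt q : flow_domain B T q ->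
    is_derive q (delta_mx 0 (rshift n 0)) (fun q => flow_map Phi q 0 j) (F (flow_map Phi q) 0 j).
  move=> [Bq qT]; apply: (@is_derive_time n (fun t y => Phi t y 0 j)).
  exact: ode.
have Dy q i : flow_domain B T q ->
    is_derive q (delta_mx 0 (lshift 1 i)) (fun q => flow_map Phi q 0 j)
      (flow_partial Phi i (rsubmx q 0 0) (lsubmx q) 0 j).
  move=> [Bq qT]; apply: (@is_derive_base n (fun t y => Phi t y 0 j)).
  have [D _ _] := flow_partialP fl i Bq qT.
  by split; [exact: D|rewrite [RHS]mxE partialE].
have derAll q (i : 'I_(n + 1)) : flow_domain B T q ->
    derivable (fun q => flow_map Phi q 0 j) q (delta_mx 0 i).
  move=> Dq; rewrite -(splitK i); case: (fintype.split i) => a /=; first by have [] := Dy q a Dq.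
  by rewrite (ord1 a); have [] := Dt q Dq.
apply/CkS; split.
- by move=> q Dq; exact: Ck_continuous (IH _ _ _ _ _ _ fl j) Dq.
- by move=> i q Dq; exact: derAll.
move=> i; rewrite -(splitK i); case: (fintype.split i) => a /=; last first.
  rewrite (ord1 a); apply: (@eq_Ck _ _ _ _ (fun q => F (flow_map Phi q) 0 j)) => //.
    by move=> q Dq; have [_] := Dt q Dq; rewrite -partialE.
  apply: (@Ck_comp _ _ _ _ _ Om (fun x => F x 0 j) (flow_map Phi)) => //.
  - by move=> q [Bq qT]; apply/KO/inK.
  - by move/(smoothP _ oO): (sF 0 j); apply.
  - exact: IH fl.
have [Om' [K' fl']] := ext_local_flow fl.
pose inj (q : 'rV[R]_(n + 1)) : 'rV[R]_((n + n) + 1) :=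
  row_mx (row_mx (lsubmx q) (delta_mx 0 a)) (rsubmx q).
apply: (@eq_Ck _ _ _ _ (fun q => flow_map (ext_flow Phi) (inj q) 0 (rshift n j))) => //.
  move=> q Dq; have [_ E] := Dy q a Dq; rewrite -partialE in E.
  rewrite [RHS]E /flow_map /ext_flow /inj !row_mxKl !row_mxKr row_mxEr.
  rewrite summxE (bigD1 a) //= big1 => [|b ba]; first by rewrite !mxE !eqxx mul1r addr0.
  by rewrite !mxE eqxx (negbTE ba) mul0r.
have IH' := IH _ _ _ _ _ _ fl' (rshift n j).
apply: (Ck_comp oD _ _ IH').
- by apply: open_flow_domain; case: fl'.
- move=> q [Bq qT]; rewrite /inj /flow_domain /= !row_mxKl !row_mxKr; split => //; split => //.
  by apply: (le_lt_trans (row_delta_norm _ _)); rewrite ltr1n.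
apply: Ck_row_mx => //; last by move=> l; move/(smoothP _ oD): (smooth_rsubmx oD 0 l); apply.
apply: Ck_row_mx => //; first by move=> l; move/(smoothP _ oD): (smooth_lsubmx oD 0 l); apply.
by move=> l; exact: Ck_cst.
Unshelve. all: by end_near. Qed.

Lemma flow_map_smooth n (Om K B : set 'rV[R]_n) (T : R) F Phi : local_flow Om K B T F Phi ->
  smooth_mx (flow_domain B T) (flow_map Phi).
Proof.
move=> fl i j; rewrite (ord1 i); apply/smoothP; first by apply: open_flow_domain; case: fl.
by move=> k; exact: flow_Ck fl j.
Qed.

Lemma clamp_lipschitz (r a b : R) : 0 < r ->
  `|Num.max (- r) (Num.min r a) - Num.max (- r) (Num.min r b)| <= `|a - b|.
Proof.
move=> r0.
have clampE (s : R) : Num.max (- r) (Num.min r s) =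
    if s <= - r then - r else if r <= s then r else s.
  case: (leP s (- r)) => h1.
    by rewrite (min_idPr _) ?(max_idPl _) //; lra.
  case: (leP r s) => h2; first by rewrite (max_idPr _) //; lra.
  by rewrite (max_idPr _) // ltW.
rewrite !clampE.
by case: (leP a (- r)) => ?; case: (leP b (- r)) => ?; case: (leP r a) => ?;
   case: (leP r b) => ?; rewrite ler_norml;
   (case: (lerP 0 (a - b)) => ?; [rewrite ger0_norm|rewrite ltr0_norm]) => //;
   apply/andP; split; lra.
Qed.

(** The vector field is stopped outside a ball, which makes it globally Lipschitz. *)
Theorem flow_exists n (Om : set 'rV[R]_n) (F : 'rV[R]_n -> 'rV[R]_n) p : open Om -> Om p ->
  smooth_mx Om F -> exists K B T Phi, [/\ local_flow Om K B T F Phi, B p & 0 < T].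
Proof.
move=> oO Op sF.
have [r r0 rO] : exists2 r : R, 0 < r & forall x, `|x - p| <= r -> Om x.
  have /nbhs_ballP[r r0 rP] := open_nbhs_nbhs (conj oO Op).
  exists (r / 2); first by rewrite divr_gt0.
  move=> x xr; apply: rP; rewrite -ball_normE /= distrC; apply: (le_lt_trans xr).
  by move: r0; rewrite /=; lra.
pose K := [set x : 'rV[R]_n | `|x - p| <= r].
have KO : K `<=` Om by move=> x /rO.
have cK : segment_convex K by exact: closed_ball_convex.
have bK : bounded_closed K by exact: closed_ball_bounded.
have [M M0 [FM lip _ _]] := field_bounds oO KO cK bK sF.
pose c (x : 'rV[R]_n) : 'rV[R]_n :=
  \row_j (p 0 j + Num.max (- r) (Num.min r (x 0 j - p 0 j))).
have cKx x : K (c x).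
  rewrite /K /=; apply: row_norm_le => [|j]; first exact: ltW.
  rewrite !mxE addrAC subrr add0r ler_norml le_max lexx /= ge_max ge_min lexx /= andbT.
  by rewrite lerNl; apply: (@le_trans _ _ 0); rewrite ?oppr_le0 ltW.
have c_id x : K x -> c x = x.
  move=> Kx; apply/rowP => j; rewrite mxE.
  have := le_trans (ler_row_norm (x - p) j) Kx; rewrite !mxE ler_norml => /andP[a b].
  by rewrite (min_idPr b) (max_idPr a) addrCA subrr addr0.
have c_lip x y : `|c x - c y| <= `|x - y|.
  apply: row_norm_le => // j; rewrite !mxE.
  apply: (le_trans _ (ler_row_norm (x - y) j)); rewrite !mxE.
  have E (a b q : R) : q + a - (q + b) = a - b by ring.
  rewrite E; have -> : x 0 j - y 0 j = (x 0 j - p 0 j) - (y 0 j - p 0 j) by ring.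
  exact: clamp_lipschitz.
pose G (t : R) (x : 'rV[R]_n) := F (c x).
have GL t u v : `|G t u - G t v| <= M * `|u - v|.
  by apply: (le_trans (lip _ _ (cKx v) (cKx u))); rewrite ler_wpM2l // ltW.
have Gcont : continuous (fun x => F (c x)).
  move=> x; apply/(@cvgrPdist_le _ _ _ (nbhs x) (nbhs_filter x)) => e e0.
  have near1 : \forall y \near x, `|x - y| < e / M.
    by apply/nbhs_ballP; exists (e / M); rewrite /= ?divr_gt0 // -ball_normE.
  near=> y; apply: (le_trans (GL 0 x y)); rewrite -ler_pdivlMl // mulrC.
  by apply: ltW; near: y; exact: near1.
have Gc (u : R -> 'rV[R]_n) : continuous u -> continuous (fun t => G t (u t)).
  by move=> cu t; apply: (@continuous_comp _ _ _ u (fun x => F (c x))); [exact: cu|exact: Gcont].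
have ex y := picard_existence M0 GL Gc y.
have [Z ZP] := choice ex.
pose T := r / (2 * (M + 1)).
have M1 : 0 < 2 * (M + 1) by lra.
have T0 : 0 < T by rewrite divr_gt0.
pose B := [set y : 'rV[R]_n | `|y - p| < r / 2].
have stay y t : B y -> `|t| < T -> K (Z y t).
  move=> By tT; rewrite /K /=.
  have [z0 dz] := ZP y.
  have := @growth_row R n (Z y) (fun s => F (c (Z y s))) (fun s => M * s) (fun=> M) t.
  rewrite z0 mulr0 subr0 => H.
  have {}H : `|Z y t - y| <= M * `|t|.
    apply: H => s st; first exact: dz.
      by have := is_deriveZ M (is_derive_id s (1 : R)); rewrite /GRing.scale /= mulr1.
    exact: FM.
  have -> : Z y t - p = (Z y t - y) + (y - p) by rewrite addrA subrK.
  apply: (le_trans (ler_normD _ _)); rewrite (splitr r); apply: lerD; last exact: ltW.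
  apply: (le_trans H); apply: (@le_trans _ _ ((M + 1) * T)).
    by apply: ler_pM => //; [exact: ltW|rewrite lerDl|exact: ltW].
  rewrite /T le_eqVlt; apply/orP; left; apply/eqP; field.
  by rewrite gt_eqF //; lra.
exists K, B, T, (fun t y => Z y t); split => //; last by rewrite /B /= subrr normr0 divr_gt0.
split => //.
- exact: open_ball_lt.
- by move=> y _; case: (ZP y).
- move=> y t By tT; have [_ dz] := ZP y.
  by rewrite -[in F _](c_id _ (stay y t By tT)); exact: dz.
Unshelve. all: by end_near. Qed.

End FlowSmooth.

(** * The inverse function theorem and flow boxes *)

HB.instance Definition _ (R : realType) (m n : nat) := Complete.on 'M[R]_(m, n).

Section InverseFunction.
Variables (R : realType) (n : nat) (Om : set 'rV[R]_n) (f : 'rV[R]_n -> 'rV[R]_n).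
Variable q0 : 'rV[R]_n.
Hypotheses (oO : open Om) (Oq0 : Om q0) (sf : smooth_mx Om f).
Hypothesis uf : diff_mx f q0 \in unitmx.

Let A := invmx (diff_mx f q0).

Lemma mulmx_norm p (v : 'rV[R]_n) (D : 'M[R]_(n, p)) :
  exists2 C : R, 0 < C & forall v : 'rV[R]_n, `|v *m D| <= C * `|v|.
Proof.
exists (n%:R * (\sum_i \sum_j `|D i j|) + 1).
  by rewrite ltr_wpDl // mulr_ge0 // sumr_ge0 // => i _; rewrite sumr_ge0.
move=> w; apply: row_norm_le => [|j].
  by rewrite mulr_ge0 // addr_ge0 // mulr_ge0 // sumr_ge0 // => i _; rewrite sumr_ge0.
rewrite mxE; apply: (le_trans (ler_norm_sum _ _ _)).
apply: (@le_trans _ _ (\sum_(i < n) (\sum_i \sum_j `|D i j|) * `|w|)).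
  apply: ler_sum => i _; rewrite normrM mulrC; apply: ler_pM => //; last exact: ler_row_norm.
  rewrite (bigD1 i) //= (bigD1 j) //= -addrA lerDl addr_ge0 ?sumr_ge0 // => k _.
  by rewrite sumr_ge0.
by rewrite sumr_const card_ord -mulrnAl ler_wpM2r // mulr_natl lerDl.
Qed.

(** Near [q0] the map [q |-> q - f q *m A] contracts by one half. *)
Lemma near_identity : exists2 r : R, 0 < r & (forall q, `|q - q0| <= r -> Om q) /\
  [/\ forall q (v : 'rV[R]_n), `|q - q0| <= r -> `|v - v *m (diff_mx f q *m A)| <= `|v| / 2 &
    forall a b, `|a - q0| <= r -> `|b - q0| <= r ->
      `|(b - a) - (f b - f a) *m A| <= `|b - a| / 2].
Proof.
pose e : R := (2 * n.+1%:R)^-1.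
have e0 : 0 < e by rewrite invr_gt0 mulr_gt0 // ltr0n.
pose g q := f q *m A.
have sg : smooth_mx Om g by apply: smooth_mx_mul => //; exact: smooth_mx_cst.
have dg q : Om q -> diff_mx g q = diff_mx f q *m A.
  move=> Oq; apply/matrixP => i j; rewrite [LHS]mxE [RHS]mxE.
  rewrite (@partial_eq _ _ _ oO _ (fun y => \sum_k A k j * f y 0 k)) //; last first.
    by move=> y _; rewrite mxE; apply: eq_bigr => k _; rewrite mulrC.
  rewrite (partial_bigsum oO) //; last by move=> k; exact: smooth_scale.
  apply: eq_bigr => k _; rewrite (partial_scale oO) // mulrC.
  by rewrite [diff_mx _ _ _ _]mxE.
have near_q0 : \forall q \near q0, Om q /\
    forall ij : 'I_n * 'I_n, `|partial ij.1 (fun y => g y 0 ij.2) q0 - partial ij.1 (fun y => g y 0 ij.2) q| <= e.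
  near=> q; split; first by near: q; exact: open_nbhs_nbhs.
  near: q; apply: filter_forall => -[i j] /=.
  have ct : {for q0, continuous (partial i (fun y => g y 0 j))}.
    by apply: differentiable_continuous; exact: smooth_differentiable (smooth_partial oO i (sg 0 j)) Oq0.
  by move/(@cvgrPdist_le _ _ _ (nbhs q0) (nbhs_filter q0)): ct => /(_ _ e0).
have /nbhs_ballP[r r0 rP] := near_q0.
have rP' q : `|q - q0| <= r / 2 -> Om q /\ forall i j, `|(diff_mx g q - 1%:M) i j| <= e.
  move=> qr; have [|Oq H] := rP q.
    rewrite -ball_normE /= distrC; apply: (le_lt_trans qr).
    by move: r0 => /=; lra.
  split => // i j; have := H (i, j); rewrite /= distrC.
  have E : diff_mx g q0 = 1%:M by rewrite dg // mulmxV.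
  have E' : partial i (fun y => g y 0 j) q0 = (1%:M : 'M[R]_n) i j by rewrite -E mxE.
  have -> // : (diff_mx g q - 1%:M) i j = partial i (fun y => g y 0 j) q - (1%:M : 'M[R]_n) i j.
    by rewrite [LHS]mxE [X in X + _]mxE [X in _ + X]mxE.
  by rewrite E'.
have half (x : R) : 0 <= x -> n%:R * e * x <= x / 2.
  move=> x0; rewrite mulrC ler_wpM2l // /e invfM mulrCA ler_piMr ?invr_ge0 //.
  by rewrite ler_pdivrMr ?ltr0n // mul1r ler_nat.
exists (r / 2); first by rewrite divr_gt0.
split; first by move=> q /rP'[].
split=> [q v /rP'[Oq H]|a b ar br].
  rewrite -dg // -{1}[v]mulmx1 -mulmxBr -normrN -mulmxN opprB.
  by apply: le_trans (half _ (normr_ge0 v)); apply: mulmx_bound => //; exact: ltW.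
pose K := [set q : 'rV[R]_n | `|q - q0| <= r / 2].
have KO : K `<=` Om by move=> q /rP'[].
have cK : segment_convex K by exact: closed_ball_convex.
rewrite mulmxBl; apply: (@le_trans _ _ (n%:R * e * `|b - a|)); last exact: half.
apply: row_norm_le => [|j]; first by rewrite mulr_ge0 // mulr_ge0 // ltW.
have [c [Kc _] E] := mean_value oO KO cK (sg 0 j) ar br.
have -> : (b - a - (f b *m A - f a *m A)) 0 j = (b - a) 0 j - (g b 0 j - g a 0 j).
  by rewrite /g !mxE.
rewrite E; have [_ H] := rP' c Kc.
have -> : (b - a) 0 j - \sum_i (b - a) 0 i * partial i (fun x => g x 0 j) c =
   - \sum_i (b - a) 0 i * (diff_mx g c - 1%:M) i j.
  have vj : (b - a) 0 j = \sum_i (b - a) 0 i * (1%:M : 'M[R]_n) i j.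
    by have := congr1 (fun u : 'rV[R]_n => u 0 j) (mulmx1 (b - a)); rewrite [X in X = _ -> _]mxE => ->.
  rewrite vj -sumrB -sumrN; apply: eq_bigr => i _.
  have -> : (diff_mx g c - 1%:M) i j = partial i (fun y => g y 0 j) c - (1%:M : 'M[R]_n) i j.
    by rewrite [LHS]mxE [X in X + _]mxE [X in _ + X]mxE.
  ring.
rewrite normrN; apply: (le_trans (ler_norm_sum _ _ _)).
apply: (@le_trans _ _ (\sum_(i < n) e * `|b - a|)).
  by apply: ler_sum => i _; rewrite normrM mulrC; apply: ler_pM => //; exact: ler_row_norm.
by rewrite sumr_const card_ord -[leLHS]mulr_natl mulrA.
Unshelve. all: by end_near. Qed.

(** The preimage of [x] is the fixed point of a contraction ([near_identity]); the inverse is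
    then Lipschitz, hence differentiable, and its derivative is the inverse matrix of that
    of [f] at the preimage, which gives all its derivatives inductively. *)
Theorem inverse_function : exists Q V (psi : 'rV[R]_n -> 'rV[R]_n),
  [/\ [/\ open Q, Q q0 & Q `<=` Om], open V,
      forall q, Q q -> V (f q) /\ psi (f q) = q,
      forall x, V x -> Q (psi x) /\ f (psi x) = x &
      smooth_mx V psi].
Proof.
have [r r0 [rO [lin con]]] := near_identity.
pose K := [set q : 'rV[R]_n | `|q - q0| <= r].
have KO : K `<=` Om by move=> q /rO.
have K0 : K q0 by rewrite /K /= subrr normr0 ltW.
have [CA CA0 CAP] := mulmx_norm q0 A.
have uA : A \in unitmx by rewrite unitmx_inv.
have uD q : K q -> diff_mx f q \in unitmx.
  move=> Kq; suff u : diff_mx f q *m A \in unitmx.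
    by move: u; rewrite unitmx_mul => /andP[].
  rewrite -row_free_unit -kermx_eq0; apply/eqP/row_matrixP => i; rewrite row0.
  set v := row i _; have v0 : v *m (diff_mx f q *m A) = 0.
    by rewrite /v -row_mul mulmx_ker row0.
  have := lin q v Kq; rewrite v0 subr0 => H.
  by apply/eqP; rewrite -normr_le0; lra.
have fixpoint x : `|(x - f q0) *m A| < r / 2 -> exists2 q, `|q - q0| < r & f q = x.
  move=> xr; pose T (q : 'rV[R]_n) := q - (f q - x) *m A.
  have Tlt q : K q -> `|T q - q0| < r.
    move=> Kq; have -> : T q - q0 = ((q - q0) - (f q - f q0) *m A) + (x - f q0) *m A.
      rewrite /T !mulmxBl; move: (f q *m A) (f q0 *m A) (x *m A) => a b c.
      by apply/rowP => j; rewrite !mxE; ring.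
    apply: (le_lt_trans (ler_normD _ _)).
    have := con q0 q; rewrite subrr normr0 => /(_ (ltW r0) Kq) H.
    by move: Kq H xr; rewrite /K /= => *; lra.
  have TK : set_fun K K T by move=> q /Tlt /ltW.
  pose T' : {fun K >-> K} := HB.pack T (isFun.Build _ _ _ _ T TK).
  have cT : is_contraction T'.
    have h0 : (0 : R) <= 2^-1 by rewrite invr_ge0.
    exists (NngNum h0); split => /=; first by rewrite invf_lt1 // ltr1n.
    move=> [a b] [/= Ka Kb]; rewrite mulrC.
    have -> : T a - T b = (a - b) - (f a - f b) *m A.
      rewrite /T !mulmxBl; move: (f a *m A) (f b *m A) (x *m A) => u v w.
      by apply/rowP => j; rewrite !mxE; ring.
    exact: con.
  have clK : closed K by have [] := closed_ball_bounded q0 r.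
  have [q Kq Eq] := banach_fixed_point cT clK (ex_intro _ q0 K0).
  exists q; first by rewrite {1}Eq; exact: Tlt.
  have : (f q - x) *m A = 0.
    by move: Eq; rewrite /= {1}/T => /(congr1 (fun y => q - y)); rewrite subrr opprB addrCA subrr addr0.
  move=> /(congr1 (mulmx^~ (invmx A))); rewrite mulmxK // mul0mx => /eqP.
  by rewrite subr_eq0 => /eqP.
have inj a b : K a -> K b -> `|b - a| <= 2 * (CA * `|f b - f a|).
  move=> Ka Kb; have H1 := con a b Ka Kb; have H2 := CAP (f b - f a).
  have := ler_normD ((b - a) - (f b - f a) *m A) ((f b - f a) *m A); rewrite subrK.
  move: H1 H2; move: `|b - a - (f b - f a) *m A| `|(f b - f a) *m A| `|b - a| => u v w.
  by move=> ? ? ?; lra.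
pose V := [set x : 'rV[R]_n | `|(x - f q0) *m A| < r / 2].
pose Q := [set q : 'rV[R]_n | `|q - q0| < r /\ V (f q)].
have oV : open V.
  apply: (@open_comp _ _ (fun x : 'rV[R]_n => (x - f q0) *m A) [set x | `|x| < r / 2]); last exact: open_norm_lt.
  move=> x _; apply: (@continuous_comp _ _ _ (fun x : 'rV[R]_n => x - f q0) (mulmx^~ A)).
    by apply: continuousB; [exact: cvg_id|exact: cst_continuous].
  apply: continuous_row => j; apply: differentiable_continuous.
  exact: (smooth_differentiable (@smooth_mx_mul R n setT openT _ _ _ id (fun=> A)
    (fun i k => eq_smooth openT (fun x _ => congr2 (fun_of_matrix x) (esym (ord1 i)) erefl) (smooth_coord openT k))
    (smooth_mx_cst openT A) 0 j)).
have cf q : Om q -> {for q, continuous f}.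
  move=> Oq; apply: continuous_row => j; apply: differentiable_continuous.
  exact: smooth_differentiable (sf 0 j) Oq.
have oQ : open Q.
  rewrite openE => q [qr Vq].
  have Oq : Om q by apply: rO; exact: ltW.
  apply: filterI.
    by apply: open_nbhs_nbhs; split => //; exact: open_ball_lt.
  by apply: (cf q Oq); apply: open_nbhs_nbhs.
have QK : Q `<=` K by move=> q [/ltW].
have V0 : V (f q0) by rewrite /V /= subrr mul0mx normr0 divr_gt0.
have ex (x : 'rV[R]_n) : exists q, V x -> `|q - q0| < r /\ f q = x.
  have [Vx|nVx] := pselect (V x); last by exists q0.
  by have [q qr fq] := fixpoint x Vx; exists q.
have [psi psiP] := choice ex.
have psiQ x : V x -> Q (psi x).
  by move=> Vx; have [h1 h2] := psiP x Vx; split; rewrite ?h2.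
have fpsi x : V x -> f (psi x) = x by move=> /psiP[].
have psif q : Q q -> psi (f q) = q.
  move=> Qq; have Vq : V (f q) by case: Qq.
  have := inj q (psi (f q)) (QK _ Qq) (QK _ (psiQ _ Vq)).
  by rewrite fpsi // subrr normr0 !mulr0 normr_le0 subr_eq0 => /eqP.
have Qq0 : Q q0 by split => //; rewrite subrr normr0.
exists Q, V, psi; split => //; first by split => // q /QK /KO.
  by move=> q Qq; split; [case: Qq|exact: psif].
  by move=> x Vx; split; [exact: psiQ|exact: fpsi].
have psi_lip x y : V x -> V y -> `|psi y - psi x| <= 2 * CA * `|y - x|.
  move=> Vx Vy; have := inj (psi x) (psi y) (QK _ (psiQ _ Vx)) (QK _ (psiQ _ Vy)).
  by rewrite !fpsi // mulrA.
have cpsi x : V x -> {for x, continuous psi}.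
  move=> Vx; apply/(@cvgrPdist_le _ _ _ (nbhs x) (nbhs_filter x)) => e e0.
  have near1 : \forall y \near x, `|x - y| < e / (2 * CA).
    by apply/nbhs_ballP; exists (e / (2 * CA)); rewrite /= ?divr_gt0 ?mulr_gt0 // -ball_normE.
  have near2 : \forall y \near x, V y by exact: open_nbhs_nbhs.
  near=> y.
  have Vy : V y by near: y; exact: near2.
  apply: (le_trans (psi_lip y x Vy Vx)); rewrite -ler_pdivlMl ?mulr_gt0 // mulrC.
  by apply: ltW; near: y; exact: near1.
have cK : segment_convex K by exact: closed_ball_convex.
have bK : bounded_closed K by exact: closed_ball_bounded.
have [M M0 [_ _ _ taylor]] := field_bounds oO KO cK bK sf.
have Dpsi x (i j : 'I_n) : V x ->
    is_derive x (delta_mx 0 i) (fun y => psi y 0 j) (invmx (diff_mx f (psi x)) i j).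
  move=> Vx; set D := diff_mx f (psi x).
  have [C C0 CP] := mulmx_norm q0 (invmx D).
  have uDx : D \in unitmx by exact: uD (QK _ (psiQ _ Vx)).
  pose C2 := C * (M * (2 * CA) ^+ 2).
  have C20 : 0 <= C2 by rewrite !mulr_ge0 ?exprn_ge0 ?mulr_ge0 // ltW.
  have est (h : R) : V (h *: delta_mx 0 i + x) ->
      `|psi (h *: delta_mx 0 i + x) - psi x - h *: row i (invmx D)| <= C2 * `|h| ^+ 2.
    set y := _ + x => Vy.
    have -> : psi y - psi x - h *: row i (invmx D) =
        - ((f (psi y) - f (psi x) - (psi y - psi x) *m D) *m invmx D).
      rewrite !fpsi // mulmxBl mulmxK // /y addrK -scalemxAl -rowE opprB //.
    rewrite normrN; apply: (le_trans (CP _)).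
    have -> : C2 * `|h| ^+ 2 = C * (M * (2 * CA * `|h|) ^+ 2) by rewrite /C2; ring.
    rewrite ler_wpM2l ?(ltW C0) //.
    apply: (le_trans (taylor _ _ (QK _ (psiQ _ Vx)) (QK _ (psiQ _ Vy)))).
    rewrite ler_wpM2l ?(ltW M0) // lerXn2r ?nnegrE ?mulr_ge0 // ?(ltW CA0) //.
    apply: (le_trans (psi_lip x y Vx Vy)); rewrite ler_wpM2l ?mulr_ge0 ?(ltW CA0) //.
    by rewrite /y addrK normrZ ler_piMr // row_delta_norm.
  have cv : (h^-1 *: (((fun y => psi y 0 j) \o shift x) (h *: delta_mx 0 i) - psi x 0 j))
       @[h --> (0 : R)^'] --> invmx D i j.
    have [d d0 dV] : exists2 d : R, 0 < d & forall h : R, `|h| < d -> V (h *: delta_mx 0 i + x).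
      have /nbhs_ballP[d d0 dP] := open_nbhs_nbhs (conj oV Vx).
      exists d => // h hd; apply: dP; rewrite -ball_normE /= opprD addrCA subrr addr0 normrN normrZ.
      by apply: le_lt_trans hd; rewrite ler_piMr // row_delta_norm.
    apply/cvgrPdist_le => e e0; near=> h.
    have h0 : h != 0 by near: h; exact: nbhs_dnbhs_neq.
    have hd : `|h| < d by near: h; exact: dnbhs0_lt.
    have he : `|h| <= e / (C2 + 1).
      by near: h; apply: dnbhs0_le; rewrite divr_gt0 // ltr_wpDl.
    have := est h (dV h hd) => /(le_trans (ler_row_norm _ j)).
    rewrite !mxE /= => E.
    have -> : invmx D i j - h^-1 *: (psi (h *: delta_mx 0 i + x) 0 j - psi x 0 j) =
       - (h^-1 * (psi (h *: delta_mx 0 i + x) 0 j - psi x 0 j - h * invmx D i j)).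
      by rewrite /GRing.scale /=; field.
    rewrite normrN normrM normfV ler_pdivrMl ?normr_gt0 //.
    apply: (le_trans E); rewrite expr2 mulrCA ler_wpM2l //.
    apply: (@le_trans _ _ ((C2 + 1) * (e / (C2 + 1)))); last by rewrite mulrCA divff ?mulr1 // gt_eqF // ltr_wpDl.
    by rewrite ler_pM // lerDl.
  split; first by apply/cvg_ex; exists (invmx D i j).
  by apply/cvg_lim.
have sD : smooth_mx Q (fun q => invmx (diff_mx f q)).
  apply: smooth_invmx => //; first by move=> q /QK /uD.
  move=> i j; apply: (eq_smooth oQ _ (smooth_sub _ (smooth_partial oO i (sf 0 j)))).
    by move=> q _; rewrite mxE.
  by move=> q /QK /KO.
suff Cpsi k (j : 'I_n) : Ck k V (fun x => psi x 0 j).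
  by move=> i j; rewrite (ord1 i); apply/(smoothP _ oV) => k.
elim: k j => [|k IH] j.
  split=> // x Vx; apply: (@continuous_comp _ _ _ psi (fun v : 'rV[R]_n => v 0 j)); first exact: cpsi.
  by apply: differentiable_continuous; exact: differentiable_coord.
apply/CkS; split.
- move=> x Vx; apply: (@continuous_comp _ _ _ psi (fun v : 'rV[R]_n => v 0 j)); first exact: cpsi.
  by apply: differentiable_continuous; exact: differentiable_coord.
- by move=> i x Vx; have [] := Dpsi x i j Vx.
move=> i; apply: (@eq_Ck _ _ _ _ (fun x => invmx (diff_mx f (psi x)) i j)) => //.
  by move=> x Vx; have [_] := Dpsi x i j Vx; rewrite -partialE.
exact: (Ck_comp oV oQ psiQ (smooth_Ck k oQ (sD i j)) IH).
Unshelve. all: by end_near. Qed.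

End InverseFunction.

Section FlowBox.
Variable R : realType.

Lemma jacobian_diff m n (f : 'rV[R]_m -> 'rV[R]_n) x :
  (forall j, differentiable (fun y => f y 0 j) x) ->
  'J f x = \matrix_(i, j) partial i (fun y => f y 0 j) x.
Proof.
move=> df; have dfx := differentiable_mx df.
apply/matrixP => i j; rewrite [RHS]mxE partialE.
have := deriveEjacobian (delta_mx 0 i) dfx; rewrite -rowE => /rowP/(_ j).
rewrite derive_mx; last exact: diff_derivable.
by rewrite [LHS]mxE [RHS]mxE => <-.
Qed.

Lemma jacobian_smooth n (U : set 'rV[R]_n) (f : 'rV[R]_n -> 'rV[R]_n) x :
  smooth_mx U f -> U x -> 'J f x = diff_mx f x.
Proof.
move=> sf Ux; apply: jacobian_diff => j; exact: smooth_differentiable (sf 0 j) Ux.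
Qed.

Lemma smooth_diff_mx n (U : set 'rV[R]_n) (f : 'rV[R]_n -> 'rV[R]_n) : open U ->
  smooth_mx U f -> smooth_mx U (diff_mx f).
Proof.
move=> oU sf i j; apply: (eq_smooth oU _ (smooth_partial oU i (sf 0 j))) => x _.
by rewrite mxE.
Qed.

Definition box n (r : R) : set 'rV[R]_(n + 1) :=
  [set q | `|lsubmx q| < r /\ `|rsubmx q 0 0| < r].

Lemma open_box n r : open (@box n r).
Proof.
have -> : @box n r = flow_domain [set y : 'rV[R]_n | `|y| < r] r by [].
by apply: open_flow_domain; exact: open_norm_lt.
Qed.

Lemma box_in_nbhs n (Q : set 'rV[R]_(n + 1)) : nbhs (0 : 'rV[R]_(n + 1)) Q ->
  exists2 r : R, 0 < r & @box n r `<=` Q.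
Proof.
move=> /nbhs_ballP[r r0 rQ].
exists (r / 2); first by rewrite divr_gt0.
move=> q [q1 q2]; apply: rQ; rewrite -ball_normE /= sub0r normrN.
apply: (@le_lt_trans _ _ (r / 2)); last by move: r0 => /=; lra.
rewrite -[q]hsubmxK; apply: row_mx_norm_le; rewrite ?divr_ge0 ?(ltW r0) ?(ltW q1) //.
by apply: row_norm_le => [|j]; rewrite ?divr_ge0 ?(ltW r0) // (ord1 j) ltW.
Qed.

(** Near a point where [X] does not vanish there are coordinates [(y, s)] in which
    [X] is the coordinate field of [s]. *)
Theorem flow_box n (N : set 'rV[R]_(n + 1)) (X : 'rV[R]_(n + 1) -> 'rV[R]_(n + 1)) p
    (E : 'M[R]_(n, n + 1)) : open N -> N p -> smooth_mx N X ->
  col_mx E (X p) \in unitmx ->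
  exists r V (Psi Ups : 'rV[R]_(n + 1) -> 'rV[R]_(n + 1)),
   [/\ [/\ 0 < r, open V, V p & V `<=` N],
       smooth_mx (@box n r) Psi /\ smooth_mx V Ups,
       forall q, box r q -> V (Psi q) /\ Ups (Psi q) = q,
       forall x, V x -> box r (Ups x) /\ Psi (Ups x) = x &
       forall q, box r q ->
         (forall j, partial (rshift n 0) (fun q => Psi q 0 j) q = X (Psi q) 0 j) /\
         0 < \det (diff_mx Psi q) * \det (col_mx E (X p))].
Proof.
move=> oN Np sX uE.
have [K [B [T [Phi [fl Bp T0]]]]] := flow_exists oN Np sX.
case: (fl) => _ KN _ _ _ oB init inK ode _.
pose a (q : 'rV[R]_(n + 1)) : 'rV[R]_(n + 1 + 1) := row_mx (p + lsubmx q *m E) (rsubmx q).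
pose f q := flow_map Phi (a q).
pose Om := [set q | flow_domain B T (a q)].
have sa : smooth_mx setT a.
  apply: smooth_row_mx; [exact: openT| |exact: smooth_rsubmx openT].
  apply: (smooth_mx_add openT); first exact: (smooth_mx_cst openT p).
  apply: (smooth_mx_mul openT); first exact: smooth_lsubmx openT.
  exact: (smooth_mx_cst openT E).
have oD := @open_flow_domain R _ B T oB.
have oO : open Om.
  apply: open_comp => // q _; apply: continuous_row => j; apply: differentiable_continuous.
  exact: smooth_differentiable (sa 0 j) I.
have sf : smooth_mx Om f.
  apply: (smooth_mx_comp oO oD) => //; first exact: flow_map_smooth fl.
  by move=> i j; apply: smooth_sub (sa i j) => ? _.
have a0 : a 0 = row_mx p 0 by rewrite /a !linear0 mul0mx addr0.
have O0 : Om 0.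
  by rewrite /Om /flow_domain /= a0 row_mxKl row_mxKr mxE normr0.
have ft q j : Om q -> partial (rshift n 0) (fun q => f q 0 j) q = X (f q) 0 j.
  move=> [Bq qT]; rewrite partialE.
  have := @is_derive_time R n (fun s y => Phi s (p + y *m E) 0 j) q (X (f q) 0 j).
  have Ef : (fun q : 'rV[R]_(n + 1) => Phi (rsubmx q 0 0) (p + lsubmx q *m E) 0 j) = (fun q => f q 0 j).
    by apply/funext => u; rewrite /f /flow_map /a row_mxKl row_mxKr.
  rewrite Ef => H; have [//|_ ->//] := H _.
  rewrite /a row_mxKl row_mxKr in Bq qT.
  have := ode _ _ Bq qT j; rewrite /f /flow_map /a row_mxKl row_mxKr; exact.
have f0 : f 0 = p.
  by rewrite /f a0 /flow_map row_mxKl row_mxKr mxE init.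
have D0 : diff_mx f 0 = col_mx E (X p).
  apply/matrixP => i j; rewrite [LHS]mxE -(splitK i); case: (fintype.split i) => k /=; last first.
    by rewrite col_mxEd (ord1 k) ft // f0.
  rewrite col_mxEu partialE.
  have := @is_derive_base R n (fun s y => Phi s (p + y *m E) 0 j) 0 k (E k j).
  have Ef : (fun q : 'rV[R]_(n + 1) => Phi (rsubmx q 0 0) (p + lsubmx q *m E) 0 j) = (fun q => f q 0 j).
    by apply/funext => u; rewrite /f /flow_map /a row_mxKl row_mxKr.
  rewrite Ef => H.
  have [//|_ ->//] := H _.
  have -> : lsubmx (0 : 'rV[R]_(n + 1)) = 0 :> 'rV[R]_n by rewrite linear0.
  have Z : (rsubmx (0 : 'rV[R]_(n + 1)) : 'rV[R]_1) 0 0 = 0 by rewrite linear0 mxE.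
  rewrite Z.
  have aff : smooth_mx setT (fun y : 'rV[R]_n => p + y *m E).
    apply: (smooth_mx_add openT); first exact: (smooth_mx_cst openT p).
    apply: (smooth_mx_mul openT); last exact: (smooth_mx_cst openT E).
    move=> u v; apply: (eq_smooth openT _ (smooth_coord openT v)) => y _.
    by rewrite (ord1 u).
  have oBE : open [set y : 'rV[R]_n | B (p + y *m E)].
    apply: open_comp => // y _; apply: continuous_row => v; apply: differentiable_continuous.
    exact: smooth_differentiable (aff 0 v) I.
  apply: (@near_eq_is_derive _ _ _ (fun y : 'rV[R]_n => (p + y *m E) 0 j)).
    have : nbhs (0 : 'rV[R]_n) [set y : 'rV[R]_n | B (p + y *m E)].
      by apply: open_nbhs_nbhs; split => //=; rewrite mul0mx addr0.
    by apply: filterS => y /= By; rewrite init.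
  split; first exact: smooth_derivable (aff 0 j) I.
  rewrite -partialE.
  rewrite (partial_eq openT _ I (g := fun y => p 0 j + \sum_l y 0 l * E l j)); last first.
    by move=> y _; rewrite !mxE.
  have s1 : smooth setT (fun _ : 'rV[R]_n => p 0 j) by exact: (smooth_cst openT (p 0 j)).
  have sE l : smooth setT (fun _ : 'rV[R]_n => E l j) by exact: (smooth_cst openT (E l j)).
  have sc l : smooth setT (fun y : 'rV[R]_n => y 0 l) by exact: (smooth_coord openT l).
  have s2 l : smooth setT (fun y : 'rV[R]_n => y 0 l * E l j) by exact: (smooth_mul openT).
  rewrite (partialD k s1 (smooth_sum openT _ (fun l _ => s2 l)) I) partial_cst add0r.
  rewrite (partial_bigsum openT _ k s2 I).
  have dE (l : 'I_n) : partial k (fun y : 'rV[R]_n => y 0 l * E l j) 0 = (k == l)%:R * E l j.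
    rewrite (partialM k (sc l) (sE l) I) partial_cst mulr0 addr0 partialE.
    by have [_ ->] := partial_coord k l (0 : 'rV[R]_n).
  rewrite (bigD1 k) //= big1 => [|l lk]; first by rewrite dE eqxx mul1r addr0.
  by rewrite dE eq_sym (negbTE lk) mul0r.
have uf : diff_mx f 0 \in unitmx by rewrite D0.
have [Q [V [psi [[oQ Q0 QO] oV fV psiV spsi]]]] := inverse_function oO O0 sf uf.
have sdet : smooth Om (fun q => \det (diff_mx f q)).
  by apply: smooth_det => //; exact: smooth_diff_mx.
set d := \det (col_mx E (X p)).
have d0 : d != 0 by move: uE; rewrite unitmxE unitfE.
have near0 : \forall q \near (0 : 'rV[R]_(n + 1)), Q q /\ 0 < \det (diff_mx f q) * d.
  apply: filterI; first exact: open_nbhs_nbhs.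
  have ct : {for (0 : 'rV[R]_(n + 1)), continuous (fun q => \det (diff_mx f q) * d)}.
    apply: continuousM; last exact: cst_continuous.
    by apply: differentiable_continuous; exact: smooth_differentiable sdet O0.
  apply: (ct [set x : R | 0 < x]); apply: open_nbhs_nbhs; split; first exact: open_gt.
  by rewrite /= D0 -/d -expr2 exprn_even_gt0.
have [r r0 rP] := box_in_nbhs near0.
exists r, (V `&` [set x | box r (psi x)]), f, psi.
have cpsi x : V x -> {for x, continuous psi}.
  move=> Vx; apply: continuous_row => j; apply: differentiable_continuous.
  exact: smooth_differentiable (spsi 0 j) Vx.
have rQ q : box r q -> Q q by move=> /rP[].
split.
- split => //.
  + rewrite openE => x [Vx bx]; apply: filterI; first exact: open_nbhs_nbhs.
    by apply: (cpsi x Vx); apply: open_nbhs_nbhs; split => //; exact: open_box.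
  + have [Vp psip] := fV 0 Q0; rewrite f0 in Vp psip; split => //=.
    by rewrite psip /box /= !linear0 normr0 mxE normr0.
  + move=> x [Vx bx]; have [Qx <-] := psiV x Vx.
    by apply: KN; have [h1 h2] := QO _ Qx; rewrite /f /flow_map; exact: inK.
- split; first by move=> i j; apply: smooth_sub (sf i j) => q /rQ /QO.
  by move=> i j; apply: smooth_sub (spsi i j) => x [].
- by move=> q bq; have [h1 h2] := fV q (rQ q bq); split => //; split => //=; rewrite h2.
- by move=> x [Vx bx]; split => //; have [] := psiV x Vx.
- move=> q bq; split; first by move=> j; apply: ft; exact: QO (rQ q bq).
  by have /rP[] := bq.
Qed.

End FlowBox.

(** * Weyl connections and their curvature *)

Section MatrixEntries.
Variable R : realType.

Lemma addmxE p q (A B : 'M[R]_(p, q)) i j : (A + B) i j = A i j + B i j.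
Proof. by rewrite mxE. Qed.

Lemma oppmxE p q (A : 'M[R]_(p, q)) i j : (- A) i j = - A i j.
Proof. by rewrite mxE. Qed.

Lemma scalemxE p q (c : R) (A : 'M[R]_(p, q)) i j : (c *: A) i j = c * A i j.
Proof. by rewrite mxE. Qed.

Lemma trmxE p q (A : 'M[R]_(p, q)) i j : A^T i j = A j i.
Proof. by rewrite mxE. Qed.

Lemma posdef_unit n (g : 'M[R]_n) :
  (forall v : 'rV[R]_n, v != 0 -> 0 < (v *m g *m v^T) 0 0) -> g \in unitmx.
Proof.
move=> pos; rewrite -row_free_unit -kermx_eq0; apply/eqP/row_matrixP => i.
rewrite row0; apply/eqP/negPn/negP => /pos.
by rewrite -row_mul mulmx_ker row0 mul0mx mxE ltxx.
Qed.

Lemma trmxD p q (A B : 'M[R]_(p, q)) : (A + B)^T = A^T + B^T.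
Proof. exact: linearD. Qed.

Lemma trmxN p q (A : 'M[R]_(p, q)) : (- A)^T = - A^T.
Proof. exact: linearN. Qed.

Lemma skew_commutator n (g A B dA dB : 'M[R]_n) :
  dB^T *m g + B^T *m (A^T *m g + g *m A) + ((A^T *m g + g *m A) *m B + g *m dB) =
  dA^T *m g + A^T *m (B^T *m g + g *m B) + ((B^T *m g + g *m B) *m A + g *m dA) ->
  (dB - dA + (A *m B - B *m A))^T *m g + g *m (dB - dA + (A *m B - B *m A)) = 0.
Proof.
move/eqP; rewrite -subr_eq0 => /eqP E; rewrite -[RHS]E.
rewrite !(trmxD, trmxN, trmx_mul, mulmxDl, mulmxDr, mulmxN, mulNmx) !mulmxA.
by apply/matrixP => a b; rewrite !(addmxE, oppmxE); ring.
Qed.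

End MatrixEntries.

Definition mxE3 := (addmxE, oppmxE, scalemxE, trmxE).

Section Connection.
Variables (R : realType) (n : nat) (U : set 'rV[R]_n).
Hypothesis oU : open U.
Implicit Types (g : 'rV[R]_n -> 'M[R]_n) (w : 'rV[R]_n -> 'rV[R]_n).
Implicit Type Gam : connection R n.

(** The matrix of the endomorphism [Y |-> D_(d_i) Y] in the coordinate frame. *)
Definition conn_mx Gam (i : 'I_n) (x : 'rV[R]_n) : 'M[R]_n := \matrix_(k, j) Gam k i j x.

Definition curv_mx Gam (i j : 'I_n) (x : 'rV[R]_n) : 'M[R]_n :=
  \matrix_(l, k) curvature Gam i j k l x.

Definition smooth_conn Gam := forall k i j, smooth U (Gam k i j).

Lemma smooth_conn_mx Gam i : smooth_conn Gam -> smooth_mx U (conn_mx Gam i).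
Proof.
by move=> sG k j; apply: (eq_smooth oU _ (sG k i j)) => x _; rewrite mxE.
Qed.

Lemma dmx_conn_mx Gam i j x : U x ->
  dmx i (conn_mx Gam j) x = \matrix_(l, k) partial i (Gam l j k) x.
Proof.
move=> Ux; apply/matrixP => a b; rewrite [LHS]mxE [RHS]mxE.
by apply: (partial_eq oU _ Ux) => y _; rewrite mxE.
Qed.

Lemma curv_mxE Gam i j x : U x ->
  curv_mx Gam i j x = dmx i (conn_mx Gam j) x - dmx j (conn_mx Gam i) x
    + (conn_mx Gam i x *m conn_mx Gam j x - conn_mx Gam j x *m conn_mx Gam i x).
Proof.
move=> Ux; rewrite !dmx_conn_mx //; apply/matrixP => l k.
rewrite [LHS]mxE /curvature !mxE3 [X in _ = X - _ + _]mxE [X in _ = _ - X + _]mxE.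
congr (_ + _); rewrite sumrB; congr (_ - _); rewrite mxE; apply: eq_bigr => m _.
  by rewrite !mxE.
by rewrite !mxE.
Qed.

Lemma curv_mx_anti Gam i j x : curv_mx Gam j i x = - curv_mx Gam i j x.
Proof.
apply/matrixP => l k; rewrite oppmxE [LHS]mxE [X in _ = - X]mxE /curvature.
have -> : \sum_m (Gam l j m x * Gam m i k x - Gam l i m x * Gam m j k x)
  = - \sum_m (Gam l i m x * Gam m j k x - Gam l j m x * Gam m i k x).
  by rewrite -sumrN; apply: eq_bigr => m _; rewrite opprB.
ring.
Qed.

(** D g = - 2 w g in matrix form. *)
Definition metric_conn g w Gam := forall a x, U x ->
  dmx a g x = (conn_mx Gam a x)^T *m g x + g x *m conn_mx Gam a x - (2 * w x 0 a) *: g x.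

Definition torsion_free Gam := forall k i j x, U x -> Gam k i j x = Gam k j i x.

Section Weyl.
Variables (g : 'rV[R]_n -> 'M[R]_n) (w : 'rV[R]_n -> 'rV[R]_n).
Hypotheses (gR : riemannian U g) (sw : smooth_mx U w).

Lemma metric_smooth : smooth_mx U g. Proof. by case: gR. Qed.

Lemma metric_sym x : U x -> (g x)^T = g x.
Proof. by move=> Ux; case: gR => _ /(_ _ Ux)[]. Qed.

Lemma metric_unit x : U x -> g x \in unitmx.
Proof. by move=> Ux; case: gR => _ /(_ _ Ux)[_]; exact: posdef_unit. Qed.

Let dg a b c x := partial a (fun y => g y b c) x + 2 * w x 0 a * g x b c.

Lemma dgC a b c x : U x -> dg a b c x = dg a c b x.
Proof.
have gC y : U y -> g y b c = g y c b by move=> Uy; rewrite -{1}(metric_sym Uy) mxE.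
by move=> Ux; rewrite /dg (gC _ Ux) (partial_eq oU _ Ux gC).
Qed.

Lemma weyl_torsion_free : torsion_free (weyl_connection g w).
Proof.
move=> k i j x Ux; rewrite /weyl_connection -!/(dg _ _ _ x); congr (_ * _).
apply: eq_bigr => l _; congr (_ * _); rewrite -!/(dg _ _ _ x).
by rewrite (dgC l i j Ux); congr (_ - _); rewrite addrC.
Qed.

Lemma weyl_lowered a b c x : U x ->
  (g x *m conn_mx (weyl_connection g w) a x) c b = 2^-1 * (dg a b c x + dg b a c x - dg c a b x).
Proof.
move=> Ux; pose L : 'cV[R]_n := \col_l (2^-1 * (dg a b l x + dg b a l x - dg l a b x)).
have -> : (g x *m conn_mx (weyl_connection g w) a x) c b = (g x *m (invmx (g x) *m L)) c 0.
  rewrite !mxE; apply: eq_bigr => k _; congr (_ * _); rewrite !mxE /weyl_connection mulr_sumr.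
  by apply: eq_bigr => l _; rewrite !mxE -!/(dg _ _ _ x); ring.
by rewrite mulKVmx ?metric_unit // mxE.
Qed.

Lemma weyl_metric : metric_conn g w (weyl_connection g w).
Proof.
move=> a x Ux; apply/matrixP => b c.
set Gm := conn_mx _ a x.
have -> : Gm^T *m g x = (g x *m Gm)^T by rewrite trmx_mul metric_sym.
rewrite !mxE3 !weyl_lowered // (dgC a c b Ux) [LHS]mxE.
have -> : partial a (fun y => g y b c) x = dg a b c x - 2 * w x 0 a * g x b c.
  by rewrite /dg addrK.
by field.
Qed.

(** Koszul: a torsion-free connection with D g = - 2 w g is the Weyl connection. *)
Lemma weyl_unique Gam : torsion_free Gam -> metric_conn g w Gam ->
  forall k i j x, U x -> Gam k i j x = weyl_connection g w k i j x.
Proof.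
move=> tf mc k i j x Ux.
pose L (Gm : connection R n) a b c := (g x *m conn_mx Gm a x) c b.
have Lsym Gm a b c : torsion_free Gm -> L Gm a b c = L Gm b a c.
  move=> t; rewrite /L !mxE; apply: eq_bigr => m _.
  by rewrite !mxE (t m a b x Ux).
have Ldg Gm a b c : metric_conn g w Gm -> dg a b c x = L Gm a b c + L Gm a c b.
  move=> m; have := congr1 (fun M : 'M[R]_n => M b c) (m a x Ux).
  have -> : (conn_mx Gm a x)^T *m g x = (g x *m conn_mx Gm a x)^T by rewrite trmx_mul metric_sym.
  rewrite [X in X = _ -> _]mxE !mxE3 /dg => ->; rewrite subrK /L; ring.
have E : conn_mx Gam i x = conn_mx (weyl_connection g w) i x.
  apply: (can_inj (mulKmx (metric_unit Ux))); apply/matrixP => c b.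
  rewrite weyl_lowered // (Ldg Gam i b c) // (Ldg Gam b i c) // (Ldg Gam c i b) //.
  rewrite (Lsym Gam b i c tf) (Lsym Gam c i b tf) (Lsym Gam c b i tf) -/(L Gam i b c).
  by rewrite (Lsym Gam b c i tf); field.
by have := congr1 (fun M : 'M[R]_n => M k j) E; rewrite !mxE.
Qed.

Lemma weyl_smooth : smooth_conn (weyl_connection g w).
Proof.
move=> k i j; apply: (smooth_scale oU); apply: (smooth_sum oU) => l _.
have sdg a b c : smooth U (dg a b c).
  apply: (@smooth_add _ _ U oU (partial a (fun y => g y b c)) (fun x => 2 * w x 0 a * g x b c)).
    exact: (smooth_partial oU a (metric_smooth b c)).
  apply: (@smooth_mul _ _ U oU (fun x => 2 * w x 0 a) (fun x => g x b c)).
    exact: (smooth_scale oU 2 (sw 0 a)).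
  exact: metric_smooth.
apply: (smooth_mul oU).
  by apply: (smooth_invmx oU) => //; [exact: metric_unit|exact: metric_smooth].
exact: (smooth_add oU (smooth_add oU (sdg i j l) (sdg j i l)) (smooth_opp oU (sdg l i j))).
Qed.

End Weyl.

(** The first Bianchi identity. *)
Lemma bianchi Gam i j k l x : torsion_free Gam -> U x ->
  curvature Gam i j k l x + curvature Gam j k i l x + curvature Gam k i j l x = 0.
Proof.
move=> tf Ux; rewrite /curvature.
have P a b c : partial a (Gam l b c) x = partial a (Gam l c b) x.
  by apply: (partial_eq oU _ Ux) => y Uy; exact: tf.
rewrite (P i k j) (P j k i) (P k j i).
have -> : forall a b c d e f s1 s2 s3 : R, a - b + s1 + (c - d + s2) + (e - f + s3) =
   (a - b + (c - d) + (e - f)) + (s1 + s2 + s3) by move=> *; ring.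
have -> : partial i (Gam l j k) x - partial j (Gam l i k) x +
   (partial j (Gam l i k) x - partial k (Gam l i j) x) +
   (partial k (Gam l i j) x - partial i (Gam l j k) x) = 0 by ring.
rewrite add0r -!big_split big1 //= => m _.
rewrite (tf m k j x Ux) (tf m k i x Ux) (tf m j i x Ux); ring.
Qed.

(** Curvature of a metric connection is skew. *)
Lemma curv_skew g Gam i j x : smooth_mx U g -> smooth_conn Gam ->
  metric_conn g (fun=> 0) Gam -> U x ->
  (curv_mx Gam i j x)^T *m g x + g x *m curv_mx Gam i j x = 0.
Proof.
move=> sg sG mc Ux.
have mc' a y : U y -> dmx a g y = (conn_mx Gam a y)^T *m g y + g y *m conn_mx Gam a y.
  by move=> Uy; rewrite mc // mxE mulr0 scale0r subr0.
have sGm a := smooth_conn_mx a sG.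
have sGt a : smooth_mx U (fun y => (conn_mx Gam a y)^T) by apply: (smooth_mx_tr oU) (sGm a).
have D2 a b : dmx b (dmx a g) x =
   ((dmx b (conn_mx Gam a) x)^T *m g x + (conn_mx Gam a x)^T *m dmx b g x)
   + (dmx b g x *m conn_mx Gam a x + g x *m dmx b (conn_mx Gam a) x).
  rewrite (eq_dmx oU _ Ux (mc' a)) (dmxD oU) //; last 2 first.
  - exact: (smooth_mx_mul oU (sGt a) sg).
  - exact: (smooth_mx_mul oU sg (sGm a)).
  by rewrite !(dmx_mul oU) // (dmx_tr oU).
have := dmxC oU i j sg Ux; rewrite !D2 !mc' // curv_mxE // => E.
exact: skew_commutator.
Qed.

End Connection.

Section PairSymmetry.
Variables (R : realType) (I : Type) (r : I -> I -> I -> I -> R).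
Hypotheses (r12 : forall i j k l, r j i k l = - r i j k l)
           (r34 : forall i j k l, r i j l k = - r i j k l)
           (rB : forall i j k l, r i j k l + r j k i l + r k i j l = 0).

Lemma pair_symmetry i j k l : r i j k l = r k l i j.
Proof.
have E1 := rB i j k l; have E2 := rB j k l i; have E3 := rB k l i j; have E4 := rB l i j k.
have a1 := r34 i j k l; have a2 := r34 j k i l; have a3 := r34 k i j l.
have a4 := r34 j k l i; have a5 := r34 k l i j; have a6 := r34 l j k i.
have a7 := r34 l i j k.
have b1 := r12 l j k i; have b2 := r12 i k l j; have b3 := r12 j l i k.
have b4 := r12 i k j l; have b5 := r12 k i l j; have b6 := r12 l j i k.
have b7 := r34 k i l j; have b8 := r34 l j i k; have b9 := r34 j l i k.
lra.
Qed.

End PairSymmetry.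

Section Curvature.
Variables (R : realType) (n : nat) (U : set 'rV[R]_n).
Hypothesis oU : open U.
Variable g : 'rV[R]_n -> 'M[R]_n.
Hypothesis gR : riemannian U g.
Let G0 := weyl_connection g (fun=> 0).

Lemma smooth_zero_form : smooth_mx U (fun=> 0 : 'rV[R]_n).
Proof. by move=> i j; apply: (eq_smooth oU _ (@smooth_cst _ _ U oU 0)) => x _; rewrite mxE. Qed.

Lemma lc_smooth : smooth_conn U G0.
Proof. exact: (weyl_smooth oU gR smooth_zero_form). Qed.

Lemma lc_skew i j x : U x ->
  (curv_mx G0 i j x)^T *m g x + g x *m curv_mx G0 i j x = 0.
Proof.
move=> Ux; apply: (curv_skew oU) => //; [exact: (metric_smooth gR)|exact: lc_smooth|].
exact: weyl_metric.
Qed.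

Lemma lc_bianchi i j k l x : U x ->
  curv_mx G0 i j x l k + curv_mx G0 j k x l i + curv_mx G0 k i x l j = 0.
Proof. by move=> Ux; rewrite !mxE; apply: (bianchi oU) => //; exact: weyl_torsion_free. Qed.

Lemma ricciE j k x : ricci G0 x j k = \sum_i curv_mx G0 i j x i k.
Proof. by rewrite mxE; apply: eq_bigr => i _; rewrite mxE. Qed.

Lemma lc_skew34 i j k l x : U x ->
  (g x *m curv_mx G0 i j x) k l = - (g x *m curv_mx G0 i j x) l k.
Proof.
move=> Ux; have /eqP := lc_skew i j Ux; rewrite addr_eq0 => /eqP E.
have : ((curv_mx G0 i j x)^T *m g x)^T = (- (g x *m curv_mx G0 i j x))^T by rewrite E.
rewrite trmx_mul trmxK (metric_sym gR Ux) => /(congr1 (fun M : 'M[R]_n => M k l)) ->.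
by rewrite trmxE oppmxE.
Qed.

(** <R(d_i, d_j) d_k, d_l> = <R(d_k, d_l) d_i, d_j>. *)
Lemma lc_pair i j k l x : U x ->
  (g x *m curv_mx G0 i j x) l k = (g x *m curv_mx G0 k l x) j i.
Proof.
move=> Ux; apply: (@pair_symmetry R _ (fun i j k l => (g x *m curv_mx G0 i j x) l k)).
- by move=> a b c d; rewrite curv_mx_anti mulmxN oppmxE.
- by move=> a b c d; exact: lc_skew34.
- move=> a b c d; rewrite !mxE -!big_split big1 //= => m _.
  by rewrite -!mulrDr lc_bianchi // mulr0.
Qed.

Lemma ricci_sym x : U x -> (ricci G0 x)^T = ricci G0 x.
Proof.
move=> Ux; apply/matrixP => j k; rewrite trmxE !ricciE.
pose gi := invmx (g x).
have giS a b : gi a b = gi b a.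
  by rewrite -[in LHS](trmxK gi) trmxE /gi trmx_inv (metric_sym gR Ux).
have E a b : \sum_i curv_mx G0 i a x i b =
    \sum_i \sum_l gi i l * (g x *m curv_mx G0 i a x) l b.
  apply: eq_bigr => i _.
  by rewrite -{1}(mulKmx (metric_unit gR Ux) (curv_mx G0 i a x)) mxE.
rewrite !E exchange_big; apply: eq_bigr => i _; apply: eq_bigr => l _ /=.
by rewrite giS lc_pair // curv_mx_anti mulmxN oppmxE lc_skew34 // opprK.
Qed.

End Curvature.

Section Forms.
Variables (R : realType) (n : nat).

Definition wedge (a b : 'rV[R]_n) : 'M[R]_n := a^T *m b - b^T *m a.

Definition extd (a : 'rV[R]_n -> 'rV[R]_n) x : 'M[R]_n :=
  \matrix_(i, j) (partial i (fun y => a y 0 j) x - partial j (fun y => a y 0 i) x).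

Lemma wedgeE a b i j : wedge a b i j = a 0 i * b 0 j - b 0 i * a 0 j.
Proof. by rewrite !mxE !big_ord1 !mxE. Qed.

End Forms.

Section ChangeOfConnection.
Variables (R : realType) (n : nat) (U : set 'rV[R]_n).
Hypothesis oU : open U.
Variables (g : 'rV[R]_n -> 'M[R]_n) (w : 'rV[R]_n -> 'rV[R]_n).
Hypotheses (gR : riemannian U g) (sw : smooth_mx U w).
Let G0 := weyl_connection g (fun=> 0).
Let Gw := weyl_connection g w.

Definition weyl_shift (g : 'M[R]_n) (w : 'rV[R]_n) (i : 'I_n) : 'M[R]_n :=
  w 0 i *: 1%:M + (delta_mx i 0 *m w - (invmx g *m w^T) *m row i g).

Lemma weyl_shiftE i x : U x -> conn_mx Gw i x = conn_mx G0 i x + weyl_shift (g x) (w x) i.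
Proof.
move=> Ux; apply: (can_inj (mulKmx (metric_unit gR Ux))).
rewrite mulmxDr /weyl_shift !mulmxDr mulmxN !mulmxA mulmxV ?(metric_unit gR Ux) // mul1mx.
rewrite -scalemxAr mulmx1; apply/matrixP => c b.
rewrite addmxE !(weyl_lowered _ gR) // !addmxE oppmxE scalemxE -mulmxA.
have -> : (g x *m (delta_mx i 0 *m w x)) c b = g x c i * w x 0 b.
  by rewrite mulmxA -colE mxE big_ord1 mxE.
have -> : ((w x)^T *m row i (g x)) c b = w x 0 c * g x i b by rewrite mxE big_ord1 !mxE.
rewrite [(0 : 'rV[R]_n) 0 i]mxE [(0 : 'rV[R]_n) 0 b]mxE [(0 : 'rV[R]_n) 0 c]mxE.
have -> : g x b c = g x c b by rewrite -{1}(metric_sym gR Ux) mxE.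
have -> : g x i b = g x b i by rewrite -{1}(metric_sym gR Ux) mxE.
have -> : g x c i = g x i c by rewrite -{1}(metric_sym gR Ux) mxE.
by field.
Qed.

Lemma partial_trace (A : 'rV[R]_n -> 'M[R]_n) k x : smooth_mx U A -> U x ->
  partial k (fun y => \tr (A y)) x = \tr (dmx k A x).
Proof.
move=> sA Ux; rewrite /mxtrace (partial_bigsum oU _ k (fun i => sA i i) Ux).
by apply: eq_bigr => i _; rewrite mxE.
Qed.

Lemma dmxB p q (A B : 'rV[R]_n -> 'M[R]_(p, q)) i x :
  smooth_mx U A -> smooth_mx U B -> U x ->
  dmx i (fun x => A x - B x) x = dmx i A x - dmx i B x.
Proof. by move=> sA sB Ux; rewrite (dmxD oU) ?(dmxN oU) //; exact: (smooth_mx_opp oU). Qed.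

Lemma cov_endoE (Gam : connection R n) J i x :
  cov_endo Gam J i x = dmx i J x + (conn_mx Gam i x *m J x - J x *m conn_mx Gam i x).
Proof.
apply/matrixP => a b; rewrite addmxE [LHS]mxE [X in _ = X + _]mxE; congr (_ + _).
rewrite sumrB addmxE oppmxE !mxE; congr (_ - _); apply: eq_bigr => l _; rewrite !mxE //.
by rewrite mulrC.
Qed.

Lemma parallel_dmx (Gam : connection R n) J i x : parallel_endo U Gam J -> U x ->
  dmx i J x = J x *m conn_mx Gam i x - conn_mx Gam i x *m J x.
Proof.
by move=> pJ Ux; have := pJ i x Ux; rewrite cov_endoE => /eqP; rewrite addr_eq0 opprB => /eqP.
Qed.

Lemma parallel_commutator (J A B dA dB : 'M[R]_n) :
  (J *m B - B *m J) *m A + J *m dA - (dA *m J + A *m (J *m B - B *m J)) =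
  (J *m A - A *m J) *m B + J *m dB - (dB *m J + B *m (J *m A - A *m J)) ->
  (dB - dA + (A *m B - B *m A)) *m J = J *m (dB - dA + (A *m B - B *m A)).
Proof.
move/eqP; rewrite -subr_eq0 => /eqP E; apply/eqP; rewrite -subr_eq0 -E; apply/eqP.
rewrite !(mulmxDl, mulmxDr, mulmxN, mulNmx, mulmxA).
by apply/matrixP => a b; rewrite !(addmxE, oppmxE); ring.
Qed.

(** The Ricci identity. *)
Lemma parallel_curv (Gam : connection R n) J i j x :
  smooth_conn U Gam -> smooth_mx U J -> parallel_endo U Gam J -> U x ->
  curv_mx Gam i j x *m J x = J x *m curv_mx Gam i j x.
Proof.
move=> sG sJ pJ Ux; have sGm a := smooth_conn_mx oU a sG.
have D a y (Uy : U y) := parallel_dmx a pJ Uy.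
have D2 a b : dmx b (dmx a J) x =
   (dmx b J x *m conn_mx Gam a x + J x *m dmx b (conn_mx Gam a) x)
   - (dmx b (conn_mx Gam a) x *m J x + conn_mx Gam a x *m dmx b J x).
  rewrite (eq_dmx oU _ Ux (D a)) dmxB //; last 2 first.
  - exact: (smooth_mx_mul oU sJ (sGm a)).
  - exact: (smooth_mx_mul oU (sGm a) sJ).
  by rewrite !(dmx_mul oU).
have := dmxC oU i j sJ Ux; rewrite !D2 !D // (curv_mxE oU) // => E.
exact: parallel_commutator.
Qed.

Lemma trace_quaternion (A B C : 'M[R]_n) :
  A *m B = - (B *m A) -> C *m A = A *m C -> \tr (A *m B *m C) = 0.
Proof.
move=> AB CA; have E : \tr (A *m B *m C) = - \tr (A *m B *m C).
  transitivity (\tr (B *m A *m C)); first by rewrite -(mulmxA A B C) (mxtrace_mulC A) -(mulmxA B C A) CA mulmxA.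
  by rewrite AB mulNmx linearN opprK.
by move: E; lra.
Qed.

End ChangeOfConnection.

Section TraceLinear.
Variables (R : realType) (n : nat).
Implicit Types A B : 'M[R]_n.

Lemma mxtraceN A : \tr (- A) = - \tr A. Proof. exact: linearN. Qed.
Lemma mxtraceB A B : \tr (A - B) = \tr A - \tr B. Proof. exact: linearB. Qed.

Lemma shift_product_trace (g J : 'M[R]_n) (w : 'rV[R]_n) (v : 'cV[R]_n) a b :
  g *m v = w^T -> g *m J *m v = - (w *m J)^T -> w *m J *m v = 0 ->
  \tr (J *m ((delta_mx a 0 *m w - v *m row a g) *m (delta_mx b 0 *m w - v *m row b g))) =
  w 0 b * (w *m J) 0 a - w 0 a * (w *m J) 0 b - (w *m v) 0 0 * (g *m J) b a.
Proof.
move=> lower_sharp lower_J_sharp J_sharp_null.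
have s1 : w *m delta_mx b 0 = (w 0 b)%:M.
  by rewrite -colE; apply/matrixP => p q; rewrite !ord1 !mxE eqxx mulr1n.
have s2 : row a g *m v = (w 0 a)%:M.
  rewrite -row_mul lower_sharp.
  by apply/matrixP => p q; rewrite !ord1 !mxE eqxx mulr1n.
have -> : (delta_mx a 0 *m w - v *m row a g) *m (delta_mx b 0 *m w - v *m row b g) = w 0 b *: (delta_mx a 0 *m w) - (w *m v) 0 0 *: (delta_mx a 0 *m row b g)
    - g a b *: (v *m w) + w 0 a *: (v *m row b g).
  have s3 : row a g *m delta_mx b 0 = (g a b)%:M.
    by rewrite -colE; apply/matrixP => p q; rewrite !ord1 !mxE eqxx mulr1n.
  rewrite !(mulmxDl, mulmxDr, mulmxN, mulNmx) !mulmxA.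
  rewrite -(mulmxA _ w) s1 -(mulmxA _ w) [w *m v]mx11_scalar -(mulmxA _ (row a g)) s3.
  rewrite -(mulmxA _ (row a g)) s2 !mul_mx_scalar -!scalemxAl !mxE eqxx mulr1n.
  by rewrite opprK !addrA; congr (_ + _); rewrite addrAC.
rewrite !(mulmxDr, mulmxN, mxtraceD, mxtraceN) -!scalemxAr !mxtraceZ.
have t1 : \tr (J *m (delta_mx a 0 *m w)) = (w *m J) 0 a.
  by rewrite mulmxA mxtrace_mulC mulmxA -colE trace_mx11 mxE.
have t2 : \tr (J *m (delta_mx a 0 *m row b g)) = (g *m J) b a.
  by rewrite mulmxA mxtrace_mulC mulmxA -colE trace_mx11 -row_mul !mxE.
have t3 : \tr (J *m (v *m w)) = 0.
  by rewrite mulmxA mxtrace_mulC mulmxA J_sharp_null linear0.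
have t4 : \tr (J *m (v *m row b g)) = - (w *m J) 0 b.
  rewrite mulmxA mxtrace_mulC mulmxA -row_mul -row_mul lower_J_sharp trace_mx11.
  by rewrite mxE oppmxE trmxE.
by rewrite t1 t2 t3 t4; ring.
Qed.

End TraceLinear.

Section ShiftTraces.
Variables (R : realType) (n : nat) (g J : 'M[R]_n) (w : 'rV[R]_n).
Hypotheses (gu : g \in unitmx) (gS : g^T = g) (gJ : J^T *m g = - (g *m J)) (trJ : \tr J = 0).
Let v := invmx g *m w^T.

Lemma sharpK : v^T *m g = w.
Proof. by rewrite /v trmx_mul trmxK trmx_inv gS mulmxKV. Qed.

Lemma lower_sharp : g *m v = w^T. Proof. by rewrite mulKVmx. Qed.

Lemma lower_J_sharp : g *m J *m v = - (w *m J)^T.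
Proof. by rewrite -[g *m J]opprK -gJ mulNmx -mulmxA lower_sharp -trmx_mul. Qed.

Lemma J_sharp_null : (w *m J *m v) = 0.
Proof.
have E : (w *m J *m v) 0 0 = - (w *m J *m v) 0 0.
  rewrite -{1}sharpK -!mulmxA (mulmxA g) lower_J_sharp mulmxN oppmxE.
  by rewrite -trmx_mul trmxE mulmxA.
by apply/matrixP => i j; rewrite !ord1 [RHS]mxE; move: E; lra.
Qed.

Lemma weyl_shift_trace i : \tr (J *m weyl_shift g w i) = 2 * (w *m J) 0 i.
Proof.
rewrite /weyl_shift -/v mulmxDr mxtraceD -scalemxAr mulmx1 mxtraceZ trJ mulr0 add0r.
rewrite mulmxDr mulmxN mxtraceB mulmxA mxtrace_mulC mulmxA -colE trace_mx11 mxE.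
rewrite mulmxA mxtrace_mulC rowE -!mulmxA (mulmxA g) lower_J_sharp mulmxN mxtraceN opprK.
rewrite -rowE trace_mx11 [row _ _ _ _]mxE trmxE; ring.
Qed.

Lemma weyl_shift_commutator i j :
  \tr (J *m (weyl_shift g w i *m weyl_shift g w j - weyl_shift g w j *m weyl_shift g w i)) =
  - 2 * wedge w (w *m J) i j + 2 * (w *m v) 0 0 * (g *m J) i j.
Proof.
pose A (i : 'I_n) : 'M[R]_n := delta_mx i 0 *m w - v *m row i g.
have -> : weyl_shift g w i *m weyl_shift g w j - weyl_shift g w j *m weyl_shift g w i
   = A i *m A j - A j *m A i.
  rewrite /weyl_shift -/v -!/(A _) !mulmxDl !mulmxDr -!scalemxAl -!scalemxAr !mul1mx !mulmx1.
  apply/matrixP => a b; rewrite !(addmxE, oppmxE, scalemxE); ring.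
have AA a b := shift_product_trace a b lower_sharp lower_J_sharp J_sharp_null.
rewrite mulmxDr mulmxN mxtraceB !AA wedgeE.
have -> : (g *m J) j i = - (g *m J) i j.
  by rewrite -trmxE trmx_mul gS gJ oppmxE.
ring.
Qed.

End ShiftTraces.

Section TraceCurvature.
Variables (R : realType) (n : nat).

Lemma trace_curvature_expand (J dGi dGj dCi dCj Gi Gj Ci Cj : 'M[R]_n) :
  \tr (J *m ((dGj - dCj) - (dGi - dCi) + ((Gi - Ci) *m (Gj - Cj) - (Gj - Cj) *m (Gi - Ci)))) =
  \tr (J *m (dGj - dGi + (Gi *m Gj - Gj *m Gi)))
  - \tr ((J *m Gi - Gi *m J) *m Cj + J *m dCj) + \tr ((J *m Gj - Gj *m J) *m Ci + J *m dCi)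
  + \tr (J *m (Ci *m Cj - Cj *m Ci)).
Proof.
rewrite !(mulmxDr, mulmxDl, mulmxN, mulNmx, mxtraceD, mxtraceN, mulmxA).
rewrite (mxtrace_mulC (J *m Cj) Gi) (mxtrace_mulC (J *m Ci) Gj) !mulmxA.
ring.
Qed.

Lemma trace_curvature_change (J R0 Rw d0i d0j di dj dCi dCj G0i G0j Gi Gj Ci Cj : 'M[R]_n) (a b : R) :
  R0 = d0j - d0i + (G0i *m G0j - G0j *m G0i) -> Rw = dj - di + (Gi *m Gj - Gj *m Gi) ->
  d0j = dj - dCj -> d0i = di - dCi -> G0i = Gi - Ci -> G0j = Gj - Cj ->
  \tr ((J *m Gi - Gi *m J) *m Cj + J *m dCj) = a ->
  \tr ((J *m Gj - Gj *m J) *m Ci + J *m dCi) = b ->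
  \tr (J *m R0) = \tr (J *m Rw) - a + b + \tr (J *m (Ci *m Cj - Cj *m Ci)).
Proof. by move=> -> -> -> -> -> -> <- <-; exact: trace_curvature_expand. Qed.

Variables (U : set 'rV[R]_n).
Hypothesis oU : open U.
Variables (g : 'rV[R]_n -> 'M[R]_n) (w : 'rV[R]_n -> 'rV[R]_n).
Hypotheses (gR : riemannian U g) (sw : smooth_mx U w).
Let G0 := weyl_connection g (fun=> 0).
Let Gw := weyl_connection g w.

Lemma weyl_shift_smooth i : smooth_mx U (fun x => weyl_shift (g x) (w x) i).
Proof.
have s0 := smooth_conn_mx oU i (lc_smooth oU gR).
have sW := smooth_conn_mx oU i (weyl_smooth oU gR sw).
apply: (eq_smooth_mx oU _ (smooth_mx_add oU sW (smooth_mx_opp oU s0))) => x Ux.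
by rewrite (weyl_shiftE w gR) // addrC addKr.
Qed.

(** The change of connection from a Weyl derivative to the Levi-Civita one, traced
    against an endomorphism parallel for the former: the terms in the derivative of
    the 1-form assemble into the exterior derivative of its image under [J]. *)
Lemma trace_curvature J i j x : smooth_mx U J -> parallel_endo U Gw J ->
  (forall y, U y -> (J y)^T *m g y = - (g y *m J y)) -> (forall y, U y -> \tr (J y) = 0) ->
  U x -> \tr (J x *m curv_mx Gw i j x) = 0 ->
  \tr (J x *m curv_mx G0 i j x) =
  - 2 * extd (fun y => w y *m J y) x i j - 2 * wedge (w x) (w x *m J x) i j
  + 2 * (w x *m (invmx (g x) *m (w x)^T)) 0 0 * (g x *m J x) i j.
Proof.
move=> sJ pJ gJ tJ Ux flat.
have sC := weyl_shift_smooth; have sG a := smooth_conn_mx oU a (weyl_smooth oU gR sw).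
have G0E a y : U y -> conn_mx G0 a y = conn_mx Gw a y - weyl_shift (g y) (w y) a.
  by move=> Uy; rewrite /Gw (weyl_shiftE w gR) // addrK.
have d0 a b : dmx a (conn_mx G0 b) x =
    dmx a (conn_mx Gw b) x - dmx a (fun y => weyl_shift (g y) (w y) b) x.
  by rewrite (eq_dmx oU _ Ux (G0E b)) (dmxB oU) //; exact: sC.
have tC a b : \tr ((J x *m conn_mx Gw a x - conn_mx Gw a x *m J x) *m weyl_shift (g x) (w x) b
     + J x *m dmx a (fun y => weyl_shift (g y) (w y) b) x)
   = 2 * partial a (fun y => (w y *m J y) 0 b) x.
  rewrite -(parallel_dmx a pJ Ux) -(dmx_mul oU a sJ (sC b) Ux).
  rewrite -(partial_trace oU) //; last exact: (smooth_mx_mul oU sJ (sC b)).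
  rewrite -(partial_scale oU) //; last exact: (smooth_mx_mul oU sw sJ 0 b).
  apply: (partial_eq oU _ Ux) => y Uy.
  by apply: weyl_shift_trace; [exact: (metric_unit gR)|exact: gJ|exact: tJ].
rewrite (trace_curvature_change (curv_mxE oU G0 i j Ux) (curv_mxE oU Gw i j Ux) (d0 i j) (d0 j i)
  (G0E i x Ux) (G0E j x Ux) (tC i j) (tC j i)) flat.
rewrite weyl_shift_commutator; [|exact: (metric_unit gR)|exact: (metric_sym gR)|exact: gJ].
rewrite [extd _ _ _ _]mxE; ring.
Qed.

End TraceCurvature.

(** * Quaternionic algebra in dimension four *)

Section Dimension4.
Variable R : realType.

Definition e0 : 'I_4 := Ordinal (isT : 0 < 4)%N.
Definition e1 : 'I_4 := Ordinal (isT : 1 < 4)%N.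
Definition e2 : 'I_4 := Ordinal (isT : 2 < 4)%N.
Definition e3 : 'I_4 := Ordinal (isT : 3 < 4)%N.

Lemma forall_ord4 (P : 'I_4 -> Prop) : P e0 -> P e1 -> P e2 -> P e3 -> forall i, P i.
Proof.
move=> P0 P1 P2 P3 [[|[|[|[|i]]]] Hi] //;
  [rewrite (_ : Ordinal Hi = e0)|rewrite (_ : Ordinal Hi = e1)
  |rewrite (_ : Ordinal Hi = e2)|rewrite (_ : Ordinal Hi = e3)] => //; exact: val_inj.
Qed.

Lemma sum4 (F : 'I_4 -> R) : \sum_i F i = F e0 + F e1 + F e2 + F e3.
Proof.
rewrite !big_ord_recl big_ord0 addr0 !addrA.
by congr (F _ + F _ + F _ + F _); exact: val_inj.
Qed.

Definition mx4 (s : seq (seq R)) : 'M[R]_4 := \matrix_(i, j) nth 0 (nth [::] s i) j.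

(** Left multiplication by the unit quaternions, on the rows of a coframe. *)
Definition K1 := mx4 [:: [:: 0; 1; 0; 0]; [:: -1; 0; 0; 0]; [:: 0; 0; 0; -1]; [:: 0; 0; 1; 0]].
Definition K2 := mx4 [:: [:: 0; 0; 1; 0]; [:: 0; 0; 0; 1]; [:: -1; 0; 0; 0]; [:: 0; -1; 0; 0]].
Definition K3 := mx4 [:: [:: 0; 0; 0; 1]; [:: 0; 0; -1; 0]; [:: 0; 1; 0; 0]; [:: -1; 0; 0; 0]].

Definition unitK K := [\/ K = K1, K = K2 | K = K3].

Ltac entries4 := apply/matrixP; apply: forall_ord4; apply: forall_ord4;
  rewrite ?(addmxE, oppmxE, scalemxE, trmxE); rewrite ?mxE ?sum4 ?mxE /=.

Lemma K12 : K1 *m K2 = K3. Proof. by entries4; ring. Qed.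
Lemma K23 : K2 *m K3 = K1. Proof. by entries4; ring. Qed.
Lemma K31 : K3 *m K1 = K2. Proof. by entries4; ring. Qed.
Lemma K21 : K2 *m K1 = - K3. Proof. by entries4; ring. Qed.
Lemma K32 : K3 *m K2 = - K1. Proof. by entries4; ring. Qed.
Lemma K13 : K1 *m K3 = - K2. Proof. by entries4; ring. Qed.
Lemma K1T : K1^T = - K1. Proof. by entries4; ring. Qed.
Lemma K2T : K2^T = - K2. Proof. by entries4; ring. Qed.
Lemma K3T : K3^T = - K3. Proof. by entries4; ring. Qed.
Lemma K11 : K1 *m K1 = - 1%:M. Proof. by entries4; ring. Qed.
Lemma K22 : K2 *m K2 = - 1%:M. Proof. by entries4; ring. Qed.
Lemma K33 : K3 *m K3 = - 1%:M. Proof. by entries4; ring. Qed.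

End Dimension4.

Section Determinants.
Variable R : comNzRingType.
Implicit Type a : nat -> nat -> R.

Definition f0 : 'I_3 := Ordinal (isT : 0 < 3)%N.
Definition f1 : 'I_3 := Ordinal (isT : 1 < 3)%N.
Definition f2 : 'I_3 := Ordinal (isT : 2 < 3)%N.

Definition natmx n a : 'M[R]_n := \matrix_(i, j) a i j.

Lemma det_natmx n a : \det (natmx n.+1 a) =
  \sum_(j < n.+1) a 0%N j * ((-1) ^+ j * \det (natmx n (fun i k => a i.+1 (bump j k)))).
Proof.
rewrite (expand_det_row _ ord0); apply: eq_bigr => j _; rewrite mxE /cofactor add0n.
by congr (_ * (_ * \det _)); apply/matrixP => i k; rewrite !mxE.
Qed.

Lemma natmxE n (A : 'M[R]_n.+1) : A = natmx n.+1 (fun i j => A (inord i) (inord j)).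
Proof. by apply/matrixP => i j; rewrite mxE !inord_val. Qed.

Lemma det_natmx3 a : \det (natmx 3 a) =
  a 0%N 0%N * (a 1%N 1%N * a 2%N 2%N - a 1%N 2%N * a 2%N 1%N)
  - a 0%N 1%N * (a 1%N 0%N * a 2%N 2%N - a 1%N 2%N * a 2%N 0%N)
  + a 0%N 2%N * (a 1%N 0%N * a 2%N 1%N - a 1%N 1%N * a 2%N 0%N).
Proof.
by rewrite det_natmx !big_ord_recl big_ord0 !det_natmx !big_ord_recl !big_ord0 !det_natmx
  !big_ord_recl !big_ord0 !det_mx00 /bump /=; ring.
Qed.

Lemma det_natmx4 a : \det (natmx 4 a) =
  let m i j k := a 1%N i * (a 2%N j * a 3%N k - a 2%N k * a 3%N j)
    - a 1%N j * (a 2%N i * a 3%N k - a 2%N k * a 3%N i)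
    + a 1%N k * (a 2%N i * a 3%N j - a 2%N j * a 3%N i) in
  a 0%N 0%N * m 1%N 2%N 3%N - a 0%N 1%N * m 0%N 2%N 3%N
  + a 0%N 2%N * m 0%N 1%N 3%N - a 0%N 3%N * m 0%N 1%N 2%N.
Proof.
by rewrite det_natmx !big_ord_recl big_ord0 !det_natmx3 /bump /=; ring.
Qed.

Lemma inord3 : (inord 0 = f0 :> 'I_3) * (inord 1 = f1 :> 'I_3) * (inord 2 = f2 :> 'I_3).
Proof. by do !split; apply: val_inj; rewrite /= inordK. Qed.

Lemma inord4 : (inord 0 = e0 :> 'I_4) * (inord 1 = e1 :> 'I_4) * (inord 2 = e2 :> 'I_4)
  * (inord 3 = e3 :> 'I_4).
Proof. by do !split; apply: val_inj; rewrite /= inordK. Qed.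

Lemma det3 (A : 'M[R]_3) : \det A =
  A f0 f0 * (A f1 f1 * A f2 f2 - A f1 f2 * A f2 f1)
  - A f0 f1 * (A f1 f0 * A f2 f2 - A f1 f2 * A f2 f0)
  + A f0 f2 * (A f1 f0 * A f2 f1 - A f1 f1 * A f2 f0).
Proof. by rewrite {1}[A]natmxE det_natmx3 !inord3. Qed.

Lemma det4 (A : 'M[R]_4) : \det A =
  let m i j k := A e1 i * (A e2 j * A e3 k - A e2 k * A e3 j)
    - A e1 j * (A e2 i * A e3 k - A e2 k * A e3 i)
    + A e1 k * (A e2 i * A e3 j - A e2 j * A e3 i) in
  A e0 e0 * m e1 e2 e3 - A e0 e1 * m e0 e2 e3 + A e0 e2 * m e0 e1 e3 - A e0 e3 * m e0 e1 e2.
Proof. by rewrite {1}[A]natmxE det_natmx4 /= !inord4. Qed.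

End Determinants.

Section Hodge.
Variable R : realType.

(** Twice the Hodge star of the Euclidean metric on antisymmetric matrices, up to orientation. *)
Definition star (b : 'M[R]_4) : 'M[R]_4 := mx4
  [:: [:: 0; b e2 e3; - b e1 e3; b e1 e2]; [:: - b e2 e3; 0; b e0 e3; - b e0 e2];
      [:: b e1 e3; - b e0 e3; 0; b e0 e1]; [:: - b e1 e2; b e0 e2; - b e0 e1; 0]].

Lemma coord_vecE (i j : 'I_4) : coord_vec R i 0 j = (i == j)%:R.
Proof. by rewrite mxE eqxx /= eq_sym. Qed.

Definition eps4 (i j k l : 'I_4) : R :=
  \det (\matrix_a tnth [tuple coord_vec R i; coord_vec R j; coord_vec R k; coord_vec R l] a).

Lemma eps4_star (b : 'M[R]_4) k l : b^T = - b ->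
  2^-1 * \sum_i \sum_j b i j * eps4 j i k l = - star b k l.
Proof.
move=> bT; have bA i j : b j i = - b i j by rewrite -trmxE bT oppmxE.
have b0 i : b i i = 0 by have := bA i i; lra.
have E i j k' l' : eps4 i j k' l' = let d (i j : 'I_4) := (i == j)%:R : R in
   let m a b c := d j a * (d k' b * d l' c - d k' c * d l' b)
    - d j b * (d k' a * d l' c - d k' c * d l' a)
    + d j c * (d k' a * d l' b - d k' b * d l' a) in
  d i e0 * m e1 e2 e3 - d i e1 * m e0 e2 e3 + d i e2 * m e0 e1 e3 - d i e3 * m e0 e1 e2.
  by rewrite /eps4 det4 /= ; set D := \matrix_a _; have DE a c : D a c = tnth [tuple coord_vec R i; coord_vec R j; coord_vec R k'; coord_vec R l'] a 0 c by [rewrite mxE]; rewrite !DE !(tnth_nth 0) /= !coord_vecE.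
rewrite !sum4 !E /= !b0 (bA e0 e1) (bA e0 e2) (bA e0 e3) (bA e1 e2) (bA e1 e3) (bA e2 e3).
by move: k l; apply: forall_ord4; apply: forall_ord4; rewrite mxE /=; field.
Qed.

Lemma star_entry (b : 'M[R]_4) : forall k l, star b k l =
  nth 0 (nth [::] [:: [:: 0; b e2 e3; - b e1 e3; b e1 e2]; [:: - b e2 e3; 0; b e0 e3; - b e0 e2];
      [:: b e1 e3; - b e0 e3; 0; b e0 e1]; [:: - b e1 e2; b e0 e2; - b e0 e1; 0]] k) l.
Proof. by move=> k l; rewrite mxE. Qed.

Lemma skew_congr (M b : 'M[R]_4) i j : b^T = - b -> (M *m b *m M^T) i j =
  b e0 e1 * (M i e0 * M j e1 - M i e1 * M j e0) + b e0 e2 * (M i e0 * M j e2 - M i e2 * M j e0)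
  + b e0 e3 * (M i e0 * M j e3 - M i e3 * M j e0) + b e1 e2 * (M i e1 * M j e2 - M i e2 * M j e1)
  + b e1 e3 * (M i e1 * M j e3 - M i e3 * M j e1) + b e2 e3 * (M i e2 * M j e3 - M i e3 * M j e2).
Proof.
move=> bT; have bA k l : b l k = - b k l by rewrite -trmxE bT oppmxE.
have b0 k : b k k = 0 by have := bA k k; lra.
have E k : (M *m b) i k = M i e0 * b e0 k + M i e1 * b e1 k + M i e2 * b e2 k + M i e3 * b e3 k.
  by rewrite mxE sum4.
rewrite mxE sum4 !trmxE !E !b0.
rewrite (bA e0 e1) (bA e0 e2) (bA e0 e3) (bA e1 e2) (bA e1 e3) (bA e2 e3); ring.
Qed.

Lemma star_skew (b : 'M[R]_4) : (star b)^T = - star b.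
Proof.
by apply/matrixP; apply: forall_ord4; apply: forall_ord4; rewrite trmxE oppmxE !star_entry /=; ring.
Qed.

Lemma star_congr (M b : 'M[R]_4) : b^T = - b ->
  M^T *m star (M *m b *m M^T) *m M = \det M *: star b.
Proof.
move=> bT; apply/matrixP => i j; set S := star _.
have -> : M^T *m S *m M = M^T *m S *m (M^T)^T by rewrite trmxK.
rewrite (skew_congr M^T i j (star_skew _)) !trmxE {}/S.
rewrite !star_entry /= !skew_congr // scalemxE star_entry det4 /=.
by move: i j; apply: forall_ord4; apply: forall_ord4; rewrite /=; ring.
Qed.

End Hodge.

Section FrameAlgebra.
Variable R : realType.

Lemma trmxZ p q (c : R) (A : 'M[R]_(p, q)) : (c *: A)^T = c *: A^T.
Proof. exact: linearZ. Qed.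

(** In the coframe the Hodge star is the constant one, up to the sign that compares
    the orientation of the coframe with the given one. *)
Lemma hodge_frame o (g : 'rV[R]_4 -> 'M[R]_4) x (phi : R) (Th a : 'M[R]_4) :
  g x = phi *: (Th^T *m Th) -> 0 < phi -> Th \in unitmx -> a^T = - a ->
  hodge o g x (Th^T *m a *m Th) = - (o x * `|\det Th| / \det Th) *: (Th^T *m star a *m Th).
Proof.
move=> gE phi0 uT aT; set E := invmx Th.
have dT : \det Th != 0 by rewrite -unitfE -unitmxE.
have gi : invmx (g x) = phi^-1 *: (E *m E^T).
  have gu : g x \in unitmx.
    by rewrite gE unitmxZ ?unitfE ?gt_eqF // unitmx_mul unitmx_tr uT.
  apply: (can_inj (mulKmx gu)); rewrite mulmxV // gE -scalemxAl -scalemxAr scalerA.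
  rewrite divff ?gt_eqF // scale1r /E trmx_inv -mulmxA (mulmxA Th) mulmxV // mul1mx mulmxV //.
  by rewrite unitmx_tr.
have upE : invmx (g x) *m (Th^T *m a *m Th) *m (invmx (g x))^T =
    phi^-2 *: (E *m a *m E^T).
  have h1 : E^T *m Th^T = 1%:M by rewrite -trmx_mul mulmxV // trmx1.
  have h2 : Th *m E = 1%:M by rewrite mulmxV.
  rewrite gi trmxZ trmx_mul trmxK -!scalemxAl -scalemxAr scalerA -invfM -expr2; congr (_ *: _).
  by rewrite !mulmxA -(mulmxA E) h1 mulmx1 -(mulmxA (E *m a)) h2 mulmx1.
have sg : Num.sqrt (\det (g x)) = phi ^+ 2 * `|\det Th|.
  rewrite gE detZ det_mulmx det_tr.
  have -> : phi ^+ 4 * (\det Th * \det Th) = (phi ^+ 2 * \det Th) ^+ 2 by ring.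
  by rewrite sqrtr_sqr normrM ger0_norm // sqr_ge0.
rewrite /hodge upE /volume sg.
have ET : (E *m a *m E^T)^T = - (E *m a *m E^T).
  by rewrite trmx_mul trmxK trmx_mul aT mulNmx mulmxN mulmxA.
have := star_congr E aT; rewrite det_inv => SE.
have SE2 : star (E *m a *m E^T) = (\det Th)^-1 *: (Th^T *m star a *m Th).
  rewrite scalemxAl scalemxAr -SE /E trmx_inv !mulmxA mulmxV ?unitmx_tr // mul1mx.
  by rewrite mulmxKV.
apply/matrixP => k l; rewrite mxE -/(eps4 _ _ _ _).
have -> : 2^-1 * \sum_i \sum_j (phi^-2 *: (E *m a *m E^T)) i j *
     (o x * (phi ^+ 2 * `|\det Th|) * eps4 R j i k l) =
   o x * `|\det Th| * (2^-1 * \sum_i \sum_j (E *m a *m E^T) i j * eps4 R j i k l).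
  rewrite [in RHS]mulrCA; congr (_ * _); rewrite mulr_sumr; apply: eq_bigr => i _.
  rewrite mulr_sumr; apply: eq_bigr => j _; rewrite scalemxE.
  by have := lt0r_neq0 phi0 => p0; field.
by rewrite eps4_star // SE2 !scalemxE mulrN mulrA mulNr.
Qed.

Lemma star_K : (star (K1 R) = - K1 R) * (star (K2 R) = - K2 R) * (star (K3 R) = - K3 R).
Proof.
by do !split; apply/matrixP; apply: forall_ord4; apply: forall_ord4;
  rewrite star_entry oppmxE !mxE /=; ring.
Qed.

(** The antiselfdual matrices are spanned by the unit quaternions. *)
Lemma star_span (a : 'M[R]_4) : a^T = - a -> star a = - a ->
  a = a e0 e1 *: K1 R + a e0 e2 *: K2 R + a e0 e3 *: K3 R.
Proof.
move=> aT aS; have aA k l : a l k = - a k l by rewrite -trmxE aT oppmxE.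
have a0 k : a k k = 0 by have := aA k k; lra.
have S k l : star a k l = - a k l by rewrite aS oppmxE.
have := S e0 e1; have := S e0 e2; have := S e0 e3; rewrite !star_entry /= => S3 S2 S1.
apply/matrixP; apply: forall_ord4; apply: forall_ord4; rewrite !addmxE !scalemxE !mxE /= ?a0;
  rewrite ?(aA e0 e1) ?(aA e0 e2) ?(aA e0 e3) ?(aA e1 e2) ?(aA e1 e3) ?(aA e2 e3); lra.
Qed.

(** A cyclic identity between three indices is tensorial. *)
Lemma cyclic_congr (n : nat) (E : 'M[R]_n) (A : 'I_n -> 'M[R]_n) :
  (forall i j k, A i j k + A j k i + A k i j = 0) ->
  let B e := \sum_i E i e *: (E^T *m A i *m E) in
  forall e f h, B e f h + B f h e + B h e f = 0.
Proof.
move=> cA B e f h.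
have BE a b c : B a b c = \sum_i \sum_j \sum_k E i a * (E j b * (E k c * A i j k)).
  rewrite /B summxE; apply: eq_bigr => i _; rewrite scalemxE mxE mulr_sumr exchange_big /=.
  apply: eq_bigr => k _; rewrite mxE mulr_suml mulr_sumr; apply: eq_bigr => j _.
  by rewrite trmxE; ring.
rewrite !BE.
have -> : \sum_i \sum_j \sum_k E i f * (E j h * (E k e * A i j k)) =
  \sum_i \sum_j \sum_k E i e * (E j f * (E k h * A j k i)).
  under eq_bigr => i _ do rewrite exchange_big /=.
  rewrite exchange_big /=; apply: eq_bigr => i _; apply: eq_bigr => j _.
  by apply: eq_bigr => k _; ring.
have -> : \sum_i \sum_j \sum_k E i h * (E j e * (E k f * A i j k)) =
  \sum_i \sum_j \sum_k E i e * (E j f * (E k h * A k i j)).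
  rewrite exchange_big /=; apply: eq_bigr => i _; rewrite exchange_big /=.
  by apply: eq_bigr => j _; apply: eq_bigr => k _; ring.
rewrite -!big_split big1 //= => i _; rewrite -!big_split big1 //= => j _.
rewrite -!big_split big1 //= => k _.
transitivity (E i e * (E j f * (E k h * (A i j k + A j k i + A k i j)))); first by ring.
by rewrite cA !mulr0.
Qed.

End FrameAlgebra.

Section QuaternionicAlgebra.
Variable R : realType.
Notation K1 := (K1 R).
Notation K2 := (K2 R).
Notation K3 := (K3 R).

Lemma comm_K (A : 'M[R]_4) s : A + A^T = s%:M ->
  let p1 := A e0 e1 - A e2 e3 in let p2 := A e0 e2 + A e1 e3 in let p3 := A e0 e3 - A e1 e2 in
  [/\ A *m K1 - K1 *m A = p3 *: K2 - p2 *: K3, A *m K2 - K2 *m A = p1 *: K3 - p3 *: K1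
    & A *m K3 - K3 *m A = p2 *: K1 - p1 *: K2].
Proof.
move=> AT; have AE i j : A i j + A j i = s * (i == j)%:R.
  by rewrite -[A j i]trmxE -addmxE AT mxE mulr_natr.
have d i : A i i = s / 2 by have := AE i i; rewrite eqxx mulr1; lra.
have o i j : i != j -> A j i = - A i j by move=> /negPf H; have := AE i j; rewrite H mulr0; lra.
move=> p1 p2 p3; have o' := (o e0 e1 isT, o e0 e2 isT, o e0 e3 isT, o e1 e2 isT, o e1 e3 isT, o e2 e3 isT).
by split; apply/matrixP; apply: forall_ord4; apply: forall_ord4;
  rewrite !addmxE !oppmxE !scalemxE mxE sum4 [in X in _ - X]mxE sum4 !mxE /= ?d ?o' /p1 /p2 /p3;
  field.
Qed.

(** A conformal frame connection is determined on the antiselfdual forms by the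
    exterior derivatives of a quaternionic triple: twelve equations in twelve unknowns. *)
Lemma cyclic_comm_K (A : 'I_4 -> 'M[R]_4) (s : 'I_4 -> R) :
  (forall e, A e + (A e)^T = (s e)%:M) ->
  (forall K, unitK K -> forall e f h, (A e *m K - K *m A e) f h
    + (A f *m K - K *m A f) h e + (A h *m K - K *m A h) e f = 0) ->
  forall K, unitK K -> forall e, A e *m K = K *m A e.
Proof.
move=> AT cA.
pose p1 e := A e e0 e1 - A e e2 e3; pose p2 e := A e e0 e2 + A e e1 e3.
pose p3 e := A e e0 e3 - A e e1 e2.
have CK e := comm_K (AT e).
have C1 e : A e *m K1 - K1 *m A e = p3 e *: K2 - p2 e *: K3 by case: (CK e).
have C2 e : A e *m K2 - K2 *m A e = p1 e *: K3 - p3 e *: K1 by case: (CK e).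
have C3 e : A e *m K3 - K3 *m A e = p2 e *: K1 - p1 e *: K2 by case: (CK e).
have U1 : unitK K1 by constructor 1.
have U2 : unitK K2 by constructor 2.
have U3 : unitK K3 by constructor 3.
have E1 := cA _ U1; have E2 := cA _ U2; have E3 := cA _ U3.
have cases e f h : [/\ p3 e * K2 f h - p2 e * K3 f h + (p3 f * K2 h e - p2 f * K3 h e)
     + (p3 h * K2 e f - p2 h * K3 e f) = 0,
    p1 e * K3 f h - p3 e * K1 f h + (p1 f * K3 h e - p3 f * K1 h e)
     + (p1 h * K3 e f - p3 h * K1 e f) = 0
  & p2 e * K1 f h - p1 e * K2 f h + (p2 f * K1 h e - p1 f * K2 h e)
     + (p2 h * K1 e f - p1 h * K2 e f) = 0].
  by split; [have := E1 e f h; rewrite !C1|have := E2 e f h; rewrite !C2|have := E3 e f h;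
    rewrite !C3]; rewrite !addmxE !oppmxE !scalemxE.
have [a1 a2 a3] := cases e0 e1 e2; have [b1 b2 b3] := cases e0 e1 e3.
have [c1 c2 c3] := cases e0 e2 e3; have [d1 d2 d3] := cases e1 e2 e3.
move: a1 a2 a3 b1 b2 b3 c1 c2 c3 d1 d2 d3; rewrite !mxE /= => a1 a2 a3 b1 b2 b3 c1 c2 c3 d1 d2 d3.
have P1 : forall e, p1 e = 0 by apply: forall_ord4; lra.
have P2 : forall e, p2 e = 0 by apply: forall_ord4; lra.
have P3 : forall e, p3 e = 0 by apply: forall_ord4; lra.
by move=> K [] -> e; apply/eqP; rewrite -subr_eq0 ?C1 ?C2 ?C3 ?P1 ?P2 ?P3 !scale0r subr0.
Qed.

(** An algebraic curvature tensor which takes selfdual values is Ricci-flat. *)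
Lemma selfdual_ricci_flat (q : 'I_4 -> 'I_4 -> 'M[R]_4) :
  (forall e f, q f e = - q e f) -> (forall e f, (q e f)^T = - q e f) ->
  (forall e f g h, q e f h g + q f g h e + q g e h f = 0) ->
  (forall K, unitK K -> forall e f, \tr (K *m q e f) = 0) ->
  forall f g, \sum_e q e f e g = 0.
Proof.
move=> q12 q34 qB qK.
have s12 e f h g : q f e h g = - q e f h g by rewrite q12 oppmxE.
have s34 e f h g : q e f g h = - q e f h g by rewrite -[LHS]trmxE q34 oppmxE.
have z12 e h g : q e e h g = 0 by have := s12 e e h g; lra.
have z34 e f h : q e f h h = 0 by have := s34 e f h h; lra.
have qP e f h g : q e f h g = q g h f e.
  by apply: (@pair_symmetry R _ (fun i j k l => q i j l k)) => *.
have T e f : [/\ q e f e0 e1 = q e f e2 e3, q e f e0 e2 = - q e f e1 e3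
    & q e f e0 e3 = q e f e1 e2].
  have t1 : \tr (K1 *m q e f) = 0 by apply: qK; constructor 1.
  have t2 : \tr (K2 *m q e f) = 0 by apply: qK; constructor 2.
  have t3 : \tr (K3 *m q e f) = 0 by apply: qK; constructor 3.
  move: t1 t2 t3; rewrite /mxtrace !sum4 !mxE !sum4 !mxE /= => t1 t2 t3.
  have a1 := s34 e f e0 e1; have a2 := s34 e f e0 e2; have a3 := s34 e f e0 e3.
  have a4 := s34 e f e1 e2; have a5 := s34 e f e1 e3; have a6 := s34 e f e2 e3.
  by split; lra.
have B := qB e0 e1 e2 e3.
have := T e0 e1; have := T e0 e2; have := T e0 e3; have := T e1 e2; have := T e1 e3.
have := T e2 e3; move=> [a1 a2 a3] [b1 b2 b3] [c1 c2 c3] [d1 d2 d3] [f1 f2 f3] [h1 h2 h3].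
have r12 := (s12 e0 e1, s12 e0 e2, s12 e0 e3, s12 e1 e2, s12 e1 e3, s12 e2 e3).
have r34 e f := (s34 e f e0 e1, s34 e f e0 e2, s34 e f e0 e3, s34 e f e1 e2, s34 e f e1 e3,
  s34 e f e2 e3).
have p1 := qP e0 e1 e0 e2; have p2 := qP e0 e1 e0 e3; have p3 := qP e0 e1 e1 e2.
have p4 := qP e0 e1 e1 e3; have p5 := qP e0 e1 e2 e3; have p6 := qP e0 e2 e0 e3.
have p7 := qP e0 e2 e1 e2; have p8 := qP e0 e2 e1 e3; have p9 := qP e0 e2 e2 e3.
have p10 := qP e0 e3 e1 e2; have p11 := qP e0 e3 e1 e3; have p12 := qP e0 e3 e2 e3.
have p13 := qP e1 e2 e1 e3; have p14 := qP e1 e2 e2 e3; have p15 := qP e1 e3 e2 e3.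
move: p1 p2 p3 p4 p5 p6 p7 p8 p9 p10 p11 p12 p13 p14 p15 B; rewrite !r12 !r34 !opprK.
move=> p1 p2 p3 p4 p5 p6 p7 p8 p9 p10 p11 p12 p13 p14 p15 B.
by apply: forall_ord4; apply: forall_ord4; rewrite sum4 ?z12 ?z34 ?r12 ?r34 ?opprK; lra.
Qed.

Lemma cyclic_K1 (m : 'I_4 -> R) :
  (forall e f h, m e * K1 f h + m f * K1 h e + m h * K1 e f = 0) -> forall e, m e = 0.
Proof.
move=> c; have := c e0 e2 e3; have := c e1 e2 e3; have := c e2 e0 e1; have := c e3 e0 e1.
by rewrite !mxE /= => ? ? ? ?; apply: forall_ord4; lra.
Qed.

End QuaternionicAlgebra.

(** * Structure equations of a hypercomplex coframe *)

Section CyclicDerivatives.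
Variables (R : realType) (n : nat) (U : set 'rV[R]_n).
Hypothesis oU : open U.
Implicit Types a b : 'rV[R]_n -> 'rV[R]_n.

Definition cyc (F : 'I_n -> 'I_n -> 'I_n -> R) i j k := F i j k + F j k i + F k i j.

Lemma extd_smooth a : smooth_mx U a -> smooth_mx U (extd a).
Proof.
move=> sa i j; have sp k l : smooth U (partial k (fun y => a y 0 l)).
  exact: (smooth_partial oU k (sa 0 l)).
by apply: (eq_smooth oU _ (smooth_add oU (sp i j) (smooth_opp oU (sp j i)))) => y _; rewrite mxE.
Qed.

Lemma wedge_smooth a b : smooth_mx U a -> smooth_mx U b -> smooth_mx U (fun y => wedge (a y) (b y)).
Proof.
move=> sa sb; apply: (smooth_mx_add oU).
  exact: (smooth_mx_mul oU (smooth_mx_tr oU sa) sb).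
exact: (smooth_mx_opp oU (smooth_mx_mul oU (smooth_mx_tr oU sb) sa)).
Qed.

Lemma cyc_extd a i j k x : smooth_mx U a -> U x ->
  cyc (fun i j k => partial i (fun y => extd a y j k) x) i j k = 0.
Proof.
move=> sa Ux.
have E p q r : partial p (fun y => extd a y q r) x =
    partial p (partial q (fun y => a y 0 r)) x - partial p (partial r (fun y => a y 0 q)) x.
  have sp u v : smooth U (partial u (fun y => a y 0 v)) by exact: (smooth_partial oU u (sa 0 v)).
  rewrite -(partialN p (sp r q) Ux) -(partialD p (sp q r) (smooth_opp oU (sp r q)) Ux).
  by apply: (partial_eq oU _ Ux) => y _; rewrite mxE.
have [d dE] : exists d : 'I_n -> 'I_n -> 'I_n -> R, forall p q r,
    partial p (partial q (fun y => a y 0 r)) x = d p q r by eexists => p q r.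
have C p q r : d p q r = d q p r by rewrite -!dE (smooth_partialC oU p q (sa 0 r) Ux).
by rewrite /cyc !E !dE (C j i k) (C k i j) (C k j i); ring.
Qed.

Lemma cyc_wedge a b i j k x : smooth_mx U a -> smooth_mx U b -> U x ->
  cyc (fun i j k => partial i (fun y => wedge (a y) (b y) j k) x) i j k =
  cyc (fun i j k => extd a x i j * b x 0 k - a x 0 i * extd b x j k) i j k.
Proof.
move=> sa sb Ux.
have sab p q : smooth U (fun y => a y 0 p * b y 0 q) by exact: (smooth_mul oU (sa 0 p) (sb 0 q)).
have E p q r : partial p (fun y => wedge (a y) (b y) q r) x =
    partial p (fun y => a y 0 q) x * b x 0 r + a x 0 q * partial p (fun y => b y 0 r) x
    - (partial p (fun y => a y 0 r) x * b x 0 q + a x 0 r * partial p (fun y => b y 0 q) x).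
  rewrite -(partialM p (sa 0 q) (sb 0 r) Ux) -(partialM p (sa 0 r) (sb 0 q) Ux).
  rewrite -(partialN p (sab r q) Ux) -(partialD p (sab q r) (smooth_opp oU (sab r q)) Ux).
  by apply: (partial_eq oU _ Ux) => y _; rewrite wedgeE (mulrC (b y 0 q)).
have X u p q : extd u x p q = partial p (fun y => u y 0 q) x - partial q (fun y => u y 0 p) x.
  by rewrite mxE.
have [da daE] : exists d : 'I_n -> 'I_n -> R, forall p q, partial p (fun y => a y 0 q) x = d p q.
  by eexists => p q.
have [db dbE] : exists d : 'I_n -> 'I_n -> R, forall p q, partial p (fun y => b y 0 q) x = d p q.
  by eexists => p q.
rewrite /cyc !E !X !daE !dbE; ring.
Qed.

(** The exterior derivative of the Kahler form is the alternation of the covariant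
    derivative of the complex structure. *)
Lemma cyc_kahler (g : 'rV[R]_n -> 'M[R]_n) w J i j k x :
  riemannian U g -> smooth_mx U w -> smooth_mx U J ->
  (forall y, U y -> (J y)^T *m g y = - (g y *m J y)) -> U x ->
  cyc (fun i j k => partial i (fun y => (g y *m J y) j k) x + 2 * w x 0 i * (g x *m J x) j k) i j k =
  cyc (fun i j k => (g x *m cov_endo (weyl_connection g w) J i x) j k) i j k.
Proof.
move=> gR sw sJ gJ Ux; set Gam := weyl_connection g w.
pose om := g x *m J x.
have omT : om^T = - om by rewrite trmx_mul (metric_sym gR Ux) gJ.
pose S i := conn_mx Gam i x.
have D p : dmx p (fun y => g y *m J y) x =
    (S p)^T *m om + om *m S p + g x *m cov_endo Gam J p x - (2 * w x 0 p) *: om.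
  rewrite (dmx_mul oU p (metric_smooth gR) sJ Ux) cov_endoE (weyl_metric oU w gR p Ux).
  rewrite -/Gam -/(S p) /om.
  rewrite !(mulmxDl, mulmxDr, mulmxN, mulNmx) -!scalemxAl !mulmxA.
  by apply/matrixP => a b; rewrite !(addmxE, oppmxE, scalemxE); ring.
have P p q r : partial p (fun y => (g y *m J y) q r) x = dmx p (fun y => g y *m J y) x q r.
  by rewrite mxE.
have V p q r : dmx p (fun y => g y *m J y) x q r + 2 * w x 0 p * om q r =
    \sum_m (Gam m p q x * om m r - Gam m p r x * om m q) + (g x *m cov_endo Gam J p x) q r.
  rewrite D !(addmxE, oppmxE, scalemxE) subrK; congr (_ + _).
  rewrite mxE [X in _ + X]mxE -big_split; apply: eq_bigr => m _.
  have -> : om q m = - om m q by rewrite -[LHS]trmxE omT oppmxE.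
  rewrite trmxE [S p m q]mxE [S p m r]mxE mulNr; congr (_ - _); exact: mulrC.
rewrite /cyc !P -/om !V.
have tf m p q : Gam m p q x = Gam m q p x by exact: (weyl_torsion_free oU w gR).
set s1 := \sum_m _; set s2 := \sum_m _; set s3 := \sum_m _.
have Z : s1 + s2 + s3 = 0.
  rewrite /s1 /s2 /s3 -!big_split big1 //= => m _.
  by rewrite (tf m j i) (tf m k i) (tf m k j); ring.
by move: Z; lra.
Qed.

End CyclicDerivatives.

Section QuaternionicStructure.
Variables (R : realType) (U : set 'rV[R]_4).
Hypothesis oU : open U.
Variable m : 'rV[R]_4 -> R.

(** The structure equation of a selfdual Einstein metric with a compatible hypercomplex
    structure, in a coframe adapted to the Obata derivative. *)
Definition structure_eq (t a b c : 'rV[R]_4 -> 'rV[R]_4) := forall x, U x ->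
  extd a x = m x *: (wedge (t x) (a x) - wedge (b x) (c x)) - 2 *: wedge (b x) (c x).

Lemma structure_entry (t a b c : 'rV[R]_4 -> 'rV[R]_4) i j x : structure_eq t a b c -> U x ->
  extd a x i j = m x * (t x 0 i * a x 0 j - a x 0 i * t x 0 j
      - (b x 0 i * c x 0 j - c x 0 i * b x 0 j)) - 2 * (b x 0 i * c x 0 j - c x 0 i * b x 0 j).
Proof.
by move=> E Ux; rewrite E // addmxE oppmxE scalemxE [in X in _ - X]scalemxE addmxE oppmxE !wedgeE.
Qed.

Variables t a b c : 'rV[R]_4 -> 'rV[R]_4.
Hypotheses (st : smooth_mx U t) (sa : smooth_mx U a) (sb : smooth_mx U b) (sc : smooth_mx U c).

(** From d (d a) = 0: the forms [m (t /\ a - b /\ c)] are closed up to [- 4 t], with the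
    same 1-form for the three of them. *)
Lemma structure_closed i j k x :
  structure_eq t a b c -> structure_eq t b c a -> structure_eq t c a b -> U x ->
  let Om y := m y *: (wedge (t y) (a y) - wedge (b y) (c y)) in
  cyc (fun i j k => partial i (fun y => Om y j k) x) i j k =
  - 4 * cyc (fun i j k => t x 0 i * Om x j k) i j k.
Proof.
move=> Ea Eb Ec Ux Om.
have O p q r : partial p (fun y => Om y q r) x =
    partial p (fun y => extd a y q r) x + 2 * partial p (fun y => wedge (b y) (c y) q r) x.
  rewrite -(partial_scale oU 2 p (wedge_smooth oU sb sc q r) Ux).
  rewrite -(partialD p (extd_smooth oU sa q r) (smooth_scale oU 2 (wedge_smooth oU sb sc q r)) Ux).
  by apply: (partial_eq oU _ Ux) => y Uy; rewrite Ea // addmxE oppmxE [in X in _ - X]scalemxE subrK.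
have X1 := cyc_extd oU i j k sa Ux; have X2 := cyc_wedge oU i j k sb sc Ux.
have -> : cyc (fun i j k => partial i (fun y => Om y j k) x) i j k =
    2 * cyc (fun i j k => extd b x i j * c x 0 k - b x 0 i * extd c x j k) i j k.
  by rewrite -X2; move: X1; rewrite /cyc !O; lra.
have OmE p q : Om x p q = m x * (t x 0 p * a x 0 q - a x 0 p * t x 0 q
    - (b x 0 p * c x 0 q - c x 0 p * b x 0 q)).
  by rewrite scalemxE addmxE oppmxE !wedgeE.
have eb p q := structure_entry p q Eb Ux; have ec p q := structure_entry p q Ec Ux.
rewrite /cyc !OmE !eb !ec; ring.
Qed.

End QuaternionicStructure.

Section WeylContraction.
Variables (R : realType) (U : set 'rV[R]_4) (g : 'rV[R]_4 -> 'M[R]_4).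
Hypotheses (oU : open U) (gR : riemannian U g).
Let G0 := weyl_connection g (fun=> 0).

Lemma einstein_schouten (l : R) x : U x -> ricci G0 x = (6 * l) *: g x ->
  scalar_curvature g (fun=> 0) x = 24 * l /\ schouten g x = l *: g x.
Proof.
move=> Ux ric; have sc : scalar_curvature g (fun=> 0) x = 24 * l.
  rewrite /scalar_curvature /sym_ricci -/G0 ric trmxZ (metric_sym gR Ux) -scalerDl scalerA.
  rewrite -scalemxAr mulVmx ?(metric_unit gR Ux) // mxtraceZ mxtrace1.
  by field.
split=> //; rewrite /schouten sc -/G0 ric -scalerBl scalerA; congr (_ *: _).
by field.
Qed.

(** Contracting the Weyl curvature with [a = g J] gives the curvature operator on [J]. *)
Lemma weyl_contraction (l : R) (J : 'M[R]_4) x k m : U x -> schouten g x = l *: g x ->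
  (g x *m J)^T = - (g x *m J) ->
  let up := invmx (g x) *m (g x *m J) *m (invmx (g x))^T in
  \sum_i \sum_j weyl_curvature g i j k m x * up i j =
  \tr (J *m curv_mx G0 k m x) - 4 * l * (g x *m J) m k.
Proof.
move=> Ux sch aT up; have gu := metric_unit gR Ux; have gS := metric_sym gR Ux.
have upE : up = J *m invmx (g x) by rewrite /up mulKmx // trmx_inv gS.
have gug : g x *m up *m g x = g x *m J by rewrite upE mulmxA mulmxKV.
have gsym i j : g x i j = g x j i by rewrite -{1}gS trmxE.
have W i j : weyl_curvature g i j k m x =
    (g x *m curv_mx G0 k m x) j i - 2 * l * (g x m i * g x j k - g x k i * g x j m).
  rewrite /weyl_curvature sch !scalemxE -(lc_pair oU gR i j k m Ux) (gsym i m) (gsym i k).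
  have -> : (g x *m curv_mx G0 i j x) m k = \sum_p g x m p * curvature G0 i j k p x.
    by rewrite mxE; apply: eq_bigr => p _; rewrite mxE.
  ring.
have E1 : \sum_i \sum_j (g x *m curv_mx G0 k m x) j i * up i j = \tr (J *m curv_mx G0 k m x).
  transitivity (\tr (up *m (g x *m curv_mx G0 k m x))); last by rewrite upE mulmxA mulmxKV.
  by apply: eq_bigr => i _; rewrite mxE; apply: eq_bigr => j _; rewrite mulrC.
have E2 p q : \sum_i \sum_j g x p i * g x j q * up i j = (g x *m J) p q.
  rewrite -gug mxE exchange_big /=; apply: eq_bigr => j _; rewrite mxE mulr_suml.
  by apply: eq_bigr => i _; ring.
have aA p q : (g x *m J) q p = - (g x *m J) p q by rewrite -trmxE aT oppmxE.
transitivity (\sum_i \sum_j (g x *m curv_mx G0 k m x) j i * up i j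
   - 2 * l * (\sum_i \sum_j g x m i * g x j k * up i j - \sum_i \sum_j g x k i * g x j m * up i j)).
  rewrite -sumrB mulr_sumr -sumrB; apply: eq_bigr => i _.
  by rewrite -sumrB mulr_sumr -sumrB; apply: eq_bigr => j _; rewrite W; ring.
by rewrite E1 !E2 (aA m k); ring.
Qed.

End WeylContraction.

Section HypercomplexCurvature.
Variables (R : realType) (n : nat) (U : set 'rV[R]_n).
Hypothesis oU : open U.
Variables (g : 'rV[R]_n -> 'M[R]_n) (t : 'rV[R]_n -> 'rV[R]_n).
Hypotheses (gR : riemannian U g) (st : smooth_mx U t).
Let G0 := weyl_connection g (fun=> 0).
Let Gw := weyl_connection g (fun y => 2 *: t y).

Lemma smooth_double : smooth_mx U (fun y => 2 *: t y).
Proof. by apply: (smooth_mx_scale oU) => //; exact: (smooth_cst oU). Qed.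

(** The Obata connection commutes with the three complex structures, so its curvature
    has no component along them; only the change of connection contributes. *)
Lemma hypercomplex_curvature (Ja Jb Jc : 'rV[R]_n -> 'M[R]_n) (a : 'rV[R]_n -> 'rV[R]_n) i j x :
  smooth_mx U Ja -> smooth_mx U Jb -> smooth_mx U Jc -> smooth_mx U a ->
  parallel_endo U Gw Ja -> parallel_endo U Gw Jb -> parallel_endo U Gw Jc ->
  (forall y, U y -> Jb y *m Jc y = Ja y /\ Jc y *m Jb y = - Ja y) ->
  (forall y, U y -> (Ja y)^T *m g y = - (g y *m Ja y)) ->
  (forall y, U y -> a y = t y *m Ja y) -> U x ->
  \tr (Ja x *m curv_mx G0 i j x) = - 4 * extd a x i j - 8 * wedge (t x) (a x) i j
    + 8 * (t x *m (invmx (g x) *m (t x)^T)) 0 0 * (g x *m Ja x) i j.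
Proof.
move=> sJa sJb sJc sa pJa pJb pJc JJ gJ aE Ux.
have sG := weyl_smooth oU gR smooth_double.
have trJ y : U y -> \tr (Ja y) = 0.
  move=> Uy; have [bc cb] := JJ y Uy.
  have : \tr (Ja y) = - \tr (Ja y) by rewrite -{1}bc mxtrace_mulC cb mxtraceN.
  lra.
have flat : \tr (Ja x *m curv_mx Gw i j x) = 0.
  have [bc cb] := JJ x Ux.
  rewrite -bc; apply: trace_quaternion; first by rewrite bc cb opprK.
  exact: (parallel_curv oU i j sG sJb pJb Ux).
rewrite (trace_curvature oU gR smooth_double sJa pJa gJ trJ Ux flat).
have -> : extd (fun y => 2 *: t y *m Ja y) x i j = 2 * extd a x i j.
  have P p q : partial p (fun y => (2 *: t y *m Ja y) 0 q) x = 2 * partial p (fun y => a y 0 q) x.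
    rewrite -(partial_scale oU 2 p (sa 0 q) Ux).
    by apply: (partial_eq oU _ Ux) => y Uy; rewrite aE // -scalemxAl scalemxE.
  by rewrite mxE !P [in RHS]mxE mulrBr.
rewrite -scalemxAl -(aE x Ux) trmxZ -!scalemxAr -scalemxAl !wedgeE !scalemxE.
ring.
Qed.

End HypercomplexCurvature.

Section ParallelIntegrable.
Variables (R : realType) (n : nat) (U : set 'rV[R]_n).
Hypothesis oU : open U.
Variables (g : 'rV[R]_n -> 'M[R]_n) (w : 'rV[R]_n -> 'rV[R]_n).
Hypotheses (gR : riemannian U g) (sw : smooth_mx U w).

(** A complex structure which is parallel for a torsion-free connection is integrable. *)
Lemma parallel_nijenhuis J : smooth_mx U J -> (forall x, U x -> J x *m J x = - 1%:M) ->
  parallel_endo U (weyl_connection g w) J -> forall i j x, U x ->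
  nijenhuis J (fun=> coord_vec R i) (fun=> coord_vec R j) x = 0.
Proof.
move=> sJ JJ pJ i j x Ux; set Gam := weyl_connection g w.
pose S p := conn_mx Gam p x; pose Jx := J x.
have D p a b : partial p (fun y => J y a b) x = (Jx *m S p) a b - (S p *m Jx) a b.
  by have /matrixP/(_ a b) := parallel_dmx p pJ Ux; rewrite mxE => ->; rewrite addmxE oppmxE.
have tf a p q : Gam a p q x = Gam a q p x by exact: (weyl_torsion_free oU w gR).
have E0 a : endo_apply J (fun=> coord_vec R a) = fun y => (\row_k J y k a).
  apply/funext => y; apply/matrixP => u k; rewrite (ord1 u) /endo_apply /coord_vec -rowE !mxE.
  by [].
have L1 a b : lie_bracket (endo_apply J (fun=> coord_vec R a)) (fun=> coord_vec R b) x =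
    \row_k (- partial b (fun y => J y k a) x).
  apply/matrixP => u k; rewrite (ord1 u) E0 !mxE (bigD1 b) //= big1 ?addr0.
    rewrite !mxE !eqxx mul1r partial_cst mulr0 sub0r; congr (- _).
    by apply: (partial_eq oU _ Ux) => y _; rewrite mxE.
  by move=> l /negPf lb; rewrite partial_cst mulr0 sub0r !mxE eqxx lb mul0r oppr0.
have L2 a b : lie_bracket (fun=> coord_vec R a) (endo_apply J (fun=> coord_vec R b)) x =
    \row_k (partial a (fun y => J y k b) x).
  apply/matrixP => u k; rewrite (ord1 u) E0 !mxE (bigD1 a) //= big1 ?addr0.
    rewrite !mxE !eqxx mul1r partial_cst mulr0 subr0.
    by apply: (partial_eq oU _ Ux) => y _; rewrite mxE.
  by move=> l /negPf lb; rewrite partial_cst mulr0 subr0 !mxE eqxx lb mul0r.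
have L3 : lie_bracket (fun=> coord_vec R i) (fun=> coord_vec R j) x = 0.
  by apply/matrixP => u k; rewrite !mxE big1 // => l _; rewrite !partial_cst !mulr0 subr0.
rewrite /nijenhuis L3 subr0.
have A (v : 'rV[R]_n) (X : 'rV[R]_n -> 'rV[R]_n) : X x = v -> endo_apply J X x = v *m (J x)^T.
  by move=> <-.
rewrite (A _ _ (L1 i j)) (A _ _ (L2 i j)).
apply/matrixP => u k; rewrite (ord1 u) [RHS]mxE !addmxE !oppmxE.
rewrite !E0 [X in X - _ - _]mxE [X in _ - X - _]mxE [X in _ - X]mxE.
have P p a b : partial p (fun y => (\row_k J y k a) 0 b) x = (Jx *m S p) b a - (S p *m Jx) b a.
  by rewrite -D; apply: (partial_eq oU _ Ux) => y _; rewrite mxE.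
have T1 a b : \sum_l Jx l a * (Jx *m S l) k b = (Jx *m S b *m Jx) k a.
  rewrite -mulmxA mxE; under eq_bigr do rewrite mxE mulr_sumr.
  rewrite exchange_big; apply: eq_bigr => m _; rewrite mxE mulr_sumr; apply: eq_bigr => l _.
  by rewrite !mxE tf; ring.
have T2 : \sum_l Jx l i * (S l *m Jx) k j = \sum_l Jx l j * (S l *m Jx) k i.
  under eq_bigr do rewrite mxE mulr_sumr.
  under [RHS]eq_bigr do rewrite mxE mulr_sumr.
  rewrite exchange_big; apply: eq_bigr => m _; apply: eq_bigr => l _.
  by rewrite !mxE tf; ring.
have T3 a b : \sum_m (\row_k (partial a (fun y => J y k b) x)) 0 m * (J x)^T m k
    = - S a k b - (Jx *m S a *m Jx) k b.
  transitivity ((Jx *m (Jx *m S a - S a *m Jx)) k b).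
    by rewrite [RHS]mxE; apply: eq_bigr => m _; rewrite mxE trmxE D addmxE oppmxE mulrC.
  by rewrite mulmxBr !mulmxA JJ // mulNmx mul1mx addmxE !oppmxE.
have -> : \sum_m (\row_k (- partial j (fun y => J y k i) x)) 0 m * (J x)^T m k
    = S j k i + (Jx *m S j *m Jx) k i.
  rewrite -[RHS]opprK opprD -T3 -sumrN; apply: eq_bigr => m _.
  by rewrite mxE [X in _ = - (X * _)]mxE mulNr.
rewrite T3.
under eq_bigr do rewrite !P mxE [X in _ - X * _]mxE !mulrBr.
rewrite !sumrB -/Jx !T1 T2.
have -> : S j k i = S i k j by rewrite !mxE tf.
ring.
Qed.

End ParallelIntegrable.

(** Compatibility with the metric says that, in a conformal frame, the connection form is
    skew up to a multiple of the identity. *)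
Lemma frame_connection_conformal (R : realType) n (T F S dT : 'M[R]_n) (dp p v : R) :
  T *m F = 1%:M -> p != 0 ->
  dp *: (T^T *m T) + p *: (dT^T *m T + T^T *m dT) =
  S^T *m (p *: (T^T *m T)) + p *: (T^T *m T) *m S - (2 * v) *: (p *: (T^T *m T)) ->
  T *m S *m F - dT *m F + (T *m S *m F - dT *m F)^T = (dp / p + 2 * v)%:M.
Proof.
move=> TF p0 D; have FT : F^T *m T^T = 1%:M by rewrite -trmx_mul TF trmx1.
pose X := T *m S *m F; pose Y := dT *m F.
have H : dp *: 1%:M + p *: (Y^T + Y) = p *: (X^T + X) - (2 * v * p) *: 1%:M.
  have := congr1 (fun M => F^T *m M *m F) D.
  rewrite !(mulmxDr, mulmxDl, mulmxN, mulNmx) -!(scalemxAr, scalemxAl) !(mulmxDr, mulmxDl).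
  have -> : F^T *m (T^T *m T) *m F = 1%:M by rewrite mulmxA FT mul1mx.
  have -> : F^T *m (dT^T *m T) *m F = Y^T by rewrite -!mulmxA TF mulmx1 trmx_mul.
  have -> : F^T *m (T^T *m dT) *m F = Y by rewrite mulmxA FT mul1mx.
  have -> : F^T *m (S^T *m (T^T *m T)) *m F = X^T.
    by rewrite -!mulmxA TF mulmx1 !trmx_mul.
  have -> : F^T *m (T^T *m T *m S) *m F = X by rewrite !mulmxA FT mul1mx.
  by move=> ->; rewrite -scalerA [in RHS]scalerDr.
rewrite -/X -/Y; move: X Y H => {D FT} X Y H; apply/matrixP => i j.
have dE a : (a%:M : 'M[R]_n) i j = a * (i == j)%:R by rewrite mxE mulr_natr.
move/matrixP: H => /(_ i j); rewrite !(addmxE, oppmxE, scalemxE, trmxE) !dE.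
move: (_ == _)%:R (X i j) (X j i) (Y i j) (Y j i) => d xij xji yij yji h.
apply: (mulfI p0); have -> : p * ((dp / p + 2 * v) * d) = dp * d + 2 * v * p * d by field.
by move: h; lra.
Qed.

Section HypercomplexCoframe.
Variables (R : realType) (U : set 'rV[R]_4).
Hypothesis oU : open U.
Variables (Th g : 'rV[R]_4 -> 'M[R]_4) (phi : 'rV[R]_4 -> R) (lam : R).
Hypotheses (sT : smooth_mx U Th) (uT : forall x, U x -> Th x \in unitmx).
Hypotheses (gR : riemannian U g) (phi0 : forall x, U x -> 0 < phi x).
Hypothesis gE : forall x, U x -> g x = phi x *: ((Th x)^T *m Th x).

Definition coform i (x : 'rV[R]_4) : 'rV[R]_4 := row i (Th x).
Notation t := (coform e0).

Definition coframe_endo (K : 'M[R]_4) x : 'M[R]_4 := invmx (Th x) *m K *m Th x.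
Notation J := coframe_endo.

Lemma coform_smooth i : smooth_mx U (coform i).
Proof. by move=> p q; apply: (eq_smooth oU _ (sT i q)) => y _; rewrite mxE. Qed.

Lemma coframe_endo_smooth K : smooth_mx U (J K).
Proof.
apply: (smooth_mx_mul oU) => //; apply: (smooth_mx_mul oU); last exact: (smooth_mx_cst oU).
by move=> i j; exact: (smooth_invmx oU uT sT).
Qed.

Lemma coframe_endoM K L x : U x -> J K x *m J L x = J (K *m L) x.
Proof. by move=> Ux; rewrite /J !mulmxA mulmxK ?uT. Qed.

Lemma coframe_endoN K x : J (- K) x = - J K x.
Proof. by rewrite /J mulmxN mulNmx. Qed.

Lemma coframe_mul K x : U x -> Th x *m J K x = K *m Th x.
Proof. by move=> Ux; rewrite /J !mulmxA mulmxV ?uT // mul1mx. Qed.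

Lemma endo_coframe K x : U x -> J K x *m invmx (Th x) = invmx (Th x) *m K.
Proof. by move=> Ux; rewrite /J mulmxK ?uT. Qed.

Lemma metric_endo K x : U x -> g x *m J K x = phi x *: ((Th x)^T *m K *m Th x).
Proof. by move=> Ux; rewrite gE // -scalemxAl -mulmxA coframe_mul // mulmxA. Qed.

Lemma endo_metric K x : U x -> K^T = - K -> (J K x)^T *m g x = - (g x *m J K x).
Proof.
move=> Ux KT; rewrite -{1}(metric_sym gR Ux) -trmx_mul metric_endo // trmxZ !trmx_mul trmxK KT.
by rewrite mulNmx mulmxN scalerN mulmxA.
Qed.

Lemma wedge_coform i j x : wedge (coform i x) (coform j x) =
  (Th x)^T *m (delta_mx i j - delta_mx j i) *m Th x.
Proof.
rewrite mulmxBr mulmxBl /wedge /coform !tr_row; congr (_ - _).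
  by rewrite -(mul_delta_mx (0 : 'I_1)) mulmxA -colE -mulmxA -rowE.
by rewrite -(mul_delta_mx (0 : 'I_1)) mulmxA -colE -mulmxA -rowE.
Qed.

Lemma K_delta : (K1 R = delta_mx e0 e1 - delta_mx e1 e0 - (delta_mx e2 e3 - delta_mx e3 e2)) *
  (K2 R = delta_mx e0 e2 - delta_mx e2 e0 - (delta_mx e3 e1 - delta_mx e1 e3)) *
  (K3 R = delta_mx e0 e3 - delta_mx e3 e0 - (delta_mx e1 e2 - delta_mx e2 e1)).
Proof.
by do !split; apply/matrixP; apply: forall_ord4; apply: forall_ord4; rewrite !mxE /=; ring.
Qed.

Lemma metric_endo_wedge x : U x ->
  (g x *m J (K1 R) x = phi x *: (wedge (t x) (coform e1 x) - wedge (coform e2 x) (coform e3 x))) *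
  (g x *m J (K2 R) x = phi x *: (wedge (t x) (coform e2 x) - wedge (coform e3 x) (coform e1 x))) *
  (g x *m J (K3 R) x = phi x *: (wedge (t x) (coform e3 x) - wedge (coform e1 x) (coform e2 x))).
Proof.
by move=> Ux; do !split; rewrite metric_endo // !wedge_coform K_delta !(mulmxBr, mulmxBl).
Qed.

Lemma coform_endo x : U x ->
  (t x *m J (K1 R) x = coform e1 x) * (t x *m J (K2 R) x = coform e2 x) *
  (t x *m J (K3 R) x = coform e3 x).
Proof.
have rK i : row i (Th x) = delta_mx 0 i *m Th x by rewrite rowE.
move=> Ux; do !split; rewrite /coform -row_mul coframe_mul // row_mul rK; congr (_ *m _);
  by apply/matrixP => p; apply: forall_ord4; rewrite (ord1 p) !mxE /=; ring.
Qed.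

Lemma length_coform x : U x -> (t x *m (invmx (g x) *m (t x)^T)) 0 0 = (phi x)^-1.
Proof.
move=> Ux; have p0 : phi x != 0 by rewrite gt_eqF ?phi0.
have gu := metric_unit gR Ux.
have h : g x *m ((phi x)^-1 *: (invmx (Th x) *m delta_mx e0 0)) = (t x)^T.
  rewrite gE // -scalemxAl -scalemxAr scalerA divff // scale1r -mulmxA (mulmxA (Th x)).
  by rewrite mulmxV ?uT // mul1mx tr_row -colE.
rewrite -h mulKmx // -scalemxAr scalemxE mulmxA -row_mul mulmxV ?uT //.
by rewrite -rowE rowE mul_delta_mx mxE !eqxx mulr1 || rewrite row1 mul_delta_mx mxE !eqxx mulr1.
Qed.

Section Parallel.
Hypotheses (lam0 : lam != 0) (sp : smooth U phi).
Let m x := lam * phi x.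
Hypotheses (S1 : structure_eq U m t (coform e1) (coform e2) (coform e3))
           (S2 : structure_eq U m t (coform e2) (coform e3) (coform e1))
           (S3 : structure_eq U m t (coform e3) (coform e1) (coform e2)).
Let w y : 'rV[R]_4 := 2 *: t y.
Let Gw := weyl_connection g w.
Let sw : smooth_mx U w := smooth_double oU (coform_smooth e0).

Lemma cyc_cov_endo K i j k x : unitK K -> U x ->
  cyc (fun i j k => (g x *m cov_endo Gw (J K) i x) j k) i j k = 0.
Proof.
move=> uK Ux; have KT : K^T = - K by case: uK => ->; rewrite ?K1T ?K2T ?K3T.
rewrite -(cyc_kahler oU i j k gR sw (coframe_endo_smooth K) _ Ux); last first.
  by move=> y Uy; exact: endo_metric.
have P : exists Om : 'rV[R]_4 -> 'M[R]_4, (forall y, U y -> Om y = lam *: (g y *m J K y)) /\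
    cyc (fun i j k => partial i (fun y => Om y j k) x) i j k
      = - 4 * cyc (fun i j k => t x 0 i * Om x j k) i j k.
  have s := coform_smooth.
  case: uK => ->.
  - exists (fun y => m y *: (wedge (t y) (coform e1 y) - wedge (coform e2 y) (coform e3 y))).
    by split; [move=> y Uy; rewrite metric_endo_wedge // scalerA
              |exact: (structure_closed oU (s e1) (s e2) (s e3) i j k S1 S2 S3 Ux)].
  - exists (fun y => m y *: (wedge (t y) (coform e2 y) - wedge (coform e3 y) (coform e1 y))).
    by split; [move=> y Uy; rewrite metric_endo_wedge // scalerA
              |exact: (structure_closed oU (s e2) (s e3) (s e1) i j k S2 S3 S1 Ux)].
  - exists (fun y => m y *: (wedge (t y) (coform e3 y) - wedge (coform e1 y) (coform e2 y))).
    by split; [move=> y Uy; rewrite metric_endo_wedge // scalerA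
              |exact: (structure_closed oU (s e3) (s e1) (s e2) i j k S3 S1 S2 Ux)].
have [Om [OmE cOm]] := P.
have OP p q r : partial p (fun y => Om y q r) x = lam * partial p (fun y => (g y *m J K y) q r) x.
  have sg : smooth U (fun y => (g y *m J K y) q r).
    exact: (smooth_mx_mul oU (metric_smooth gR) (coframe_endo_smooth K) q r).
  rewrite -(partial_scale oU lam p sg Ux).
  by apply: (partial_eq oU _ Ux) => y Uy; rewrite OmE // scalemxE.
apply: (mulfI lam0); rewrite mulr0; move: cOm.
have wE p : w x 0 p = 2 * t x 0 p by rewrite scalemxE.
rewrite /cyc !OP OmE // !wE !scalemxE.
have [d dE] : exists d : 'I_4 -> 'I_4 -> 'I_4 -> R, forall p q r,
  partial p (fun y => (g y *m J K y) q r) x = d p q r by eexists => p q r.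
by rewrite !dE => H; lra.
Qed.

(** The structure equations make the complex structures parallel for [D mu = 2 theta mu]. *)
Lemma coframe_parallel K : unitK K -> parallel_endo U Gw (J K).
Proof.
move=> uK i x Ux; have Ux' := uT Ux.
pose E := invmx (Th x); pose S i := conn_mx Gw i x; pose dT i := dmx i Th x.
pose A i := Th x *m S i *m E - dT i *m E.
have NE L p : unitK L ->
    Th x *m cov_endo Gw (J L) p x *m E = A p *m L - L *m A p.
  move=> uL.
  have D : dT p *m J L x + Th x *m dmx p (J L) x = L *m dT p.
    rewrite -(dmx_mul oU p sT (coframe_endo_smooth L) Ux).
    rewrite (eq_dmx oU p Ux (fun y Uy => coframe_mul L Uy)).
    by rewrite (dmx_mul oU p (smooth_mx_cst oU L) sT Ux) dmx_cst mul0mx add0r.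
  rewrite cov_endoE mulmxDr mulmxDl.
  have -> : Th x *m dmx p (J L) x *m E = L *m dT p *m E - dT p *m E *m L.
    rewrite -D; move: (J L x) (endo_coframe L Ux) => Jx JE.
    by rewrite mulmxDl -(mulmxA _ Jx) JE mulmxA addrC addKr.
  have -> : Th x *m (S p *m J L x - J L x *m S p) *m E = Th x *m S p *m E *m L - L *m (Th x *m S p *m E).
    move: (J L x) (coframe_mul L Ux) (endo_coframe L Ux) => Jx TJ JE.
    by rewrite mulmxBr mulmxBl !mulmxA -(mulmxA _ Jx) JE TJ !mulmxA.
  rewrite /A mulmxBl mulmxBr !mulmxA.
  by apply/matrixP => u v; rewrite !(addmxE, oppmxE); ring.
have sA p : A p + (A p)^T = (partial p phi x / phi x + 2 * w x 0 p)%:M.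
  have D : partial p phi x *: ((Th x)^T *m Th x) + phi x *: ((dT p)^T *m Th x + (Th x)^T *m dT p)
      = (S p)^T *m g x + g x *m S p - (2 * w x 0 p) *: g x.
    rewrite -(weyl_metric oU w gR p Ux).
    have sq := smooth_mx_mul oU (smooth_mx_tr oU sT) sT.
    rewrite (eq_dmx oU p Ux gE) (dmxZ oU p sp sq Ux).
    by rewrite (dmx_mul oU p (smooth_mx_tr oU sT) sT Ux) (dmx_tr oU).
  have p0 : phi x != 0 by rewrite gt_eqF ?phi0.
  by apply: (frame_connection_conformal (mulmxV Ux') p0); rewrite -gE.
pose B e := \sum_i E i e *: A i.
have BK L e : unitK L -> B e *m L - L *m B e = \sum_i E i e *: (A i *m L - L *m A i).
  move=> uL; rewrite /B mulmx_suml mulmx_sumr -sumrB; apply: eq_bigr => p _.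
  by rewrite -scalemxAl -scalemxAr scalerBr.
have cB L e f h : unitK L -> (B e *m L - L *m B e) f h + (B f *m L - L *m B f) h e
     + (B h *m L - L *m B h) e f = 0.
  move=> uL; have := cyclic_congr E (fun p q r => cyc_cov_endo p q r uL Ux) e f h.
  have F k : \sum_i E i k *: (E^T *m (g x *m cov_endo Gw (J L) i x) *m E) = phi x *: (B k *m L - L *m B k).
    rewrite BK // scaler_sumr; apply: eq_bigr => p _; rewrite -NE // scalerA mulrC -scalerA.
    congr (_ *: _); rewrite gE // -!scalemxAl -!scalemxAr -scalemxAl; congr (_ *: _).
    by rewrite !mulmxA -trmx_mul mulmxV // trmx1 mul1mx.
  rewrite /= !F !scalemxE -!mulrDr => /eqP; rewrite mulf_eq0 gt_eqF ?phi0 //= => /eqP.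
  by [].
have sB e : B e + (B e)^T = (\sum_i E i e * (partial i phi x / phi x + 2 * w x 0 i))%:M.
  rewrite /B raddf_sum raddf_sum -big_split; apply: eq_bigr => p _ /=.
  by rewrite trmxZ -scalerDr sA scale_scalar_mx.
have comm := cyclic_comm_K sB (fun L uL e f h => cB L e f h uL) uK.
have AB p : A p = \sum_e Th x e p *: B e.
  transitivity (\sum_i (E *m Th x) i p *: A i).
    by rewrite mulVmx // (bigD1 p) //= mxE eqxx scale1r big1 ?addr0 // => q /negPf qp;
      rewrite mxE qp scale0r.
  under eq_bigr do rewrite mxE scaler_suml.
  rewrite exchange_big; apply: eq_bigr => e _; rewrite /B scaler_sumr; apply: eq_bigr => q _.
  by rewrite scalerA mulrC.
have AK : A i *m K - K *m A i = 0.
  rewrite AB mulmx_suml mulmx_sumr -sumrB big1 // => e _.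
  by rewrite -scalemxAl -scalemxAr comm subrr.
have := NE K i uK; rewrite AK => H.
rewrite -(mulKmx Ux' (cov_endo _ _ _ _)) -[X in _ *m X](mulmxKV Ux') -/E H.
by rewrite mul0mx mulmx0.
Qed.

Let G0 := weyl_connection g (fun=> 0).

Lemma coframe_hyper y : U y ->
  (J (K2 R) y *m J (K3 R) y = J (K1 R) y /\ J (K3 R) y *m J (K2 R) y = - J (K1 R) y) /\
  (J (K3 R) y *m J (K1 R) y = J (K2 R) y /\ J (K1 R) y *m J (K3 R) y = - J (K2 R) y) /\
  (J (K1 R) y *m J (K2 R) y = J (K3 R) y /\ J (K2 R) y *m J (K1 R) y = - J (K3 R) y).
Proof.
by move=> Uy; rewrite !coframe_endoM // K12 K23 K31 K21 K32 K13 !coframe_endoN.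
Qed.

(** The change of connection, with the exterior derivatives given by the structure equations,
    leaves a constant multiple of the Kahler forms exactly because [m] is that constant
    times the conformal factor. *)
Lemma coframe_trace K i j x : unitK K -> U x ->
  \tr (J K x *m curv_mx G0 i j x) = - 4 * lam * (g x *m J K x) i j.
Proof.
move=> uK Ux; have p0 : phi x != 0 by rewrite gt_eqF ?phi0.
have s := coform_smooth; have sJ := coframe_endo_smooth.
have U1 : unitK (K1 R) by constructor 1.
have U2 : unitK (K2 R) by constructor 2.
have U3 : unitK (K3 R) by constructor 3.
have pJ L (uL : unitK L) := coframe_parallel uL.
have aJ L (uL : unitK L) y (Uy : U y) : (J L y)^T *m g y = - (g y *m J L y).
  by apply: endo_metric => //; case: uL => ->; rewrite ?K1T ?K2T ?K3T.
have fin (e b gj th : R) : e = m x * (th - b) - 2 * b -> gj = phi x * (th - b) ->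
    - 4 * e - 8 * th + 8 * (phi x)^-1 * gj = - 4 * lam * gj.
  by move=> -> ->; rewrite /m; field.
have H1 : \tr (J (K1 R) x *m curv_mx G0 i j x) = - 4 * lam * (g x *m J (K1 R) x) i j.
  rewrite (hypercomplex_curvature oU gR (s e0) i j (sJ (K1 R)) (sJ (K2 R)) (sJ (K3 R)) (s e1)
    (pJ _ U1) (pJ _ U2) (pJ _ U3) _ (aJ _ U1) _ Ux); last 2 first.
  - by move=> y /coframe_hyper[].
  - by move=> y Uy; rewrite coform_endo.
  rewrite length_coform //; apply: (fin _ (wedge (coform e2 x) (coform e3 x) i j)).
    by rewrite S1 // addmxE oppmxE !scalemxE addmxE oppmxE.
  by rewrite metric_endo_wedge // scalemxE addmxE oppmxE.
have H2 : \tr (J (K2 R) x *m curv_mx G0 i j x) = - 4 * lam * (g x *m J (K2 R) x) i j.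
  rewrite (hypercomplex_curvature oU gR (s e0) i j (sJ (K2 R)) (sJ (K3 R)) (sJ (K1 R)) (s e2)
    (pJ _ U2) (pJ _ U3) (pJ _ U1) _ (aJ _ U2) _ Ux); last 2 first.
  - by move=> y /coframe_hyper[_ []].
  - by move=> y Uy; rewrite coform_endo.
  rewrite length_coform //; apply: (fin _ (wedge (coform e3 x) (coform e1 x) i j)).
    by rewrite S2 // addmxE oppmxE !scalemxE addmxE oppmxE.
  by rewrite metric_endo_wedge // scalemxE addmxE oppmxE.
have H3 : \tr (J (K3 R) x *m curv_mx G0 i j x) = - 4 * lam * (g x *m J (K3 R) x) i j.
  rewrite (hypercomplex_curvature oU gR (s e0) i j (sJ (K3 R)) (sJ (K1 R)) (sJ (K2 R)) (s e3)
    (pJ _ U3) (pJ _ U1) (pJ _ U2) _ (aJ _ U3) _ Ux); last 2 first.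
  - by move=> y /coframe_hyper[_ []].
  - by move=> y Uy; rewrite coform_endo.
  rewrite length_coform //; apply: (fin _ (wedge (coform e1 x) (coform e2 x) i j)).
    by rewrite S3 // addmxE oppmxE !scalemxE addmxE oppmxE.
  by rewrite metric_endo_wedge // scalemxE addmxE oppmxE.
by case: uK => ->.
Qed.

(** The curvature minus that of constant curvature [lam] takes selfdual values by
    [coframe_trace], so [selfdual_ricci_flat] applies to it. *)
Lemma coframe_ricci x : U x -> ricci G0 x = (6 * lam) *: g x.
Proof.
move=> Ux; have gS i j : g x i j = g x j i by rewrite -{1}(metric_sym gR Ux) trmxE.
pose E := invmx (Th x); have uTx := uT Ux.
pose D (i j : 'I_4) : 'M[R]_4 := delta_mx i 0 *m row j (g x) - delta_mx j 0 *m row i (g x).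
pose Q (i j : 'I_4) : 'M[R]_4 := curv_mx G0 i j x - (2 * lam) *: D i j.
have DE i j l k : D i j l k = (l == i)%:R * g x j k - (l == j)%:R * g x i k.
  by rewrite !mxE !big_ord1 !mxE !eqxx !andbT.
have QE i j l k : Q i j l k = curv_mx G0 i j x l k
    - 2 * lam * ((l == i)%:R * g x j k - (l == j)%:R * g x i k).
  by rewrite /Q addmxE oppmxE scalemxE DE.
have QB i j k l : Q i j l k + Q j k l i + Q k i l j = 0.
  rewrite !QE (gS k j) (gS k i) (gS j i).
  by have := lc_bianchi oU gR i j k l Ux; rewrite -/G0; lra.
have Q12 i j : Q j i = - Q i j.
  rewrite /Q curv_mx_anti opprB addrC -scalerN; congr (_ *: _ + _).
  by rewrite /D !opprB.
have Q34 i j : (g x *m Q i j)^T = - (g x *m Q i j).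
  have gD p q u v : (g x *m D p q) u v = g x u p * g x q v - g x u q * g x p v.
    by rewrite /D mulmxBr !mulmxA -!colE addmxE oppmxE [X in X - _]mxE [X in _ - X]mxE !big_ord1 !mxE.
  apply/matrixP => a b; rewrite /Q mulmxBr -scalemxAr [LHS]trmxE [RHS]oppmxE !addmxE !oppmxE !scalemxE.
  rewrite (lc_skew34 oU gR i j b a Ux) -/G0.
  by rewrite !gD (gS b i) (gS b j) (gS j a) (gS i a); ring.
have QK K i j : unitK K -> \tr (J K x *m Q i j) = 0.
  move=> uK; rewrite /Q mulmxBr mxtraceB coframe_trace // -scalemxAr mxtraceZ.
  have gA : (g x *m J K x) j i = - (g x *m J K x) i j.
    rewrite -trmxE trmx_mul (metric_sym gR Ux) endo_metric ?oppmxE //.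
    by case: uK => ->; rewrite ?K1T ?K2T ?K3T.
  have tD p q : \tr (J K x *m (delta_mx p 0 *m row q (g x))) = (g x *m J K x) q p.
    by rewrite mulmxA mxtrace_mulC mulmxA -colE trace_mx11 -row_mul !mxE.
  by rewrite /D mulmxBr mxtraceB !tD gA; ring.
pose q e f := \sum_i \sum_j (E i e * E j f) *: (Th x *m Q i j *m E).
have qE e f h k : q e f h k =
    \sum_l Th x h l * (\sum_i E i e *: (E^T *m (\matrix_(j, k) Q i j l k) *m E)) f k.
  have BE l i : (E^T *m (\matrix_(j, k) Q i j l k) *m E) f k = \sum_j E j f * (Q i j *m E) l k.
    rewrite -mulmxA mxE; apply: eq_bigr => j _; rewrite trmxE; congr (_ * _).
    by rewrite mxE [RHS]mxE; apply: eq_bigr => p _; rewrite mxE.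
  transitivity (\sum_i \sum_j \sum_l E i e * E j f * (Th x h l * (Q i j *m E) l k)).
    rewrite /q summxE; apply: eq_bigr => i _; rewrite summxE; apply: eq_bigr => j _.
    by rewrite scalemxE -mulmxA mxE mulr_sumr.
  under eq_bigr do rewrite exchange_big /=.
  rewrite exchange_big /=; apply: eq_bigr => l _; rewrite summxE mulr_sumr; apply: eq_bigr => i _.
  rewrite scalemxE BE !mulr_sumr; apply: eq_bigr => j _; ring.
have q0 : forall f h, \sum_e q e f e h = 0.
  apply: selfdual_ricci_flat.
  - move=> e f; rewrite /q exchange_big -sumrN; apply: eq_bigr => i _; rewrite -sumrN.
    by apply: eq_bigr => j _; rewrite Q12 mulmxN mulNmx scalerN mulrC.
  - have pp : phi x != 0 by rewrite gt_eqF ?phi0.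
    have sk i j : (Th x *m Q i j *m E)^T = - (Th x *m Q i j *m E).
      have TE : E^T *m (Th x)^T = 1%:M by rewrite -trmx_mul mulmxV // trmx1.
      have X : Th x *m Q i j *m E = (phi x)^-1 *: (E^T *m (g x *m Q i j) *m E).
        rewrite gE // -!scalemxAl -scalemxAr -scalemxAl scalerA mulVf // scale1r.
        by rewrite !mulmxA TE mul1mx.
      rewrite X; move: (g x *m Q i j) (Q34 i j) => Z ZT.
      by rewrite trmxZ !trmx_mul trmxK ZT mulNmx mulmxN scalerN mulmxA.
    move=> e f; rewrite /q raddf_sum -sumrN; apply: eq_bigr => i _; rewrite raddf_sum -sumrN.
    by apply: eq_bigr => j _ /=; rewrite trmxZ sk scalerN.
  - move=> e f k h; rewrite !qE -!big_split big1 //= => l _; rewrite -!mulrDr.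
    pose A i : 'M[R]_4 := \matrix_(j, k) Q i j l k.
    have cA a b c : A a b c + A b c a + A c a b = 0.
      by rewrite -(QB a b c l) [A a b c]mxE [A b c a]mxE [A c a b]mxE.
    by rewrite -[RHS](mulr0 (Th x h l)); congr (_ * _); exact: (cyclic_congr E cA e f k).
  - move=> K uK e f; rewrite /q mulmx_sumr raddf_sum big1 // => i _.
    rewrite mulmx_sumr raddf_sum big1 // => j _ /=.
    rewrite -scalemxAr mxtraceZ mulmxA mulmxA -coframe_mul // mxtrace_mulC !mulmxA mulVmx // mul1mx.
    by rewrite QK // mulr0.
pose RQ : 'M[R]_4 := \matrix_(j, k) \sum_i Q i j i k.
have RQ0 : E^T *m RQ *m E = 0.
  apply/matrixP => f h; rewrite [RHS]mxE -(q0 f h).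
  under [RHS]eq_bigr do rewrite qE.
  rewrite exchange_big /= mxE.
  transitivity (\sum_l (E^T *m (\matrix_(j, k) Q l j l k) *m E) f h).
    rewrite -summxE -mulmx_suml -mulmx_sumr mxE; apply: eq_bigr => p _; congr (_ * _).
    rewrite mxE [RHS]mxE; apply: eq_bigr => r _; congr (_ * _).
    by rewrite summxE [LHS]mxE; apply: eq_bigr => l _; rewrite [RHS]mxE.
  apply: eq_bigr => l _.
  transitivity (\sum_i (E *m Th x) i l * (E^T *m (\matrix_(j, k) Q i j l k) *m E) f h).
    rewrite mulVmx // (bigD1 l) //= [(_%:M) _ _]mxE eqxx mul1r big1 ?addr0 // => i /negPf il.
    by rewrite [(_%:M) _ _]mxE il mul0r.
  under [RHS]eq_bigr do rewrite summxE mulr_sumr.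
  rewrite exchange_big /=; apply: eq_bigr => i _; rewrite [(E *m _) _ _]mxE mulr_suml.
  by apply: eq_bigr => e _; rewrite scalemxE; ring.
have : RQ = 0.
  have TE : (Th x)^T *m E^T = 1%:M by rewrite -trmx_mul mulVmx // trmx1.
  have ET : E *m Th x = 1%:M by rewrite mulVmx.
  have := congr1 (fun M => (Th x)^T *m M *m Th x) RQ0.
  rewrite mulmx0 mul0mx => <-.
  by rewrite !mulmxA TE mul1mx -mulmxA ET mulmx1.
move=> RQE; apply/matrixP => j k; rewrite scalemxE ricciE.
have := congr1 (fun M : 'M[R]_4 => M j k) RQE; rewrite [RQ _ _]mxE [RHS]mxE.
under eq_bigr do rewrite QE eqxx mul1r.
rewrite sumrB -mulr_sumr sumrB.
have -> : \sum_(i < 4) (i == j)%:R * g x i k = g x j k.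
  by rewrite (bigD1 j) //= eqxx mul1r big1 ?addr0 // => i /negPf ->; rewrite mul0r.
rewrite sumr_const card_ord -mulr_natl -/G0; lra.
Qed.

Lemma coframe_einstein x : U x ->
  [/\ ricci G0 x = (6 * lam) *: g x, scalar_curvature g (fun=> 0) x = 24 * lam
    & schouten g x = lam *: g x].
Proof. by move=> Ux; have [] := einstein_schouten gR Ux (coframe_ricci Ux); split=> //; exact: coframe_ricci. Qed.

(** For an Einstein metric the Weyl curvature is the curvature minus its constant
    part, which vanishes on the antiselfdual forms. *)
Lemma coframe_selfdual o : (forall x, U x -> o x * `|\det (Th x)| = - \det (Th x)) ->
  selfdual U o g.
Proof.
move=> oT x Ux a [aT aS] k l /=; have uTx := uT Ux; have [_ _ sch] := coframe_einstein Ux.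
have dT : \det (Th x) != 0 by rewrite -unitfE -unitmxE.
have p0 : phi x != 0 by rewrite gt_eqF ?phi0.
pose E := invmx (Th x); pose b := E^T *m a *m E.
have bT : b^T = - b by rewrite /b !trmx_mul trmxK aT mulNmx mulmxN mulmxA.
have aE : a = (Th x)^T *m b *m Th x.
  by rewrite /b !mulmxA -trmx_mul mulVmx // trmx1 mul1mx -mulmxA mulVmx // mulmx1.
have bS : star b = - b.
  have := aS; rewrite {1}aE (hodge_frame o (gE Ux) (phi0 Ux) uTx bT) oT // mulNr divff //.
  rewrite opprK scale1r aE => /(congr1 (fun M => E^T *m M *m E)).
  have TE : E^T *m (Th x)^T = 1%:M by rewrite -trmx_mul mulmxV // trmx1.
  have ET : Th x *m E = 1%:M by rewrite mulmxV.
  by rewrite mulmxN mulNmx !mulmxA !TE !mul1mx -!(mulmxA _ (Th x)) !ET !mulmx1.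
have [c1 [c2 [c3 bE]]] : exists c1 c2 c3, b = c1 *: K1 R + c2 *: K2 R + c3 *: K3 R.
  by do 3 eexists; exact: star_span.
pose j := (phi x)^-1 *: (c1 *: J (K1 R) x + c2 *: J (K2 R) x + c3 *: J (K3 R) x).
have aj : a = g x *m j.
  rewrite /j -scalemxAr !mulmxDr -!scalemxAr !metric_endo // aE bE.
  rewrite !(scalerA c1, scalerA c2, scalerA c3) !(mulrC _ (phi x)) -!(scalerA (phi x)) -!scalerDr.
  rewrite scalerA mulVf // scale1r !(mulmxDr, mulmxDl) -!(scalemxAr, scalemxAl).
  by [].
have jT : (g x *m j)^T = - (g x *m j) by rewrite -aj.
have := weyl_contraction oU gR k l Ux sch jT; rewrite -aj => /= -> {aE aS aT}.
rewrite aj.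
have U1 : unitK (K1 R) by constructor 1.
have U2 : unitK (K2 R) by constructor 2.
have U3 : unitK (K3 R) by constructor 3.
rewrite /j -scalemxAl -scalemxAr mxtraceZ !mulmxDl !mulmxDr -!scalemxAl -!scalemxAr !mxtraceD !mxtraceZ.
rewrite !coframe_trace // !(scalemxE, addmxE).
have S K : unitK K -> (g x *m J K x) l k = - (g x *m J K x) k l.
  move=> uK; rewrite -trmxE trmx_mul (metric_sym gR Ux) endo_metric ?oppmxE //.
  by case: uK => ->; rewrite ?K1T ?K2T ?K3T.
by rewrite !S //; ring.
Qed.

Lemma coframe_complex K o : unitK K -> (forall x, U x -> o x * `|\det (Th x)| = - \det (Th x)) ->
  antiselfdual_complex U o g (J K).
Proof.
move=> uK oT; have KT : K^T = - K by case: uK => ->; rewrite ?K1T ?K2T ?K3T.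
have KK : K *m K = - 1%:M by case: uK => ->; rewrite ?K11 ?K22 ?K33.
have J2 x : U x -> J K x *m J K x = - 1%:M.
  by move=> Ux; rewrite coframe_endoM // KK coframe_endoN /J mulmx1 mulVmx ?uT.
split.
- split=> //; first exact: coframe_endo_smooth.
  exact: (parallel_nijenhuis oU gR (coframe_endo_smooth K) J2 (coframe_parallel uK)).
- move=> x Ux; rewrite endo_metric // mulNmx -mulmxA J2 // mulmxN mulmx1 opprK //.
- move=> x Ux; have uTx := uT Ux.
  have dT : \det (Th x) != 0 by rewrite -unitfE -unitmxE.
  rewrite /form_of endo_metric // metric_endo //.
  have -> : - (phi x *: ((Th x)^T *m K *m Th x)) = (Th x)^T *m (- phi x *: K) *m Th x.
    by rewrite -scalemxAr -scalemxAl scaleNr.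
  have bT : (- phi x *: K)^T = - (- phi x *: K) by rewrite trmxZ KT scalerN.
  split; first by rewrite !trmx_mul trmxK bT mulNmx mulmxN mulmxA.
  rewrite (hodge_frame o (gE Ux) (phi0 Ux) uTx bT) oT // mulNr divff // opprK scale1r.
  have -> : star (- phi x *: K) = - (- phi x *: K).
    have SZ c M : star (c *: M) = c *: star M.
      by apply/matrixP; apply: forall_ord4; apply: forall_ord4;
        rewrite scalemxE !star_entry /= ?scalemxE; ring.
    by rewrite SZ; case: uK => ->; rewrite star_K scalerN.
  by rewrite mulmxN mulNmx.
Qed.

Lemma coframe_hypercomplex o : (forall x, U x -> o x * `|\det (Th x)| = - \det (Th x)) ->
  compatible_hypercomplex U o g (J (K1 R)) (J (K2 R)) (J (K3 R)).
Proof.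
move=> oT; split; try (apply: coframe_complex => //; by [constructor 1|constructor 2|constructor 3]).
by move=> x /coframe_hyper[[? _] [[? _] [? _]]].
Qed.

End Parallel.
End HypercomplexCoframe.

(** * Orthonormal coframes in dimension three *)

Lemma coframe_curv (R : realType) n (S Mi Mj Ai Aj dSi dSj dMi dMj dAi dAj dd : 'M[R]_n) :
  S *m Mi = dSi + Ai *m S -> S *m Mj = dSj + Aj *m S ->
  dSj *m Mi + S *m dMi = dd + (dAi *m S + Ai *m dSj) ->
  dSi *m Mj + S *m dMj = dd + (dAj *m S + Aj *m dSi) ->
  S *m (dMj - dMi + (Mi *m Mj - Mj *m Mi)) = (dAj - dAi + (Ai *m Aj - Aj *m Ai)) *m S.
Proof.
move=> Hi Hj Ei Ej; have {Hi} Si : dSi = S *m Mi - Ai *m S by rewrite Hi addrK.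
have {Hj} Sj : dSj = S *m Mj - Aj *m S by rewrite Hj addrK.
have Zi : S *m dMi = dd + (dAi *m S + Ai *m dSj) - dSj *m Mi by rewrite -Ei addrC addKr.
have Zj : S *m dMj = dd + (dAj *m S + Aj *m dSi) - dSi *m Mj by rewrite -Ej addrC addKr.
rewrite mulmxDr mulmxBr Zi Zj Si Sj {Ei Ej Zi Zj Si Sj}.
rewrite !(mulmxDl, mulmxDr, mulmxN, mulNmx, mulmxA).
by apply/matrixP => a b; rewrite !(addmxE, oppmxE); ring.
Qed.

Lemma coframe_metric_conn (R : realType) n (S M dS A : 'M[R]_n) v :
  S *m M = dS + A *m S -> A + A^T = v *: 1%:M ->
  dS^T *m S + S^T *m dS = M^T *m (S^T *m S) + S^T *m S *m M - v *: (S^T *m S).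
Proof.
move=> SM AT; have MT : M^T *m S^T = dS^T + S^T *m A^T by rewrite -trmx_mul SM trmxD trmx_mul.
have -> : v *: (S^T *m S) = S^T *m (A + A^T) *m S by rewrite AT -scalemxAr mulmx1 -scalemxAl.
rewrite mulmxA MT -(mulmxA S^T S M) SM !(mulmxDl, mulmxDr) !mulmxA.
by apply/matrixP => a b; rewrite !(addmxE, oppmxE); ring.
Qed.

Lemma gram_posdef (R : realType) n (T : 'M[R]_n) (v : 'rV[R]_n) :
  T \in unitmx -> v != 0 -> 0 < (v *m (T^T *m T) *m v^T) 0 0.
Proof.
move=> uT v0; pose u := v *m T^T.
have -> : v *m (T^T *m T) *m v^T = u *m u^T by rewrite /u trmx_mul trmxK !mulmxA.
have u0 : u != 0.
  apply: contra v0 => /eqP u0; have uT' : T^T \in unitmx by rewrite unitmx_tr.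
  by rewrite -(mulmxK uT' v) -/u u0 mul0mx.
rewrite mxE; under eq_bigr do rewrite trmxE.
rewrite lt_def sumr_ge0 ?andbT; last by move=> i _; rewrite -expr2 sqr_ge0.
apply: contra u0; rewrite psumr_eq0 => [/allP z|i _]; last by rewrite -expr2 sqr_ge0.
apply/eqP/rowP => i; have /= := z i (mem_index_enum _); rewrite mulf_eq0 orbb => /eqP ->.
by rewrite mxE.
Qed.

Section Dimension3.
Variable R : realType.

Lemma forall_ord3 (P : 'I_3 -> Prop) : P f0 -> P f1 -> P f2 -> forall i, P i.
Proof.
move=> P0 P1 P2 [[|[|[|i]]] Hi] //;
  [rewrite (_ : Ordinal Hi = f0)|rewrite (_ : Ordinal Hi = f1)
  |rewrite (_ : Ordinal Hi = f2)] => //; exact: val_inj.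
Qed.

Lemma sum3 (V : zmodType) (F : 'I_3 -> V) : \sum_i F i = F f0 + F f1 + F f2.
Proof.
rewrite !big_ord_recl big_ord0 addr0 !addrA.
by congr (F _ + F _ + F _); exact: val_inj.
Qed.

Lemma frame_contraction (T S : 'I_3 -> 'I_3 -> R) (s dw p : 'I_3 -> R) (C : 'I_3 -> 'I_3 -> R)
    (G F : 'I_3 -> 'I_3 -> 'I_3 -> R) :
  (forall i a b, F i a b = dw i * (a == b)%:R - p i * C a b + \sum_c S c i * G c a b) ->
  \sum_i \sum_a \sum_b T i a * (F i a b * s b) =
  \sum_i dw i * (\sum_a T i a * s a) + \sum_a \sum_b
    ((\sum_c (\sum_i S c i * T i a) * G c a b) * s b - (\sum_i T i a * p i) * C a b * s b).
Proof.
move=> FE; transitivity (\sum_i \sum_a \sum_b T i a *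
    ((dw i * (a == b)%:R - p i * C a b + \sum_c S c i * G c a b) * s b)).
  by apply: eq_bigr => i _; apply: eq_bigr => a _; apply: eq_bigr => b _; rewrite FE.
by rewrite !sum3 /=; ring.
Qed.

Definition mx3 (s : seq (seq R)) : 'M[R]_3 := \matrix_(i, j) nth 0 (nth [::] s i) j.

(** The matrix of the cross product by [u]. *)
Definition crossmx (u : 'I_3 -> R) : 'M[R]_3 :=
  mx3 [:: [:: 0; - u f2; u f1]; [:: u f2; 0; - u f0]; [:: - u f1; u f0; 0]].

Lemma crossmxE (u : 'I_3 -> R) i j : crossmx u i j =
  nth 0 (nth [::] [:: [:: 0; - u f2; u f1]; [:: u f2; 0; - u f0]; [:: - u f1; u f0; 0]] i) j.
Proof. by rewrite mxE. Qed.

Definition crossmul (S : 'M[R]_3) i : 'M[R]_3 := crossmx (S^~ i) *m S.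

Lemma crossmulE S i a j : crossmul S i a j =
  nth 0 [:: S f1 i * S f2 j - S f2 i * S f1 j; S f2 i * S f0 j - S f0 i * S f2 j;
            S f0 i * S f1 j - S f1 i * S f0 j] a.
Proof.
rewrite /crossmul mxE sum3 !crossmxE; move: a; apply: forall_ord3; rewrite /=; ring.
Qed.

Lemma crossmul_anti S i j a : crossmul S j a i = - crossmul S i a j.
Proof. by rewrite !crossmulE; move: a; apply: forall_ord3; rewrite /=; ring. Qed.

Lemma crossmx_skew u : (crossmx u)^T = - crossmx u.
Proof.
by apply/matrixP; apply: forall_ord3; apply: forall_ord3; rewrite trmxE oppmxE !crossmxE /=; ring.
Qed.

(** In an orthonormal frame the volume form is the determinant. *)
Lemma volume_coframe (h : 'rV[R]_3 -> 'M[R]_3) x (X S : 'M[R]_3) a i j :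
  h x = S^T *m S -> X *m S^T = 1%:M ->
  volume (fun=> 1) h x (tnth [tuple row a X; coord_vec R i; coord_vec R j]) =
  `|\det S| / \det S * crossmul S i a j.
Proof.
move=> hE XS; have dS : \det S != 0.
  have := congr1 determinant XS; rewrite det_mulmx det_tr det1 => H.
  by apply/eqP => d0; move: H; rewrite d0 mulr0 => /eqP; rewrite eq_sym oner_eq0.
rewrite /volume mul1r hE det_mulmx det_tr -expr2 sqrtr_sqr -mulrA; congr (_ * _).
apply: (mulfI dS); rewrite mulrA divff // mul1r.
set M := \matrix_l _; have -> : \det S * \det M = \det (M *m S^T).
  by rewrite det_mulmx det_tr mulrC.
have ME b : row b (M *m S^T) = tnth [tuple delta_mx 0 a; row i S^T; row j S^T] b.
  rewrite row_mul rowK; move: b; apply: forall_ord3; rewrite !(tnth_nth 0) /=.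
  - by rewrite -row_mul XS row1.
  - by rewrite -rowE.
  - by rewrite -rowE.
have E b c : (M *m S^T) b c = tnth [tuple delta_mx 0 a; row i S^T; row j S^T] b 0 c.
  by rewrite -ME [RHS]mxE.
rewrite det3 !E !(tnth_nth 0) /= crossmulE !mxE ?eqxx.
by move: a {M ME E}; apply: forall_ord3; rewrite /=; ring.
Qed.

Variable U : set 'rV[R]_3.
Hypothesis oU : open U.
Variables (h : 'rV[R]_3 -> 'M[R]_3) (w : 'rV[R]_3 -> 'rV[R]_3) (k : 'rV[R]_3 -> R).
Let Gw := weyl_connection h w.

(** d sigma_a = - w /\ sigma_a + 2 k sigma_b /\ sigma_c for the rows of S. *)
Definition structure3 (S : 'rV[R]_3 -> 'M[R]_3) := forall x, U x -> forall a i j,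
  partial i (fun y => S y a j) x - partial j (fun y => S y a i) x =
  - (w x 0 i * S x a j - w x 0 j * S x a i) + 2 * k x * crossmul (S x) i a j.

Lemma cov_weightless_lower X i j x : riemannian U h -> smooth_mx U X -> U x ->
  \sum_l h x j l * cov_weightless h w X i l x =
  (dmx i (fun y => X y *m h y) x - X x *m h x *m conn_mx Gw i x + w x 0 i *: (X x *m h x)) 0 j.
Proof.
move=> hR sX Ux; have hS p q : h x p q = h x q p by rewrite -{1}(metric_sym hR Ux) trmxE.
rewrite (dmx_mul oU i sX (metric_smooth hR) Ux) (weyl_metric oU w hR i Ux) -/Gw.
pose N : 'rV[R]_3 := dmx i X x + X x *m (conn_mx Gw i x)^T - w x 0 i *: X x.
have -> : \sum_l h x j l * cov_weightless h w X i l x = (N *m h x) 0 j.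
  rewrite mxE; apply: eq_bigr => l _; rewrite hS mulrC; congr (_ * _).
  rewrite /N !addmxE oppmxE scalemxE mxE /cov_weightless -/Gw; congr (_ + _ - _).
  by rewrite mxE; apply: eq_bigr => q _; rewrite !mxE mulrC.
apply: (congr1 (fun M : 'rV[R]_3 => M 0 j)); rewrite /N !(mulmxDl, mulmxDr, mulmxN, mulNmx) -!scalemxAl -!scalemxAr !mulmxA.
by apply/rowP => v; rewrite !(addmxE, oppmxE, scalemxE); ring.
Qed.

(** Lowering the index in the equation of the congruences and alternating it gives
    the exterior derivative of the dual coframe. *)
Lemma congruence_structure3 (X : 'rV[R]_3 -> 'M[R]_3) : riemannian U h -> smooth_mx U X ->
  (forall y, U y -> X y *m h y *m (X y)^T = 1%:M) ->
  (forall a, congruence U h w k (fun y => row a (X y))) ->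
  let S y := X y *m h y in
  (forall y, U y -> h y = (S y)^T *m S y) /\
  forall x, U x -> forall a i j,
  partial i (fun y => S y a j) x - partial j (fun y => S y a i) x =
  - (w x 0 i * S x a j - w x 0 j * S x a i)
  + 2 * k x * (`|\det (S x)| / \det (S x) * crossmul (S x) i a j).
Proof.
move=> hR sX XhX cX S.
have XS y : U y -> X y *m (S y)^T = 1%:M.
  by move=> Uy; rewrite /S trmx_mul (metric_sym hR Uy) mulmxA XhX.
have hE y : U y -> h y = (S y)^T *m S y.
  by move=> Uy; have := mulmx1C (XS y Uy); rewrite {2}/S mulmxA => ->; rewrite mul1mx.
split=> // x Ux a i j.
have E p q : k x * (`|\det (S x)| / \det (S x) * crossmul (S x) p a q) =
    partial p (fun y => S y a q) x - \sum_m S x a m * Gw m p q x + w x 0 p * S x a q.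
  rewrite -(volume_coframe a p q (hE x Ux) (XS x Ux)); have [sr cr] := cX a.
  rewrite -(cr x Ux p q) cov_weightless_lower // -row_mul -/(S x).
  rewrite !addmxE oppmxE scalemxE mxE [X in _ - X + _]mxE [row _ _ _ _]mxE; congr (_ - _ + _).
    by apply: (partial_eq oU _ Ux) => y _; rewrite -row_mul mxE.
  by apply: eq_bigr => m _; rewrite !mxE.
have tf : \sum_m S x a m * Gw m i j x = \sum_m S x a m * Gw m j i x.
  by apply: eq_bigr => m _; congr (_ * _); exact: (weyl_torsion_free oU w hR).
have Eij := E i j; have Eji := E j i; move: Eij Eji; rewrite tf (crossmul_anti _ i j a).
move: (\sum_m _) (crossmul _ _ _ _) (_ / _) => s c d.
have [q qE] : exists q : 'I_3 -> 'I_3 -> R, forall p r, partial p (fun y => S y a r) x = q p r.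
  by eexists => p r.
by rewrite !qE; lra.
Qed.

Section FromCoframe.
Variable S : 'rV[R]_3 -> 'M[R]_3.
Hypotheses (sS : smooth_mx U S) (sw : smooth_mx U w) (sk : smooth U k).
Hypotheses (dS : forall x, U x -> 0 < \det (S x)) (hE : forall x, U x -> h x = (S x)^T *m S x).
Hypothesis strS : structure3 S.

Lemma coframe3_unit x : U x -> S x \in unitmx.
Proof. by move=> Ux; rewrite unitmxE unitfE gt_eqF // dS. Qed.

Lemma coframe3_riemannian : riemannian U h.
Proof.
split=> [|x Ux].
  by apply: (eq_smooth_mx oU _ (smooth_mx_mul oU (smooth_mx_tr oU sS) sS)) => x Ux; rewrite hE.
rewrite hE //; split=> [|v v0]; first by rewrite trmx_mul trmxK.
exact: gram_posdef (coframe3_unit Ux) v0.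
Qed.
Let hR := coframe3_riemannian.

(** The Weyl connection in an oriented orthonormal coframe. *)
Definition twist_form i x : 'M[R]_3 := w x 0 i *: 1%:M - k x *: crossmx ((S x)^~ i).

Lemma crossmx_smooth i : smooth_mx U (fun y => crossmx ((S y)^~ i)).
Proof.
have z : smooth U (fun=> 0) := smooth_cst oU 0.
have sSN a := smooth_opp oU (sS a i).
by apply: forall_ord3; apply: forall_ord3;
  (apply: (eq_smooth oU) => [y _|]; first by rewrite crossmxE) => /=; first [exact: z|exact: sS|exact: sSN].
Qed.

Lemma dmx_crossmx i j x : U x ->
  dmx i (fun y => crossmx ((S y)^~ j)) x = crossmx (fun c => partial i (fun y => S y c j) x).
Proof.
move=> Ux; apply/matrixP => a b; rewrite crossmxE mxE.
rewrite (partial_eq oU i Ux (fun y _ => crossmxE ((S y)^~ j) a b)).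
by move: a b; apply: forall_ord3; apply: forall_ord3; rewrite /= ?partial_cst // (partialN i (sS _ j) Ux).
Qed.

Lemma twist_smooth i : smooth_mx U (twist_form i).
Proof.
apply: (smooth_mx_add oU).
  by apply: (smooth_mx_scale oU); [exact: sw|exact: (smooth_mx_cst oU)].
apply: (smooth_mx_opp oU); apply: (smooth_mx_scale oU); first exact: sk.
exact: crossmx_smooth.
Qed.

Lemma weyl_coframe i x : U x ->
  S x *m conn_mx Gw i x = dmx i S x + twist_form i x *m S x.
Proof.
move=> Ux; pose M i y := invmx (S y) *m (dmx i S y + twist_form i y *m S y).
pose Gam : connection R 3 := fun l p q y => M p y l q.
have ME p y : conn_mx Gam p y = M p y by apply/matrixP => a b; rewrite mxE.
have SM p y : U y -> S y *m M p y = dmx p S y + twist_form p y *m S y.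
  by move=> Uy; rewrite /M mulKVmx // coframe3_unit.
have E p y a b : (dmx p S y + twist_form p y *m S y) a b =
    partial p (fun z => S z a b) y + w y 0 p * S y a b - k y * crossmul (S y) p a b.
  rewrite addmxE [X in X + _]mxE /twist_form mulmxBl -!scalemxAl mul1mx addmxE oppmxE !scalemxE.
  by rewrite addrA.
have GE l p q y : U y -> Gam l p q y = Gw l p q y.
  apply: (weyl_unique hR) => [{l p q y}|].
    move=> y p q z Uz; have uz := coframe3_unit Uz.
    have : S z *m col q (M p z) = S z *m col p (M q z).
      have cm (A B : 'M[R]_3) c : A *m col c B = col c (A *m B) by rewrite !colE mulmxA.
      rewrite !cm !SM //; apply/colP => a.
      rewrite [LHS]mxE [RHS]mxE !E (crossmul_anti (S z) p q a).
      by have := strS Uz a p q; lra.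
    move/(can_inj (mulKmx uz)) => /(congr1 (fun v : 'cV[R]_3 => v y 0)).
    by rewrite [X in X = _ -> _]mxE [X in _ = X -> _]mxE.
  move=> {l p q y} p z Uz; rewrite (eq_dmx oU p Uz hE) (dmx_mul oU p (smooth_mx_tr oU sS) sS Uz).
  rewrite (dmx_tr oU) // ME hE //; apply: (coframe_metric_conn (SM p z Uz)).
  rewrite /twist_form trmxD trmxN !trmxZ trmx1 crossmx_skew; apply/matrixP => a b.
  by rewrite !(addmxE, oppmxE, scalemxE); ring.
have -> : conn_mx Gw i x = M i x.
  by rewrite -ME; apply/matrixP => a b; rewrite !mxE GE.
exact: SM.
Qed.

Lemma coframe3_congruence a :
  congruence U h w k (fun y => row a ((invmx (S y))^T)).
Proof.
have sX : smooth_mx U (fun y => (invmx (S y))^T).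
  apply: (smooth_mx_tr oU) => p q; exact: (smooth_invmx oU coframe3_unit sS).
have sXa : smooth_mx U (fun y => row a ((invmx (S y))^T)).
  by move=> p q; apply: (eq_smooth oU _ (sX a q)) => y _; rewrite [RHS]mxE.
split=> // x Ux i j; have uS := coframe3_unit Ux.
have XhE y : U y -> row a ((invmx (S y))^T) *m h y = row a (S y).
  by move=> Uy; rewrite -row_mul hE // mulmxA -trmx_mul mulmxV ?coframe3_unit // trmx1 mul1mx.
rewrite cov_weightless_lower // XhE // (eq_dmx oU i Ux XhE) (volume_coframe a i j (hE Ux)); last first.
  by rewrite -trmx_mul mulmxV // trmx1.
rewrite ger0_norm ?ltW ?dS // divff ?gt_eqF ?dS // mul1r -row_mul weyl_coframe //.
rewrite /twist_form mulmxBl -!scalemxAl mul1mx -/(crossmul (S x) i) !addmxE oppmxE scalemxE.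
have -> : dmx i (fun y => row a (S y)) x 0 j = dmx i S x a j.
  by rewrite mxE [RHS]mxE; apply: (partial_eq oU _ Ux) => y _; rewrite mxE.
have rE (A : 'M[R]_3) : row a A 0 j = A a j by rewrite mxE.
rewrite !rE !addmxE oppmxE !scalemxE; ring.
Qed.

(** S R = F S, with F the curvature of the twist form. *)
Lemma twist_curv i j x : U x -> S x *m curv_mx Gw i j x =
  (dmx i (twist_form j) x - dmx j (twist_form i) x
   + (twist_form i x *m twist_form j x - twist_form j x *m twist_form i x)) *m S x.
Proof.
move=> Ux; have sG a := smooth_conn_mx oU a (weyl_smooth oU hR sw).
have D a b : dmx b S x *m conn_mx Gw a x + S x *m dmx b (conn_mx Gw a) x =
    dmx b (dmx a S) x + (dmx b (twist_form a) x *m S x + twist_form a x *m dmx b S x).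
  have sA := twist_smooth a; have sdS : smooth_mx U (dmx a S) by exact: (smooth_dmx oU).
  rewrite -(dmx_mul oU b sS (sG a) Ux) (eq_dmx oU b Ux (weyl_coframe a)).
  by rewrite (dmxD oU b sdS (smooth_mx_mul oU sA sS) Ux) (dmx_mul oU b sA sS Ux).
have Dij := D j i; have Dji := D i j; rewrite (dmxC oU j i sS Ux) in Dji.
rewrite (curv_mxE oU) //.
have Wi := weyl_coframe i Ux; have Wj := weyl_coframe j Ux.
exact: (coframe_curv Wi Wj Dji Dij).
Qed.

(** The connection form is [w] times the identity minus [k] times the cross products by
    the columns of the coframe; its curvature only contains derivatives of [k], of
    [w] and of the coframe, and the structure equations differentiated once more relate them. *)
Lemma coframe3_einstein_weyl : einstein_weyl U h w.
Proof.
move=> x Ux; have uS := coframe3_unit Ux; pose T := invmx (S x).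
have ric : sym_ricci Gw x = (2 * k x ^+ 2) *: h x.
  pose dw i j := partial i (fun y => w y 0 j) x - partial j (fun y => w y 0 i) x.
  pose p i := partial i k x - k x * w x 0 i.
  pose G j c a b := p j * crossmx (fun d => (d == c)%:R) a b - k x ^+ 2 *
    crossmx (fun d => nth 0 [:: (f1 == c)%:R * S x f2 j - (f2 == c)%:R * S x f1 j;
      (f2 == c)%:R * S x f0 j - (f0 == c)%:R * S x f2 j;
      (f0 == c)%:R * S x f1 j - (f1 == c)%:R * S x f0 j] d) a b.
  pose F i j := dmx i (twist_form j) x - dmx j (twist_form i) x
   + (twist_form i x *m twist_form j x - twist_form j x *m twist_form i x).
  have dA i j a b : dmx i (twist_form j) x a b = partial i (fun y => w y 0 j) x * (a == b)%:R
     - (partial i k x * crossmx ((S x)^~ j) a b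
        + k x * crossmx (fun c => partial i (fun y => S y c j) x) a b).
    have s1 := smooth_mx_cst oU (1%:M : 'M[R]_3).
    rewrite (dmxB oU i (smooth_mx_scale oU (sw 0 j) s1) (smooth_mx_scale oU sk (crossmx_smooth j)) Ux).
    rewrite (dmxZ oU i (sw 0 j) s1 Ux) (dmxZ oU i sk (crossmx_smooth j) Ux) dmx_crossmx // dmx_cst.
    by rewrite scaler0 addr0 addmxE oppmxE addmxE !scalemxE [1%:M _ _]mxE.
  have FE i j a b : F i j a b = dw i j * (a == b)%:R - p i * crossmx ((S x)^~ j) a b
      + \sum_c S x c i * G j c a b.
    have tE q u v : twist_form q x u v = w x 0 q * (u == v)%:R - k x * crossmx ((S x)^~ q) u v.
      by rewrite addmxE oppmxE !scalemxE [1%:M _ _]mxE.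
    have gen (A B C D : 'M[R]_3) : (A - B + (C - D)) a b = A a b - B a b + (C a b - D a b).
      by rewrite !(addmxE, oppmxE).
    have mm (A B : 'M[R]_3) : (A *m B) a b = A a f0 * B f0 b + A a f1 * B f1 b + A a f2 * B f2 b.
      by rewrite mxE sum3.
    rewrite /F gen !dA !mm !sum3 !tE /G /dw /p !crossmxE; have st c := strS Ux c i j.
    have st' c : partial i (fun y => S y c j) x = partial j (fun y => S y c i) x
        - (w x 0 i * S x c j - w x 0 j * S x c i) + 2 * k x * crossmul (S x) i c j.
      by rewrite -addrA -st addrC subrK.
    rewrite !st' !crossmulE /=.
    have [q qE] : exists q : 'I_3 -> 'I_3 -> R, forall l c, partial l (fun y => S y c i) x = q l c.
      by eexists => l c.
    rewrite !qE.
    have [q1 q1E] : exists q1 : 'I_3 -> 'I_3 -> R, forall l c, partial l (fun y => w y 0 c) x = q1 l c.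
      by eexists => l c.
    have [q2 q2E] : exists q2 : 'I_3 -> R, forall l, partial l k x = q2 l by eexists => l.
    rewrite !q1E !q2E; move: (w x) (k x) (S x) => w' k' S'.
    clear gen mm; move: a b.
    by apply: forall_ord3; apply: forall_ord3; rewrite /=; ring.
  have TS i l : \sum_a T i a * S x a l = (i == l)%:R.
    by have := congr1 (fun M : 'M[R]_3 => M i l) (mulVmx uS); rewrite mxE [X in _ = X]mxE.
  have ST c a : \sum_i S x c i * T i a = (c == a)%:R.
    by have := congr1 (fun M : 'M[R]_3 => M c a) (mulmxV uS); rewrite mxE [X in _ = X]mxE.
  pose P a := \sum_i T i a * p i.
  have ricE j l : ricci Gw x j l = dw l j + \sum_a \sum_b
      (G j a a b * S x b l - P a * crossmx ((S x)^~ j) a b * S x b l).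
    have -> : ricci Gw x j l = \sum_i curv_mx Gw i j x i l.
      by rewrite mxE; apply: eq_bigr => i _; rewrite mxE.
    have RE i : curv_mx Gw i j x i l = \sum_a \sum_b T i a * (F i j a b * S x b l).
      rewrite -(mulKmx uS (curv_mx Gw i j x)) twist_curv // -/(F i j) mxE; apply: eq_bigr => a _.
      by rewrite mxE mulr_sumr.
    under eq_bigr do rewrite RE.
    rewrite (frame_contraction T (fun b => S x b l) (fun i a b => FE i j a b)).
    congr (_ + _).
      under eq_bigr do rewrite TS.
      by rewrite (bigD1 l) //= eqxx mulr1 big1 ?addr0 // => i /negPf ->; rewrite mulr0.
    apply: eq_bigr => a _; apply: eq_bigr => b _; congr (_ * _ - _).
    under eq_bigr do rewrite ST.
    by rewrite (bigD1 a) //= eqxx mul1r big1 ?addr0 // => i /negPf ->; rewrite mul0r.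
  apply/matrixP => j l; rewrite /sym_ricci !scalemxE addmxE trmxE !ricE hE // mxE.
  have -> : dw l j = - dw j l by rewrite /dw opprB.
  rewrite !sum3 !trmxE /G !crossmxE /=; move: (dw j l) (P) (p) (k x) (S x) => d P' p' k' S'.
  by field.
rewrite /scalar_curvature -/Gw ric -scalemxAr mulVmx ?(metric_unit hR) // mxtraceZ mxtrace1.
by rewrite -scalerBl (_ : _ - _ = 0) ?scale0r //; field.
Qed.

(** The dual frame consists of the congruences. *)
Lemma coframe3_hyperCR : hyperCR U h w k.
Proof.
split=> //; first exact: coframe3_einstein_weyl.
move=> x Ux; exists U; split=> //; exists (fun a y => row a ((invmx (S y))^T)); split.
  move=> y Uy a b; have uS := coframe3_unit Uy.
  have : (invmx (S y))^T *m h y *m ((invmx (S y))^T)^T = 1%:M.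
    by rewrite hE // mulmxA -trmx_mul mulmxV // trmx1 mul1mx trmxK mulmxV.
  move/(congr1 (fun M : 'M[R]_3 => M a b)); rewrite [X in _ = X]mxE => <-.
  rewrite -row_mul tr_row [LHS]mxE [RHS]mxE; apply: eq_bigr => c _.
  by rewrite [row _ _ _ _]mxE [col _ _ _ _]mxE.
by move=> a; exact: coframe3_congruence.
Qed.

End FromCoframe.

End Dimension3.

(** * The metric on the total space *)

(* The names of the total space take precedence over the libraries here. *)
Import Defs.

Section OpenPositive.
Variables (R : realType) (n : nat).

Lemma open_pos (U : set 'rV[R]_n) f : open U -> smooth U f -> open [set x | U x /\ 0 < f x].
Proof.
move=> oU sf; rewrite openE => x [Ux fx].
have /cvgr_gt cf : {for x, continuous f}.
  by apply: differentiable_continuous; exact: (smooth_differentiable sf Ux).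
have nU : nbhs x U by exact: open_nbhs_nbhs.
by near=> y; split; [near: y|near: y; exact: cf].
Unshelve. all: by end_near. Qed.

End OpenPositive.

Section Total.
Variable R : realType.
Notation point4 := 'rV[R]_(3 + 1).

Lemma row4E (A : 'rV[R]_3) (B : 'rV[R]_1) :
  (forall i, (row_mx A B : 'rV[R]_4) 0 (@lshift 3 1 i) = A 0 i) /\
  (row_mx A B : 'rV[R]_4) 0 (@rshift 3 1 ord0) = B 0 0.
Proof. by split=> [i|]; [exact: (@row_mxEl R 1 3 1 A B 0 i)|exact: (@row_mxEr R 1 3 1 A B 0 0)]. Qed.

Lemma block4E (A : 'M[R]_3) : let B : 'M[R]_4 := @block_mx R 3 1 3 1 A 0 0 0 in
  (forall i j, B (@lshift 3 1 i) (@lshift 3 1 j) = A i j) /\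
  [/\ forall i, B (@lshift 3 1 i) (@rshift 3 1 ord0) = 0,
     forall j, B (@rshift 3 1 ord0) (@lshift 3 1 j) = 0
    & B (@rshift 3 1 ord0) (@rshift 3 1 ord0) = 0].
Proof.
split=> [i j|]; first exact: (@block_mxEul R 3 1 3 1 A 0 0 0 i j).
split=> [i|j|].
- by rewrite [LHS](@block_mxEur R 3 1 3 1 A 0 0 0 i ord0) mxE.
- by rewrite [LHS](@block_mxEdl R 3 1 3 1 A 0 0 0 ord0 j) mxE.
- by rewrite [LHS](@block_mxEdr R 3 1 3 1 A 0 0 0 ord0 ord0) mxE.
Qed.

Lemma partial_base (V : set 'rV[R]_3) (f : 'rV[R]_3 -> R) (p : point4) :
  smooth V f -> V (base p) ->
  (forall i, partial (@lshift 3 1 i) (fun q => f (base q)) p = partial i f (base p)) /\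
  partial (@rshift 3 1 ord0) (fun q => f (base q)) p = 0.
Proof.
move=> sf Vp; have df := smooth_differentiable sf Vp.
have bE (j : 'I_3) : (fun y : point4 => base y 0 j) = (fun y => y 0 (@lshift 3 1 j)).
  by apply/funext => y; rewrite /base mxE.
have dF (j : 'I_3) : differentiable (fun y : point4 => base y 0 j) p.
  by rewrite bE; exact: differentiable_coord.
have D (i : 'I_(3 + 1)) : partial i (fun q => f (base q)) p =
    \sum_(j < 3) (i == @lshift 3 1 j)%:R * partial j f (base p).
  have [_] := partial_comp i df dF; rewrite -partialE => ->; apply: eq_bigr => j _; congr (_ * _).
  by rewrite bE; have [_] := partial_coord i (@lshift 3 1 j) p; rewrite -partialE.
split=> [i|]; rewrite D.
  rewrite (bigD1 i) //= eqxx mul1r big1 ?addr0 // => j ji.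
  by rewrite (inj_eq (@lshift_inj _ _)) eq_sym (negPf ji) mul0r.
by rewrite big1 // => j _; rewrite eq_rlshift mul0r.
Qed.

Lemma fibre_smooth (U : set point4) : open U -> smooth U (@fibre R).
Proof.
by move=> oU; apply: (eq_smooth oU _ (smooth_coord oU (@rshift 3 1 ord0))) => y _; rewrite /fibre mxE.
Qed.

Lemma partial_fibre (p : point4) : (forall i, partial (@lshift 3 1 i) (@fibre R) p = 0) /\
  partial (@rshift 3 1 ord0) (@fibre R) p = 1.
Proof.
have -> : @fibre R = fun y => y 0 (@rshift 3 1 ord0) by apply/funext => y; rewrite /fibre mxE.
split=> [i|]; [have [_] := partial_coord (@lshift 3 1 i) (@rshift 3 1 ord0) p
              |have [_] := partial_coord (@rshift 3 1 ord0) (@rshift 3 1 ord0) p]; rewrite -partialE => ->.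
  by rewrite eq_lrshift.
by rewrite eqxx.
Qed.

Variables (w : 'rV[R]_3 -> 'rV[R]_3) (k : 'rV[R]_3 -> R) (S : 'rV[R]_3 -> 'M[R]_3).

Definition fibre_form (p : point4) : 'rV[R]_4 := (2 * fibre p * factor k p)^-1 *: D_mu_t w p.
Definition lift_form a (p : point4) : 'rV[R]_4 :=
  (2 * fibre p)^-1 *: row_mx (row a (S (base p))) (0 : 'rV[R]_1).
Definition total_coframe (p : point4) : 'M[R]_4 :=
  \matrix_i nth 0 [:: fibre_form p; lift_form f0 p; lift_form f1 p; lift_form f2 p] i.

Lemma fibre_formE p : (forall i, fibre_form p 0 (@lshift 3 1 i) =
    (2 * fibre p * factor k p)^-1 * (fibre p * w (base p) 0 i)) /\
  fibre_form p 0 (@rshift 3 1 ord0) = (2 * fibre p * factor k p)^-1.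
Proof.
have [L T] := row4E (fibre p *: w (base p)) 1%:M.
by split=> [i|]; rewrite scalemxE ?L ?scalemxE // T mxE eqxx mulr1.
Qed.

Lemma lift_formE a p : (forall i, lift_form a p 0 (@lshift 3 1 i) = (2 * fibre p)^-1 * S (base p) a i) /\
  lift_form a p 0 (@rshift 3 1 ord0) = 0.
Proof.
have [L T] := row4E (row a (S (base p))) 0.
by split=> [i|]; rewrite scalemxE ?L ?T mxE // mulr0.
Qed.

Lemma split4 (P : 'I_(3 + 1) -> Prop) : (forall i, P (@lshift 3 1 i)) -> P (@rshift 3 1 ord0) ->
  forall i, P i.
Proof. by move=> Pl Pr i; rewrite -(splitK i); case: (fintype.split i) => j //=; rewrite (ord1 j). Qed.

Lemma total_coframeE p :
  ((coform total_coframe e0 p = fibre_form p) * (coform total_coframe e1 p = lift_form f0 p) *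
   (coform total_coframe e2 p = lift_form f1 p) * (coform total_coframe e3 p = lift_form f2 p))%type.
Proof. by do !split; rewrite /coform rowK. Qed.

Lemma det_total_coframe p :
  \det (total_coframe p) = - (2 * fibre p * factor k p)^-1 * (2 * fibre p)^-1 ^+ 3 * \det (S (base p)).
Proof.
have c0 : e0 = @lshift 3 1 f0 by exact: val_inj.
have c1 : e1 = @lshift 3 1 f1 by exact: val_inj.
have c2 : e2 = @lshift 3 1 f2 by exact: val_inj.
have c3 : e3 = @rshift 3 1 ord0 by exact: val_inj.
have [F Ft] := fibre_formE p; have [L0 L0t] := lift_formE f0 p.
have [L1 L1t] := lift_formE f1 p; have [L2 L2t] := lift_formE f2 p.
have r i j : total_coframe p i j = nth 0 [:: fibre_form p; lift_form f0 p; lift_form f1 p; lift_form f2 p] i 0 j.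
  by rewrite mxE.
rewrite det4 det3 /= !r /= c0 c1 c2 c3 !F !Ft !L0 !L0t !L1 !L1t !L2 !L2t.
move: (_^-1) (_^-1) => u v; ring.
Qed.

(** The factors are chosen so that the coframe satisfies the structure
    equations of [total_structure] without further rescaling. *)
Lemma positive_metric_coframe (h : 'rV[R]_3 -> 'M[R]_3) p :
  h (base p) = (S (base p))^T *m S (base p) -> fibre p != 0 -> factor k p != 0 ->
  positive_metric h w k p =
  (4 * `|factor k p|) *: ((total_coframe p)^T *m total_coframe p).
Proof.
move=> hE t0 v0; rewrite /positive_metric /metric.
set t := fibre p in t0 *; set v := factor k p in v0 *.
have hij i j : h (base p) i j = S (base p) f0 i * S (base p) f0 j + S (base p) f1 i * S (base p) f1 j
    + S (base p) f2 i * S (base p) f2 j.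
  by rewrite hE mxE sum3 !trmxE.
have Dij' (D : 'rV[R]_4) i j : (D^T *m D) i j = D 0 i * D 0 j by rewrite mxE big_ord1 trmxE.
have Tij i j : ((total_coframe p)^T *m total_coframe p) i j =
   fibre_form p 0 i * fibre_form p 0 j + lift_form f0 p 0 i * lift_form f0 p 0 j
   + lift_form f1 p 0 i * lift_form f1 p 0 j + lift_form f2 p 0 i * lift_form f2 p 0 j.
  have r a c : total_coframe p a c =
     nth 0 [:: fibre_form p; lift_form f0 p; lift_form f1 p; lift_form f2 p] a 0 c by rewrite mxE.
  by rewrite mxE sum4 !trmxE !r.
have sgn : `|v| = Num.sg v * v by rewrite normrEsg.
have [F Ft] := fibre_formE p; have [L0 L0t] := lift_formE f0 p.
have [L1 L1t] := lift_formE f1 p; have [L2 L2t] := lift_formE f2 p.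
pose D : 'rV[R]_4 := D_mu_t w p; pose B : 'M[R]_4 := @block_mx R 3 1 3 1 (h (base p)) 0 0 0.
have [L T] := row4E (t *: w (base p)) 1%:M.
have DL i : D 0 (@lshift 3 1 i) = t * w (base p) 0 i by rewrite [LHS]L scalemxE.
have DR : D 0 (@rshift 3 1 ord0) = 1 by rewrite [LHS]T mxE eqxx.
have [Bul [Bur Bdl Bdr]] := block4E (h (base p)); rewrite -/B in Bul Bur Bdl Bdr.
have gE (A A' : 'M[R]_4) (a b c d : R) i j : (a *: (b *: (c *: A + d *: A'))) i j =
    a * (b * (c * A i j + d * A' i j)) by rewrite !scalemxE addmxE !scalemxE.
apply/matrixP => i j; rewrite [LHS](gE B (D^T *m D)) Dij' scalemxE Tij sgn.
move: (Num.sg v) => s; move: i j; apply: split4 => [i|]; apply: split4 => [j|].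
- by rewrite Bul hij !DL !F !L0 !L1 !L2 -/t -/v; field; rewrite v0 t0.
- by rewrite Bur !DL !DR !F !Ft !L0t !L1t !L2t -/t -/v; field; rewrite v0 t0.
- by rewrite Bdl !DL !DR !F !Ft !L0t !L1t !L2t -/t -/v; field; rewrite v0 t0.
- by rewrite Bdr !DR !Ft !L0t !L1t !L2t -/t -/v; field; rewrite v0 t0.
Qed.

Section Structure.
Variable V : set 'rV[R]_3.
Hypotheses (oV : open V) (sS : smooth_mx V S) (sw : smooth_mx V w) (sk : smooth V k).
Hypothesis strS : structure3 V w k S.
Variable W : set point4.
Hypotheses (oW : open W) (WV : forall p, W p -> V (base p)).
Hypotheses (t0 : forall p, W p -> fibre p != 0) (v0 : forall p, W p -> factor k p != 0).

Lemma base_comp_smooth f : smooth V f -> smooth W (fun p => f (base p)).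
Proof. by move=> sf; exact: (smooth_comp oW oV WV sf (smooth_lsubmx oW)). Qed.

Lemma factor_smooth : smooth W (factor k).
Proof.
apply: (smooth_add oW (smooth_cst oW 1)); apply: (smooth_mul oW); last exact: base_comp_smooth.
exact: (smooth_scale oW 2 (fibre_smooth oW)).
Qed.

Lemma inv_fibre_smooth : smooth W (fun p => (2 * fibre p)^-1).
Proof.
apply: (smooth_inv oW); last exact: (smooth_scale oW 2 (fibre_smooth oW)).
by move=> p Wp; rewrite mulf_neq0 ?t0 // pnatr_eq0.
Qed.

Lemma total_coframe_smooth : smooth_mx W total_coframe.
Proof.
have sl a : smooth_mx W (lift_form a).
  apply: (smooth_mx_scale oW inv_fibre_smooth).
  apply: (@smooth_row_mx R 4 3 1 W (fun p => row a (S (base p))) (fun=> 0) oW).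
    move=> i j; apply: (eq_smooth oW _ (base_comp_smooth (sS a j))) => p _.
    by rewrite mxE.
  exact: (smooth_mx_cst oW).
have sf : smooth_mx W fibre_form.
  apply: (smooth_mx_scale oW).
    apply: (smooth_inv oW) => [p Wp|].
      by rewrite !mulf_neq0 ?t0 ?v0 // pnatr_eq0.
    exact: (smooth_mul oW (smooth_scale oW 2 (fibre_smooth oW)) factor_smooth).
  apply: (@smooth_row_mx R 4 3 1 W (fun p => fibre p *: w (base p)) (fun=> 1%:M) oW);
    last exact: (smooth_mx_cst oW).
  apply: (smooth_mx_scale oW (fibre_smooth oW)) => i j; exact: (base_comp_smooth (sw i j)).
have r (a : 'I_4) c p : nth 0 [:: fibre_form p; lift_form f0 p; lift_form f1 p; lift_form f2 p] a 0 c =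
    total_coframe p a c by rewrite mxE.
by apply: forall_ord4 => c; [apply: (eq_smooth oW _ (sf 0 c))|apply: (eq_smooth oW _ (sl f0 0 c))
  |apply: (eq_smooth oW _ (sl f1 0 c))|apply: (eq_smooth oW _ (sl f2 0 c))] => p _; rewrite -r.
Qed.

Lemma extd_lift_form a p : W p ->
  (forall i j, extd (lift_form a) p (@lshift 3 1 i) (@lshift 3 1 j) = (2 * fibre p)^-1 *
     (partial i (fun y => S y a j) (base p) - partial j (fun y => S y a i) (base p))) /\
  [/\ forall j, extd (lift_form a) p (@rshift 3 1 ord0) (@lshift 3 1 j)
        = - 2 * (2 * fibre p)^-1 ^+ 2 * S (base p) a j,
     forall i, extd (lift_form a) p (@lshift 3 1 i) (@rshift 3 1 ord0)
        = 2 * (2 * fibre p)^-1 ^+ 2 * S (base p) a i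
    & extd (lift_form a) p (@rshift 3 1 ord0) (@rshift 3 1 ord0) = 0].
Proof.
move=> Wp; have su := inv_fibre_smooth; have Vp := WV Wp.
have [uL uR] : (forall i, partial (@lshift 3 1 i) (fun q : point4 => (2 * fibre q)^-1) p = 0) /\
   partial (@rshift 3 1 ord0) (fun q : point4 => (2 * fibre q)^-1) p = - 2 * (2 * fibre p)^-1 ^+ 2.
  have nz q : W q -> 2 * fibre q != 0 by move=> Wq; rewrite mulf_neq0 ?t0 // pnatr_eq0.
  have D i : partial i (fun q : point4 => (2 * fibre q)^-1) p * (2 * fibre p)
     + (2 * fibre p)^-1 * (2 * partial i (@fibre R) p) = 0.
    rewrite -(partial_scale oW 2 i (fibre_smooth oW) Wp).
    rewrite -(partialM i su (smooth_scale oW 2 (fibre_smooth oW)) Wp) -(partial_cst 1 i p).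
    by apply: (partial_eq oW i Wp) => q Wq; rewrite mulVf ?nz.
  have [fL fR] := partial_fibre p.
  split=> [i|]; apply: (mulIf (nz p Wp)).
    by have := D (@lshift 3 1 i); rewrite fL !mulr0 addr0 mul0r.
  have := D (@rshift 3 1 ord0); rewrite fR mulr1 => /eqP; rewrite addr_eq0 => /eqP ->.
  by have := t0 Wp => tt; field.
have [SL ST] : (forall i j, partial (@lshift 3 1 i) (fun q => S (base q) a j) p
      = partial i (fun y => S y a j) (base p)) /\
    (forall j, partial (@rshift 3 1 ord0) (fun q => S (base q) a j) p = 0).
  by split=> [i j|j]; have [L T] := partial_base (sS a j) Vp; [exact: L|exact: T].
have P i j : partial i (fun q => lift_form a q 0 (@lshift 3 1 j)) p =
   partial i (fun q : point4 => (2 * fibre q)^-1) p * S (base p) a j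
   + (2 * fibre p)^-1 * partial i (fun q => S (base q) a j) p.
  rewrite -(partialM i su (base_comp_smooth (sS a j)) Wp).
  by apply: (partial_eq oW i Wp) => q _; have [-> _] := lift_formE a q.
have Z i : partial i (fun q => lift_form a q 0 (@rshift 3 1 ord0)) p = 0.
  rewrite -(partial_cst 0 i p); apply: (partial_eq oW i Wp) => q _.
  by have [_ ->] := lift_formE a q.
have X i j : extd (lift_form a) p i j = partial i (fun q => lift_form a q 0 j) p
    - partial j (fun q => lift_form a q 0 i) p by rewrite mxE.
split=> [i j|]; first by rewrite X !P !uL !SL !mul0r !add0r mulrBr.
split=> [j|i|].
- by rewrite X P Z uR ST mulr0 addr0 subr0.
- by rewrite X P Z uR ST mulr0 addr0 sub0r !mulNr opprK.
- by rewrite X !Z subrr.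
Qed.

(** Here [m = - 2 (1 + 2 t k)], and the conformal factor of the metric is
    [4 |1 + 2 t k|]: their ratio is locally constant. *)
Lemma total_structure :
  let m p := - 2 * factor k p in let c := coform total_coframe in
  [/\ structure_eq W m (c e0) (c e1) (c e2) (c e3), structure_eq W m (c e0) (c e2) (c e3) (c e1)
    & structure_eq W m (c e0) (c e3) (c e1) (c e2)].
Proof.
move=> m c.
have cE : ((c e0 = fibre_form) * (c e1 = lift_form f0) * (c e2 = lift_form f1) * (c e3 = lift_form f2))%type.
  by do !split; apply/funext => p; rewrite /c total_coframeE.
have key a b d : (forall x i j, crossmul (S x) i a j = S x b i * S x d j - S x d i * S x b j) ->
    structure_eq W m fibre_form (lift_form a) (lift_form b) (lift_form d).
  move=> X p Wp; have [F Ft] := fibre_formE p; have [La Lat] := lift_formE a p.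
  have [Lb Lbt] := lift_formE b p; have [Ld Ldt] := lift_formE d p.
  have [XL [XT XT' XZ]] := extd_lift_form a Wp; have tt := t0 Wp; have vv := v0 Wp.
  have gen i j : (m p *: (wedge (fibre_form p) (lift_form a p) - wedge (lift_form b p) (lift_form d p))
      - 2 *: wedge (lift_form b p) (lift_form d p)) i j =
    m p * (fibre_form p 0 i * lift_form a p 0 j - lift_form a p 0 i * fibre_form p 0 j
      - (lift_form b p 0 i * lift_form d p 0 j - lift_form d p 0 i * lift_form b p 0 j))
      - 2 * (lift_form b p 0 i * lift_form d p 0 j - lift_form d p 0 i * lift_form b p 0 j).
    by rewrite addmxE oppmxE scalemxE [in X in _ - X]scalemxE addmxE oppmxE !wedgeE.
  have vE : factor k p = 1 + 2 * fibre p * k (base p) by [].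
  apply/matrixP => i j; rewrite gen /m; move: i j; apply: split4 => [i|]; apply: split4 => [j|].
  - rewrite XL (strS (WV Wp)) X !F !La !Lb !Ld.
    move: vv; rewrite vE; move: (fibre p) tt (k (base p)) (w (base p)) (S (base p)) => t t1 k' w' S' vv.
    by field; rewrite t1 vv.
  - rewrite XT' !Lat !Lbt !Ldt !F !Ft !La.
    by field; rewrite tt vv.
  - rewrite XT !Lat !Lbt !Ldt !Ft !La.
    by field; rewrite tt vv.
  - by rewrite XZ !Lat !Lbt !Ldt; ring.
by split; rewrite !cE; apply: key => x i j; rewrite crossmulE.
Qed.

End Structure.
End Total.

Section Construction.
Variable R : realType.

(** The coframe dual to the congruences may be negatively oriented; its opposite is then
    positively oriented, which removes the sign in [congruence_structure3]. *)
Lemma hyperCR_coframe (U : set 'rV[R]_3) h w k x : hyperCR U h w k -> U x ->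
  exists V S, [/\ open V, V x, V `<=` U, smooth_mx V S &
    [/\ forall y, V y -> 0 < \det (S y), forall y, V y -> h y = (S y)^T *m S y
      & structure3 V w k S]].
Proof.
move=> [[oU hR] sw sk ew chis] Ux; have [V [oV Vx VU [chi [on cg]]]] := chis x Ux.
have hRV : riemannian V h.
  by split=> [i j|y /VU Uy]; [exact: smooth_sub VU (metric_smooth hR i j)|case: hR => _; apply].
pose X y : 'M[R]_3 := \matrix_a chi a y.
have rX a : (fun y => row a (X y)) = chi a by apply/funext => y; rewrite rowK.
have sX : smooth_mx V X.
  move=> a j; have [sa _] := cg a; apply: (eq_smooth oV _ (sa 0 j)) => y _; by rewrite mxE.
have XhX y : V y -> X y *m h y *m (X y)^T = 1%:M.
  move=> Vy; apply/matrixP => a b; rewrite [RHS]mxE -(on y Vy a b) -!rX.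
  rewrite -row_mul tr_row [LHS]mxE [RHS]mxE; apply: eq_bigr => c _.
  by rewrite [row _ _ _ _]mxE [col _ _ _ _]mxE.
have cX a : congruence V h w k (fun y => row a (X y)) by rewrite rX.
have [hE str] := congruence_structure3 oV hRV sX XhX cX.
pose S0 y := X y *m h y; have sS0 : smooth_mx V S0 := smooth_mx_mul oV sX (metric_smooth hRV).
have d0 y : V y -> \det (S0 y) != 0.
  move=> Vy; have := congr1 determinant (XhX y Vy); rewrite det_mulmx -/(S0 y) det1 => H.
  by apply/eqP => z; move: H; rewrite z mul0r => /eqP; rewrite eq_sym oner_eq0.
pose e := Num.sg (\det (S0 x)); have ee : e * e = 1 by rewrite -expr2 sqr_sg d0.
pose V' := [set y | V y /\ 0 < e * \det (S0 y)].
have VV' : V' `<=` V by move=> y [].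
have oV' : open V' := open_pos oV (smooth_scale oV e (smooth_det oV sS0)).
exists V', (fun y => e *: S0 y); split=> //.
- by split=> //; rewrite -normrEsg normr_gt0 d0.
- by move=> y /VV' /VU.
- by move=> i j; apply: (smooth_sub VV'); exact: (smooth_mx_scale oV (smooth_cst oV e) sS0 i j).
have e3 : e ^+ 3 = e by rewrite exprS expr2 ee mulr1.
split=> [y [Vy dy]|y [Vy dy]|y [Vy dy] a i j].
- by rewrite detZ e3.
- by rewrite trmxZ -scalemxAl -scalemxAr scalerA ee scale1r hE.
have P p q : partial p (fun z => (e *: S0 z) a q) y = e * partial p (fun z => S0 z a q) y.
  by rewrite -(partial_scale oV e p (sS0 a q) Vy); apply: (partial_eq oV p Vy) => z _; rewrite scalemxE.
have C : crossmul (e *: S0 y) i a j = crossmul (S0 y) i a j.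
  rewrite !crossmulE !scalemxE.
  have ex (u v : R) : e * u * (e * v) = u * v by rewrite mulrACA ee mul1r.
  by rewrite !ex.
have sgn : `|\det (S0 y)| / \det (S0 y) = e.
  have -> : `|\det (S0 y)| = e * \det (S0 y).
    rewrite -(ger0_norm (ltW dy)) normrM.
    by rewrite normr_sg d0 // mul1r.
  by rewrite mulfK // d0.
rewrite !P -mulrBr C !scalemxE (str y Vy a i j) -/(S0 y) sgn.
move: (crossmul _ _ _ _) (w y 0 i) (w y 0 j) (S0 y a i) (S0 y a j) (k y) => c wi wj si sj k'.
have -> : e * (- (wi * sj - wj * si) + 2 * k' * (e * c)) =
   - (wi * (e * sj) - wj * (e * si)) + 2 * k' * (e * e * c) by ring.
by rewrite ee mul1r.
Qed.

Lemma gram_riemannian n (U : set 'rV[R]_n) (g Th : 'rV[R]_n -> 'M[R]_n) phi : open U ->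
  smooth_mx U Th -> smooth U phi -> (forall x, U x -> Th x \in unitmx) ->
  (forall x, U x -> 0 < phi x) -> (forall x, U x -> g x = phi x *: ((Th x)^T *m Th x)) ->
  riemannian U g.
Proof.
move=> oU sT sp uT p0 gE; split=> [|x Ux].
  apply: (eq_smooth_mx oU _ (smooth_mx_scale oU sp (smooth_mx_mul oU (smooth_mx_tr oU sT) sT))) => x Ux.
  by rewrite gE.
rewrite gE //; split=> [|v v0]; first by rewrite trmxZ trmx_mul trmxK.
by rewrite -scalemxAr -scalemxAl scalemxE mulr_gt0 ?p0 // gram_posdef ?uT.
Qed.

Lemma structure_eq_ext (U : set 'rV[R]_4) m m' t a b c : (forall x, U x -> m x = m' x) ->
  structure_eq U m t a b c -> structure_eq U m' t a b c.
Proof. by move=> mm s x Ux; rewrite s // mm. Qed.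

Lemma construction_local (U : set 'rV[R]_3) h w k (p : 'rV[R]_(3 + 1)) :
  hyperCR U h w k -> total_space k U p ->
  exists W : set 'rV[R]_4, [/\ open W, W p, W `<=` total_space k U &
    riemannian W (positive_metric h w k) /\ exists l, l != 0 /\
    [/\ forall x, W x -> ricci (weyl_connection (positive_metric h w k) (fun=> 0)) x
          = (6 * l) *: positive_metric h w k x,
        selfdual W (orientation k) (positive_metric h w k) &
        exists I1 I2 I3, compatible_hypercomplex W (orientation k) (positive_metric h w k) I1 I2 I3]].
Proof.
move=> hcr [Up tp vp]; have [V [S [oV Vp VU sS [dS hE strS]]]] := hyperCR_coframe hcr Up.
have [_ sw0 sk0 _ _] := hcr.
have sw : smooth_mx V w by move=> i j; exact: smooth_sub VU (sw0 i j).
have sk : smooth V k by exact: smooth_sub VU sk0.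
pose s := Num.sg (factor k p); have ss : s * s = 1 by rewrite -expr2 sqr_sg vp.
pose W0 : set 'rV[R]_(3 + 1) := [set q | V (base q)].
have oW0 : open W0 by exact: open_lsubmx.
have sv0 : smooth W0 (factor k) by exact: (factor_smooth oV sk oW0).
pose W : set 'rV[R]_4 := [set q | W0 q /\ 0 < fibre q * fibre q * (s * factor k q)].
have sf := fibre_smooth oW0.
have oW : open W.
  exact: (open_pos oW0 (smooth_mul oW0 (smooth_mul oW0 sf sf) (smooth_scale oW0 s sv0))).
have sq_pos (u : R) : u != 0 -> 0 < u * u.
  by move=> u0; rewrite lt_def mulf_neq0 //= -expr2 sqr_ge0.
have t0 q : W q -> fibre q != 0.
  by move=> [_ H]; apply/eqP => z; move: H; rewrite z !mul0r ltxx.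
have sgn q : W q -> 0 < s * factor k q.
  move=> Wq; have tt := t0 q Wq; by case: Wq => _; rewrite (pmulr_rgt0 _ (sq_pos _ tt)).
have v0 q : W q -> factor k q != 0.
  by move=> /sgn H; apply/eqP => z; move: H; rewrite z mulr0 ltxx.
have WV q : W q -> V (base q) by case.
have WT : W `<=` total_space k U.
  by move=> q Wq; split; [apply: VU; exact: WV|exact: t0|exact: v0].
have Wp : W p.
  by split=> //; rewrite -normrEsg mulr_gt0 ?normr_gt0 // sq_pos.
have s0 : s != 0 by rewrite sgr_eq0.
have vE q : W q -> `|factor k q| = s * factor k q.
  move=> Wq; rewrite -(ger0_norm (ltW (sgn q Wq))) normrM.
  by rewrite normr_sg vp mul1r.
have sE q : W q -> Num.sg (factor k q) = s.
  move=> Wq; apply: (mulIf (v0 q Wq)); rewrite -normrEsg; exact: vE.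
pose Th := total_coframe w k S; pose g := positive_metric h w k.
pose phi q := 4 * `|factor k q|.
have sT : smooth_mx W Th by exact: (total_coframe_smooth oV sS sw sk oW WV t0 v0).
have uT q : W q -> Th q \in unitmx.
  move=> Wq; rewrite unitmxE unitfE det_total_coframe.
  rewrite !mulf_neq0 ?oppr_eq0 ?expf_neq0 ?invr_eq0 ?mulf_neq0 ?t0 ?v0 ?pnatr_eq0 //.
  by rewrite gt_eqF // dS //; exact: WV.
have p0 q : W q -> 0 < phi q by move=> Wq; rewrite mulr_gt0 // normr_gt0 v0.
have gE q : W q -> g q = phi q *: ((Th q)^T *m Th q).
  by move=> Wq; apply: positive_metric_coframe; [apply: hE; exact: WV|exact: t0|exact: v0].
have sp : smooth W phi.
  have sv : smooth W (factor k) by exact: (factor_smooth oV sk oW).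
  apply: (eq_smooth oW _ (smooth_scale oW 4 (smooth_scale oW s sv))) => q Wq.
  by rewrite /phi vE.
have gR : riemannian W g := gram_riemannian oW sT sp uT p0 gE.
pose l := - (s / 2); have l0 : l != 0 by rewrite oppr_eq0 mulf_neq0 // invr_eq0 pnatr_eq0.
have mE q : W q -> - 2 * factor k q = l * phi q.
  move=> Wq; rewrite /l /phi vE // (_ : - (s / 2) * (4 * (s * factor k q)) = - 2 * (s * s * factor k q)).
    by rewrite ss mul1r.
  by field.
have [S1 S2 S3] := total_structure oV sS strS oW WV t0 v0.
have {}S1 := structure_eq_ext mE S1; have {}S2 := structure_eq_ext mE S2.
have {}S3 := structure_eq_ext mE S3.
have oT q : W q -> orientation k q * `|\det (Th q)| = - \det (Th q).
  move=> Wq; rewrite det_total_coframe /orientation; have dq := dS _ (WV q Wq).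
  rewrite !normrM normrN !normfV !normrM (gtr0_norm dq) ger0_norm ?ler0n //.
  have tt := t0 q Wq; have vv := v0 q Wq; have Sg := normrEsg (factor k q).
  have tsq : `|fibre q| * `|fibre q| = fibre q * fibre q by rewrite -normrM ger0_norm // -expr2 sqr_ge0.
  have nt : `|fibre q| != 0 by rewrite normr_eq0.
  rewrite vE // sE //.
  transitivity ((16 * factor k q)^-1 * (`|fibre q| * `|fibre q|)^-1 ^+ 2 * \det (S (base q))).
    by move: (`|fibre q|) nt => a na; field; rewrite na s0 vv.
  by rewrite tsq; field; rewrite tt vv.
exists W; split=> //; split=> //; exists l; split=> //; split.
- move=> x Wx; exact: (coframe_ricci oW sT uT gR p0 gE l0 sp S1 S2 S3 Wx).
- exact: (coframe_selfdual oW sT uT gR p0 gE l0 sp S1 S2 S3 oT).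
- do 3 eexists; exact: (coframe_hypercomplex oW sT uT gR p0 gE l0 sp S1 S2 S3 oT).
Qed.

(** All the conclusions except the hypercomplex structure are pointwise, so that the local
    coframes suffice. *)
Theorem construction (U : set 'rV[R]_3) h w k : hyperCR U h w k ->
  sd_einstein (total_space k U) (orientation k) (positive_metric h w k) /\
  (forall p, total_space k U p ->
    exists V : set 'rV[R]_4,
      [/\ open V, V p, V `<=` total_space k U &
        exists I1 I2 I3 : 'rV[R]_4 -> 'M[R]_4,
          compatible_hypercomplex V (orientation k) (positive_metric h w k) I1 I2 I3]).
Proof.
move=> hcr; have loc p := construction_local hcr (p := p).
split; last by move=> p /loc[W [oW Wp WT [_ [l [_ [_ _ hc]]]]]]; exists W.
have gR : riemannian (total_space k U : set 'rV[R]_4) (positive_metric h w k).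
  split=> [i j s x /loc[W [oW Wx _ [[sW _] _]]]|x /loc[W [oW Wx _ [[_ gW] _]]]].
    exact: (sW i j s x Wx).
  exact: gW.
split.
- split=> //; rewrite openE => x /loc[W [oW Wx WT _]].
  by apply: (filterS WT); exact: open_nbhs_nbhs.
- move=> x /loc[W [oW Wx _ [_ [l [_ [_ sd _]]]]]]; exact: sd.
- move=> x /loc[W [oW Wx _ [gW [l [_ [ric _ _]]]]]].
  have [sc _] := einstein_schouten gW Wx (ric x Wx).
  rewrite sc /sym_ricci (ric x Wx) trmxZ (metric_sym gW Wx) -scalerDl scalerA -scalerBl.
  by rewrite (_ : _ - _ = 0) ?scale0r //; field.
- move=> x /loc[W [oW Wx _ [gW [l [l0 [ric _ _]]]]]].
  have [sc _] := einstein_schouten gW Wx (ric x Wx).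
  by rewrite sc mulf_neq0 // pnatr_eq0.
Qed.

End Construction.

(** * The coframe of the difference of the Obata and Levi-Civita derivatives *)

Section Converse.
Variables (R : realType) (N : set 'rV[R]_4) (g : 'rV[R]_4 -> 'M[R]_4).
Variables (I1 I2 I3 : 'rV[R]_4 -> 'M[R]_4) (t : 'rV[R]_4 -> 'rV[R]_4).
Hypotheses (sde : sd_einstein N (fun=> 1) g) (hyp : compatible_hypercomplex N (fun=> 1) g I1 I2 I3).
Hypothesis ob : obata N g I1 I2 I3 (fun x => 2 *: t x).

Let oN : open N. Proof. by case: sde => [[]]. Qed.
Let gR : riemannian N g. Proof. by case: sde => [[]]. Qed.
Let G0 := weyl_connection g (fun=> 0).

Definition lambda x : R := scalar_curvature g (fun=> 0) x / 24.
Definition sqlen x : R := (t x *m (invmx (g x) *m (t x)^T)) 0 0.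
Definition obata_coframe x : 'M[R]_4 :=
  \matrix_i nth 0 [:: t x; t x *m I1 x; t x *m I2 x; t x *m I3 x] i.
Notation Th := obata_coframe.

Lemma obata_form_smooth : smooth_mx N t.
Proof.
case: ob => s2 _ i j; apply: (eq_smooth oN _ (smooth_scale oN 2^-1 (s2 i j))) => x _.
by rewrite scalemxE mulKf // pnatr_eq0.
Qed.

Lemma hyper_smooth : [/\ smooth_mx N I1, smooth_mx N I2 & smooth_mx N I3].
Proof. by case: hyp => [[[s1 _ _] _ _] [[s2 _ _] _ _] [[s3 _ _] _ _] _]. Qed.

Lemma obata_coframe_smooth : smooth_mx N Th.
Proof.
have [s1 s2 s3] := hyper_smooth; have st := obata_form_smooth.
have r (a : 'I_4) c x : nth 0 [:: t x; t x *m I1 x; t x *m I2 x; t x *m I3 x] a 0 c = Th x a c.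
  by rewrite mxE.
apply: forall_ord4 => c.
- by apply: (eq_smooth oN _ (st 0 c)) => x _; rewrite -r.
- by apply: (eq_smooth oN _ (smooth_mx_mul oN st s1 0 c)) => x _; rewrite -r.
- by apply: (eq_smooth oN _ (smooth_mx_mul oN st s2 0 c)) => x _; rewrite -r.
- by apply: (eq_smooth oN _ (smooth_mx_mul oN st s3 0 c)) => x _; rewrite -r.
Qed.

Lemma hyper_square x : N x -> [/\ I1 x *m I1 x = - 1%:M, I2 x *m I2 x = - 1%:M & I3 x *m I3 x = - 1%:M].
Proof. by move=> Nx; case: hyp => [[[_ s1 _] _ _] [[_ s2 _] _ _] [[_ s3 _] _ _] _]; split; auto. Qed.

Lemma hyper_rel x : N x ->
  [/\ I1 x *m I2 x = I3 x, I2 x *m I3 x = I1 x & I3 x *m I1 x = I2 x].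
Proof. by move=> Nx; case: hyp => _ _ _; apply. Qed.

Lemma hyper_anti x : N x ->
  [/\ I2 x *m I1 x = - I3 x, I3 x *m I2 x = - I1 x & I1 x *m I3 x = - I2 x].
Proof.
move=> Nx; have [s1 s2 s3] := hyper_square Nx; have [r1 r2 r3] := hyper_rel Nx; split.
- by rewrite -[in LHS]r2 -r3 -mulmxA (mulmxA (I3 x)) s3 mulNmx mul1mx mulmxN r3 || rewrite -{1}r3 -mulmxA s1 mulmxN mulmx1.
- by rewrite -{1}r1 -mulmxA s2 mulmxN mulmx1.
- by rewrite -{1}r2 -mulmxA s3 mulmxN mulmx1.
Qed.

Lemma complex_metric J x : antiselfdual_complex N (fun=> 1) g J -> N x ->
  (J x)^T *m g x = - (g x *m J x).
Proof.
move=> [[_ JJ _] orth _] Nx; have := orth x Nx; rewrite -[in RHS](mulmx1 (g x)).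
move=> /(congr1 (fun M => M *m J x)); rewrite -mulmxA JJ // mulmx1 mulmxN mulmx1 => <-.
by rewrite opprK.
Qed.

Lemma hyper_metric : [/\ forall x, N x -> (I1 x)^T *m g x = - (g x *m I1 x),
  forall x, N x -> (I2 x)^T *m g x = - (g x *m I2 x)
  & forall x, N x -> (I3 x)^T *m g x = - (g x *m I3 x)].
Proof. by case: hyp => a1 a2 a3 _; split=> x Nx; exact: complex_metric. Qed.

(** For an Einstein metric the Schouten tensor is a multiple of the metric. *)
Lemma lambda_einstein x : N x -> ricci G0 x = (6 * lambda x) *: g x /\ schouten g x = lambda x *: g x.
Proof.
move=> Nx; have [_ _ ein _] := sde.
have ric : ricci G0 x = (6 * lambda x) *: g x.
  have := ein x Nx; rewrite /sym_ricci (ricci_sym oN gR Nx) -/G0 => /eqP; rewrite subr_eq0 => /eqP.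
  rewrite scalerDr -scalerDl => E.
  have -> : 6 * lambda x = scalar_curvature g (fun=> 0) x / 4 by rewrite /lambda; field.
  by rewrite -E (_ : 2^-1 + 2^-1 = 1) ?scale1r //; field.
by split=> //; have [] := einstein_schouten gR Nx ric.
Qed.

(** Selfduality prescribes the curvature operator on the complex structures. *)
Lemma selfdual_trace J x i j : antiselfdual_complex N (fun=> 1) g J -> N x ->
  \tr (J x *m curv_mx G0 i j x) = - 4 * lambda x * (g x *m J x) i j.
Proof.
move=> aJ Nx; have [_ sch] := lambda_einstein Nx; have gJ := complex_metric aJ Nx.
have [_ sd _ _] := sde; have [_ _ asd] := aJ; have aT := asd x Nx.
have fE : form_of g J x = g x *m (- J x) by rewrite /form_of gJ mulmxN.
have kT : (g x *m - J x)^T = - (g x *m - J x).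
  by rewrite -fE; case: aT.
have := sd x Nx _ aT i j; rewrite /= fE (weyl_contraction oN gR i j Nx sch kT) => /eqP.
have sk : (g x *m J x) j i = - (g x *m J x) i j.
  by rewrite -[LHS]trmxE trmx_mul (metric_sym gR Nx) gJ oppmxE.
rewrite mulNmx mxtraceN mulmxN oppmxE sk -/G0 => /eqP; lra.
Qed.

Lemma sqlen_smooth : smooth N sqlen.
Proof.
have st := obata_form_smooth.
have si : smooth_mx N (fun x => invmx (g x)).
  by move=> i j; exact: (smooth_invmx oN (fun x Nx => metric_unit gR Nx) (metric_smooth gR)).
exact: (smooth_mx_mul oN st (smooth_mx_mul oN si (smooth_mx_tr oN st)) 0 0).
Qed.

Lemma sqlen_pos x : N x -> t x != 0 -> 0 < sqlen x.
Proof.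
move=> Nx tx; have gu := metric_unit gR Nx; have [_ /(_ x Nx)[gS gpos]] := gR.
pose v := t x *m invmx (g x).
have v0 : v != 0.
  by apply: contra tx => /eqP z; rewrite -(mulmxKV gu (t x)) -/v z mul0mx.
have := gpos v v0; rewrite /v mulmxKV // trmx_mul trmx_inv gS.
by rewrite /sqlen.
Qed.

(** By the quaternion relations, the complex structures permute the forms of the coframe
    up to sign, as the unit quaternions do. *)
Lemma coframe_mul_hyper x : N x -> [/\ Th x *m I1 x = K1 R *m Th x,
  Th x *m I2 x = K2 R *m Th x & Th x *m I3 x = K3 R *m Th x].
Proof.
move=> Nx; have [s1 s2 s3] := hyper_square Nx; have [r1 r2 r3] := hyper_rel Nx.
have [a1 a2 a3] := hyper_anti Nx.
have rT a J : row a (Th x *m J) = nth 0 [:: t x; t x *m I1 x; t x *m I2 x; t x *m I3 x] a *m J.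
  by rewrite row_mul rowK.
have rK a (K : 'M[R]_4) : row a (K *m Th x) = K a e0 *: t x + K a e1 *: (t x *m I1 x)
    + K a e2 *: (t x *m I2 x) + K a e3 *: (t x *m I3 x).
  apply/rowP => c; rewrite mxE [LHS]mxE sum4 !addmxE !scalemxE.
  have Tr b : Th x b c = nth 0 [:: t x; t x *m I1 x; t x *m I2 x; t x *m I3 x] b 0 c by rewrite mxE.
  by rewrite !Tr.
have key J (K : 'M[R]_4) : (forall a : 'I_4, nth 0 [:: t x; t x *m I1 x; t x *m I2 x; t x *m I3 x] a *m J
    = K a e0 *: t x + K a e1 *: (t x *m I1 x) + K a e2 *: (t x *m I2 x) + K a e3 *: (t x *m I3 x)) ->
    Th x *m J = K *m Th x.
  by move=> H; apply/row_matrixP => a; rewrite rT rK H.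
split; apply: key; apply: forall_ord4; rewrite /= !mxE /= !(scale0r, scale1r, scaleN1r, add0r, addr0)
  -?mulmxA ?s1 ?s2 ?s3 ?r1 ?r2 ?r3 ?a1 ?a2 ?a3 ?mulmxN ?mulmx1 //.
Qed.

(** A symmetric matrix commuting with the unit quaternions is a scalar. *)
Lemma commute_scalar (G : 'M[R]_4) : G^T = G -> K1 R *m G = G *m K1 R -> K2 R *m G = G *m K2 R ->
  G = (G e0 e0)%:M.
Proof.
move=> GT c1 c2; have gs i j : G i j = G j i by rewrite -{1}GT trmxE.
have E1 i j := congr1 (fun M : 'M[R]_4 => M i j) c1; have E2 i j := congr1 (fun M : 'M[R]_4 => M i j) c2.
have := E1 e0 e0; have := E1 e0 e1; have := E1 e0 e2; have := E1 e0 e3; have := E1 e2 e2; have := E1 e2 e3.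
have := E2 e0 e0; have := E2 e0 e1; have := E2 e0 e2; have := E2 e0 e3; have := E2 e1 e1; have := E2 e1 e3.
have gs' := (gs e1 e0, gs e2 e0, gs e3 e0, gs e2 e1, gs e3 e1, gs e3 e2).
rewrite ![(_ *m _) _ _]mxE !sum4 !mxE /= !gs' => H1 H2 H3 H4 H5 H6 H7 H8 H9 H10 H11 H12.
apply/matrixP; apply: forall_ord4; apply: forall_ord4; rewrite [RHS]mxE /= ?gs'; lra.
Qed.

(** The matrix commutes with the unit quaternions, because the complex structures are
    orthogonal. *)
Lemma coframe_gram x : N x -> Th x *m invmx (g x) *m (Th x)^T = (sqlen x)%:M.
Proof.
move=> Nx; have gu := metric_unit gR Nx; have gS := metric_sym gR Nx.
have [m1 m2 m3] := coframe_mul_hyper Nx; have [h1 h2 h3] := hyper_metric.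
set G := Th x *m _ *m _.
have GT : G^T = G by rewrite /G !trmx_mul trmxK trmx_inv gS mulmxA.
have cK J K : (J)^T *m g x = - (g x *m J) -> Th x *m J = K *m Th x -> K^T = - K -> K *m G = G *m K.
  move=> hJ mJ KT; have Jg : J *m invmx (g x) = - (invmx (g x) *m J^T).
    have := congr1 (fun M => invmx (g x) *m M *m invmx (g x)) hJ.
    by rewrite mulmxN mulNmx !mulmxA mulVmx // mul1mx -mulmxA mulmxV // mulmx1 => ->; rewrite opprK.
  rewrite /G !mulmxA -mJ -(mulmxA (Th x)) Jg mulmxN !mulNmx -!mulmxA -trmx_mul mJ trmx_mul KT.
  by rewrite !mulmxN opprK.
rewrite (commute_scalar GT (cK _ _ (h1 x Nx) m1 (K1T R)) (cK _ _ (h2 x Nx) m2 (K2T R))).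
congr (_%:M); rewrite /G /sqlen.
have r0 : row e0 (Th x) = t x by rewrite rowK.
rewrite mulmxA [LHS]mxE [RHS]mxE; apply: eq_bigr => c _; congr (_ * _).
  by rewrite -[in RHS]r0 -row_mul [RHS]mxE.
by rewrite !trmxE -[in RHS]r0 [RHS]mxE.
Qed.

(** The open set where the structure equations hold. *)
Definition regular := [set x | N x /\ 0 < sqlen x].
Let oM : open regular := open_pos oN sqlen_smooth.
Let MN : regular `<=` N. Proof. by move=> x []. Qed.

Lemma regular_unit x : regular x -> Th x \in unitmx.
Proof.
move=> [Nx fx]; have := congr1 determinant (coframe_gram Nx).
rewrite !det_mulmx det_tr det_scalar unitmxE unitfE => H.
by apply/eqP => z; move: H; rewrite z !mul0r => /esym/eqP; rewrite expf_eq0 /= gt_eqF.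
Qed.

Lemma regular_metric x : regular x -> g x = (sqlen x)^-1 *: ((Th x)^T *m Th x).
Proof.
move=> Mx; have [Nx fx] := Mx; have uT := regular_unit Mx; have gu := metric_unit gR Nx.
have G := coframe_gram Nx; have f0 : sqlen x != 0 by rewrite gt_eqF.
pose E := invmx (Th x).
have gi : invmx (g x) = sqlen x *: (E *m E^T).
  have := congr1 (fun M => E *m M *m E^T) G.
  rewrite mul_mx_scalar -scalemxAl !mulmxA mulVmx // mul1mx -mulmxA -trmx_mul mulVmx //.
  by rewrite trmx1 mulmx1.
have ET : E *m Th x = 1%:M by rewrite mulVmx.
have TE : Th x *m E = 1%:M by rewrite mulmxV.
have H : invmx (g x) *m ((sqlen x)^-1 *: ((Th x)^T *m Th x)) = 1%:M.
  rewrite gi -scalemxAl -scalemxAr scalerA divff // scale1r -mulmxA (mulmxA E^T) -trmx_mul TE.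
  by rewrite trmx1 mul1mx ET.
by rewrite -[RHS](mulKVmx gu) H mulmx1.
Qed.

Lemma regular_endo x : regular x -> [/\ I1 x = coframe_endo Th (K1 R) x,
  I2 x = coframe_endo Th (K2 R) x & I3 x = coframe_endo Th (K3 R) x].
Proof.
move=> Mx; have uT := regular_unit Mx; have [m1 m2 m3] := coframe_mul_hyper (MN Mx).
by rewrite /coframe_endo -!mulmxA -m1 -m2 -m3 !mulKmx.
Qed.

Let phi x := (sqlen x)^-1.
Lemma regular_phi : smooth regular phi /\ forall x, regular x -> 0 < phi x.
Proof.
split; last by move=> x [_ fx]; rewrite invr_gt0.
apply: (smooth_inv oM) => [x [_ fx]|]; first by rewrite gt_eqF.
exact: (smooth_sub MN sqlen_smooth).
Qed.

Lemma regular_riemannian : riemannian regular g.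
Proof.
split=> [i j|x Mx]; first exact: (smooth_sub MN (metric_smooth gR i j)).
by case: gR => _; apply; exact: MN.
Qed.

Lemma coform_obata :
  [/\ coform Th e0 = t, coform Th e1 = fun x => t x *m I1 x, coform Th e2 = fun x => t x *m I2 x
    & coform Th e3 = fun x => t x *m I3 x].
Proof. by split; apply/funext => x; rewrite /coform rowK. Qed.

(** The trace of the curvature against each complex structure is computed in two
    ways: by selfduality ([selfdual_trace]) and by the change to the Obata connection
    ([hypercomplex_curvature]). *)
Lemma regular_structure :
  let m x := lambda x * phi x in let c := coform Th in
  [/\ structure_eq regular m (c e0) (c e1) (c e2) (c e3), structure_eq regular m (c e0) (c e2) (c e3) (c e1)
    & structure_eq regular m (c e0) (c e3) (c e1) (c e2)].
Proof.
move=> m c; have [c0 c1 c2 c3] := coform_obata.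
have [s1 s2 s3] := hyper_smooth; have st := obata_form_smooth.
have [_ [p1 p2 p3]] := ob; have [a1 a2 a3 _] := hyp; have [h1 h2 h3] := hyper_metric.
have rel x Nx := @hyper_rel x Nx; have ant x Nx := @hyper_anti x Nx.
have [sp pp] := regular_phi.
have sT := obata_coframe_smooth.
have mw x : regular x -> _ := fun Mx => metric_endo_wedge regular_unit regular_metric Mx.
have fin (e th b gj l f p : R) : f * p = 1 -> gj = p * (th - b) ->
    - 4 * e - 8 * th + 8 * f * gj = - 4 * l * gj -> e = l * p * (th - b) - 2 * b.
  move=> fp -> H; have H2 : 8 * f * (p * (th - b)) = 8 * (th - b).
    by rewrite mulrA -(mulrA 8) fp mulr1.
  by move: H; rewrite H2; lra.
have fp x : regular x -> sqlen x * phi x = 1 by move=> [_ fx]; rewrite divff // gt_eqF.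
have gen (m1 : R) (A B : 'M[R]_4) i j : (m1 *: (A - B) - 2 *: B) i j = m1 * (A i j - B i j) - 2 * B i j.
  by rewrite addmxE oppmxE scalemxE [in X in _ - X]scalemxE addmxE oppmxE.
split=> x Mx; have Nx := MN Mx; apply/matrixP => i j; rewrite gen /m.
- apply: (fin _ (wedge (c e0 x) (c e1 x) i j) (wedge (c e2 x) (c e3 x) i j) ((g x *m I1 x) i j)
    (lambda x) (sqlen x) (phi x) (fp x Mx)).
    by have [-> _ _] := regular_endo Mx; rewrite (mw _ Mx) scalemxE addmxE oppmxE.
  have := hypercomplex_curvature oN gR st i j s1 s2 s3 (smooth_mx_mul oN st s1) p1 p2 p3
    (fun y Ny => let: And3 _ r _ := rel y Ny in let: And3 _ q _ := ant y Ny in conj r q)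
    h1 (fun y _ => erefl) Nx; rewrite selfdual_trace // => H; rewrite /c c0 c1; exact: (esym H).
- apply: (fin _ (wedge (c e0 x) (c e2 x) i j) (wedge (c e3 x) (c e1 x) i j) ((g x *m I2 x) i j)
    (lambda x) (sqlen x) (phi x) (fp x Mx)).
    by have [_ -> _] := regular_endo Mx; rewrite (mw _ Mx) scalemxE addmxE oppmxE.
  have := hypercomplex_curvature oN gR st i j s2 s3 s1 (smooth_mx_mul oN st s2) p2 p3 p1
    (fun y Ny => let: And3 _ _ r := rel y Ny in let: And3 _ _ q := ant y Ny in conj r q)
    h2 (fun y _ => erefl) Nx; rewrite selfdual_trace // => H; rewrite /c c0 c2; exact: (esym H).
- apply: (fin _ (wedge (c e0 x) (c e3 x) i j) (wedge (c e1 x) (c e2 x) i j) ((g x *m I3 x) i j)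
    (lambda x) (sqlen x) (phi x) (fp x Mx)).
    by have [_ _ ->] := regular_endo Mx; rewrite (mw _ Mx) scalemxE addmxE oppmxE.
  have := hypercomplex_curvature oN gR st i j s3 s1 s2 (smooth_mx_mul oN st s3) p3 p1 p2
    (fun y Ny => let: And3 r _ _ := rel y Ny in let: And3 q _ _ := ant y Ny in conj r q)
    h3 (fun y _ => erefl) Nx; rewrite selfdual_trace // => H; rewrite /c c0 c3; exact: (esym H).
Qed.

(** The orientation comes from the complex structures being antiselfdual. *)
Lemma regular_det x : regular x -> \det (Th x) < 0.
Proof.
move=> Mx; have [Nx fx] := Mx; have uT := regular_unit Mx.
have dT : \det (Th x) != 0 by rewrite -unitfE -unitmxE.
have [sp pp] := regular_phi; have p0 : phi x != 0 by rewrite gt_eqF ?pp.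
have [[_ _ asd] _ _ _] := hyp; have [_ hod] := asd x Nx; have [h1 _ _] := hyper_metric.
have KT : (K1 R)^T = - K1 R := K1T R.
have bT : (- phi x *: K1 R)^T = - (- phi x *: K1 R) by rewrite trmxZ KT scalerN.
have fE : form_of g I1 x = (Th x)^T *m (- phi x *: K1 R) *m Th x.
  rewrite /form_of h1 //; have [-> _ _] := regular_endo Mx.
  by rewrite (metric_endo regular_unit regular_metric) // -scalemxAr -scalemxAl scaleNr.
have := hod; rewrite fE (hodge_frame _ (regular_metric Mx) (pp x Mx) uT bT) mul1r.
have -> : star (- phi x *: K1 R) = - (- phi x *: K1 R).
  have SZ d M : star (d *: M) = d *: star M :> 'M[R]_4.
    by apply/matrixP; apply: forall_ord4; apply: forall_ord4;
      rewrite scalemxE !star_entry /= ?scalemxE; ring.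
  by rewrite SZ star_K scalerN.
set A := (Th x)^T *m (- phi x *: K1 R) *m Th x => H.
have {}H : (`|\det (Th x)| / \det (Th x)) *: A = - A.
  by rewrite -H mulmxN mulNmx -/A scalerN scaleNr opprK.
rewrite lt_neqAle dT /= leNgt; apply/negP => dpos.
move: H; rewrite gtr0_norm // divff // scale1r => /eqP; rewrite -addr_eq0 -mulr2n => /eqP A2.
have A0 : A = 0.
  by move/eqP: A2; rewrite -scaler_nat scaler_eq0 pnatr_eq0 /= => /eqP.
have := congr1 (fun M => (invmx (Th x))^T *m M *m invmx (Th x)) A0.
rewrite mulmx0 mul0mx /A !mulmxA -trmx_mul mulmxV // trmx1 mul1mx -mulmxA mulmxV // mulmx1.
move=> /(congr1 (fun M : 'M[R]_4 => M e0 e1)); rewrite scalemxE !mxE /= mulr1 => /eqP.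
by rewrite oppr_eq0 (negPf p0).
Qed.

Lemma lambda_smooth : smooth regular lambda.
Proof.
pose Om x := extd (coform Th e1) x + 2 *: wedge (coform Th e2 x) (coform Th e3 x).
have sT i j : smooth regular (fun x => Th x i j) := smooth_sub MN (obata_coframe_smooth i j).
have sc i : smooth_mx regular (coform Th i) := coform_smooth oM sT i.
have sO : smooth_mx regular Om.
  apply: (smooth_mx_add oM (extd_smooth oM (sc e1))).
  exact: (smooth_mx_scale oM (smooth_cst oM 2) (wedge_smooth oM (sc e2) (sc e3))).
have si : smooth_mx regular (fun x => invmx (Th x)).
  by move=> i j; exact: (smooth_invmx oM regular_unit sT).
have [sp pp] := regular_phi.
have sE := smooth_mx_mul oM (smooth_mx_mul oM (smooth_mx_tr oM si) sO) si e0 e1.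
apply: (eq_smooth oM _ (smooth_mul oM (smooth_sub MN sqlen_smooth) sE)) => x Mx.
have uT := regular_unit Mx; have [Nx fx] := Mx; have f0 : sqlen x != 0 by rewrite gt_eqF.
have [S1 _ _] := regular_structure.
have -> : Om x = (lambda x * phi x) *: ((Th x)^T *m K1 R *m Th x).
  rewrite /Om S1 // subrK; congr (_ *: _).
  by rewrite !wedge_coform K_delta !(mulmxBr, mulmxBl).
rewrite -scalemxAr -scalemxAl !mulmxA -trmx_mul mulmxV // trmx1 mul1mx -mulmxA mulmxV // mulmx1.
by rewrite scalemxE mxE /= mulr1 /phi; field.
Qed.

(** Schur: the exterior derivative of the structure equations. *)
Lemma lambda_partial i x : regular x -> partial i lambda x = 0.
Proof.
move=> Mx; have uT := regular_unit Mx; have [Nx fx] := Mx.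
have [S1 S2 S3] := regular_structure; have [sp pp] := regular_phi.
have sT i' j : smooth regular (fun x => Th x i' j) := smooth_sub MN (obata_coframe_smooth i' j).
have sc i' : smooth_mx regular (coform Th i') := coform_smooth oM sT i'.
have [s1 _ _] := hyper_smooth; have [_ [p1 _ _]] := ob; have [h1 _ _] := hyper_metric.
have gRM := regular_riemannian; have [c0 _ _ _] := coform_obata.
have s1M : smooth_mx regular I1 by move=> u v; exact: smooth_sub MN (s1 u v).
have st : smooth_mx regular (fun y => 2 *: t y).
  by rewrite -c0; exact: (smooth_double oM (sc e0)).
pose om y := g y *m I1 y.
have som : smooth_mx regular om := smooth_mx_mul oM (metric_smooth gRM) s1M.
have omE y : regular y -> (lambda y * phi y) *: (wedge (coform Th e0 y) (coform Th e1 y)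
    - wedge (coform Th e2 y) (coform Th e3 y)) = lambda y *: om y.
  move=> My; rewrite /om; have [-> _ _] := regular_endo My.
  by rewrite (metric_endo_wedge regular_unit regular_metric My) scalerA.
have A (a b c : 'I_4) := structure_closed oM (sc e1) (sc e2) (sc e3) a b c S1 S2 S3 Mx.
have B (a b c : 'I_4) := cyc_kahler oM a b c gRM st s1M (fun y My => h1 y (MN My)) Mx.
have N0 a : cov_endo (weyl_connection g (fun y => 2 *: t y)) I1 a x = 0 by exact: p1.
have D a b c : partial a (fun y => ((lambda y * phi y) *: (wedge (coform Th e0 y) (coform Th e1 y)
    - wedge (coform Th e2 y) (coform Th e3 y))) b c) x =
    partial a lambda x * om x b c + lambda x * partial a (fun y => om y b c) x.
  rewrite -(partialM a lambda_smooth (som b c) Mx).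
  by apply: (partial_eq oM a Mx) => y My; rewrite omE // scalemxE.
have Z a b c : partial a lambda x * om x b c + partial b lambda x * om x c a
    + partial c lambda x * om x a b = 0.
  have := A a b c; have := B a b c; rewrite /cyc /= !D !N0 !mulmx0 ![(0 : 'M[R]_4) _ _]mxE.
  rewrite !omE // !scalemxE c0 -/(om x).
  have [q qE] : exists q : 'I_4 -> 'I_4 -> 'I_4 -> R, forall l m n, partial l (fun y => om y m n) x = q l m n.
    by eexists => l m n.
  have [r rE] : exists r : 'I_4 -> R, forall l, partial l lambda x = r l by eexists => l.
  have q' l m n : partial l (fun y => (g y *m I1 y) m n) x = q l m n by rewrite -qE.
  rewrite !q' ?qE !rE; move: (om x) (lambda x) (t x) => O l T.
  move=> H1 H2.
  have : l * (q a b c + 2 * (2 * T 0 a) * O b c + (q b c a + 2 * (2 * T 0 b) * O c a)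
     + (q c a b + 2 * (2 * T 0 c) * O a b)) = l * (0 + 0 + 0) by rewrite H1.
  by move: H2; lra.
pose E := invmx (Th x).
pose mu e := \sum_j E j e * partial j lambda x.
have mu0 : forall e, mu e = 0.
  apply: (@cyclic_K1 R) => e f h.
  have p0 : phi x != 0 by rewrite gt_eqF ?pp.
  have cA a b c : (partial a lambda x *: om x) b c + (partial b lambda x *: om x) c a
      + (partial c lambda x *: om x) a b = 0.
    have sc3 (u v z : R) (O : 'M[R]_4) : (u *: O) b c + (v *: O) c a + (z *: O) a b
        = u * O b c + v * O c a + z * O a b by rewrite !mxE.
    by rewrite sc3; exact: Z.
  have := cyclic_congr E cA e f h => /=.
  have F k : \sum_j E j k *: (E^T *m (partial j lambda x *: om x) *m E) = (mu k * phi x) *: K1 R.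
    have omx : E^T *m om x *m E = phi x *: K1 R.
      rewrite /om; have [-> _ _] := regular_endo Mx.
      rewrite (metric_endo regular_unit regular_metric _ Mx) -scalemxAr -scalemxAl !mulmxA -trmx_mul.
      by rewrite mulmxV // trmx1 mul1mx -mulmxA mulmxV // mulmx1.
    rewrite /mu mulr_suml scaler_suml; apply: eq_bigr => j _.
    by rewrite -scalemxAr -scalemxAl omx !scalerA.
  rewrite !F !scalemxE => H; apply: (mulfI p0); rewrite mulr0 -[RHS]H; ring.
have -> : partial i lambda x = \sum_e mu e * Th x e i.
  rewrite /mu; under eq_bigr do rewrite mulr_suml.
  rewrite exchange_big /=.
  transitivity (\sum_j (E *m Th x) j i * partial j lambda x).
    by rewrite mulVmx // (bigD1 i) //= mxE eqxx mul1r big1 ?addr0 // => j /negPf ji; rewrite mxE ji mul0r.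
  apply: eq_bigr => j _; rewrite mxE mulr_suml; apply: eq_bigr => e _; ring.
by rewrite big1 // => e _; rewrite mu0 mul0r.
Qed.

Lemma lambda_constant p : regular p ->
  exists r : R, 0 < r /\ forall x, `|x - p| < r -> regular x /\ lambda x = lambda p.
Proof.
move=> Mp; have /nbhs_ballP[r r0 rM] : nbhs p regular by exact: open_nbhs_nbhs.
exists r; split=> // x xr.
have inM (s : R) : 0 <= s <= 1 -> regular (p + s *: (x - p)).
  move=> /andP[s0 s1]; apply: rM; rewrite -ball_normE /= opprD addNKr normrN normrZ ger0_norm //.
  by apply: le_lt_trans xr; rewrite ler_piMl.
have Mx : regular x by have := inM 1; rewrite lexx ler01 scale1r addrC subrK; apply.
split=> //.
have [|c cc] := @mvt_line R 4 lambda p (x - p) 1 ler01.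
  move=> s ss; apply: diff_derivable; exact: (smooth_differentiable lambda_smooth (inM s ss)).
rewrite scale1r (addrC p) subrK partial_sum; last first.
  exact: (smooth_differentiable lambda_smooth (inM c cc)).
rewrite big1 ?mulr0 => [/eqP|j _]; first by rewrite subr_eq0 => /eqP.
by rewrite (lambda_partial j (inM c cc)) mulr0.
Qed.

End Converse.

(** * Normal form along the flow *)

Section Pullback.
Variables (R : realType) (n : nat).
Variables (V W : set 'rV[R]_n) (F : 'rV[R]_n -> 'rV[R]_n).
Hypotheses (oV : open V) (oW : open W) (sF : smooth_mx V F) (VW : forall q, V q -> W (F q)).

Lemma partial_pullback (f : 'rV[R]_n -> R) i q : smooth W f -> V q ->
  partial i (fun y => f (F y)) q = \sum_k diff_mx F q i k * partial k f (F q).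
Proof.
move=> sf Vq.
have [_] := partial_comp i (smooth_differentiable sf (VW Vq)) (fun j => smooth_differentiable (sF 0 j) Vq).
by rewrite -partialE => ->; apply: eq_bigr => k _; rewrite [diff_mx _ _ _ _]mxE.
Qed.

Lemma diff_mx_comp (G : 'rV[R]_n -> 'rV[R]_n) q : smooth_mx W G -> V q ->
  diff_mx (fun y => G (F y)) q = diff_mx F q *m diff_mx G (F q).
Proof.
move=> sG Vq; apply/matrixP => i j; rewrite [LHS]mxE (partial_pullback i (sG 0 j) Vq) [RHS]mxE.
by apply: eq_bigr => k _; rewrite [diff_mx G _ _ _]mxE.
Qed.

(** The second derivatives of [F] are symmetric. *)
Lemma pullback_extd (a : 'rV[R]_n -> 'rV[R]_n) q : smooth_mx W a -> V q ->
  extd (fun y => a (F y) *m (diff_mx F y)^T) q = diff_mx F q *m extd a (F q) *m (diff_mx F q)^T.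
Proof.
move=> sa Vq.
have [D DE] : exists D : 'M[R]_n, D = diff_mx F q by eexists.
have [da daE] : exists d : 'I_n -> 'I_n -> R, forall l k, partial l (fun y => a y 0 k) (F q) = d l k.
  by eexists => l k.
have [H HE] : exists d : 'I_n -> 'I_n -> 'I_n -> R, forall i j k,
    partial i (partial j (fun y => F y 0 k)) q = d i j k by eexists => i j k.
have HC i j k : H i j k = H j i k by rewrite -!HE (smooth_partialC oV i j (sF 0 k) Vq).
have saF k : smooth V (fun y => a (F y) 0 k) := smooth_comp oV oW VW (sa 0 k) sF.
have sD j k : smooth V (fun y => diff_mx F y j k) := smooth_diff_mx oV sF j k.
have P i j : partial i (fun y => (a (F y) *m (diff_mx F y)^T) 0 j) q =
    \sum_k ((\sum_l D i l * da l k) * D j k + a (F q) 0 k * H i j k).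
  rewrite (partial_eq oV i (g := fun y => \sum_k a (F y) 0 k * diff_mx F y j k) Vq); last first.
    by move=> y _; rewrite mxE; apply: eq_bigr => k _; rewrite trmxE.
  rewrite (partial_bigsum oV _ i (fun k => smooth_mul oV (saF k) (sD j k)) Vq).
  apply: eq_bigr => k _; rewrite (partialM i (saF k) (sD j k) Vq) DE; congr (_ * _ + _ * _).
    by rewrite (partial_pullback i (sa 0 k) Vq); apply: eq_bigr => l _; rewrite daE.
  by rewrite -HE; apply: (partial_eq oV i Vq) => y _; rewrite mxE.
have EX i j : extd a (F q) i j = da i j - da j i by rewrite mxE !daE.
apply/matrixP => i j; rewrite [LHS]mxE !P -DE [RHS]mxE.
under [RHS]eq_bigr => k _.
  rewrite mxE trmxE.
  under eq_bigr do rewrite EX mulrBr.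
  rewrite sumrB mulrBl.
  over.
rewrite sumrB !big_split /=.
have -> : \sum_k a (F q) 0 k * H i j k = \sum_k a (F q) 0 k * H j i k.
  by apply: eq_bigr => k _; rewrite HC.
have -> : \sum_k (\sum_l D i l * da k l) * D j k = \sum_k (\sum_l D j l * da l k) * D i k.
  under eq_bigr do rewrite mulr_suml.
  rewrite exchange_big /=; apply: eq_bigr => k _; rewrite mulr_suml; apply: eq_bigr => l _; ring.
by rewrite opprD addrACA subrr addr0.
Qed.

End Pullback.

Lemma wedge_congr (R : realType) n (D : 'M[R]_n) (u v : 'rV[R]_n) :
  D *m wedge u v *m D^T = wedge (u *m D^T) (v *m D^T).
Proof. by rewrite /wedge mulmxBr mulmxBl !trmx_mul trmxK !mulmxA. Qed.

Lemma diff_mx_id (R : realType) n (q : 'rV[R]_n) : diff_mx (fun y => y) q = 1%:M.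
Proof.
apply/matrixP => i j; rewrite [LHS]mxE [RHS]mxE; have [_] := partial_coord i j q.
by rewrite -partialE => ->.
Qed.

Lemma partial_expR (R : realType) n (U : set 'rV[R]_n) f i x : smooth U f -> U x ->
  partial i (fun y => expR (f y)) x = expR (f x) * partial i f x.
Proof.
move=> sf Ux; have [] : is_derive x (delta_mx 0 i) (fun y => expR (f y)) (expR (f x) * partial i f x).
  by apply: is_derive_comp1; apply: diff_derivable; exact: (smooth_differentiable sf Ux).
by rewrite -partialE => _ ->.
Qed.

Section NormalForm.
Variables (R : realType) (r : R) (r0 : 0 < r).
Notation point4 := 'rV[R]_(3 + 1).
Notation ls := (@lshift 3 1).
Notation rs := (@rshift 3 1 ord0).
Let B : set point4 := @box R 3 r.
Variables (P : 'rV[R]_4 -> 'M[R]_4) (m : 'rV[R]_4 -> R).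
Hypotheses (sP : smooth_mx B P) (sm : smooth B m) (m0 : forall q, B q -> m q != 0).
Hypothesis str : [/\ structure_eq B m (coform P e0) (coform P e1) (coform P e2) (coform P e3),
  structure_eq B m (coform P e0) (coform P e2) (coform P e3) (coform P e1)
  & structure_eq B m (coform P e0) (coform P e3) (coform P e1) (coform P e2)].
Hypotheses (P0 : forall q, B q -> P q e0 rs = (m q)^-1)
  (P1 : forall q, B q -> [/\ P q e1 rs = 0, P q e2 rs = 0 & P q e3 rs = 0]).
Hypothesis dP : forall q, B q -> 0 < - m q * \det (P q).

Definition sp (a : 'I_3) : 'I_4 := nth e0 [:: e1; e2; e3] a.
Definition slice (y : 'rV[R]_3) : point4 := row_mx y (0 : 'rV[R]_1).
Definition slice_frame q : 'M[R]_3 := \matrix_(a, j) P q (sp a) (ls j).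
Definition eta q (j : 'I_3) : R := m q * P q e0 (ls j).
Let D3 : set 'rV[R]_3 := [set y | `|y| < r].

Definition baseS y : 'M[R]_3 := 2 *: slice_frame (slice y).
Definition basew y : 'rV[R]_3 := \row_j - eta (slice y) j.
Definition basek y : R := - (m (slice y) + 2) / 4.

Let oB : open B := @open_box R 3 r.
Let oD : open D3 := @open_norm_lt R _ r.

Lemma slice_box y : D3 y -> B (slice y).
Proof. by move=> Dy; split; rewrite /slice ?row_mxKl // row_mxKr mxE normr0. Qed.

Lemma box_base q : B q -> D3 (base q). Proof. by case. Qed.

Lemma slice_smooth : smooth_mx D3 slice.
Proof.
apply: (@smooth_row_mx R 3 3 1 D3 (fun y => y) (fun=> 0) oD).
  by move=> i j; rewrite (ord1 i); exact: (smooth_coord oD j).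
exact: (smooth_mx_cst oD).
Qed.

Lemma sp_rs q a : B q -> P q (sp a) rs = 0.
Proof. by move=> /P1[p1 p2 p3]; move: a; apply: forall_ord3. Qed.

Lemma slice_frame_det q : B q -> 0 < \det (slice_frame q).
Proof.
move=> Bq; have := dP Bq; have p0 := P0 Bq; have [p1 p2 p3] := P1 Bq.
have -> : \det (P q) = - (m q)^-1 * \det (slice_frame q).
  have c0 : e0 = ls f0 by exact: val_inj.
  have c1 : e1 = ls f1 by exact: val_inj.
  have c2 : e2 = ls f2 by exact: val_inj.
  have c3 : e3 = rs by exact: val_inj.
  have sE a j : slice_frame q a j = P q (sp a) (ls j) by rewrite mxE.
  rewrite det3 !sE /sp /= det4 /=.
  have -> : P q e0 e3 = (m q)^-1 by rewrite c3.
  have -> : P q e1 e3 = 0 by rewrite [in X in P q _ X]c3.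
  have -> : P q e2 e3 = 0 by rewrite [in X in P q _ X]c3.
  have -> : P q e3 e3 = 0 by rewrite [in X in P q _ X]c3.
  by rewrite -c0 -c1 -c2; ring.
by rewrite mulrA mulrNN divff ?m0 // mul1r.
Qed.

Lemma coformP a q j : coform P a q 0 j = P q a j. Proof. by rewrite mxE. Qed.

Lemma cross_sp q a i j : crossmul (slice_frame q) i a j =
  nth 0 [:: P q e2 (ls i) * P q e3 (ls j) - P q e3 (ls i) * P q e2 (ls j);
            P q e3 (ls i) * P q e1 (ls j) - P q e1 (ls i) * P q e3 (ls j);
            P q e1 (ls i) * P q e2 (ls j) - P q e2 (ls i) * P q e1 (ls j)] a.
Proof. by rewrite crossmulE ![slice_frame q _ _]mxE. Qed.

Lemma structure_components a q : B q ->
  (forall i j, partial (ls i) (fun y => P y (sp a) (ls j)) q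
      - partial (ls j) (fun y => P y (sp a) (ls i)) q =
    eta q i * P q (sp a) (ls j) - P q (sp a) (ls i) * eta q j
    - (m q + 2) * crossmul (slice_frame q) i a j) /\
  (forall j, partial rs (fun y => P y (sp a) (ls j)) q = P q (sp a) (ls j)).
Proof.
move=> Bq; have [S1 S2 S3] := str.
have E i j : partial i (fun y => P y (sp a) j) q - partial j (fun y => P y (sp a) i) q =
   extd (coform P (sp a)) q i j.
  rewrite [RHS]mxE; congr (_ - _); by apply: (partial_eq oB _ Bq) => y _; rewrite coformP.
have K i j : extd (coform P (sp a)) q i j =
    m q * (P q e0 i * P q (sp a) j - P q (sp a) i * P q e0 j)
    - (m q + 2) * nth 0 [:: P q e2 i * P q e3 j - P q e3 i * P q e2 j;
       P q e3 i * P q e1 j - P q e1 i * P q e3 j; P q e1 i * P q e2 j - P q e2 i * P q e1 j] a.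
  move: a {E}; apply: forall_ord3; rewrite /sp /=.
  - by rewrite (structure_entry i j S1 Bq) !coformP; ring.
  - by rewrite (structure_entry i j S2 Bq) !coformP; ring.
  - by rewrite (structure_entry i j S3 Bq) !coformP; ring.
split=> [i j|j].
  by rewrite E K cross_sp /eta; ring.
have Z : partial (ls j) (fun y => P y (sp a) rs) q = 0.
  by rewrite -(partial_cst 0 (ls j) q); apply: (partial_eq oB _ Bq) => y By; rewrite sp_rs.
have := E rs (ls j); rewrite Z subr0 K => ->.
have [p1 p2 p3] := P1 Bq; rewrite P0 // sp_rs // p1 p2 p3 !mul0r !subr0.
have -> : nth 0 [:: 0; 0; 0] a = 0 :> R by move: a {E K Z}; apply: forall_ord3.
by rewrite mulr0 subr0 mulrA divff ?m0 // mul1r.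
Qed.

Let s (q : point4) : R := fibre q.
Let ss : smooth B s := fibre_smooth oB.

(** The spatial forms scale by the flow. *)
Lemma flow_scaling a j q : B q -> P q (sp a) (ls j) = expR (s q) * P (slice (base q)) (sp a) (ls j).
Proof.
move=> Bq; pose f y := expR (- s y) * P y (sp a) (ls j).
have sns := smooth_opp oB ss.
have sE : smooth B (fun y => expR (- s y)) := smooth_expR oB sns.
have sf : smooth B f := smooth_mul oB sE (sP (sp a) (ls j)).
have df y : B y -> partial rs f y = 0.
  move=> By; have [_ fr] := partial_fibre y; have [_ ps] := structure_components a By.
  rewrite (partialM rs sE (sP (sp a) (ls j)) By) (partial_expR rs sns By) (partialN rs ss By) fr ps.
  by ring.
pose v : point4 := delta_mx 0 rs.
have qE : q = slice (base q) + s q *: v.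
  apply/rowP; apply: split4 => [i|]; rewrite mxE [X in _ = _ + X]mxE [delta_mx _ _ _ _]mxE eqxx /=.
    have [-> _] := row4E (base q) 0.
    by rewrite eq_lrshift mulr0 addr0 [base q 0 i]mxE.
  have [_ ->] := row4E (base q) 0.
  by rewrite [(0 : 'M[R]_1) _ _]mxE ?eqxx mulr1 add0r /s /fibre [rsubmx _ _ _]mxE.
have inB (c : R) : `|c| <= `|s q| -> B (slice (base q) + c *: v).
  move=> cs; case: Bq => b1 b2; split.
    rewrite (_ : lsubmx _ = lsubmx q) //; apply/rowP => i; rewrite mxE [LHS]mxE [X in _ + X]mxE.
    rewrite [delta_mx _ _ _ _]mxE eqxx /= eq_lrshift mulr0 addr0.
    by have [-> _] := row4E (base q) 0.
  rewrite (_ : rsubmx _ 0 0 = c); first exact: le_lt_trans cs b2.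
  rewrite mxE [LHS]mxE [X in _ + X]mxE [delta_mx _ _ _ _]mxE ?eqxx /= ?eqxx mulr1.
  by have [_ ->] := row4E (base q) 0; rewrite mxE add0r.
have fE : f q = f (slice (base q)).
  have key (b : point4) c : (forall d, 0 <= d <= c -> B (b + d *: v)) -> 0 <= c ->
      f (b + c *: v) = f b.
    move=> bB c0; have [|d dc] := @mvt_line R 4 f b v c c0.
      by move=> d dc; apply: diff_derivable; exact: (smooth_differentiable sf (bB d dc)).
    by rewrite -partialE (df _ (bB d dc)) mulr0 => /eqP; rewrite subr_eq0 => /eqP.
  have qs d : q + d *: v = slice (base q) + (s q + d) *: v.
    by apply/rowP => i; rewrite {1}qE !addmxE !scalemxE; ring.
  have [sp0|sn0] := lerP 0 (s q).
    rewrite {1}qE; apply: key => // d /andP[d0 d1]; apply: inB.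
    by rewrite !ger0_norm.
  have <- : f (q + (- s q) *: v) = f q.
    apply: key; last by rewrite oppr_ge0 ltW.
    move=> d /andP[d0 d1]; rewrite qs; apply: inB.
    by rewrite (ltr0_norm sn0) ler_norml; apply/andP; split; lra.
  by rewrite qs subrr scale0r addr0.
have : f (slice (base q)) = P (slice (base q)) (sp a) (ls j).
  have -> : f (slice (base q)) = expR (- s (slice (base q))) * P (slice (base q)) (sp a) (ls j) by [].
  have -> : s (slice (base q)) = 0 by rewrite /s /fibre /slice row_mxKr mxE.
  by rewrite oppr0 expR0 mul1r.
move=> <-; rewrite -fE /f mulrA -expRD subrr expR0 mul1r.
by [].
Qed.

(** The exterior derivative of [a] at [q], written on the slice through [flow_scaling]. *)
Lemma base_structure a q : B q -> let y := base q in forall i j,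
  partial i (fun y => slice_frame (slice y) a j) y - partial j (fun y => slice_frame (slice y) a i) y =
  eta q i * slice_frame (slice y) a j - slice_frame (slice y) a i * eta q j
  - (m q + 2) * expR (s q) * crossmul (slice_frame (slice y)) i a j.
Proof.
move=> Bq y i j; have Dy := box_base Bq.
have sS b k : smooth D3 (fun y => slice_frame (slice y) b k).
  apply: (eq_smooth oD _ (smooth_comp oD oB slice_box (sP (sp b) (ls k)) slice_smooth)) => z _.
  by rewrite mxE.
have sE : smooth B (fun y => expR (s y)) := smooth_expR oB ss.
have e0' : expR (s q) != 0 by rewrite gt_eqF // expR_gt0.
have SF b k : slice_frame q b k = expR (s q) * slice_frame (slice y) b k.
  by rewrite mxE flow_scaling // [in RHS]mxE.
have D k l : partial (ls k) (fun z => P z (sp a) (ls l)) q =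
    expR (s q) * partial k (fun z => slice_frame (slice z) a l) y.
  have sb : smooth B (fun z => slice_frame (slice (base z)) a l).
    exact: (smooth_comp oB oD box_base (sS a l) (smooth_lsubmx oB)).
  have [L _] := partial_base (sS a l) Dy.
  have fl := (partial_fibre q).1.
  transitivity (partial (ls k) (fun z => expR (s z) * slice_frame (slice (base z)) a l) q).
    by apply: (partial_eq oB _ Bq) => z Bz; rewrite flow_scaling // [slice_frame _ _ _]mxE.
  by rewrite (partialM (ls k) sE sb Bq) (partial_expR (ls k) ss Bq) fl mulr0 mul0r add0r L.
have [C _] := structure_components a Bq; have := C i j; rewrite !D.
have Pe k : P q (sp a) (ls k) = expR (s q) * slice_frame (slice y) a k by rewrite -SF mxE.
have cr : crossmul (slice_frame q) i a j = expR (s q) * expR (s q) * crossmul (slice_frame (slice y)) i a j.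
  rewrite !crossmulE !SF; move: (slice_frame (slice y)) => X.
  by move: a {C D Pe}; apply: forall_ord3; rewrite /=; ring.
rewrite !Pe cr -mulrBr => H; apply: (mulfI e0'); rewrite H; ring.
Qed.

(** The structure equations of the slice hold at every time with the same left-hand
    side; since the coframe of the slice is a basis, their coefficients are
    the same at every time. *)
Lemma base_constant q : B q -> (forall i, eta q i = eta (slice (base q)) i) /\
  (m q + 2) * expR (s q) = m (slice (base q)) + 2.
Proof.
move=> Bq; set y := base q; have Bs := slice_box (box_base Bq).
have ys : base (slice y) = y by rewrite /base /slice row_mxKl.
have s0 : s (slice y) = 0 by rewrite /s /fibre /slice row_mxKr mxE.
pose S := slice_frame (slice y).
have uS : S \in unitmx by rewrite unitmxE unitfE gt_eqF // slice_frame_det.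
pose d : 'rV[R]_3 := \row_i (eta q i - eta (slice y) i).
pose c := (m q + 2) * expR (s q) - (m (slice y) + 2).
have E a i j : d 0 i * S a j - S a i * d 0 j = c * crossmul S i a j.
  have h1 := base_structure a Bq i j; have h2 := base_structure a Bs i j.
  rewrite /= ys s0 expR0 mulr1 -/y in h1 h2.
  have := etrans (esym h1) h2; rewrite -/S !mxE /c.
  move: (crossmul S i a j) (S a j) (S a i) (eta q i) (eta q j) (eta (slice y) i) (eta (slice y) j) => x1 x2 x3 x4 x5 x6 x7 H.
  by move: H; lra.
pose T := invmx S; pose v := d *m T.
have rS a : row a S *m T = delta_mx 0 a by rewrite -row_mul mulmxV // row1.
have Wd (u1 u2 : 'rV[R]_3) : wedge (u1 *m T) (u2 *m T) = T^T *m wedge u1 u2 *m T.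
  by have := wedge_congr T^T u1 u2; rewrite trmxK => <-.
have W a b l : (forall i j, crossmul S i a j = S b i * S l j - S l i * S b j) ->
    wedge v (delta_mx 0 a) = c *: wedge (delta_mx 0 b) (delta_mx 0 l).
  move=> X; rewrite -!rS /v !Wd [RHS]scalemxAl [X in _ = X *m _]scalemxAr; congr (_ *m _ *m _).
  by apply/matrixP => i j; rewrite wedgeE scalemxE wedgeE ![row _ _ _ _]mxE E X.
have W0 := W f0 f1 f2 (fun i j => crossmulE S i f0 j).
have W1 := W f1 f2 f0 (fun i j => crossmulE S i f1 j).
have en (A A' : 'M[R]_3) i j : A = A' -> A i j = A' i j by move=> ->.
have c0 : c = 0.
  by have := en _ _ f1 f2 W0; rewrite scalemxE !wedgeE !mxE /= !mulr0 !subr0 !mul0r !mulr1 subr0.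
have z1 : v 0 f1 = 0.
  by have := en _ _ f1 f0 W0; rewrite c0 scale0r wedgeE [X in _ = X -> _]mxE [delta_mx _ _ _ _]mxE [X in _ - X * _]mxE /= mulr1 mul0r subr0.
have z2 : v 0 f2 = 0.
  by have := en _ _ f2 f0 W0; rewrite c0 scale0r wedgeE [X in _ = X -> _]mxE [delta_mx _ _ _ _]mxE [X in _ - X * _]mxE /= mulr1 mul0r subr0.
have z0 : v 0 f0 = 0.
  by have := en _ _ f0 f1 W1; rewrite c0 scale0r wedgeE [X in _ = X -> _]mxE [delta_mx _ _ _ _]mxE [X in _ - X * _]mxE /= mulr1 mul0r subr0.
have v0 : v = 0.
  by apply/rowP; apply: forall_ord3; rewrite [RHS]mxE.
have d0 : d = 0 by rewrite -(mulmxKV uS d) -/T -/v v0 mul0mx.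
split=> [i|]; last by apply/eqP; rewrite -subr_eq0 -/c c0.
have := congr1 (fun M : 'rV[R]_3 => M 0 i) d0; rewrite [X in X = _ -> _]mxE [X in _ = X -> _]mxE.
by move/eqP; rewrite subr_eq0 => /eqP.
Qed.

Lemma base_smooth : [/\ smooth_mx D3 baseS, smooth_mx D3 basew & smooth D3 basek].
Proof.
have cs f : smooth B f -> smooth D3 (fun y => f (slice y)).
  by move=> sf; exact: (smooth_comp oD oB slice_box sf slice_smooth).
split=> [a j|i j|].
- apply: (eq_smooth oD _ (smooth_scale oD 2 (cs _ (sP (sp a) (ls j))))) => y _.
  by rewrite scalemxE [slice_frame _ _ _]mxE.
- apply: (eq_smooth oD _ (smooth_opp oD (cs _ (smooth_mul oB sm (sP e0 (ls j)))))) => y _.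
  by rewrite [RHS]mxE.
- apply: (eq_smooth oD _ (smooth_scale oD (- 4^-1) (smooth_add oD (cs _ sm) (smooth_cst oD 2)))) => y _.
  by rewrite /basek mulNr mulrC mulNr.
Qed.

Lemma base_det y : D3 y -> 0 < \det (baseS y).
Proof. by move=> Dy; rewrite detZ mulr_gt0 ?exprn_gt0 // slice_frame_det //; exact: slice_box. Qed.

Lemma base_structure3 : structure3 D3 basew basek baseS.
Proof.
move=> y Dy a i j; have Bs := slice_box Dy.
have ys : base (slice y) = y by rewrite /base /slice row_mxKl.
have s0 : s (slice y) = 0 by rewrite /s /fibre /slice row_mxKr mxE.
have := base_structure a Bs i j; rewrite /= ys s0 expR0 mulr1 => H.
have sS b k : smooth D3 (fun y => slice_frame (slice y) b k).
  apply: (eq_smooth oD _ (smooth_comp oD oB slice_box (sP (sp b) (ls k)) slice_smooth)) => z _.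
  by rewrite mxE.
have PS k l : partial k (fun z => baseS z a l) y = 2 * partial k (fun z => slice_frame (slice z) a l) y.
  rewrite -(partial_scale oD 2 k (sS a l) Dy); apply: (partial_eq oD k Dy) => z _.
  by rewrite scalemxE.
have cr : crossmul (baseS y) i a j = 4 * crossmul (slice_frame (slice y)) i a j.
  rewrite !crossmulE /baseS !scalemxE; move: (slice_frame (slice y)) => X.
  by move: a {H PS}; apply: forall_ord3; rewrite /=; ring.
have bS b k : baseS y b k = 2 * slice_frame (slice y) b k by rewrite scalemxE.
have bw k : basew y 0 k = - eta (slice y) k by rewrite mxE.
have mk : m (slice y) + 2 = - 4 * basek y by rewrite /basek; lra.
rewrite !PS -mulrBr H cr !bS !bw mk; ring.
Qed.

Definition exp_map (q : point4) : point4 := row_mx (base q) (expR (- s q))%:M.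

Lemma exp_map_base q : base (exp_map q) = base q /\ fibre (exp_map q) = expR (- s q).
Proof. by rewrite /base /fibre /exp_map row_mxKl row_mxKr mxE eqxx mulr1n. Qed.

Lemma exp_map_smooth : smooth_mx B exp_map.
Proof.
apply: (@smooth_row_mx R 4 3 1 B (@base R) (fun q => (expR (- s q))%:M) oB).
  exact: (smooth_lsubmx oB).
move=> i j; apply: (eq_smooth oB _ (smooth_expR oB (smooth_opp oB ss))) => q _.
by rewrite !ord1 mxE eqxx mulr1n.
Qed.

Lemma exp_map_factor q : B q -> factor basek (exp_map q) = - m q / 2.
Proof.
move=> Bq; have [bE fE] := exp_map_base q; rewrite /factor bE fE /basek.
have [_ <-] := base_constant Bq.
have e0' : expR (s q) != 0 by rewrite gt_eqF // expR_gt0.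
by rewrite expRN; field.
Qed.

Lemma exp_map_coframe q : B q -> total_coframe basew basek baseS (exp_map q) *m (diff_mx exp_map q)^T = P q.
Proof.
move=> Bq; have [bE fE] := exp_map_base q; have [etaE mE] := base_constant Bq.
have fac := exp_map_factor Bq; have mq := m0 Bq.
have eN : expR (- s q) = (expR (s q))^-1 by rewrite expRN.
have e0' : expR (s q) != 0 by rewrite gt_eqF // expR_gt0.
pose TC := total_coframe basew basek baseS (exp_map q).
have dL i j : diff_mx exp_map q i (ls j) = (i == ls j)%:R.
  rewrite mxE; have [_] := partial_coord i (ls j) q; rewrite -partialE => <-.
  apply: (partial_eq oB i Bq) => z _; have [-> _] := row4E (base z) (expR (- s z))%:M.
  by rewrite [base z 0 j]mxE.
have dR i : diff_mx exp_map q i rs = partial i (fun z => expR (- s z)) q.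
  rewrite mxE; apply: (partial_eq oB i Bq) => z _; have [_ ->] := row4E (base z) (expR (- s z))%:M.
  by rewrite mxE eqxx mulr1n.
have dEl i : partial (ls i) (fun z => expR (- s z)) q = 0.
  have pl : partial (ls i) s q = 0 := (partial_fibre q).1 i.
  by rewrite (partial_expR (ls i) (smooth_opp oB ss) Bq) (partialN (ls i) ss Bq) pl oppr0 mulr0.
have dEr : partial rs (fun z => expR (- s z)) q = - expR (- s q).
  have pr : partial rs s q = 1 := (partial_fibre q).2.
  by rewrite (partial_expR rs (smooth_opp oB ss) Bq) (partialN rs ss Bq) pr mulrN mulr1.
have C a i : (TC *m (diff_mx exp_map q)^T) a (ls i) = TC a (ls i).
  rewrite mxE (bigD1 (ls i)) //= trmxE dL eqxx mulr1 big1 ?addr0 // => k.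
  move: k; apply: split4 => [k ki|_].
    by rewrite trmxE dL eq_sym (negPf ki) mulr0.
  by rewrite trmxE dR dEl mulr0.
have C' a : (TC *m (diff_mx exp_map q)^T) a rs = - expR (- s q) * TC a rs.
  rewrite mxE (bigD1 (rs : 'I_4)) //= trmxE dR dEr big1 ?addr0 => [|k].
    by rewrite mulrC.
  move: k; apply: split4 => [k ki|]; last by rewrite eqxx.
  by rewrite trmxE dL eq_rlshift mulr0.
have rT a j : TC a j = nth 0 [:: fibre_form basew basek (exp_map q); lift_form baseS f0 (exp_map q);
    lift_form baseS f1 (exp_map q); lift_form baseS f2 (exp_map q)] a 0 j by rewrite mxE.
have [F Ft] := fibre_formE basew basek (exp_map q).
have L a := lift_formE baseS a (exp_map q).
have bS a i : (2 * fibre (exp_map q))^-1 * baseS (base (exp_map q)) a i = P q (sp a) (ls i).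
  have -> : baseS (base (exp_map q)) a i = 2 * P (slice (base q)) (sp a) (ls i).
    by rewrite bE scalemxE [slice_frame _ _ _]mxE.
  rewrite fE eN (flow_scaling a i Bq); field.
  by rewrite e0'.
apply/matrixP => a; apply: split4 => [i|].
  rewrite C rT; move: a; apply: forall_ord4; rewrite /=.
  - rewrite F fac fE bE [basew _ _ _]mxE -etaE /eta eN; field.
    by rewrite mq e0'.
  - by rewrite (L f0).1 bS.
  - by rewrite (L f1).1 bS.
  - by rewrite (L f2).1 bS.
rewrite C' rT; have [p1 p2 p3] := P1 Bq; move: a; apply: forall_ord4; rewrite /=.
- rewrite Ft fac fE P0 // eN; field.
  by rewrite mq e0'.
- by rewrite (L f0).2 mulr0 p1.
- by rewrite (L f1).2 mulr0 p2.
- by rewrite (L f2).2 mulr0 p3.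
Qed.

(** The coframe [P] is the one that the base data define on the total space, read in
    the coordinate [expR (- s)] instead of the time [s] of the flow. *)
Theorem normal_form :
  [/\ [/\ smooth_mx D3 baseS, smooth_mx D3 basew & smooth D3 basek],
      forall y, D3 y -> 0 < \det (baseS y), structure3 D3 basew basek baseS,
      smooth_mx B exp_map &
      forall q, B q -> factor basek (exp_map q) = - m q / 2 /\
        total_coframe basew basek baseS (exp_map q) *m (diff_mx exp_map q)^T = P q].
Proof.
split; [exact: base_smooth|exact: base_det|exact: base_structure3|exact: exp_map_smooth|].
by move=> q Bq; split; [exact: exp_map_factor|exact: exp_map_coframe].
Qed.

End NormalForm.

Section NormalCoordinates.
Variable R : realType.
Notation ls := (@lshift 3 1).
Notation rs := (@rshift 3 1 ord0).
Variables (M : set 'rV[R]_4) (Th : 'rV[R]_4 -> 'M[R]_4) (m : 'rV[R]_4 -> R) (p : 'rV[R]_4).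
Hypotheses (oM : open M) (Mp : M p) (sT : smooth_mx M Th) (sm : smooth M m).
Hypotheses (mm : forall x y, M x -> M y -> 0 < m x * m y) (dT : forall x, M x -> \det (Th x) < 0).
Hypothesis str : [/\ structure_eq M m (coform Th e0) (coform Th e1) (coform Th e2) (coform Th e3),
  structure_eq M m (coform Th e0) (coform Th e2) (coform Th e3) (coform Th e1)
  & structure_eq M m (coform Th e0) (coform Th e3) (coform Th e1) (coform Th e2)].

Let m0 x : M x -> m x != 0.
Proof. by move=> Mx; apply/eqP => z; have := mm Mx Mx; rewrite z mulr0 ltxx. Qed.

Let uT x : M x -> Th x \in unitmx.
Proof. by move=> Mx; rewrite unitmxE unitfE ltr0_neq0 // dT. Qed.

(** The vector field whose flow is the fibre coordinate: [coform Th e1], [coform Th e2]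
    and [coform Th e3] vanish on it, so its trajectories are the fibres. *)
Definition dual_field x : 'rV[R]_4 := (m x)^-1 *: (invmx (Th x) *m (delta_mx e0 0 : 'cV[R]_4))^T.

Lemma dual_fieldE x : M x -> Th x *m (dual_field x)^T = (m x)^-1 *: delta_mx e0 0.
Proof. by move=> Mx; rewrite /dual_field linearZ /= trmxK -scalemxAr mulKVmx ?uT. Qed.

Lemma dual_field_smooth : smooth_mx M dual_field.
Proof.
apply: (smooth_mx_scale oM (smooth_inv oM m0 sm)); apply: (smooth_mx_tr oM).
exact: (smooth_mx_mul oM (smooth_invmx oM uT sT) (smooth_mx_cst oM _)).
Qed.

Definition transversal : 'M[R]_(3, 4) := rowsub sp (invmx (Th p))^T.

(** In the coframe, the frame formed by the transversal and the dual field is a cyclic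
    permutation of the dual frame, which is odd, up to the factor [(m p)^-1]. *)
Lemma transversal_det :
  \det (col_mx transversal (dual_field p) : 'M[R]_4) * \det (Th p) = - (m p)^-1.
Proof.
have [K KE] : exists K : 'M[R]_4, K = (col_mx transversal (dual_field p) : 'M[R]_(3 + 1, 4)) *m (Th p)^T.
  by eexists.
have KE2 : K = (col_mx (transversal *m (Th p)^T) (dual_field p *m (Th p)^T) : 'M[R]_(3 + 1, 4)).
  by rewrite KE; exact: (@mul_col_mx R 3 1 4 4).
have c0 : e0 = ls f0 by exact: val_inj.
have c1 : e1 = ls f1 by exact: val_inj.
have c2 : e2 = ls f2 by exact: val_inj.
have c3 : e3 = rs by exact: val_inj.
have KL a j : K (ls a) j = (sp a == j)%:R.
  have -> : K (ls a) j = (transversal *m (Th p)^T) a j by rewrite KE2; exact: (@col_mxEu R 3 1 4).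
  by rewrite /transversal mul_rowsub_mx mxE -trmx_mul mulmxV ?uT // trmx1 mxE.
have XT : dual_field p *m (Th p)^T = ((m p)^-1 *: (delta_mx e0 0 : 'cV[R]_4))^T.
  by rewrite -dual_fieldE // trmx_mul trmxK.
have KR j : K rs j = (m p)^-1 * (j == e0)%:R.
  have -> : K rs j = (dual_field p *m (Th p)^T) 0 j by rewrite KE2; exact: (@col_mxEd R 3 1 4).
  by rewrite XT trmxE scalemxE [delta_mx _ _ _ _]mxE eqxx andbT.
have <- : \det K = - (m p)^-1.
  have k0 j : K e0 j = (e1 == j)%:R by rewrite c0 KL.
  have k1 j : K e1 j = (e2 == j)%:R by rewrite c1 KL.
  have k2 j : K e2 j = (e3 == j)%:R by rewrite c2 KL.
  have k3 j : K e3 j = (m p)^-1 * (j == e0)%:R by rewrite c3 KR.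
  by rewrite det4 /= !k0 !k1 !k2 !k3 -?val_eqE /=; ring.
by rewrite KE det_mulmx det_tr.
Qed.

(** In the flow box, the forms vanish on the coordinate field of the flow parameter or
    take the value [1/m] on it, and the orientation follows from [transversal_det]. *)
Lemma flow_coframe : exists (r : R) (V : set 'rV[R]_4) (Psi Ups : 'rV[R]_4 -> 'rV[R]_4),
  let P q := Th (Psi q) *m (diff_mx Psi q)^T in
  [/\ [/\ 0 < r, open V, V p & V `<=` M],
      smooth_mx (@box R 3 r) Psi /\ smooth_mx V Ups,
      forall q, @box R 3 r q -> V (Psi q) /\ Ups (Psi q) = q,
      forall x, V x -> @box R 3 r (Ups x) /\ Psi (Ups x) = x &
      forall q, @box R 3 r q -> (forall e, P q e rs = (m (Psi q))^-1 * (e == e0)%:R) /\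
        0 < - m (Psi q) * \det (P q)].
Proof.
have dC := transversal_det.
have uC : col_mx transversal (dual_field p) \in unitmx.
  rewrite unitmxE unitfE; apply/eqP => C0; move: dC; rewrite C0 mul0r => /eqP.
  by rewrite eq_sym oppr_eq0 invr_eq0 (negPf (m0 Mp)).
have [r [V [Psi [Ups [[r0 oV Vp VM] sPU hP hU fl]]]]] :=
  @flow_box R 3 M dual_field p transversal oM Mp dual_field_smooth uC.
exists r, V, Psi, Ups; split=> // q Bq; have [fx dq] := fl q Bq; have Mq := VM _ (hP q Bq).1.
split=> [e|].
  transitivity ((Th (Psi q) *m (dual_field (Psi q))^T) e 0).
    rewrite mxE [RHS]mxE; apply: eq_bigr => k _; rewrite !trmxE; congr (_ * _).
    by rewrite [diff_mx _ _ _ _]mxE fx.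
  by rewrite dual_fieldE // scalemxE [delta_mx _ _ _ _]mxE eqxx andbT.
rewrite det_mulmx det_tr.
have := mm Mq Mp; have := dT Mq; have d := dT Mp; move: dC dq d (m0 Mp).
move: (\det (col_mx _ _)) (\det (Th p)) (\det (diff_mx _ _)) (m p) (m (Psi q)) (\det (Th (Psi q))).
move=> c d a mp mq dq cd ac d0 mp0 dq0 mqp.
have cm : 0 < c * mp.
  by rewrite -(nmulr_llt0 _ d0) mulrAC cd mulNr mulVf // oppr_lt0 ltr01.
have am : 0 < a * mq.
  rewrite -(pmulr_lgt0 _ (mulr_gt0 cm cm)).
  have -> : a * mq * (c * mp * (c * mp)) = (a * c) * (mq * mp) * (c * mp) by ring.
  exact: (mulr_gt0 (mulr_gt0 ac mqp) cm).
have -> : - mq * (dq * a) = - dq * (a * mq) by ring.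
by rewrite mulr_gt0 // oppr_gt0.
Qed.

Lemma row_base_fibre (y : 'rV[R]_(3 + 1)) : row_mx (base y) (fibre y)%:M = y.
Proof. by rewrite -[RHS]hsubmxK; congr row_mx; rewrite [RHS]mx11_scalar. Qed.

(** A coframe with these structure equations is, near [p], the one that a hyperCR
    Einstein-Weyl structure defines on its total space. *)
Theorem normal_coordinates :
  exists (V W : set 'rV[R]_4) (phi : 'rV[R]_4 -> 'rV[R]_4) (U : set 'rV[R]_3)
    (S : 'rV[R]_3 -> 'M[R]_3) (w : 'rV[R]_3 -> 'rV[R]_3) (k : 'rV[R]_3 -> R),
  [/\ [/\ open V, V p & V `<=` M], hyperCR U (fun y => (S y)^T *m S y) w k,
      open W /\ W `<=` total_space k U, diffeomorphism V W phi &
      forall x, V x -> [/\ factor k (phi x) = - m x / 2, 0 < fibre (phi x),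
        0 < \det (S (base (phi x))) & Th x = total_coframe w k S (phi x) *m ('J phi x)^T]].
Proof.
have [r [V [Psi [Ups [[r0 oV Vp VM] [sPsi sUps] hP hU fl]]]]] := flow_coframe.
set P := fun q => Th (Psi q) *m (diff_mx Psi q)^T.
pose B : set 'rV[R]_4 := @box R 3 r.
pose mP q := m (Psi q).
have oB : open B := @open_box R 3 r.
pose D : set 'rV[R]_3 := [set y | `|y| < r].
have oD : open D := @open_norm_lt R _ r.
have BM q : B q -> M (Psi q) by move=> /hP[/VM].
have sP : smooth_mx B P.
  apply: (smooth_mx_mul oB (smooth_mx_comp oB oM BM sT sPsi)).
  exact: (smooth_mx_tr oB (smooth_diff_mx oB sPsi)).
have smP : smooth B mP := smooth_comp oB oM BM sm sPsi.
have mP0 q : B q -> mP q != 0 by move=> /BM/m0.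
have cP a : coform P a = fun q => coform Th a (Psi q) *m (diff_mx Psi q)^T.
  by apply/funext => q; rewrite /coform row_mul.
have strP a b c d : structure_eq M m (coform Th a) (coform Th b) (coform Th c) (coform Th d) ->
    structure_eq B mP (coform P a) (coform P b) (coform P c) (coform P d).
  move=> E q Bq; rewrite !cP (pullback_extd oB oM sPsi BM (coform_smooth oM sT b) Bq) (E _ (BM q Bq)).
  rewrite -!wedge_congr mulmxBr mulmxBl -!scalemxAr -!scalemxAl mulmxBr mulmxBl.
  by [].
have sstr : [/\ structure_eq B mP (coform P e0) (coform P e1) (coform P e2) (coform P e3),
    structure_eq B mP (coform P e0) (coform P e2) (coform P e3) (coform P e1)
    & structure_eq B mP (coform P e0) (coform P e3) (coform P e1) (coform P e2)].
  by have [E1 E2 E3] := str; split; apply: strP.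
have P0 q : B q -> P q e0 rs = (mP q)^-1.
  by move=> Bq; have [E _] := fl q Bq; rewrite /P E eqxx mulr1.
have P1 q : B q -> [/\ P q e1 rs = 0, P q e2 rs = 0 & P q e3 rs = 0].
  by move=> Bq; have [E _] := fl q Bq; rewrite /P !E -?val_eqE /= !mulr0.
have dP q : B q -> 0 < - mP q * \det (P q) by move=> Bq; have [_] := fl q Bq.
have [[sS sw sk] dS stS sE EE] : [/\ [/\ smooth_mx D (baseS P), smooth_mx D (basew P mP) & smooth D (basek mP)],
      forall y, D y -> 0 < \det (baseS P y), structure3 D (basew P mP) (basek mP) (baseS P),
      smooth_mx B (@exp_map R) &
      forall q, B q -> factor (basek mP) (exp_map q) = - mP q / 2 /\
        total_coframe (basew P mP) (basek mP) (baseS P) (exp_map q) *m (diff_mx (@exp_map R) q)^T = P q].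
  by apply: normal_form; assumption.
pose phi x := exp_map (Ups x).
pose W1 : set 'rV[R]_(3 + 1) := [set y | setT y /\ 0 < fibre y].
have oW1 : open W1 := open_pos openT (fibre_smooth openT).
have sl : smooth W1 (fun y => ln (fibre y)).
  by apply: (smooth_ln oW1 _ (fibre_smooth oW1)) => y [].
pose W2 : set 'rV[R]_(3 + 1) := [set y | W1 y /\ 0 < r + ln (fibre y)].
have oW2 : open W2 := open_pos oW1 (smooth_add oW1 (smooth_cst oW1 r) sl).
have W21 : W2 `<=` W1 by move=> y [].
pose W3 : set 'rV[R]_(3 + 1) := [set y | W2 y /\ 0 < r + - ln (fibre y)].
have oW3 : open W3 := open_pos oW2 (smooth_add oW2 (smooth_cst oW2 r) (smooth_opp oW2 (smooth_sub W21 sl))).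
pose W : set 'rV[R]_(3 + 1) := W3 `&` [set y | D (lsubmx y)].
have oW : open W by apply: openI => //; exact: (open_lsubmx oD).
have WW1 : W `<=` W1 by move=> y [[[]]].
pose log (y : 'rV[R]_(3 + 1)) : 'rV[R]_(3 + 1) := row_mx (base y) (- ln (fibre y))%:M.
have logE y : base (log y) = base y /\ fibre (log y) = - ln (fibre y).
  by rewrite /base /fibre /log row_mxKl row_mxKr mxE eqxx mulr1n.
have slog : smooth_mx W log.
  apply: (smooth_row_mx oW (smooth_lsubmx oW)) => i j.
  apply: (eq_smooth oW _ (smooth_opp oW (smooth_sub WW1 sl))) => y _.
  by rewrite !ord1 mxE eqxx mulr1n.
have WB y : W y -> B (log y).
  move=> [[[_ a] b] c]; have [bE fE] := logE y; split.
    by change (`|base (log y)| < r); rewrite bE.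
  by change (`|fibre (log y)| < r); rewrite fE normrN ltr_norml; apply/andP; split; lra.
pose psi y := Psi (log y).
have VB x : V x -> B (Ups x) by move=> /hU[].
have hphi x : V x -> W (phi x) /\ psi (phi x) = x.
  move=> Vx; have [bE fE] := exp_map_base (Ups x); have [b1 b2] := VB x Vx.
  have lE : ln (fibre (phi x)) = - fibre (Ups x) by rewrite /phi fE expRK.
  move: b2; rewrite -/(fibre _) ltr_norml => /andP[b2 b3].
  split.
    split; last by change (`|base (phi x)| < r); rewrite /phi bE.
    by split; [split; [split=> //; rewrite /phi fE expR_gt0|rewrite /= lE; lra]|rewrite /= lE; lra].
  rewrite /psi /log lE opprK /phi bE row_base_fibre.
  exact: (hU x Vx).2.
have hpsi y : W y -> V (psi y) /\ phi (psi y) = y.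
  move=> Wy; have [Vy Uy] := hP _ (WB y Wy); split=> //.
  have [bE fE] := logE y.
  rewrite /phi /psi Uy /exp_map bE fE opprK lnK ?row_base_fibre // posrE.
  by have [] := WW1 _ Wy.
have sphi : smooth_mx V phi := smooth_mx_comp oV oB VB sE sUps.
have U0 x : V x -> factor (basek mP) (phi x) = - m x / 2.
  by move=> Vx; rewrite /phi (EE _ (VB x Vx)).1 /mP (hU x Vx).2.
exists V, W, phi, D, (baseS P), (basew P mP), (basek mP); split=> //.
- by apply: (coframe3_hyperCR oD sS sw sk dS _ stS).
- split=> // y Wy; have [Vy yE] := hpsi y Wy; have [_ f0] := WW1 _ Wy.
  split; [by case: Wy|by rewrite gt_eqF|].
  by rewrite -yE U0 // mulf_neq0 ?oppr_eq0 ?m0 ?invr_eq0 ?pnatr_eq0 //; exact: VM.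
- by exists psi; split=> //; exact: (smooth_mx_comp oW oB WB sPsi slog).
move=> x Vx; have [Wx _] := hphi x Vx; have [_ f0] := WW1 _ Wx.
split=> //; [exact: U0|by apply: dS; case: Wx|].
rewrite (jacobian_smooth sphi Vx).
have -> : diff_mx phi x = diff_mx Ups x *m diff_mx (@exp_map R) (Ups x) := diff_mx_comp sUps VB sE Vx.
rewrite trmx_mul mulmxA (EE _ (VB x Vx)).2 /P (hU x Vx).2 -mulmxA -trmx_mul.
have -> : diff_mx Ups x *m diff_mx Psi (Ups x) = 1%:M.
  rewrite -(diff_mx_comp sUps VB sPsi Vx) -(diff_mx_id x); apply/matrixP => i j.
  rewrite [LHS]mxE [RHS]mxE; apply: (partial_eq oV i Vx) => y Vy.
  by rewrite (hU y Vy).2.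
by rewrite trmx1 mulmx1.
Qed.

End NormalCoordinates.

(** The constant is [(2 |lambda|)^-1]: the conformal factor of the given metric is [m] over
    lambda, that of the metric on the total space is [2 |m|]. *)
Theorem converse (R : realType) (N : set 'rV[R]_4) (g : 'rV[R]_4 -> 'M[R]_4)
    (I1 I2 I3 : 'rV[R]_4 -> 'M[R]_4) (t : 'rV[R]_4 -> 'rV[R]_4) p :
  sd_einstein N (fun=> 1) g -> compatible_hypercomplex N (fun=> 1) g I1 I2 I3 ->
  obata N g I1 I2 I3 (fun x => 2 *: t x) -> N p -> t p != 0 ->
  exists (V W : set 'rV[R]_4) (phi : 'rV[R]_4 -> 'rV[R]_4) (c : R) (U : set 'rV[R]_3)
    (h : 'rV[R]_3 -> 'M[R]_3) (w : 'rV[R]_3 -> 'rV[R]_3) (k : 'rV[R]_3 -> R),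
  [/\ [/\ open V, V p & V `<=` N], hyperCR U h w k, open W /\ W `<=` total_space k U,
      diffeomorphism V W phi /\
      (forall x, V x -> 0 < orientation k (phi x) * \det ('J phi x)) &
      0 < c /\ (forall x, V x -> g x = c *: pullback phi (positive_metric h w k) x)].
Proof.
move=> sde hyp ob Np tp.
have Rp : regular N g t p by split=> //; exact: (sqlen_pos sde).
have [r [r0 rM]] := lambda_constant sde hyp ob Rp.
pose M : set 'rV[R]_4 := [set x | `|x - p| < r].
have oM : open M by exact: open_ball_lt.
have Mp : M p by rewrite /M /= subrr normr0.
have MR : M `<=` regular N g t by move=> x /rM[].
have MN : M `<=` N by move=> x /MR[].
have lE x : M x -> lambda g x = lambda g p by move=> /rM[].
have l0 : lambda g p != 0.
  by have [_ _ _ sc] := sde; rewrite /lambda mulf_neq0 ?sc ?invr_eq0 ?pnatr_eq0.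
have [sf f0] := regular_phi sde ob.
pose m x := lambda g x * (sqlen g t x)^-1.
have sm : smooth M m.
  exact: (smooth_mul oM (smooth_sub MR (lambda_smooth sde hyp ob)) (smooth_sub MR sf)).
have mm x y : M x -> M y -> 0 < m x * m y.
  move=> Mx My; rewrite /m !lE //.
  have -> : lambda g p * (sqlen g t x)^-1 * (lambda g p * (sqlen g t y)^-1)
    = lambda g p ^+ 2 * ((sqlen g t x)^-1 * (sqlen g t y)^-1) by ring.
  apply: mulr_gt0; first by rewrite exprn_even_gt0.
  by apply: mulr_gt0; apply: f0; exact: MR.
have dT x : M x -> \det (obata_coframe I1 I2 I3 t x) < 0 by move=> /MR; exact: regular_det.
have sT : smooth_mx M (obata_coframe I1 I2 I3 t).
  by move=> i j; exact: (smooth_sub MN (obata_coframe_smooth sde hyp ob i j)).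
have [E1 E2 E3] := regular_structure sde hyp ob.
have [|V [W [phi [U [S [w [k [[oV Vp VM] hCR oW dphi fact]]]]]]]] := normal_coordinates oM Mp sT sm mm dT.
  by split=> x Mx; [exact: E1 (MR _ Mx)|exact: E2 (MR _ Mx)|exact: E3 (MR _ Mx)].
have l1 : 0 < `|lambda g p| by rewrite normr_gt0.
exists V, W, phi, (2 * `|lambda g p|)^-1, U, (fun y => (S y)^T *m S y), w, k; split=> //.
- by split=> // x /VM/MN.
- split=> // x Vx; have [fE t0 dS ThE] := fact x Vx.
  have := dT x (VM x Vx); rewrite ThE det_mulmx det_tr det_total_coframe invfM.
  have v0 : factor k (phi x) != 0.
    rewrite fE mulf_neq0 ?invr_eq0 ?pnatr_eq0 // oppr_eq0; apply/eqP => z.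
    by have := mm x x (VM x Vx) (VM x Vx); rewrite z mulr0 ltxx.
  have a0 : 0 < (2 * fibre (phi x))^-1 by rewrite invr_gt0 mulr_gt0.
  rewrite /orientation; move: (\det ('J phi x)) (\det (S _)) (factor k _) ((2 * fibre _)^-1) v0 dS a0.
  move=> j d v a v0 d0 a0 H.
  have H1 : 0 < v^-1 * j.
    have e4 : 0 < a * a ^+ 3 * d by rewrite !mulr_gt0 // exprn_gt0.
    rewrite -(pmulr_rgt0 _ e4) -oppr_lt0; apply: le_lt_trans H.
    by rewrite le_eqVlt; apply/orP; left; apply/eqP; ring.
  move: v0; rewrite neq_lt => /orP[v0|v0].
    by rewrite ltr0_sg // mulN1r oppr_gt0; move: H1; rewrite nmulr_rgt0 ?invr_lt0.
  by rewrite gtr0_sg // mul1r; move: H1; rewrite pmulr_rgt0 ?invr_gt0.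
split=> [|x Vx]; first by rewrite invr_gt0 mulr_gt0.
have [fE t0 dS ThE] := fact x Vx.
have mx0 : m x != 0.
  by apply/eqP => z; have := mm x x (VM x Vx) (VM x Vx); rewrite z mulr0 ltxx.
have v0 : factor k (phi x) != 0 by rewrite fE mulf_neq0 ?invr_eq0 ?pnatr_eq0 ?oppr_eq0.
rewrite (regular_metric sde hyp (MR _ (VM x Vx))) ThE /pullback.
rewrite (positive_metric_coframe w erefl _ v0) ?gt_eqF //.
rewrite -scalemxAr -scalemxAl scalerA trmx_mul trmxK !mulmxA; congr (_ *: _).
have p0 := f0 x (MR _ (VM x Vx)).
have nE (l s : R) : 0 < s -> `|- (l * s) / 2| = `|l| * s / 2.
  move=> s0; have h : 0 < 2^-1 :> R by rewrite invr_gt0.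
  by rewrite normrM normrN normrM (gtr0_norm s0) (gtr0_norm h).
rewrite fE /m (lE _ (VM x Vx)) nE //.
move: (sqlen g t x)^-1 `|lambda g p| (lt0r_neq0 l1) => a L L0; field.
by rewrite L0.
Qed.

Theorem mainTheorem9 (R : realType) :
  (forall (U : set 'rV[R]_3) (h : 'rV[R]_3 -> 'M[R]_3)
          (w : 'rV[R]_3 -> 'rV[R]_3) (k : 'rV[R]_3 -> R),
     hyperCR U h w k ->
     sd_einstein (total_space k U) (orientation k) (positive_metric h w k) /\
     (forall p, total_space k U p ->
        exists V : set 'rV[R]_4,
          [/\ open V, V p, V `<=` total_space k U &
              exists I1 I2 I3 : 'rV[R]_4 -> 'M[R]_4,
                compatible_hypercomplex V (orientation k)
                  (positive_metric h w k) I1 I2 I3])) /\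
  (forall (N : set 'rV[R]_4) (g : 'rV[R]_4 -> 'M[R]_4)
          (I1 I2 I3 : 'rV[R]_4 -> 'M[R]_4) (theta : 'rV[R]_4 -> 'rV[R]_4),
     sd_einstein N (fun=> 1) g ->
     compatible_hypercomplex N (fun=> 1) g I1 I2 I3 ->
     obata N g I1 I2 I3 (fun x => 2 *: theta x) ->
     forall p, N p -> theta p != 0 ->
     exists (V W : set 'rV[R]_4) (phi : 'rV[R]_4 -> 'rV[R]_4) (c : R)
            (U : set 'rV[R]_3) (h : 'rV[R]_3 -> 'M[R]_3)
            (w : 'rV[R]_3 -> 'rV[R]_3) (k : 'rV[R]_3 -> R),
       [/\ [/\ open V, V p & V `<=` N],
           hyperCR U h w k,
           open W /\ W `<=` total_space k U,
           diffeomorphism V W phi /\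
           (forall x, V x -> 0 < orientation k (phi x) * \det ('J phi x)) &
           0 < c /\
           (forall x, V x ->
              g x = c *: pullback phi (positive_metric h w k) x)]).
Proof.
split=> [U h w k hCR|N g I1 I2 I3 theta sde hyp ob p Np tp]; first exact: construction.
exact: (converse sde hyp ob Np tp).
Qed.
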